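(* Let $\lambda=\theta+\mathrm{i}\eta\in\mathcal D$ with $\theta\ge 0$ and $m(\lambda)\neq 0$ be such that $\sigma_\theta^2<\infty$, $\sigma_\lambda^2>0$ and $m(2\theta)<|m(\lambda)|^2$. Define $$m=\begin{cases} m(2\theta) & \text{if } |m(2\lambda)|<m(2\theta),\\ m(2\lambda) & \text{if } |m(2\lambda)|=m(2\theta).\end{cases}$$ Then, as $n\to\infty$, the conditional distributions satisfy $$\mathcal L\Big(\tfrac{m(\lambda)^n}{m^{n/2}}\,(Z(\lambda)-Z_n(\lambda))\,\Big|\,\mathcal F_n\Big)\ \to\ \mathcal L\Big(\tfrac{\sigma_\lambda}{\sqrt{1-m(2\theta)/|m(\lambda)|^2}}\,\sqrt{Z(2\theta)}\,X\,\Big|\,\mathcal F_\infty\Big)\quad\text{weakly, in } \mathbb P\text{-probability},$$ where $X$ is independent of $\mathcal F_\infty$, and $X$ is complex standard normal if $|m(2\lambda)|<m(2\theta)$, whereas $X$ is real standard normal if $|m(2\lambda)|=m(2\theta)$. If, additionally, either $2\theta\in\Lambda$ or $Z(2\theta)=0$ a.s., then the weak convergence in $\mathbb P$-probability can be strengthened to weak convergence $\mathbb P$-a.s.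
   Context: Branching random walk. $\mathbb N=\{1,2,\dots\}$, $\mathbb N_0=\mathbb N\cup\{0\}$. Let $\mathcal Z=\sum_{j=1}^N\delta_{X_j}$ be a point process on $\mathbb R$ with $N=\mathcal Z(\mathbb R)<\infty$ a.s. and $\mathbb E[N]>1$ (supercriticality). Let $\mathcal I=\bigcup_{n\ge0}\mathbb N^n$ with $\mathbb N^0=\{\varnothing\}$, and let $\mathcal Z(u)=\sum_{j=1}^{N(u)}\delta_{X_j(u)}$, $u\in\mathcal I$, be i.i.d. copies of $\mathcal Z$, with $\mathcal Z(\varnothing)=\mathcal Z$. Put $\mathcal G_0=\{\varnothing\}$, $\mathcal G_{n+1}=\{uj:u\in\mathcal G_n,\,1\le j\le N(u)\}$, $\mathcal G=\bigcup_n\mathcal G_n$, and write $|u|=n$ for $u\in\mathcal G_n$. Positions: $S(\varnothing)=0$, $S(u_1\dots u_n)=X_{u_1}(\varnothing)+\dots+X_{u_n}(u_1\dots u_{n-1})$. For $\lambda=\theta+\mathrm i\eta\in\mathbb C$ (always $\theta=\mathrm{Re}\,\lambda$, $\eta=\mathrm{Im}\,\lambda$) let $m(\lambda)=\mathbb E[\sum_{|u|=1}e^{-\lambda S(u)}]$ and $\mathcal D=\{\lambda\in\mathbb C: m(\theta)<\infty\}$, assumed non-empty. For $\lambda\in\mathcal D$ with $m(\lambda)\ne0$, $Z_n(\lambda)=m(\lambda)^{-n}\sum_{|u|=n}e^{-\lambda S(u)}$, a martingale with respect to $\mathcal F_n=\sigma(\mathcal Z(u):u\in\bigcup_{k=0}^{n-1}\mathbb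 N^k)$; $\mathcal F_\infty=\sigma(\mathcal F_n:n\in\mathbb N_0)$. $Z(\lambda)$ denotes the a.s. limit of $Z_n(\lambda)$ (it exists under the hypotheses; $Z(2\theta)$ is the a.s. limit of the nonnegative martingale $Z_n(2\theta)$). $\sigma_\lambda^2=\mathbb E[|Z_1(\lambda)-1|^2]\in[0,\infty]$, and $\sigma_\theta^2$ is the same quantity at the real parameter $\theta$. In $m^{n/2}$ a fixed square root of $m$ is used, $m^{n/2}=(m^{1/2})^n$. $\Lambda=\bigcup_{\gamma\in(1,2]}(\Lambda^1_\gamma\cap\Lambda^3_\gamma)$, where $\Lambda_\gamma^1$ is the interior of $\{\lambda\in\mathcal D:\mathbb E[Z_1(\theta)^\gamma]<\infty\}$ and $\Lambda_\gamma^3$ is the interior of $\{\lambda\in\mathcal D:\inf_{1\le p\le\gamma} m(p\theta)/|m(\lambda)|^p<1\}$. A complex random variable $\zeta=\xi+\mathrm i\tau$ is (complex) standard normal if $\xi,\tau$ are i.i.d. centered (real) normal with $\mathbb E[|\zeta|^2]=1$. For $\mathbb C$-valued random variables, $\mathcal L(\zeta_n|\mathcal F_n)\to\mathcal L(\zeta|\mathcal F_\infty)$ weakly in $\mathbb P$-probability (resp. $\mathbb P$-a.s.) means that for every bounded continuous $\phi:\mathbb C\to\mathbb R$, $\mathbb E[\phi(\zeta_n)|\mathcal F_n]\to\mathbb E[\phi(\zeta)|\mathcal F_\infty]$ in $\mathbb P$-probability (resp. $\mathbb P$-a.s.). *)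

(* Defs.v *)
From HB Require Import structures.
From mathcomp Require Import all_boot all_order all_algebra.
From mathcomp Require Import all_classical all_reals all_analysis.
From mathcomp Require Import measurable_realfun.
From mathcomp.real_closed Require Import complex.

Set Implicit Arguments.
Unset Strict Implicit.
Unset Printing Implicit Defensive.

Import Order.TTheory GRing.Theory Num.Theory.
Import numFieldNormedType.Exports.

Local Open Scope classical_set_scope.
Local Open Scope ring_scope.
Local Open Scope complex_scope.

(* R[i] packed as a numClosedFieldType, so that it inherits the topology and
   the norm that MathComp-Analysis puts on every numFieldType. *)
Definition cplx (R : realType) : numClosedFieldType := R[i].

Section complex_values.
Context {R : realType}.

Definition re (z : cplx R) : R := complex.Re z.
Definition im (z : cplx R) : R := complex.Im z.
Definition toC (x : R) : cplx R := x%:C.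

(* The norm `|z| lives in cplx R; cmod z is the same number as an element of R. *)
Definition cmod (z : cplx R) : R := ComplexField.Normc.normc z.

Definition cexp (z : cplx R) : cplx R :=
  toC (expR (re z)) * (cos (im z) +i* sin (im z)).

End complex_values.

Section complex_random_variables.
Context {d : measure_display} {T : measurableType d} {R : realType}.
Variable P : probability T R.

Definition cmeasurable (f : T -> cplx R) : Prop :=
  measurable_fun setT (re \o f) /\ measurable_fun setT (im \o f).

Definition cexpectation (f : T -> cplx R) : cplx R :=
  Rintegral P setT (re \o f) +i* Rintegral P setT (im \o f).

Definition complex_std_normal (X : T -> cplx R) : Prop :=
  cmeasurable X /\
  (exists2 s : R, 0 < s & forall B : set R, measurable B ->
     P ((re \o X) @^-1` B) = normal_prob 0 s B /\
     P ((im \o X) @^-1` B) = normal_prob 0 s B) /\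
  (forall A B : set R, measurable A -> measurable B ->
     P ((re \o X) @^-1` A `&` (im \o X) @^-1` B) =
     (P ((re \o X) @^-1` A) * P ((im \o X) @^-1` B))%E) /\
  (\int[P]_w (cmod (X w) ^+ 2)%:E = 1)%E.

Definition real_std_normal (X : T -> cplx R) : Prop :=
  cmeasurable X /\
  {ae P, forall w, im (X w) = 0} /\
  forall B : set R, measurable B -> P ((re \o X) @^-1` B) = normal_prob 0 1 B.

Definition cindependent (G : set (set T)) (X : T -> cplx R) : Prop :=
  forall (A : set T) (B : set (R * R)), G A -> measurable B ->
    P (A `&` [set w | B (re (X w), im (X w))]) =
    (P A * P [set w | B (re (X w), im (X w))])%E.

(* g is a version of E[f | G], where G is a sub-sigma-algebra. *)
Definition is_condexp (G : set (set T)) (f g : T -> R) : Prop :=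
  (forall B : set R, measurable B -> G (g @^-1` B)) /\
  P.-integrable setT (EFin \o g) /\
  forall A, G A -> (\int[P]_(w in A) (g w)%:E = \int[P]_(w in A) (f w)%:E)%E.

Definition cvg_in_prob (g : nat -> T -> R) (h : T -> R) : Prop :=
  forall e : R, 0 < e ->
    P [set w | e < `|g n w - h w|] @[n --> \oo] --> 0%E.

Definition cvg_as (g : nat -> T -> R) (h : T -> R) : Prop :=
  {ae P, forall w, g n w @[n --> \oo] --> h w}.

(* L(zeta_n | F_n) -> L(zeta | Foo) weakly, in the mode given by conv. Versions
   of a conditional expectation agree a.s., so asking for some versions is the
   same as asking for all of them, but the former also asserts existence. *)
Definition cond_weak_cvg
    (conv : (nat -> T -> R) -> (T -> R) -> Prop)
    (F : nat -> set (set T)) (Foo : set (set T))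
    (zeta : nat -> T -> cplx R) (zetaoo : T -> cplx R) : Prop :=
  forall phi : cplx R -> R, continuous phi ->
    (exists M : R, forall z, `|phi z| <= M) ->
    exists (g : nat -> T -> R) (h : T -> R),
      (forall n, is_condexp (F n) (phi \o zeta n) (g n)) /\
      is_condexp Foo (phi \o zetaoo) h /\
      conv g h.

End complex_random_variables.

(* A realization of an enumerated point process sum_(j < N) delta_(x_j): its
   number of points N, in {0, 1, ..., +oo}, and the sequence of its points, put
   to 0 from the index N on. *)
Definition config (R : realType) : Type := (\bar R * (nat -> R))%type.

(* The product sigma-algebra on configurations. *)
Definition config_measurable (R : realType) : set (set (config R)) :=
  <<s [set B | (exists2 A : set (\bar R), measurable A & B = [set c | A c.1]) \/
       (exists j, exists2 A : set R, measurable A & B = [set c | A (c.2 j)])] >>.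

(* Individuals are labelled by seq nat, the empty sequence being the root.
   Labels start at 0: the j-th child of u, j >= 1, is rcons u j.-1, at
   displacement pos u j.-1 from u. *)
Record branching_walk (d : measure_display) (T : measurableType d)
    (R : realType) (P : probability T R) := BranchingWalk {
  num : seq nat -> T -> \bar R ;
  pos : seq nat -> nat -> T -> R ;
  pproc : seq nat -> T -> config R :=
    fun u w => (num u w,
                fun j => if (j%:R%:E < num u w)%E then pos u j w else 0) ;
  num_natP : forall u w,
    num u w = +oo%E \/ exists k : nat, num u w = k%:R%:E ;
  num_fin : {ae P, forall w, (num [::] w < +oo)%E} ;
  pproc_measurable : forall u B,
    config_measurable B -> measurable (pproc u @^-1` B) ;
  pproc_identd : forall u B,
    config_measurable B -> P (pproc u @^-1` B) = P (pproc [::] @^-1` B) ;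
  pproc_indep : forall (s : seq (seq nat)) (B : seq nat -> set (config R)),
    uniq s -> (forall u, u \in s -> config_measurable (B u)) ->
    P (\bigcap_(u in [set` s]) pproc u @^-1` B u) =
    (\prod_(u <- s) P (pproc u @^-1` B u))%E
}.

Section branching_walk.
Context {d : measure_display} {T : measurableType d} {R : realType}
  {P : probability T R}.
Variable b : branching_walk P.

Definition supercritical : Prop := (1 < \int[P]_w num b [::] w)%E.

Fixpoint generation (n : nat) (w : T) : set (seq nat) :=
  if n is k.+1 then
    [set u | exists v j, generation k w v /\ (j%:R%:E < num b v w)%E /\
                         u = rcons v j]
  else [set [::]].

Definition position (u : seq nat) (w : T) : R :=
  \sum_(i < size u) pos b (take i u) (nth 0%N u i) w.

(* The sums over a generation are finitely supported sums (fsbigop): on the null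
   event where the generation is infinite, they are 0. *)
Definition csum (n : nat) (l : cplx R) (w : T) : cplx R :=
  \sum_(u \in generation n w) cexp (- l * toC (position u w)).

(* m(t) in [0, +oo] for real t. *)
Definition mgf (t : R) : \bar R :=
  \int[P]_w (\sum_(u \in generation 1 w) expR (- t * position u w))%:E.

Definition dom : set (cplx R) := [set l | (mgf (re l) < +oo)%E].

(* m(l) for l in dom. *)
Definition cmgf (l : cplx R) : cplx R := cexpectation P (csum 1 l).

Definition Zn (n : nat) (l : cplx R) (w : T) : cplx R :=
  cmgf l ^- n * csum n l w.

Definition Zlim (l : cplx R) (w : T) : cplx R := lim (Zn n l w @[n --> \oo]).

Definition sigma2 (l : cplx R) : \bar R :=
  \int[P]_w (cmod (Zn 1 l w - 1) ^+ 2)%:E.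

Definition filtration (n : nat) : set (set T) :=
  <<s [set A | exists u, (size u < n)%N /\
         exists2 B, config_measurable B & A = pproc b u @^-1` B] >>.

Definition filtration_oo : set (set T) := <<s \bigcup_n filtration n >>.

Definition Lambda1 (gamma : R) : set (cplx R) :=
  [set l | dom l /\
     (\int[P]_w (re (Zn 1 (toC (re l)) w) `^ gamma)%:E < +oo)%E]°.

(* cmgf l != 0 is required: for m(l) = 0 the ratio below is +oo in the
   mathematical convention, whereas the inverse of 0 is 0 in Rocq. *)
Definition Lambda3 (gamma : R) : set (cplx R) :=
  [set l | dom l /\ cmgf l != 0 /\
     (ereal_inf [set mgf (p * re l) * ((cmod (cmgf l) `^ p)^-1)%:E
                | p in `[1%R, gamma]] < 1)%E]°.

Definition Lambda : set (cplx R) :=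
  \bigcup_(gamma in `]1, 2]) (Lambda1 gamma `&` Lambda3 gamma).

(* |m(2 l)| <= m(2 Re l) always holds, so the second case is the equality. *)
Definition norming (l : cplx R) : cplx R :=
  if cmod (cmgf (2 * l)) < fine (mgf (2 * re l))
  then toC (fine (mgf (2 * re l))) else cmgf (2 * l).

End branching_walk.

(* Main.v *)
(* After time n, Z(lambda) - Z_n(lambda) is a weighted sum, over the individuals
   u of generation n, of independent copies of Z(lambda) - 1 that are independent
   of F_n. With weights a_u = e^(-lambda S(u)) / m^(n/2), the sums of |a_u|^2 are
   the martingale W_n = Z_n(2 theta), the sums of |a_u|^4 tend to 0, and the sums
   of a_u^2 tend to 0 if |m(2 lambda)| < m(2 theta), whereas a_u^2 = |a_u|^2 if
   |m(2 lambda)| = m(2 theta), since then all the weights are real. Hence,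
   conditionally on F_n, a Lindeberg central limit theorem applies with variance
   sigma_lambda^2 / (1 - m(2 theta) / |m(lambda)|^2) * W_n. These limits hold in
   probability in general, and almost surely, by summability of p-th moments, if
   2 theta is in Lambda. All of this takes place on the space of marked trees with
   i.i.d. marks, on which F_n consists of the events that depend on the marks of
   the labels of length < n only. *)

Require Import Defs.
From HB Require Import structures.
From mathcomp Require Import all_boot all_order all_algebra.
From mathcomp Require Import all_classical all_reals all_analysis.
From mathcomp Require Import measurable_realfun.
From mathcomp Require Import ring lra.
From mathcomp.real_closed Require Import complex.

Set Implicit Arguments.
Unset Strict Implicit.
Unset Printing Implicit Defensive.

Import Order.TTheory GRing.Theory Num.Theory.
Import numFieldNormedType.Exports.

Local Open Scope classical_set_scope.
Local Open Scope ring_scope.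

(** * Trigonometric and integral estimates *)

(** Conditioning on F_n is made concrete by resampling: two independent trees are spliced at depth
    n, and integrating over the second one gives the conditional expectation. The conditional limit
    theorem thus becomes a statement about one fixed first tree. The obstacle is convergence in
    probability, where no moment of W_1 beyond the first is at hand. That the sums of |a_u|^4 vanish
    is read off from the martingale W_n itself: its increments tend to 0, whereas a weight that
    stays large would keep producing increments of a fixed size with a fixed probability. The sums
    Q_n of a_u^2 satisfy Q_(n+1) = kappa Q_n + noise with |kappa| < 1 when |m(2 lambda)| < m(2
    theta), and the noise has a first moment only; it is therefore measured by sqrt(1 + x^2) - 1,
    which is quadratic near 0 and linear at infinity. Laws are compared through cosines with an
    arbitrary phase, so that real integrals carry the whole characteristic function. *)

Section trigonometric_bounds.
Context {R : realType}.
Implicit Types x y : R.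

(** The Taylor bounds below follow from one another by this lemma: each difference of two sides is
    nonnegative at 0, and its derivative is a bound of one order less. *)
Lemma is_derive_ge0 (f df : R -> R) : (forall x, is_derive x 1 f (df x)) ->
  0 <= f 0 -> (forall x, 0 <= x -> 0 <= df x) -> forall x, 0 <= x -> 0 <= f x.
Proof.
move=> fdf f0 df0 x; rewrite le_eqVlt => /orP[/eqP<-//|x0].
have [|c cx] := @MVT R f df 0 x x0 (fun z _ => fdf z).
  apply: derivable_within_continuous => z _.
  exact: (@ex_derive _ _ _ _ _ _ _ (fdf z)).
move=> e; rewrite -(subrK (f 0) (f x)) e subr0 addr_ge0// mulr_ge0 ?(ltW x0)//.
by apply: df0; move: cx; rewrite in_itv/= => /andP[/ltW].
Qed.

Lemma sin_le x : 0 <= x -> sin x <= x.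
Proof.
move=> x0; rewrite -subr_ge0.
apply: (@is_derive_ge0 (fun x => x - sin x) (fun x => 1 - cos x)) => //.
by rewrite sin0 subr0.
Qed.

Lemma cos_ge x : 1 - x ^+ 2 / 2 <= cos x.
Proof.
wlog x0 : x / 0 <= x.
  by move=> h; have [/h//|/ltW] := leP 0 x; rewrite -oppr_ge0 => /h; rewrite sqrrN cosN.
rewrite -subr_ge0.
apply: (@is_derive_ge0 (fun x => cos x - (1 - x ^+ 2 / 2)) (fun x => x - sin x)) => //.
- move=> z; by apply: is_derive_eq; rewrite /GRing.scale/=; field.
- by rewrite cos0; lra.
- by move=> z z0; rewrite subr_ge0 sin_le.
Qed.

Lemma sin_ge_sqr x : 0 <= x -> x - x ^+ 2 / 2 <= sin x.
Proof.
move=> x0; rewrite -subr_ge0.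
apply: (@is_derive_ge0 (fun x => sin x - (x - x ^+ 2 / 2)) (fun x => cos x - (1 - x))) => //.
- move=> z; by apply: is_derive_eq; rewrite /GRing.scale/=; field.
- by rewrite sin0; lra.
- move=> z z0.
  apply: (@is_derive_ge0 (fun x => cos x - (1 - x)) (fun x => 1 - sin x)) => //.
  + move=> t; apply: is_derive_eq; rewrite /GRing.scale/=; ring.
  + by rewrite cos0; lra.
Qed.

Lemma sin_ge_cube x : 0 <= x -> x - x ^+ 3 / 6 <= sin x.
Proof.
move=> x0; rewrite -subr_ge0.
apply: (@is_derive_ge0 (fun x => sin x - (x - x ^+ 3 / 6)) (fun x => cos x - (1 - x ^+ 2 / 2))) => //.
- move=> z; by apply: is_derive_eq; rewrite /GRing.scale/=; field.
- by rewrite sin0; lra.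
- by move=> z z0; rewrite subr_ge0 cos_ge.
Qed.

Lemma cos_le_cube x : 0 <= x -> cos x <= 1 - x ^+ 2 / 2 + x ^+ 3 / 6.
Proof.
move=> x0; rewrite -subr_ge0.
apply: (@is_derive_ge0 (fun x => 1 - x ^+ 2 / 2 + x ^+ 3 / 6 - cos x)
   (fun x => sin x - (x - x ^+ 2 / 2))) => //.
- move=> z; by apply: is_derive_eq; rewrite /GRing.scale/=; field.
- by rewrite cos0; lra.
- by move=> z z0; rewrite subr_ge0 sin_ge_sqr.
Qed.

(** The factor min(1, |x|) lets the error be integrated under a second moment only, and makes it
    small against x^2 for small x, as a Lindeberg condition requires. *)
Lemma cos_taylor x :
  `|cos x - (1 - x ^+ 2 / 2)| <= x ^+ 2 * Num.min 1 `|x|.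
Proof.
wlog x0 : x / 0 <= x.
  by move=> h; have [/h//|/ltW] := leP 0 x; rewrite -oppr_ge0 => /h; rewrite sqrrN cosN normrN.
rewrite ger0_norm ?subr_ge0 ?cos_ge// (ger0_norm x0).
have := cos_le1 x; have := cos_le_cube x0.
have : 0 <= x ^+ 2 by exact: sqr_ge0.
have : 0 <= x ^+ 3 by rewrite exprn_ge0.
have [_|_] := leP 1 x; rewrite ?mulr1 -?exprSr; lra.
Qed.

Lemma sin_taylor x : `|sin x - x| <= x ^+ 2 * Num.min 1 `|x|.
Proof.
wlog x0 : x / 0 <= x.
  move=> h; have [/h//|/ltW] := leP 0 x; rewrite -oppr_ge0 => /h.
  by rewrite sqrrN sinN normrN -opprD normrN.
rewrite distrC ger0_norm ?subr_ge0 ?sin_le// (ger0_norm x0).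
have := sin_ge_sqr x0; have := sin_ge_cube x0.
have : 0 <= x ^+ 2 by exact: sqr_ge0.
have : 0 <= x ^+ 3 by rewrite exprn_ge0.
have [_|_] := leP 1 x; rewrite ?mulr1 -?exprSr; lra.
Qed.

Lemma expRN_taylor x : 0 <= x -> `|expR (- x) - (1 - x)| <= x ^+ 2.
Proof.
move=> x0; rewrite ger0_norm ?subr_ge0 ?expR_ge1Dx//.
have : expR (- x) <= 1 - x + x ^+ 2.
  rewrite expRN -div1r ler_pdivrMr ?expR_gt0//.
  have x1 := expR_ge1Dx x.
  have e : 1 = (1 - x + x ^+ 2) * (1 + x) - x ^+ 3 by ring.
  apply: (@le_trans _ _ ((1 - x + x ^+ 2) * (1 + x))).
    by rewrite [leLHS]e gerBl exprn_ge0.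
  by apply: ler_wpM2l => //; nra.
lra.
Qed.

Lemma cos_add_taylor x y :
  `|cos (x + y) - (cos x * (1 - y ^+ 2 / 2) - sin x * y)| <=
  2 * (y ^+ 2 * Num.min 1 `|y|).
Proof.
rewrite cosD.
have -> : cos x * cos y - sin x * sin y - (cos x * (1 - y ^+ 2 / 2) - sin x * y) =
  cos x * (cos y - (1 - y ^+ 2 / 2)) - sin x * (sin y - y) by ring.
rewrite mulr2n mulrDl mul1r (le_trans (ler_normB _ _))// !normrM lerD//.
- by rewrite -[leRHS]mul1r ler_pM// ?cos_taylor// ler_norml cos_geN1 cos_le1.
- by rewrite -[leRHS]mul1r ler_pM// ?sin_taylor// ler_norml sin_geN1 sin_le1.
Qed.

(** A smooth substitute for |x|, of order x^2 near 0 and of order |x| at infinity. Through it, sums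
    of independent centered variables with only a first moment can be controlled term by term, as
    through a variance. *)
Definition softabs x : R := Num.sqrt (1 + x ^+ 2) - 1.

Lemma softabs_ge0 x : 0 <= softabs x.
Proof.
rewrite /softabs subr_ge0 -[leLHS]sqrtr1 ler_sqrt ?lerDl ?sqr_ge0//.
by rewrite addr_ge0// sqr_ge0.
Qed.

Lemma softabs0 : softabs 0 = 0.
Proof. by rewrite /softabs expr0n/= addr0 sqrtr1 subrr. Qed.

Lemma softabs_mono x y : 0 <= x -> x <= `|y| -> softabs x <= softabs y.
Proof.
move=> x0 xy; rewrite /softabs lerB// ler_sqrt ?addr_ge0 ?sqr_ge0// lerD2l.
by rewrite -[leRHS]real_normK ?num_real// lerXn2r ?nnegrE.
Qed.

Lemma softabs_gt0 x : 0 < x -> 0 < softabs x.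
Proof.
move=> x0; rewrite /softabs subr_gt0 -[ltLHS]sqrtr1 ltr_sqrt ?ltrDl ?exprn_gt0//.
by rewrite addr_gt0// exprn_gt0.
Qed.

(** The linear term integrates to 0 against a centered y, and the remainder is quadratic for small y
    but only linear for large y. *)
Lemma softabs_add x y : softabs (x + y) <=
  softabs x + x / Num.sqrt (1 + x ^+ 2) * y + 2 * Num.min `|y| (y ^+ 2).
Proof.
rewrite /softabs.
set A := Num.sqrt (1 + x ^+ 2); set B := Num.sqrt (1 + (x + y) ^+ 2).
have A2 : A ^+ 2 = 1 + x ^+ 2 by rewrite sqr_sqrtr// addr_ge0 ?sqr_ge0.
have B2 : B ^+ 2 = 1 + (x + y) ^+ 2 by rewrite sqr_sqrtr// addr_ge0 ?sqr_ge0.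
have A1 : 1 <= A by have := softabs_ge0 x; rewrite /softabs -/A; lra.
have B1 : 1 <= B by have := softabs_ge0 (x + y); rewrite /softabs -/B; lra.
have xA : `|x / A| <= 1.
  rewrite normrM normfV (ger0_norm (_ : 0 <= A)); last lra.
  rewrite ler_pdivrMr; last lra.
  rewrite mul1r -(ger0_norm (_ : 0 <= A)); last lra.
  rewrite -ler_sqr ?nnegrE// !real_normK ?num_real//; lra.
(* The Lipschitz bound, used when |y| <= y^2. The linear term is at least -|y|, whence the constant
   2 in front of the remainder. *)
have key1 : B <= A + `|y|.
  rewrite -ler_sqr ?nnegrE; [|lra|have := normr_ge0 y; lra].
  rewrite sqrrD A2 B2 real_normK ?num_real// sqrrD.
  have : x * y <= A * `|y|.
    rewrite (le_trans (ler_norm _))// normrM ler_wpM2r//.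
    rewrite -(ger0_norm (_ : 0 <= A)); last lra.
    rewrite -ler_sqr ?nnegrE// !real_normK ?num_real//; lra.
  rewrite mulr2n [X in _ -> _ <= X]addrAC; lra.
(* The tangent bound for the square root, equivalent to (B - A)^2 / A >= 0. *)
have key2 : B <= A + x / A * y + y ^+ 2 / 2.
  have Ai : 0 < A^-1 by rewrite invr_gt0; lra.
  have Ai1 : A^-1 <= 1 by rewrite invf_le1; lra.
  have AAi : A * A^-1 = 1 by rewrite divff//; apply/eqP; lra.
  have : 0 <= (B - A) ^+ 2 * A^-1 by rewrite mulr_ge0 ?sqr_ge0// ltW.
  have -> : (B - A) ^+ 2 * A^-1 = 2 * (A + x / A * y + y ^+ 2 / A / 2 - B).
    have -> : (B - A) ^+ 2 = 2 * A ^+ 2 + 2 * x * y + y ^+ 2 - 2 * A * B.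
      by rewrite sqrrB B2 A2; ring.
    by field; apply/eqP; lra.
  have : y ^+ 2 / A <= y ^+ 2 by rewrite ler_piMr// sqr_ge0.
  lra.
have xAy : - `|y| <= x / A * y.
  rewrite lerNl (le_trans (ler_norm _))// normrN normrM.
  by rewrite -[leRHS]mul1r ler_wpM2r.
have : 0 <= y ^+ 2 by exact: sqr_ge0.
have := normr_ge0 y.
have [_|_] := leP `|y| (y ^+ 2); lra.
Qed.

Lemma continuous_softabs : continuous softabs.
Proof.
move=> x; apply: cvgB; last exact: cvg_cst.
apply: (@continuous_comp _ _ _ (fun x => 1 + x ^+ 2) Num.sqrt).
  by apply: cvgD; [exact: cvg_cst|exact: exprn_continuous].
exact: sqrt_continuous.
Qed.

Lemma measurable_softabs : measurable_fun setT softabs.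
Proof. apply: continuous_measurable_fun; exact: continuous_softabs. Qed.

Lemma measurable_cos : measurable_fun setT (@cos R).
Proof. apply: continuous_measurable_fun; exact: continuous_cos. Qed.

Lemma normr_cos_le1 x : `|cos x| <= 1.
Proof. by rewrite ler_norml cos_geN1 cos_le1. Qed.

End trigonometric_bounds.

Section integral_toolbox.
Import HBNNSimple.
Context {d : measure_display} {T : measurableType d} {R : realType}.

(** Neither function is assumed measurable: the integral of a nonnegative function is a supremum
    over the simple functions below it, and each of these can be set to 0 on [N] without changing
    its integral. Limits and sums over generations agree with measurable functions of the tree only
    off a null set, so this generality is used throughout. *)
Lemma integral_eq_off_null (mu : {measure set T -> \bar R}) (D N : set T)
    (f g : T -> \bar R) :
  measurable N -> mu N = 0%E -> (forall x, D x -> ~ N x -> f x = g x) ->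
  (\int[mu]_(x in D) f x = \int[mu]_(x in D) g x)%E.
Proof.
move=> mN N0 fg.
have key (F G : T -> \bar R) : (forall x, 0 <= F x)%E -> (forall x, 0 <= G x)%E ->
    (forall x, ~ N x -> F x = G x) -> (\int[mu]_x F x <= \int[mu]_x G x)%E.
  move=> F0 G0 FG; rewrite !ge0_integralTE//; apply: ge_ereal_sup => _ [h hF <-].
  have mNC : measurable (~` N) by exact: measurableC.
  pose h' : T -> R := proj_nnsfun h mNC.
  have <- : sintegral mu h' = sintegral mu h.
    rewrite /h' -!integralT_nnsfun; apply: ge0_ae_eq_integral => //.
    - exact/measurable_EFinP/measurable_funP.
    - exact/measurable_EFinP/measurable_funP.
    - by move=> x _; rewrite lee_fin.
    - by move=> x _; rewrite lee_fin.
    - exists N; split => // x /=; apply: contra_notP => Nx _ /=.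
      by rewrite mindicE mem_set ?mulr1.
  apply: ereal_sup_ubound; exists (proj_nnsfun h mNC) => // x /=.
  rewrite /= mindicE; have [Nx|Nx] := pselect (N x).
    by rewrite memNset ?mulr0//=; exact/contra_notP.
  by rewrite mem_set// mulr1 -FG.
have keyE (F G : T -> \bar R) : (forall x, 0 <= F x)%E -> (forall x, 0 <= G x)%E ->
    (forall x, ~ N x -> F x = G x) -> (\int[mu]_x F x = \int[mu]_x G x)%E.
  by move=> F0 G0 FG; apply/eqP; rewrite eq_le !key// => x /FG.
rewrite integral_mkcond [RHS]integral_mkcond integralE [RHS]integralE.
have fgD x : ~ N x -> (f \_ D) x = (g \_ D) x.
  by move=> Nx; rewrite /patch; case: ifPn => // /set_mem/fg; exact.
by congr (_ - _)%E; apply: keyE => //= x /fgD e; rewrite !(funeposE, funenegE) e.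
Qed.

End integral_toolbox.

Section integrable_functions.
Context {d : measure_display} {T : measurableType d} {R : realType}.
Variable mu : {measure set T -> \bar R}.

Lemma integrable_add (f g : T -> R) : mu.-integrable setT (EFin \o f) ->
  mu.-integrable setT (EFin \o g) -> mu.-integrable setT (EFin \o (fun x => f x + g x)).
Proof. by move=> fi gi; exact: (integrableD measurableT fi gi). Qed.

Lemma integrable_sub (f g : T -> R) : mu.-integrable setT (EFin \o f) ->
  mu.-integrable setT (EFin \o g) -> mu.-integrable setT (EFin \o (fun x => f x - g x)).
Proof. by move=> fi gi; exact: (integrableB measurableT fi gi). Qed.

Lemma integrable_scale (c : R) (f : T -> R) : mu.-integrable setT (EFin \o f) ->
  mu.-integrable setT (EFin \o (fun x => c * f x)).
Proof. by move=> fi; exact: (integrableZl measurableT c fi). Qed.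

Lemma integrable_normr (f : T -> R) : mu.-integrable setT (EFin \o f) ->
  mu.-integrable setT (EFin \o (fun x => `|f x|)).
Proof. by move=> fi; exact: (integrable_abse fi). Qed.

Lemma EFin_Rintegral (f : T -> R) : mu.-integrable setT (EFin \o f) ->
  (\int[mu]_x (f x)%:E = (\int[mu]_x f x)%:E)%E.
Proof. by move=> fi; rewrite /Rintegral fineK//; exact: integrable_fin_num. Qed.

Lemma integrable_dominated (f g : T -> R) : measurable_fun setT f ->
  (forall x, `|f x| <= g x) -> mu.-integrable setT (EFin \o g) ->
  mu.-integrable setT (EFin \o f).
Proof.
move=> mf fg; apply: le_integrable => //; first exact/measurable_EFinP.
by move=> x _ /=; rewrite lee_fin (le_trans (fg x))// ler_norm.
Qed.

Lemma ge0_integrable (f : T -> R) : measurable_fun setT f ->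
  (forall x, 0 <= f x) -> (\int[mu]_x (f x)%:E < +oo)%E ->
  mu.-integrable setT (EFin \o f).
Proof.
move=> mf f0 fi; apply/integrableP; split; first exact/measurable_EFinP.
by under eq_integral do rewrite /= ger0_norm//.
Qed.

Lemma ge0_integral_le_EFin (f g : T -> R) : measurable_fun setT f ->
  measurable_fun setT g -> (forall x, 0 <= f x) -> (forall x, f x <= g x) ->
  (\int[mu]_x (f x)%:E <= \int[mu]_x (g x)%:E)%E.
Proof.
move=> mf mg f0 fg; apply: ge0_le_integral => //; try exact/measurable_EFinP.
all: by move=> x _; rewrite lee_fin.
Qed.

End integrable_functions.

Section probability_toolbox.
Context {d : measure_display} {T : measurableType d} {R : realType}.
Variable P : probability T R.

Lemma probability_setT1 : P [set: T] = 1%E.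
Proof. exact: probability_setT. Qed.

Lemma integral_indic_probability (A : set T) : measurable A ->
  (\int[P]_w (\1_A w)%:E = P A)%E.
Proof. by move=> mA; rewrite integral_indic// setIT. Qed.

Lemma integrable_cst (c : R) : P.-integrable setT (EFin \o (fun=> c)).
Proof. exact: finite_measure_integrable_cst. Qed.

Definition bounded_mfun (f : T -> R) :=
  measurable_fun setT f /\ exists M, forall x, `|f x| <= M.

Lemma bounded_mfun_integrable (f : T -> R) : bounded_mfun f ->
  P.-integrable setT (EFin \o f).
Proof.
move=> [mf [M fM]]; apply: measurable_bounded_integrable => //.
  by rewrite [X in (X < _)%E]probability_setT1 ltry.
by exists M; split; [exact: num_real|move=> y My x _ /=; exact: (le_trans (fM x) (ltW My))].
Qed.

Lemma Rintegral_probability_cst (c : R) : \int[P]_x c = c.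
Proof. by rewrite Rintegral_cst// [X in fine X]probability_setT1 mulr1. Qed.

Lemma integral_probability_cst (c : \bar R) : (\int[P]_x c = c)%E.
Proof. by rewrite integral_cst// [X in (_ * X)%E]probability_setT1 mule1. Qed.

Lemma Rintegral_norm_le (f g : T -> R) :
  P.-integrable setT (EFin \o f) -> P.-integrable setT (EFin \o g) ->
  (forall x, `|f x| <= g x) -> `|\int[P]_x f x| <= \int[P]_x g x.
Proof.
move=> fi gi fg; apply: (le_trans (le_normr_Rintegral _ _)) => //.
apply: le_Rintegral => //.
exact: integrable_normr.
Qed.

Lemma Rintegral_bounded_le (f : T -> R) (M : R) : measurable_fun setT f ->
  (forall x, `|f x| <= M) -> `|\int[P]_x f x| <= M.
Proof.
move=> mf fM; rewrite -[leRHS](Rintegral_probability_cst M).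
apply: Rintegral_norm_le => //.
  by apply: bounded_mfun_integrable; split => //; exists M.
exact: finite_measure_integrable_cst.
Qed.

Definition centered_L2 (xi : T -> R) (v : R) :=
  [/\ measurable_fun setT xi, (\int[P]_w (xi w ^+ 2)%:E = v%:E)%E &
      \int[P]_w xi w = 0].

Section centered.
Context (xi : T -> R) (v : R).
Hypothesis xiv : centered_L2 xi v.

Lemma centered_L2_measurable : measurable_fun setT xi.
Proof. by case: xiv. Qed.

Lemma centered_L2_sqr_integrable : P.-integrable setT (EFin \o (fun w => xi w ^+ 2)).
Proof.
case: xiv => m i _; apply: ge0_integrable => [||]; last by rewrite i ltry.
  exact: measurable_funX.
by move=> x; exact: sqr_ge0.
Qed.

Lemma centered_L2_integrable : P.-integrable setT (EFin \o xi).
Proof.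
apply: (integrable_dominated (g := fun w => 1 + xi w ^+ 2)).
- exact: centered_L2_measurable.
- move=> x; have : 0 <= (`|xi x| - 1) ^+ 2 by exact: sqr_ge0.
  rewrite sqrrB real_normK ?num_real// expr1n mulr1.
  by have := normr_ge0 (xi x); have := sqr_ge0 (xi x); nra.
- apply: integrable_add; [exact: integrable_cst|exact: centered_L2_sqr_integrable].
Qed.

Lemma centered_L2_ge0 : 0 <= v.
Proof.
case: xiv => _ i _; rewrite -lee_fin -i; apply: integral_ge0 => x _.
by rewrite lee_fin sqr_ge0.
Qed.

Lemma centered_L2_add (y : R) :
  (\int[P]_w ((y + xi w) ^+ 2)%:E = (y ^+ 2 + v)%:E)%E.
Proof.
have [m i c] := xiv; have i1 := centered_L2_integrable.
have i2 := centered_L2_sqr_integrable.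
have i3 : P.-integrable setT (EFin \o (fun w => (2 * y) * xi w)).
  exact: (integrable_scale (2 * y) i1).
have i4 : P.-integrable setT (EFin \o (fun w => y ^+ 2 + (2 * y) * xi w)).
  by apply: integrable_add => //; exact: integrable_cst.
transitivity (\int[P]_w ((y ^+ 2 + (2 * y) * xi w) + xi w ^+ 2)%:E)%E.
  by apply: eq_integral => w _; congr (_%:E); ring.
rewrite EFin_Rintegral; last first.
  exact: integrable_add.
rewrite RintegralD// RintegralD//; last exact: integrable_cst.
rewrite RintegralZl// c mulr0 addr0 Rintegral_probability_cst.
by rewrite /Rintegral i.
Qed.

End centered.

End probability_toolbox.

(** * Sums of independent random variables *)

Section independent_sums.
Context {d : measure_display} {T : measurableType d} {R : realType}.
Variable P : probability T R.

(* Independence of X and Y, in the form of a Fubini formula for their joint law. *)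
Definition indep2 (X Y : T -> R) := forall f : R * R -> \bar R,
  measurable_fun setT f -> (forall z, 0 <= f z)%E ->
  (\int[P]_w f (X w, Y w) = \int[P]_w \int[P]_w' f (X w', Y w))%E.

(** The Fubini formula [indep2] is for nonnegative functions; it is applied to f + M, and the
    constant is cancelled afterwards. *)
Lemma indep2_bounded (X Y : T -> R) (f : R * R -> R) :
  measurable_fun setT X -> measurable_fun setT Y -> indep2 X Y ->
  bounded_mfun f ->
  bounded_mfun (fun w => \int[P]_w' f (X w', Y w)) /\
  \int[P]_w f (X w, Y w) = \int[P]_w \int[P]_w' f (X w', Y w).
Proof.
move=> mX mY XY [mf [M fM]].
have mfXY : measurable_fun setT (fun z : T * T => f (X z.2, Y z.1)).
  apply: (measurableT_comp mf); apply: measurable_fun_pair.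
    exact: (measurableT_comp mX).
  exact: (measurableT_comp mY).
have bin w : bounded_mfun (fun w' => f (X w', Y w)).
  split; last by exists M.
  exact: (measurable_fun_pair2 w mfXY).
pose g z := (f z + M)%:E.
have mg : measurable_fun setT g.
  by apply/measurable_EFinP; exact: measurable_funD.
have g0 z : (0 <= g z)%E.
  by rewrite lee_fin; have := fM z; rewrite ler_norml => /andP[]; lra.
have inE w : (\int[P]_w' g (X w', Y w) = (\int[P]_w' f (X w', Y w) + M)%:E)%E.
  rewrite EFin_Rintegral; last first.
    apply: (integrable_add (f := fun w' => f (X w', Y w))); last exact: integrable_cst.
    exact: bounded_mfun_integrable.
  rewrite RintegralD//; last exact: integrable_cst.
    by rewrite Rintegral_probability_cst.
  exact: bounded_mfun_integrable.
have mgin : measurable_fun setT (fun w => \int[P]_w' f (X w', Y w)).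
  have := @measurable_fun_fubini_tonelli_F _ _ T T R P (fun z => g (X z.2, Y z.1)).
  have mgXY : measurable_fun setT (fun z : T * T => g (X z.2, Y z.1)).
    by apply/measurable_EFinP; exact: measurable_funD.
  move=> /(_ mgXY (fun z => g0 _)); rewrite /fubini_F.
  under eq_fun do rewrite inE.
  move/measurable_EFinP => h.
  have := measurable_funB h (@measurable_cst _ _ T R setT M).
  by apply: eq_measurable_fun => w _ /=; rewrite addrK.
have bi w : `|\int[P]_w' f (X w', Y w)| <= M.
  by apply: Rintegral_bounded_le => //; case: (bin w).
split; first by split => //; exists M.
have := XY g mg g0; under [in RHS]eq_integral do rewrite inE.
rewrite EFin_Rintegral; last first.
  apply: (integrable_add (f := fun w' => f (X w', Y w'))); last exact: integrable_cst.
  apply: bounded_mfun_integrable; split; last by exists M.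
  by apply: (measurableT_comp mf); exact: measurable_fun_pair.
rewrite EFin_Rintegral; last first.
  apply: (integrable_add (f := fun w => \int[P]_w' f (X w', Y w))); last exact: integrable_cst.
  by apply: bounded_mfun_integrable; split => //; exists M.
move=> [].
rewrite RintegralD//; [|apply: bounded_mfun_integrable; split; last by exists M
  |exact: integrable_cst]; last first.
  by apply: (measurableT_comp mf); exact: measurable_fun_pair.
rewrite RintegralD//; [|by apply: bounded_mfun_integrable; split => //; exists M
  |exact: integrable_cst].
exact: addIr.
Qed.

Context {I : Type} (xi : I -> T -> R).
Hypothesis mxi : forall u, measurable_fun setT (xi u).

(** Each term is independent of the sum of the later ones. This is weaker than joint independence,
    but it is exactly what an induction that removes one term at a time consumes. *)
Fixpoint indep_sum (s : seq I) : Prop :=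
  if s is u :: s' then indep2 (xi u) (fun w => \sum_(v <- s') xi v w) /\ indep_sum s'
  else True.

Let msum s : measurable_fun setT (fun w => \sum_(v <- s) xi v w).
Proof. exact: measurable_sum. Qed.

Lemma indep_sum_sqr (s : seq I) (v : I -> R) (x : R) : indep_sum s ->
  (forall u, centered_L2 P (xi u) (v u)) ->
  (\int[P]_w ((x + \sum_(u <- s) xi u w) ^+ 2)%:E = (x ^+ 2 + \sum_(u <- s) v u)%:E)%E.
Proof.
move=> + cxi; elim: s x => [x _|u s ih x [ius /ih{}ih]].
  under eq_integral do rewrite big_nil addr0.
  by rewrite integral_probability_cst big_nil addr0.
under eq_integral do rewrite big_cons.
rewrite (ius (fun z => ((x + (z.1 + z.2)) ^+ 2)%:E)); last first.
- by move=> z; rewrite lee_fin sqr_ge0.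
- apply/measurable_EFinP; apply: measurable_funX; apply: measurable_funD => //.
  by apply: measurable_funD; [exact: measurable_fst|exact: measurable_snd].
transitivity (\int[P]_w ((((x + \sum_(u <- s) xi u w) ^+ 2)%:E) + (v u)%:E))%E.
  apply: eq_integral => w _ /=; rewrite -EFinD -(centered_L2_add (cxi u)).
  by apply: eq_integral => w' _; congr (_%:E); ring.
rewrite ge0_integralD//; last 3 first.
- by move=> w _; rewrite lee_fin sqr_ge0.
- apply/measurable_EFinP; apply: measurable_funX; exact: measurable_funD.
- by move=> w _; rewrite lee_fin (centered_L2_ge0 (cxi u)).
rewrite ih integral_probability_cst -EFinD big_cons; congr (_%:E); ring.
Qed.

Lemma centered_softabs_add (X : T -> R) (e x : R) : measurable_fun setT X ->
  P.-integrable setT (EFin \o X) -> \int[P]_w X w = 0 ->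
  (\int[P]_w (Num.min `|X w| (X w ^+ 2))%:E <= e%:E)%E ->
  (\int[P]_w (softabs (x + X w))%:E <= (softabs x + 2 * e)%:E)%E.
Proof.
move=> mX iX X0 Xe.
have mmin : measurable_fun setT (fun w => Num.min `|X w| (X w ^+ 2)).
  by apply: measurable_minr; [exact: measurableT_comp|exact: measurable_funX].
have min0 w : 0 <= Num.min `|X w| (X w ^+ 2) by rewrite le_min normr_ge0 sqr_ge0.
have imin : P.-integrable setT (EFin \o (fun w => Num.min `|X w| (X w ^+ 2))).
  by apply: ge0_integrable => //; rewrite (le_lt_trans Xe)// ltry.
set c := x / Num.sqrt (1 + x ^+ 2).
have i1 : P.-integrable setT (EFin \o (fun w => softabs x + c * X w)).
  by apply: integrable_add; [exact: integrable_cst|exact: integrable_scale].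
have i2 := integrable_scale 2 imin.
apply: (@le_trans _ _ (\int[P]_w ((softabs x + c * X w) + 2 * Num.min `|X w| (X w ^+ 2))%:E)%E).
  apply: ge0_integral_le_EFin.
  - apply: measurableT_comp; first exact: measurable_softabs.
    exact: measurable_funD.
  - apply: measurable_funD; last by apply: measurable_funM.
    by apply: measurable_funD => //; apply: measurable_funM.
  - by move=> w; exact: softabs_ge0.
  - by move=> w; exact: softabs_add.
rewrite EFin_Rintegral; last exact: integrable_add.
rewrite RintegralD// RintegralD//; [|exact: integrable_cst|exact: integrable_scale].
rewrite !RintegralZl// X0 mulr0 addr0 Rintegral_probability_cst lee_fin lerD2l.
by rewrite ler_pM2l// -lee_fin -EFin_Rintegral.
Qed.

(** Each term removed costs at most twice its truncated moment, because its linear contribution has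
    mean 0. The costs add up as variances do, although no second moment is required. *)
Lemma indep_sum_softabs (s : seq I) (e : I -> R) (x : R) : indep_sum s ->
  (forall u, P.-integrable setT (EFin \o xi u)) -> (forall u, \int[P]_w xi u w = 0) ->
  (forall u, (\int[P]_w (Num.min `|xi u w| (xi u w ^+ 2))%:E <= (e u)%:E)%E) ->
  (\int[P]_w (softabs (x + \sum_(u <- s) xi u w))%:E
     <= (softabs x + 2 * \sum_(u <- s) e u)%:E)%E.
Proof.
move=> + ixi cxi exi; elim: s x => [x _|u s ih x [ius /ih{}ih]].
  under eq_integral do rewrite big_nil addr0.
  by rewrite integral_probability_cst big_nil mulr0 addr0.
have msoft : measurable_fun setT (@softabs R).
  exact: measurable_softabs.
under eq_integral do rewrite big_cons.
rewrite (ius (fun z => (softabs (x + (z.1 + z.2)))%:E)); last first.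
- by move=> z; rewrite lee_fin softabs_ge0.
- apply/measurable_EFinP; apply: measurableT_comp => //; apply: measurable_funD => //.
  by apply: measurable_funD; [exact: measurable_fst|exact: measurable_snd].
have mss : measurable_fun setT (fun w => softabs (x + \sum_(u <- s) xi u w)).
  by apply: measurableT_comp => //; exact: measurable_funD.
have e0 : 0 <= e u.
  rewrite -lee_fin (le_trans _ (exi u))// integral_ge0// => w _.
  by rewrite lee_fin le_min normr_ge0 sqr_ge0.
apply: (@le_trans _ _ (\int[P]_w ((softabs (x + \sum_(u <- s) xi u w))%:E + (2 * e u)%:E))%E).
  apply: ge0_le_integral => //.
  - by move=> w _; apply: integral_ge0 => w' _; rewrite lee_fin softabs_ge0.
  - pose F (z : T * T) := (softabs (x + (xi u z.2 + \sum_(u <- s) xi u z.1)))%:E.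
    have := @measurable_fun_fubini_tonelli_F _ _ T T R P F; apply.
    + apply/measurable_EFinP; apply: measurableT_comp => //; apply: measurable_funD => //.
      apply: measurable_funD; first exact: (measurableT_comp (mxi u) measurable_snd).
      exact: (measurableT_comp (msum s) measurable_fst).
    + by move=> z; rewrite lee_fin softabs_ge0.
  - by apply/measurable_EFinP; exact: measurable_funD.
  - move=> w _; rewrite -EFinD.
    under eq_integral do rewrite /= addrCA addrC.
    exact: (centered_softabs_add _ (mxi u) (ixi u) (cxi u) (exi u)).
rewrite ge0_integralD//; last 3 first.
- by move=> w _; rewrite lee_fin softabs_ge0.
- exact/measurable_EFinP.
- by move=> w _; rewrite lee_fin mulr_ge0.
rewrite integral_probability_cst big_cons.
apply: (le_trans (leeD (ih x) (lexx _))); rewrite -EFinD lee_fin mulrDr; lra.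
Qed.

(** X may be replaced by a centered normal variable of the same variance, for which the integral is
    exactly exp(-v/2) cos x. The term v^2 is the error made when 1 - v/2 is replaced by
    exp(-v/2). *)
Lemma centered_cos_add (X : T -> R) (v e x : R) : centered_L2 P X v ->
  (\int[P]_w (X w ^+ 2 * Num.min 1 `|X w|)%:E <= e%:E)%E ->
  `|\int[P]_w cos (x + X w) - expR (- (v / 2)) * cos x| <= 2 * e + v ^+ 2.
Proof.
move=> cX Xe; have [mX iX2 X0] := cX; have v0 := centered_L2_ge0 cX.
have mmin : measurable_fun setT (fun w => X w ^+ 2 * Num.min 1 `|X w|).
  apply: measurable_funM; first exact: measurable_funX.
  by apply: measurable_minr => //; exact: measurableT_comp.
have min0 w : 0 <= X w ^+ 2 * Num.min 1 `|X w|.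
  by rewrite mulr_ge0 ?sqr_ge0// le_min ler01 normr_ge0.
have imin : P.-integrable setT (EFin \o (fun w => X w ^+ 2 * Num.min 1 `|X w|)).
  by apply: ge0_integrable => //; rewrite (le_lt_trans Xe)// ltry.
have i1 := centered_L2_integrable cX.
have i2 := centered_L2_sqr_integrable cX.
have i3 : P.-integrable setT (EFin \o (fun w => cos x * (1 - X w ^+ 2 / 2) - sin x * X w)).
  apply: integrable_sub; apply: integrable_scale => //.
  apply: integrable_sub; first exact: integrable_cst.
  by under eq_fun do rewrite mulrC; exact: integrable_scale.
have i4 : P.-integrable setT (EFin \o (fun w => cos (x + X w))).
  apply: bounded_mfun_integrable; split.
    apply: measurableT_comp; first exact: measurable_cos.
    exact: measurable_funD.
  by exists 1 => w; rewrite ler_norml cos_geN1 cos_le1.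
have E3 : \int[P]_w (cos x * (1 - X w ^+ 2 / 2) - sin x * X w) = cos x * (1 - v / 2).
  transitivity (\int[P]_w ((cos x + (- (cos x / 2)) * X w ^+ 2) + (- sin x) * X w)).
    by apply: eq_Rintegral => w _; field.
  rewrite RintegralD//; [|apply: integrable_add; [exact: integrable_cst|exact: integrable_scale]|exact: integrable_scale].
  rewrite RintegralD//; [|exact: integrable_cst|exact: integrable_scale].
  by rewrite !RintegralZl// X0 Rintegral_probability_cst {1}/Rintegral iX2/=; field.
have h1 : `|\int[P]_w cos (x + X w) - cos x * (1 - v / 2)| <= 2 * e.
  rewrite -E3 -RintegralB//.
  apply: (@le_trans _ _ (\int[P]_w (2 * (X w ^+ 2 * Num.min 1 `|X w|)))).
    apply: Rintegral_norm_le; [exact: integrable_sub|exact: integrable_scale|].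
    by move=> w; exact: cos_add_taylor.
  by rewrite RintegralZl// ler_pM2l// -lee_fin -EFin_Rintegral.
have h2 : `|cos x * (1 - v / 2) - expR (- (v / 2)) * cos x| <= v ^+ 2.
  rewrite [_ * cos x]mulrC -mulrBr normrM distrC.
  have : `|expR (- (v / 2)) - (1 - v / 2)| <= (v / 2) ^+ 2.
    by apply: expRN_taylor; rewrite divr_ge0.
  have : `|cos x| <= 1 by rewrite ler_norml cos_geN1 cos_le1.
  move=> c1 e1; apply: (@le_trans _ _ (1 * (v / 2) ^+ 2)).
    by apply: ler_pM.
  by rewrite mul1r expr_div_n ler_pdivrMr// ler_peMr ?sqr_ge0//; lra.
have := ler_distD (cos x * (1 - v / 2)) (\int[P]_w cos (x + X w)) (expR (- (v / 2)) * cos x).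
lra.
Qed.

(** Removing a term multiplies the rest by exp(-v/2) <= 1, so the errors add up without
    amplification. The phase x must be arbitrary for the induction, and with it the cosine alone
    also covers the sine. *)
Lemma indep_sum_cos (s : seq I) (v e : I -> R) (x : R) : indep_sum s ->
  (forall u, centered_L2 P (xi u) (v u)) ->
  (forall u, (\int[P]_w (xi u w ^+ 2 * Num.min 1 `|xi u w|)%:E <= (e u)%:E)%E) ->
  `|\int[P]_w cos (x + \sum_(u <- s) xi u w)
    - expR (- ((\sum_(u <- s) v u) / 2)) * cos x|
  <= \sum_(u <- s) (2 * e u + v u ^+ 2).
Proof.
move=> + cxi exi; elim: s x => [x _|u s ih x [ius /ih{}ih]].
  under eq_Rintegral do rewrite big_nil addr0.
  by rewrite Rintegral_probability_cst !big_nil mul0r oppr0 expR0 mul1r subrr normr0.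
have mcos : measurable_fun setT (@cos R).
  exact: measurable_cos.
have cos1 (y : R) : `|cos y| <= 1 by rewrite ler_norml cos_geN1 cos_le1.
have bf : bounded_mfun (fun z : R * R => cos (x + (z.1 + z.2))).
  split; last by exists 1.
  apply: measurableT_comp => //; apply: measurable_funD => //.
  by apply: measurable_funD; [exact: measurable_fst|exact: measurable_snd].
have [bin] := indep2_bounded (mxi u) (msum s) ius bf.
under eq_Rintegral do rewrite /=.
move=> E; under eq_Rintegral do rewrite big_cons.
rewrite {}E !big_cons.
set c := expR (- (v u / 2)).
have c1 : 0 <= c <= 1.
  rewrite expR_ge0 -[leRHS]expR0 ler_expR oppr_le0 divr_ge0//.
  exact: (centered_L2_ge0 (cxi u)).
set B := \int[P]_w cos (x + \sum_(u <- s) xi u w).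
have ib : P.-integrable setT (EFin \o (fun w => cos (x + \sum_(u <- s) xi u w))).
  apply: bounded_mfun_integrable; split; last by exists 1.
  by apply: measurableT_comp => //; exact: measurable_funD.
have h1 : `|\int[P]_w \int[P]_w' cos (x + (xi u w' + \sum_(u <- s) xi u w)) - c * B|
    <= 2 * e u + v u ^+ 2.
  rewrite /B -RintegralZl// -RintegralB//; last 2 first.
  - exact: (bounded_mfun_integrable P bin).
  - exact: integrable_scale.
  apply: Rintegral_bounded_le.
    apply: measurable_funB; first by case: bin.
    by apply: measurable_funM => //; apply: measurableT_comp => //; exact: measurable_funD.
  move=> w; under eq_Rintegral do rewrite /= addrCA addrC.
  exact: (centered_cos_add _ (cxi u) (exi u)).
have -> : expR (- ((v u + \sum_(u <- s) v u) / 2)) = c * expR (- ((\sum_(u <- s) v u) / 2)).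
  by rewrite /c -expRD; congr expR; ring.
have h2 : `|c * B - c * expR (- ((\sum_(u <- s) v u) / 2)) * cos x| <=
   \sum_(u <- s) (2 * e u + v u ^+ 2).
  rewrite -mulrA -mulrBr normrM (le_trans _ (ih x))// ler_piMl//.
  by rewrite ger0_norm; case/andP: c1.
exact: (le_trans (ler_distD (c * B) _ _) (lerD h1 h2)).
Qed.

(** Symmetrization: for any constant y, if |X_1 + y| and |X_2 + y| were both at most c, then |X_1 -
    X_2| would be at most 2c. Hence |X + y| > c has probability at least k/2 whatever y is, and the
    independent Y can be frozen. *)
Lemma indep2_anticoncentration (X Y : T -> R) (c k : R) :
  measurable_fun setT X -> measurable_fun setT Y -> indep2 X Y ->
  (k%:E <= (P \x P) [set z | (2 * c < `|X z.1 - X z.2|)%R])%E ->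
  ((k / 2)%:E <= P [set w | (c < `|X w + Y w|)%R])%E.
Proof.
move=> mX mY XY kc.
have mB : measurable [set x : R | c < `|x|].
  have -> : [set x : R | c < `|x|] = (@Num.norm _ R) @^-1` `]c, +oo[%classic.
    by apply/seteqP; split => x /=; rewrite in_itv/= andbT.
  by rewrite -[X in measurable X]setTI; exact: (@normr_measurable _ setT).
have mset (Z : T -> R) : measurable_fun setT Z -> measurable [set w | c < `|Z w|].
  by move=> mZ; rewrite -[X in measurable X]setTI; exact: (mZ measurableT _ mB).
have mset2 : measurable [set z : T * T | 2 * c < `|X z.1 - X z.2|].
  have -> : [set z : T * T | 2 * c < `|X z.1 - X z.2|] =
     (fun z => `|X z.1 - X z.2|) @^-1` `]2 * c, +oo[%classic.
    by apply/seteqP; split => x /=; rewrite in_itv/= andbT.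
  rewrite -[X in measurable X]setTI.
  suff mh : measurable_fun setT (fun z : T * T => `|X z.1 - X z.2|) by apply: mh.
  by apply: measurableT_comp => //; apply: measurable_funB; exact: measurableT_comp.
pose f (z : R * R) : \bar R := (\1_[set x : R | c < `|x|] (z.1 + z.2))%:E.
have f0 z : (0 <= f z)%E by rewrite lee_fin.
have indE (Z : T -> R) : measurable_fun setT Z ->
    (\int[P]_w (\1_[set x : R | c < `|x|] (Z w))%:E = P [set w | (c < `|Z w|)%R])%E.
  by move=> /mset mZ; rewrite -integral_indic_probability.
rewrite -indE; last exact: measurable_funD.
rewrite (_ : (\int[P]_w _)%E = (\int[P]_w f (X w, Y w))%E)// XY//; last first.
  by apply/measurable_EFinP; apply: measurableT_comp => //; apply: measurable_funD;
    [exact: measurable_fst|exact: measurable_snd].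
rewrite -(integral_probability_cst P (k / 2)%:E).
have [k0|k0] := ltP k 0.
  apply: (@le_trans _ _ 0%E).
    by rewrite integral_probability_cst lee_fin; lra.
  by apply: integral_ge0 => w _; apply: integral_ge0.
apply: ge0_le_integral => //.
- by move=> w _; rewrite lee_fin divr_ge0.
- have := @measurable_fun_fubini_tonelli_F _ _ T T R P (fun z => f (X z.2, Y z.1)).
  apply => //; apply/measurable_EFinP; apply: measurableT_comp => //.
  apply: measurable_funD; first exact: (measurableT_comp mX measurable_snd).
  exact: (measurableT_comp mY measurable_fst).
move=> w _; rewrite (indE (fun w' => X w' + Y w)); last exact: measurable_funD.
set A := [set w' | c < `|X w' + Y w|].
have mA : measurable A by apply: mset; exact: measurable_funD.
have : (k%:E <= P A + P A)%E.
  apply: (le_trans kc).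
  apply: (@le_trans _ _ ((P \x P)%E (A `*` setT `|` setT `*` A))).
    apply: le_measure; rewrite ?inE//.
      by apply: measurableU; exact: measurableX.
    move=> z /= h.
    have := ler_normB (X z.1 + Y w) (X z.2 + Y w).
    have -> : X z.1 + Y w - (X z.2 + Y w) = X z.1 - X z.2 by ring.
    rewrite /A/=; have [a|a] := ltP c `|X z.1 + Y w|; first by left.
    by move=> b; right; split => //; lra.
  apply: (le_trans (measureU2 _ _ _)); try exact: measurableX.
  have PT : P setT = 1%E by exact: probability_setT.
  apply: leeD; rewrite le_eqVlt; apply/orP; left; apply/eqP.
    by rewrite -[RHS]mule1 -PT; exact: product_measure1E.
  by rewrite -[RHS]mul1e -PT; exact: product_measure1E.
have : P A \is a fin_num by exact: fin_num_measure.
by case: (P A) => [r| |]//= _; rewrite -EFinD !lee_fin => ?; lra.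
Qed.

End independent_sums.

(** * Marked trees *)

Section countably_valued.
Context {d : measure_display} {T : measurableType d}.

Lemma countable_bigcup_measurable (I : countType) (A : set I) (F : I -> set T) :
  (forall i, A i -> measurable (F i)) -> measurable (\bigcup_(i in A) F i).
Proof.
move=> mF; rewrite bigcup_mkcond; apply: countable_bigcupT_measurable => [|i].
  exact: countableP.
by case: ifPn => [/set_mem/mF|].
Qed.

(** Meant for generations, which are random finite sequences of labels. They take countably many
    values, so measurability is a condition on level sets and needs no sigma-algebra on the
    values. *)
Definition countably_measurable (I : Type) (k : T -> I) :=
  forall i, measurable [set w | k w = i].

Lemma countably_measurable_preimage (I : countType) (k : T -> I) (A : set I) :
  countably_measurable k -> measurable (k @^-1` A).
Proof.
move=> mk; have -> : k @^-1` A = \bigcup_(i in A) [set w | k w = i].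
  by apply/seteqP; split => [w Aw|w [i Ai /= ->//]]; exists (k w).
exact: countable_bigcup_measurable.
Qed.

Lemma countably_measurable_comp (I J : countType) (k : T -> I) (g : I -> J) :
  countably_measurable k -> countably_measurable (g \o k).
Proof. by move=> mk j; exact: (countably_measurable_preimage [set i | g i = j] mk). Qed.

Lemma countably_measurable_case (I J : countType) (k : T -> I) (F : I -> T -> J) :
  countably_measurable k -> (forall i, countably_measurable (F i)) ->
  countably_measurable (fun w => F (k w) w).
Proof.
move=> mk mF j.
have -> : [set w | F (k w) w = j] =
    \bigcup_(i in setT) ([set w | k w = i] `&` [set w | F i w = j]).
  apply/seteqP; split => [w Aw|w [i _ [/= <-//]]]; by exists (k w).
by apply: countable_bigcup_measurable => i _; exact: (measurableI _ _ (mk i) (mF i j)).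
Qed.

(** A sum over a random generation is measurable because it is so for each fixed list of labels. *)
Lemma measurable_fun_countable_case d' (U : measurableType d') (I : countType)
    (k : T -> I) (F : I -> T -> U) :
  countably_measurable k -> (forall i, measurable_fun setT (F i)) ->
  measurable_fun setT (fun w => F (k w) w).
Proof.
move=> mk mF _ B mB; rewrite setTI.
have -> : (fun w => F (k w) w) @^-1` B =
    \bigcup_(i in setT) ([set w | k w = i] `&` F i @^-1` B).
  apply/seteqP; split => [w Aw|w [i _ [/= <-//]]]; by exists (k w).
apply: countable_bigcup_measurable => i _; apply: measurableI => //.
by rewrite -[X in measurable X]setTI; exact: mF.
Qed.

End countably_valued.

Section tree_space.
Context {R : realType}.

(** The generators are copied from [config_measurable], so that the measurable sets of this type are
    those of the definition by conversion ([cfg_measurableE]). *)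
Definition cfg : Type := g_sigma_algebraType
  [set B : set (config R) | (exists2 A : set (\bar R), measurable A & B = [set c | A c.1]) \/
       (exists j, exists2 A : set R, measurable A & B = [set c | A (c.2 j)])].
HB.instance Definition _ := Measurable.on cfg.

Lemma cfg_measurableE : (measurable : set (set cfg)) = @config_measurable R.
Proof. by []. Qed.

Definition cyl (s : seq (seq nat)) (B : seq nat -> set cfg) : set (seq nat -> cfg) :=
  [set w | forall u, u \in s -> B u (w u)].

Definition cylinders : set (set (seq nat -> cfg)) :=
  [set C | exists s B, [/\ uniq s, forall u, u \in s -> measurable (B u) & C = cyl s B]].

(* A marked tree: the configuration of the children of each label of the
   Ulam-Harris tree, with the product sigma-algebra. *)
Definition tree : Type := g_sigma_algebraType cylinders.
HB.instance Definition _ := Measurable.on tree.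

Implicit Types (w : tree) (u v : seq nat) (n k : nat).

Lemma cylinders_setI : setI_closed cylinders.
Proof.
move=> _ _ [s [B [us mB ->]]] [s' [B' [us' mB' ->]]].
exists (undup (s ++ s')).
exists (fun u => (if u \in s then B u else setT) `&` (if u \in s' then B' u else setT)).
split; first exact: undup_uniq.
  move=> u _; apply: measurableI; case: ifPn => // h; [exact: mB|exact: mB'].
apply/seteqP; split => [w [h h'] u _|w h]; first by split; case: ifPn; [exact: h| |exact: h'|].
split => u us1.
  have := h u; rewrite mem_undup mem_cat us1 => /(_ isT) [].
  by [].
have := h u; rewrite mem_undup mem_cat us1 orbT => /(_ isT) [_].
by [].
Qed.

Lemma cylinders_setT : cylinders setT.
Proof. by exists [::], (fun=> setT); split => //; apply/seteqP; split. Qed.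

Lemma measurable_cyl s B : (forall u, u \in s -> measurable (B u)) ->
  measurable (cyl s B : set tree).
Proof.
move=> mB; apply: sub_sigma_algebra; exists (undup s), B; split.
- exact: undup_uniq.
- by move=> u; rewrite mem_undup; exact: mB.
- by apply/seteqP; split => w h u us; apply: h; move: us; rewrite mem_undup.
Qed.

Lemma measurable_coord u : measurable_fun setT (fun w : tree => w u : cfg).
Proof.
move=> _ B mB; rewrite setTI.
have -> : (fun w : tree => w u) @^-1` B = cyl [:: u] (fun=> B).
  apply/seteqP; split => w /=; first by move=> Bw v; rewrite inE => /eqP ->.
  by apply; rewrite inE.
exact: measurable_cyl.
Qed.

Lemma measurable_fun_tree d (T : measurableType d) (f : T -> tree) :
  (forall u, measurable_fun setT (fun x => f x u : cfg)) -> measurable_fun setT f.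
Proof.
move=> mf; apply: (@measurability _ _ T tree setT f cylinders) => //.
move=> _ [_ [s [B [us mB ->]]] <-]; rewrite setTI.
have -> : f @^-1` cyl s B = \bigcap_(u in [set` s]) ((fun x => f x u : cfg) @^-1` B u).
  by apply/seteqP; split => x /= h u us1; exact: h.
apply: fin_bigcap_measurable; first exact: finite_seq.
move=> u us1; rewrite -[X in measurable X]setTI; exact: (mf u measurableT _ (mB _ us1)).
Qed.

Lemma tree_measure_unique (m1 m2 : {measure set tree -> \bar R}) :
  (m1 setT < +oo)%E ->
  (forall s (B : seq nat -> set cfg), uniq s -> (forall u, u \in s -> measurable (B u)) ->
    m1 (cyl s B) = m2 (cyl s B)) ->
  forall A, measurable A -> m1 A = m2 A.
Proof.
move=> m1T m12; apply: (@measure_unique _ R tree cylinders (fun=> setT)) => //.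
- exact: cylinders_setI.
- by move=> _; exact: cylinders_setT.
- exact: bigcup_const.
- by move=> _ [s [B [us mB ->]]]; exact: m12.
Qed.

(** Resampling: labels in [p] keep the marks of the first tree, all others receive those of the
    second. With [p] the labels of length < n, integrating over the second tree amounts to
    conditioning on F_n. *)
Definition splice (p : pred (seq nat)) (z : tree * tree) : tree :=
  fun u => if p u then z.1 u else z.2 u.

Definition shift u w : tree := fun v => w (u ++ v).

Lemma measurable_splice p : measurable_fun setT (splice p).
Proof.
apply: measurable_fun_tree => u; rewrite /splice; case: (p u).
  exact: (measurableT_comp (measurable_coord u) measurable_fst).
exact: (measurableT_comp (measurable_coord u) measurable_snd).
Qed.

Lemma measurable_shift u : measurable_fun setT (shift u).
Proof. by apply: measurable_fun_tree => v; exact: measurable_coord. Qed.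

(** An infinite number of points is read as 0, since [fine] sends +oo to 0. This concerns a null
    event only and keeps generations finite lists everywhere. *)
Definition nchildren (c : cfg) : nat := Num.truncn (fine c.1).

Fixpoint gen n w : seq (seq nat) :=
  if n is k.+1 then
    flatten [seq [seq rcons u j | j <- iota 0 (nchildren (w u))] | u <- gen k w]
  else [:: [::]].

Definition tpos u w : R := \sum_(i < size u) (w (take i u)).2 (nth 0%N u i).

(** A pointwise counterpart of measurability with respect to the marks of the labels in [p]. It is
    easy to check for explicit functionals and behaves well under splicing, from which independence
    is derived. *)
Definition depends_on (A : Type) (p : pred (seq nat)) (f : tree -> A) :=
  forall w w', (forall u, p u -> w u = w' u) -> f w = f w'.

Lemma depends_on_splice_l A p (f : tree -> A) z :
  depends_on p f -> f (splice p z) = f z.1.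
Proof. by move=> /(_ (splice p z) z.1); apply => u pu; rewrite /splice pu. Qed.

Lemma depends_on_splice_r A p (f : tree -> A) z :
  depends_on (predC p) f -> f (splice p z) = f z.2.
Proof.
by move=> /(_ (splice p z) z.2); apply => u /= /negbTE pu; rewrite /splice pu.
Qed.

Lemma depends_on_sub A (p q : pred (seq nat)) (f : tree -> A) :
  (forall u, p u -> q u) -> depends_on p f -> depends_on q f.
Proof. by move=> pq fp w w' h; apply: fp => u /pq; exact: h. Qed.

Lemma depends_on_shift A (f : tree -> A) u : depends_on (prefix u) (f \o shift u).
Proof.
move=> w w' h; congr f; apply/funext => v; apply: h.
exact: prefix_prefix.
Qed.

Lemma gen_size n w u : u \in gen n w -> size u = n.
Proof.
elim: n u => [u|n ih u] /=; first by rewrite inE => /eqP ->.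
move=> /flatten_mapP[v /ih vn /mapP[j _ ->]]; by rewrite size_rcons vn.
Qed.

Lemma gen_uniq n w : uniq (gen n w).
Proof.
elim: n => [//|n ih] /=.
elim: (gen n w) ih => [//|u s ih] /= /andP[us /ih{}ih].
rewrite cat_uniq ih andbT map_inj_uniq ?iota_uniq/=; last first.
  by move=> i j /rcons_inj[].
apply/hasPn => x /flatten_mapP[v vs /mapP[j _ ->]].
apply/mapP => -[i _ /rcons_inj[vu _]].
by move: us; rewrite -vu vs.
Qed.

Lemma gen_depends n : depends_on (fun u => (size u < n)%N) (gen n).
Proof.
elim: n => [//|n ih] w w' h /=.
rewrite (ih w w'); last by move=> u un; apply: h; exact: ltnW.
congr flatten; apply/eq_in_map => u /gen_size un.
by rewrite h// un.
Qed.

Lemma tpos_depends n u : (size u <= n)%N -> depends_on (fun v => (size v < n)%N) (tpos u).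
Proof.
move=> un w w' h; apply: eq_bigr => i _; rewrite h// size_take.
by rewrite ltn_ord (leq_trans (ltn_ord i) un).
Qed.

Lemma tpos_nil w : tpos [::] w = 0.
Proof. by rewrite /tpos big_ord0. Qed.

Lemma tpos_cat u v w : tpos (u ++ v) w = tpos u w + tpos v (shift u w).
Proof.
rewrite /tpos size_cat big_split_ord/=; congr (_ + _).
  apply: eq_bigr => i _; rewrite nth_cat (ltn_ord i) take_cat.
  by rewrite (ltn_ord i).
apply: eq_bigr => i _; rewrite nth_cat ltnNge leq_addr/= addKn take_cat.
by rewrite ltnNge leq_addr/= addKn.
Qed.

Lemma gen_add n k w : gen (n + k) w =
  flatten [seq [seq u ++ v | v <- gen k (shift u w)] | u <- gen n w].
Proof.
elim: k => [|k ih].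
  rewrite addn0 /=; elim: (gen n w) => //= u s {1}->; by rewrite cats0.
rewrite addnS/= ih.
elim: (gen n w) => //= u s ihs.
rewrite map_cat flatten_cat ihs; congr cat.
elim: (gen k (shift u w)) => //= v s' ->.
rewrite map_cat; congr cat; rewrite -map_comp; apply: eq_map => j /=.
by rewrite rcons_cat.
Qed.

Lemma sum_gen_add (A : nmodType) n k w (F : seq nat -> A) :
  \sum_(x <- gen (n + k) w) F x =
  \sum_(u <- gen n w) \sum_(v <- gen k (shift u w)) F (u ++ v).
Proof. by rewrite gen_add big_flatten/= big_map; apply: eq_bigr => u _; rewrite big_map. Qed.

Lemma gen1 w : gen 1 w = [seq [:: j] | j <- iota 0 (nchildren (w [::]))].
Proof. by rewrite /= cats0. Qed.

Lemma measurable_num : measurable_fun setT (fun c : cfg => c.1).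
Proof. by move=> _ B mB; rewrite setTI; apply: sub_sigma_algebra; left; exists B. Qed.

Lemma measurable_disp j : measurable_fun setT (fun c : cfg => c.2 j).
Proof. by move=> _ B mB; rewrite setTI; apply: sub_sigma_algebra; right; exists j, B. Qed.

Lemma measurable_nchildren : countably_measurable nchildren.
Proof.
move=> k.
have mf : measurable_fun setT (fun c : cfg => fine c.1).
  exact: (measurableT_comp (fine_measurable measurableT) measurable_num).
have mlt (n : nat) : measurable [set c : cfg | (nchildren c <= n)%N].
  rewrite (_ : [set c | _] = (fun c : cfg => fine c.1) @^-1` [set x | x < n.+1%:R]).
    by rewrite -[X in measurable X]setTI; apply: mf => //; rewrite -set_itvNyo; exact: measurable_itv.
  by apply/seteqP; split => c /=; rewrite /nchildren truncn_le_nat.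
case: k => [|k].
  by have := mlt 0%N; congr measurable; apply/seteqP; split => c /=; rewrite leqn0 => /eqP.
have := measurableD (mlt k.+1) (mlt k); congr measurable.
apply/seteqP; split => c /=; rewrite /nchildren.
  by move=> [h /negP]; rewrite -ltnNge => h'; apply/eqP; rewrite eqn_leq h.
by move=> ->; split => //; rewrite ltnn.
Qed.

Lemma gen_countably_measurable n : countably_measurable (gen n).
Proof.
elim: n => [|n ih] /=.
  by move=> s; have [e|ne] := pselect ([:: [::]] = s);
    [rewrite (_ : [set _ | _] = setT)|rewrite (_ : [set _ | _] = set0)];
    try exact: measurableT; try exact: measurable0; apply/seteqP; split.
apply: (countably_measurable_case (F := fun s w => flatten
  [seq [seq rcons u j | j <- iota 0 (nchildren (w u))] | u <- s])) => // s.
elim: s => [|u s ihs] /=.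
  by move=> s; have [e|ne] := pselect ([::] = s);
    [rewrite (_ : [set _ | _] = setT)|rewrite (_ : [set _ | _] = set0)];
    try exact: measurableT; try exact: measurable0; apply/seteqP; split.
apply: (countably_measurable_case (k := fun w => nchildren (w u))
  (F := fun k w => [seq rcons u j | j <- iota 0 k] ++ flatten
  [seq [seq rcons u j | j <- iota 0 (nchildren (w u))] | u <- s])).
  move=> k; rewrite -[X in measurable X]setTI.
  exact: (measurable_coord u measurableT (measurable_nchildren k)).
by move=> k; exact: (countably_measurable_comp (cat _) ihs).
Qed.

Lemma measurable_tpos u : measurable_fun setT (tpos u).
Proof.
apply: measurable_sum => i.
exact: (measurableT_comp (measurable_disp _) (measurable_coord _)).
Qed.

Lemma measurable_sum_gen n (f : seq nat -> tree -> R) :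
  (forall u, measurable_fun setT (f u)) ->
  measurable_fun setT (fun w => \sum_(u <- gen n w) f u w).
Proof.
move=> mf; apply: (measurable_fun_countable_case
  (F := fun s w => \sum_(u <- s) f u w) (gen_countably_measurable n)) => s.
exact: measurable_sum.
Qed.

End tree_space.

Arguments tree : clear implicits.
Arguments cfg : clear implicits.

Section iid_tree.
Context {R : realType}.
Local Notation tree := (tree R).
Local Notation cfg := (cfg R).

Definition iid_tree_law (mu : probability tree R) (nu : probability cfg R) :=
  forall s (B : seq nat -> set cfg), uniq s ->
  (forall u, u \in s -> measurable (B u)) -> (mu (cyl s B) = \prod_(u <- s) nu (B u))%E.

Variables (mu : probability tree R) (nu : probability cfg R).
Hypothesis mu_cyl : iid_tree_law mu nu.

(** The preimage of a cylinder is a product of a cylinder over its labels in [p] and one over its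
    other labels; the two products of marginal probabilities recombine into one. *)
Lemma pushforward_splice p A : measurable A ->
  pushforward (mu \x mu)%E (splice p) A = mu A.
Proof.
have ms := @measurable_splice R p.
pose m1 : {measure set tree -> \bar R} := pushforward (mu \x mu)%E (splice p).
apply: (@tree_measure_unique R (m1 ms) mu).
  rewrite /m1/= /pushforward preimage_setT.
  have -> : [set: tree * tree] = setT `*` setT by rewrite setXTT.
  have -> : (mu \x mu)%E (setT `*` setT) = (mu setT * mu setT)%E.
    by apply: product_measure1E.
  by rewrite (_ : mu setT = 1%E) ?mule1 ?ltry//; exact: probability_setT.
move=> s B us mB; rewrite /m1/= /pushforward.
have -> : splice p @^-1` cyl s B =
    cyl [seq u <- s | p u] B `*` cyl [seq u <- s | ~~ p u] B.
  apply/seteqP; split => -[w w'] /=.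
    move=> h; split => u /=; rewrite mem_filter => /andP[pu us1]; have := h u us1;
    by rewrite /splice ?pu// (negbTE pu).
  move=> [h h'] u us1; rewrite /splice; case: ifPn => pu.
    by apply: h; rewrite mem_filter pu.
  by apply: h'; rewrite mem_filter pu.
have mB1 : measurable (cyl [seq u <- s | p u] B : set tree).
  by apply: measurable_cyl => u; rewrite mem_filter => /andP[_ /mB].
have mB2 : measurable (cyl [seq u <- s | ~~ p u] B : set tree).
  by apply: measurable_cyl => u; rewrite mem_filter => /andP[_ /mB].
transitivity (mu (cyl [seq u <- s | p u] B) * mu (cyl [seq u <- s | ~~ p u] B))%E.
  exact: product_measure1E.
rewrite !mu_cyl ?filter_uniq//; last 2 first.
- by move=> u; rewrite mem_filter => /andP[_ /mB].
- by move=> u; rewrite mem_filter => /andP[_ /mB].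
by rewrite !big_filter [in RHS](bigID p).
Qed.

(** Prefixing labels by u is injective, so a cylinder is pulled back to a cylinder over as many
    distinct labels with the same constraints. *)
Lemma pushforward_shift u A : measurable A -> pushforward mu (shift u) A = mu A.
Proof.
have ms := @measurable_shift R u.
pose m1 : {measure set tree -> \bar R} := pushforward mu (shift u).
apply: (@tree_measure_unique R (m1 ms) mu).
  rewrite /m1/= /pushforward preimage_setT.
  by rewrite (_ : mu setT = 1%E) ?ltry//; exact: probability_setT.
move=> s B us mB; rewrite /m1/= /pushforward.
have -> : shift u @^-1` cyl s B =
    cyl [seq u ++ v | v <- s] (fun v => B (drop (size u) v)).
  apply/seteqP; split => w /= h.
    by move=> _ /mapP[v vs ->]; rewrite drop_size_cat//; exact: h.
  by move=> v vs; have := h (u ++ v); rewrite drop_size_cat//; apply; apply/mapP; exists v.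
rewrite !mu_cyl//; last 2 first.
- by rewrite map_inj_uniq// => v v' /eqP; rewrite eqseq_cat// eqxx/= => /eqP.
- by move=> _ /mapP[v vs ->]; rewrite drop_size_cat//; exact: mB.
rewrite big_map; apply: eq_bigr => v _; by rewrite drop_size_cat.
Qed.

(** The tower property: the inner integral is the conditional expectation of F given the marks in
    [p]. All conditioning arguments below start from here. *)
Lemma ge0_integral_splice p (F : tree -> \bar R) : measurable_fun setT F ->
  (forall w, 0 <= F w)%E ->
  (\int[mu]_w F w = \int[mu]_w \int[mu]_w' F (splice p (w, w')))%E.
Proof.
move=> mF F0; have ms := @measurable_splice R p.
transitivity (\int[pushforward (mu \x mu)%E (splice p)]_w F w)%E.
  by apply: eq_measure_integral => A mA _; first [exact: pushforward_splice|apply/esym; exact: pushforward_splice].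
rewrite ge0_integral_pushforward//.
have mFs := measurableT_comp mF ms.
exact: (@fubini_tonelli1 _ _ _ _ R mu mu _ mFs (fun z => F0 _)).
Qed.

Lemma measurable_integral_splice p (F : tree -> \bar R) : measurable_fun setT F ->
  (forall w, 0 <= F w)%E ->
  measurable_fun setT (fun w => \int[mu]_w' F (splice p (w, w')))%E.
Proof.
move=> mF F0; have ms := @measurable_splice R p.
have mFs := measurableT_comp mF ms.
exact: (@measurable_fun_fubini_tonelli_F _ _ tree tree R mu (F \o splice p) mFs (fun z => F0 _)).
Qed.

Lemma ge0_integral_shift u (F : tree -> \bar R) : measurable_fun setT F ->
  (forall w, 0 <= F w)%E -> (\int[mu]_w F (shift u w) = \int[mu]_w F w)%E.
Proof.
move=> mF F0; have ms := @measurable_shift R u.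
transitivity (\int[pushforward mu (shift u)]_w F w)%E.
  by rewrite ge0_integral_pushforward.
by apply: eq_measure_integral => A mA _; first [exact: pushforward_shift|apply/esym; exact: pushforward_shift].
Qed.

Lemma integrable_shift u (F : tree -> R) :
  mu.-integrable setT (EFin \o F) -> mu.-integrable setT (EFin \o (F \o shift u)).
Proof.
move=> /integrableP[mF iF]; apply/integrableP; split.
  exact: (measurableT_comp mF (@measurable_shift R u)).
rewrite (@ge0_integral_shift u (fun w => `|(F w)%:E|)%E)//.
exact: measurableT_comp.
Qed.

Lemma Rintegral_shift u (F : tree -> R) : mu.-integrable setT (EFin \o F) ->
  \int[mu]_w F (shift u w) = \int[mu]_w F w.
Proof.
move=> iF; have ms := @measurable_shift R u; have mF := measurable_int _ iF.
rewrite /Rintegral; congr fine.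
transitivity (\int[pushforward mu (shift u)]_w (F w)%:E)%E; last first.
  by apply: eq_measure_integral => A mA _; first [exact: pushforward_shift|apply/esym; exact: pushforward_shift].
rewrite integral_pushforward//.
exact: integrable_shift.
Qed.

Lemma probability_shift u (A : set tree) : measurable A -> mu (shift u @^-1` A) = mu A.
Proof. exact: pushforward_shift. Qed.

(** Only the labels in [p] are resampled: this renews X and leaves Y as it was. *)
Lemma depends_on_indep2 p (X Y : tree -> R) :
  measurable_fun setT X -> measurable_fun setT Y ->
  depends_on p X -> depends_on (predC p) Y -> indep2 mu X Y.
Proof.
move=> mX mY pX pY f mf f0.
have mfXY := measurableT_comp mf (measurable_fun_pair mX mY).
etransitivity; first exact: (ge0_integral_splice (predC p) mfXY (fun w => f0 _)).
apply: eq_integral => w _; apply: eq_integral => w' _.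
rewrite /= (depends_on_splice_l _ pY) (depends_on_splice_r (p := predC p))//.
by apply: depends_on_sub pX => u /= ->.
Qed.

(** Two distinct labels of the same length have no common descendant, so the subtrees rooted at them
    use disjoint sets of marks. *)
Lemma indep_sum_shift (eta : seq nat -> tree -> R) n (s : seq (seq nat)) :
  (forall u, measurable_fun setT (eta u)) -> uniq s -> (forall u, u \in s -> size u = n) ->
  indep_sum mu (fun u w => eta u (shift u w)) s.
Proof.
move=> meta; have mes u : measurable_fun setT (fun w => eta u (shift u w)).
  exact: (measurableT_comp (meta u) (@measurable_shift R u)).
elim: s => //= u s ih /andP[us uqs] sn; split; last first.
  by apply: ih => // v vs; apply: sn; rewrite inE vs orbT.
apply: (@depends_on_indep2 (prefix u)) => //.
- exact: measurable_sum.
- exact: depends_on_shift.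
move=> w w' h; apply: eq_big_seq => v vs.
apply: depends_on_shift => x vx; apply: h => /=.
apply: contra us => ux.
have un : size u = n by apply: sn; rewrite inE eqxx.
have vn : size v = n by apply: sn; rewrite inE vs orbT.
move: ux vx => /prefixP[x1 e1] /prefixP[x2 e2].
have /eqP : u ++ x1 = v ++ x2 by rewrite -e1 -e2.
by rewrite eqseq_cat ?un ?vn// => /andP[/eqP -> _].
Qed.

End iid_tree.

(** * Normal laws *)

Section normal_law.
Context {R : realType}.
Variables (m s : R).
Hypothesis s0 : 0 < s.
Local Notation mu := (@lebesgue_measure R).
Local Notation pdf := (normal_pdf m s).

(** The density is identified with the Radon-Nikodym derivative: both have the same integral over
    every measurable set. *)
Lemma normal_probE (f : R -> \bar R) : measurable_fun setT f ->
  (forall x, 0 <= f x)%E ->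
  (\int[normal_prob m s]_x f x = \int[mu]_x (f x * (pdf x)%:E))%E.
Proof.
move=> mf f0.
have dom : normal_prob m s `<< mu by exact: normal_prob_dominates.
rewrite -(@Radon_Nikodym_SigmaFinite.change_of_variables _ _ _ (normal_prob m s) mu dom f setT)//.
have mRN : mu.-integrable setT (Radon_Nikodym_SigmaFinite.f (normal_prob m s) mu).
  exact: Radon_Nikodym_SigmaFinite.f_integrable.
have mpdf : measurable_fun setT (EFin \o pdf).
  by apply/measurable_EFinP; exact: measurable_normal_pdf.
apply: ae_eq_integral => //.
- by apply: emeasurable_funM => //; exact: measurable_int mRN.
- exact: emeasurable_funM.
apply: ae_eqe_mul2l; apply: integral_ae_eq => // E _ mE.
by rewrite -Radon_Nikodym_SigmaFinite.f_integral.
Qed.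

Lemma normal_pdfE' x : pdf x = normal_peak s * expR (- (x - m) ^+ 2 / (s ^+ 2 *+ 2)).
Proof. by rewrite normal_pdfE// gt_eqF. Qed.

Lemma is_derive_normal_pdf (x : R) : is_derive x 1 pdf (- ((x - m) / s ^+ 2) * pdf x).
Proof.
have -> : pdf = (fun x => normal_peak s * expR (- (x - m) ^+ 2 / (s ^+ 2 *+ 2))).
  by apply/funext => y; rewrite normal_pdfE'.
apply: is_derive_eq; rewrite /GRing.scale/=.
by field; rewrite gt_eqF.
Qed.

Lemma normal_sqr_integrable :
  mu.-integrable setT (EFin \o (fun x => (x - m) ^+ 2 * pdf x)).
Proof.
(* Half of the Gaussian exponent is spent on the quadratic factor: with z = (x - m)^2 / (4 s^2), the
   bound z exp(-2z) <= exp(-z) compares the integrand with the normal density of variance 2 s^2. *)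
pose s' := s * Num.sqrt 2.
have s'0 : 0 < s' by rewrite mulr_gt0// sqrtr_gt0.
have s'2 : s' ^+ 2 = 2 * s ^+ 2 by rewrite exprMn sqr_sqrtr// mulrC.
pose C := 4 * s ^+ 2 * normal_peak s / normal_peak s'.
have p0 : 0 < normal_peak s by rewrite normal_peak_gt0// gt_eqF.
have p'0 : 0 < normal_peak s' by rewrite normal_peak_gt0// gt_eqF.
have s20 : 0 < s ^+ 2 by rewrite exprn_gt0.
apply: (integrable_dominated (mu := mu) (g := fun x => C * normal_pdf m s' x)).
- apply: measurable_funM; last exact: measurable_normal_pdf.
  by apply: measurable_funX; exact: measurable_funB.
- move=> x; rewrite ger0_norm; last by rewrite mulr_ge0 ?normal_pdf_ge0// sqr_ge0.
  rewrite normal_pdfE' normal_pdfE ?gt_eqF//= /normal_fun s'2.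
  set y := x - m.
  have -> : C * (normal_peak s' * expR (- y ^+ 2 / ((2 * s ^+ 2) *+ 2))) =
      normal_peak s * (4 * s ^+ 2 * expR (- y ^+ 2 / ((2 * s ^+ 2) *+ 2))).
    by rewrite /C; field; rewrite gt_eqF.
  rewrite mulrCA ler_pM2l//.
  set z := y ^+ 2 / ((2 * s ^+ 2) *+ 2).
  have -> : - y ^+ 2 / (s ^+ 2 *+ 2) = - z - z by rewrite /z; field; rewrite gt_eqF.
  have -> : - y ^+ 2 / ((2 * s ^+ 2) *+ 2) = - z by rewrite /z mulNr.
  have -> : y ^+ 2 = 4 * s ^+ 2 * z by rewrite /z; field; rewrite gt_eqF.
  rewrite expRD mulrA ler_wpM2r ?expR_ge0//.
  apply: (@le_trans _ _ (4 * s ^+ 2 * 1)); last by rewrite mulr1.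
  rewrite -[leLHS]mulrA; apply: ler_wpM2l; first by rewrite mulr_ge0// ltW.
  rewrite expRN ler_pdivrMr ?expR_gt0// mul1r (le_trans _ (expR_ge1Dx z))//; lra.
- exact: (integrable_scale C (integrable_normal_pdf m s')).
Qed.

Section stein.
Variables (f df : R -> R) (c : R).
Hypothesis fdf : forall x : R, is_derive x 1 f (df x).
Hypothesis cdf : continuous df.
Hypothesis fc : forall x, `|f x| <= c * (1 + `|x - m|).
Hypothesis dfc : forall x, `|df x| <= c.

Let c0 : 0 <= c. Proof. exact: (le_trans _ (dfc 0)). Qed.

Let cf : continuous f.
Proof.
move=> x; apply/differentiable_continuous/derivable1_diffP.
exact: (@ex_derive _ _ _ _ _ _ _ (fdf x)).
Qed.

Let cpdf : continuous pdf.
Proof. by apply: continuous_normal_pdf; rewrite gt_eqF. Qed.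

Let mf : measurable_fun setT f. Proof. exact: continuous_measurable_fun. Qed.
Let mdf : measurable_fun setT df. Proof. exact: continuous_measurable_fun. Qed.
Let mpdf : measurable_fun setT pdf. Proof. exact: measurable_normal_pdf. Qed.

Lemma normal_derive_integrable : mu.-integrable setT (EFin \o (fun x => df x * pdf x)).
Proof.
apply: (integrable_dominated (mu := mu) (g := fun x => c * pdf x)).
- exact: measurable_funM.
- by move=> x; rewrite normrM (ger0_norm (normal_pdf_ge0 m s x)) ler_wpM2r// normal_pdf_ge0.
- exact: (integrable_scale c (integrable_normal_pdf m s)).
Qed.

Lemma normal_linear_integrable :
  mu.-integrable setT (EFin \o (fun x => (x - m) * f x * pdf x)).
Proof.
apply: (integrable_dominated (mu := mu)
  (g := fun x => c * pdf x + 2 * c * ((x - m) ^+ 2 * pdf x))).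
- apply: measurable_funM => //; apply: measurable_funM => //.
  exact: measurable_funB.
- move=> x; rewrite !normrM (ger0_norm (normal_pdf_ge0 m s x)) mulrA -mulrDl.
  rewrite ler_wpM2r ?normal_pdf_ge0//.
  rewrite -[X in 2 * c * X]real_normK ?num_real//.
  apply: (le_trans (ler_wpM2l (normr_ge0 _) (fc x))).
  have := sqr_ge0 (`|x - m| - 1); have := normr_ge0 (x - m).
  set y := `|x - m|; move=> y0; rewrite sqrrB expr1n mulr1 => h.
  have -> : c + 2 * c * y ^+ 2 = c * (1 + 2 * y ^+ 2) by ring.
  rewrite mulrCA ler_wpM2l//; nra.
- have h1 := integrable_scale c (integrable_normal_pdf m s).
  have h2 := integrable_scale (2 * c) normal_sqr_integrable.
  exact: (integrable_add h1 h2).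
Qed.

(* Integrate the derivative of [f * pdf] over [-n, n] and let n tend to infinity. *)
Lemma normal_stein :
  \int[mu]_x ((x - m) * f x * pdf x) = s ^+ 2 * \int[mu]_x (df x * pdf x).
Proof.
have s20 : s ^+ 2 != 0 by rewrite gt_eqF// exprn_gt0.
pose h x := f x * pdf x.
pose dh x := df x * pdf x - (s ^+ 2)^-1 * ((x - m) * f x * pdf x).
have dhE (x : R) : is_derive x 1 h (dh x).
  have d1 := fdf x; have d2 := is_derive_normal_pdf x.
  apply: is_derive_eq; rewrite /GRing.scale/= /dh; field.
  by rewrite gt_eqF.
have idh : mu.-integrable setT (EFin \o dh).
  have h1 := integrable_scale (s ^+ 2)^-1 normal_linear_integrable.
  exact: (integrable_sub normal_derive_integrable h1).
have cdh : continuous dh.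
  move=> x; apply: cvgB; first by apply: cvgM; [exact: cdf|exact: cpdf].
  apply: cvgM; first exact: cvg_cst.
  apply: cvgM; last exact: cpdf.
  apply: cvgM; last exact: cf.
  by apply: cvgB; [exact: cvg_id|exact: cvg_cst].
suff dh0 : \int[mu]_x dh x = 0.
  move: dh0; rewrite RintegralB//; last 2 first.
  - exact: normal_derive_integrable.
  - exact: (integrable_scale (s ^+ 2)^-1 normal_linear_integrable).
  rewrite RintegralZl//; last exact: normal_linear_integrable.
  by move/eqP; rewrite subr_eq0 => /eqP ->; rewrite mulrA divff// mul1r.
pose I (n : nat) : set R := [set` `[- n%:R, n%:R] ].
pose F n := EFin \o (dh \_ (I n)).
have mI n : measurable (I n) by exact: measurable_itv.
have mF n : measurable_fun setT (F n).
  apply/measurable_EFinP/(measurable_restrictT _ (mI n)).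
  exact: measurable_funTS (continuous_measurable_fun cdh).
have Fdh (x : R) : F n x @[n --> \oo] --> (EFin \o dh) x.
  apply: cvg_near_cst; near=> n; rewrite /F/= patchE mem_set// /I/= in_itv/= -ler_norml.
  near: n; exact: nbhs_infty_ger.
have Fle n x : (`|F n x| <= (`|dh x|%R)%:E)%E.
  by rewrite /F/= lee_fin patchE; case: ifPn => // _; rewrite normr0.
have [||||| _ _] := @dominated_convergence _ _ _ mu setT measurableT F (EFin \o dh)
  (fun x => (`|dh x|%R)%:E).
- exact: mF.
- exact: (measurable_int _ idh).
- by apply: aeW => x _; exact: Fdh.
- exact: (integrable_normr idh).
- by apply: aeW => x n _; exact: Fle.
have IF n : (\int[mu]_x F n x = (h n%:R - h (- n%:R))%:E)%E.
  have [->|n0] := eqVneq n 0%N.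
    rewrite oppr0 subrr /F -restrict_EFin -integral_mkcond /I oppr0.
    by rewrite set_itv1 integral_set1.
  rewrite /F -restrict_EFin -integral_mkcond.
  rewrite (@continuous_FTC2 _ _ h)//.
  - by rewrite gtrN// ltr0n lt0n.
  - exact: continuous_subspaceT.
  - split.
    + move=> x _; exact: (@ex_derive _ _ _ _ _ _ _ (dhE x)).
    + apply: cvg_at_right_filter.
      apply/differentiable_continuous/derivable1_diffP.
      exact: (@ex_derive _ _ _ _ _ _ _ (dhE _)).
    + apply: cvg_at_left_filter.
      apply/differentiable_continuous/derivable1_diffP.
      exact: (@ex_derive _ _ _ _ _ _ _ (dhE _)).
  - by move=> x _; rewrite derive1E; exact: (@derive_val _ _ _ _ _ _ _ (dhE x)).
rewrite EFin_Rintegral//.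
under eq_fun do rewrite IF.
move=> hcvg; have {}hcvg : h n%:R - h (- n%:R) @[n --> \oo] --> \int[mu]_x dh x.
  exact: (fine_cvg hcvg).
(* The boundary terms decay like 1/n because |h(x)| (1 + |x|) is bounded: with z = (x - m)^2 / (2
   s^2), the exponential is at most 1 / (1 + z), which absorbs (1 + |x - m|)^2 up to the constant 2
   (1 + 2 s^2). *)
pose K := normal_peak s * c * (2 * (1 + 2 * s ^+ 2)) * (1 + `|m|).
have K0 : 0 <= normal_peak s * c * (2 * (1 + 2 * s ^+ 2)).
  rewrite !mulr_ge0 ?normal_peak_ge0//.
  by rewrite addr_ge0// mulr_ge0// sqr_ge0.
have hK (x : R) : `|h x| * (1 + `|x|) <= K.
  rewrite /h normrM (ger0_norm (normal_pdf_ge0 m s x)) normal_pdfE'.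
  set y := x - m; set z := y ^+ 2 / (s ^+ 2 *+ 2).
  have z0 : 0 <= z by rewrite divr_ge0 ?sqr_ge0// mulrn_wge0// sqr_ge0.
  have ez : expR (- y ^+ 2 / (s ^+ 2 *+ 2)) <= (1 + z)^-1.
    rewrite mulNr expRN lef_pV2 ?posrE ?expR_gt0//; last lra.
    exact: expR_ge1Dx.
  have xm : 1 + `|x| <= (1 + `|m|) * (1 + `|y|).
    have := ler_normD y m; rewrite /y subrK.
    have := normr_ge0 m; have := normr_ge0 (x - m); nra.
  have yz : (1 + `|y|) ^+ 2 <= 2 * (1 + 2 * s ^+ 2) * (1 + z).
    have yE : `|y| ^+ 2 = 2 * s ^+ 2 * z.
      by rewrite real_normK ?num_real// /z; field; rewrite gt_eqF.
    have h1 : 2 * `|y| <= 1 + `|y| ^+ 2.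
      by have := sqr_ge0 (`|y| - 1); rewrite sqrrB expr1n mulr1; lra.
    have h2 : (1 + `|y|) ^+ 2 <= 2 * (1 + `|y| ^+ 2) by rewrite sqrrD expr1n mul1r; lra.
    apply: (le_trans h2); rewrite yE -[leRHS]mulrA ler_pM2l//.
    have := sqr_ge0 s; nra.
  apply: (@le_trans _ _ (c * (1 + `|y|) * (normal_peak s * (1 + z)^-1) * ((1 + `|m|) * (1 + `|y|)))).
    apply: ler_pM => //.
    - by rewrite mulr_ge0// mulr_ge0 ?normal_peak_ge0 ?expR_ge0.
    - apply: ler_pM => //; first by rewrite mulr_ge0 ?normal_peak_ge0 ?expR_ge0.
      by rewrite ler_wpM2l ?normal_peak_ge0.
  have -> : c * (1 + `|y|) * (normal_peak s * (1 + z)^-1) * ((1 + `|m|) * (1 + `|y|)) =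
      (normal_peak s * c * (1 + `|m|)) * ((1 + `|y|) ^+ 2 / (1 + z)) by ring.
  have -> : K = (normal_peak s * c * (1 + `|m|)) * (2 * (1 + 2 * s ^+ 2)) by rewrite /K; ring.
  rewrite ler_wpM2l//; first by rewrite !mulr_ge0 ?normal_peak_ge0// addr_ge0.
  by rewrite ler_pdivrMr//; lra.
have h0 : h n%:R - h (- n%:R) @[n --> \oo] --> (0 : R).
  apply/norm_cvg0P.
  have c1 : 2 * K * n.+1%:R^-1 @[n --> \oo] --> (0 : R).
    by rewrite -[X in _ --> X](mulr0 (2 * K)); apply: cvgM; [exact: cvg_cst|exact: cvg_harmonic].
  apply: (@squeeze_cvgr _ _ _ _ (cst 0) (fun n => 2 * K * n.+1%:R^-1)) => //; last exact: cvg_cst.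
  near=> n; rewrite normr_ge0/= (le_trans (ler_normB _ _))//.
  have n1 : 0 < n.+1%:R :> R by rewrite ltr0n.
  have := hK n%:R; have := hK (- n%:R); rewrite normrN normr_nat.
  rewrite [1 + _]addrC natr1 => a b.
  by rewrite ler_pdivlMr// mulrDl; move: a b; lra.
exact: (cvg_unique _ hcvg h0).
Unshelve. all: by end_near. Qed.

End stein.

Lemma normal_variance : \int[mu]_x ((x - m) ^+ 2 * pdf x) = s ^+ 2.
Proof.
have E : \int[mu]_x ((x - m) * (x - m) * pdf x) = s ^+ 2 * \int[mu]_x (1 * pdf x).
  apply: (@normal_stein (fun x => x - m) (fun=> 1) 1).
  - by move=> x; apply: is_derive_eq; rewrite oppr0 addr0.
  - by move=> x; exact: cvg_cst.
  - by move=> x; rewrite mul1r lerDr.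
  - by move=> x; rewrite normr1. under eq_Rintegral do rewrite expr2.
rewrite E -[RHS]mulr1; congr (_ * _); under eq_Rintegral do rewrite /= mul1r.
by rewrite /Rintegral integral_normal_pdf.
Qed.

End normal_law.

Section normal_characteristic_function.
Context {R : realType}.
Variable s : R.
Hypothesis s0 : 0 < s.
Local Notation mu := (@lebesgue_measure R).
Local Notation pdf := (normal_pdf 0 s).

Let ipdf := integrable_normal_pdf (0 : R) s.

Let mpdf : measurable_fun setT pdf. Proof. exact: measurable_normal_pdf. Qed.

Let icos (t : R) : mu.-integrable setT (EFin \o (fun x => cos (t * x) * pdf x)).
Proof.
apply: (integrable_dominated (mu := mu) (g := pdf)) => //.
- by apply: measurable_funM => //; apply: measurableT_comp => //; exact: measurable_cos.
- move=> x; rewrite normrM (ger0_norm (normal_pdf_ge0 0 s x)) ler_piMl ?normal_pdf_ge0//.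
  exact: normr_cos_le1.
Qed.

Let msin : measurable_fun setT (@sin R).
Proof. by apply: continuous_measurable_fun; exact: continuous_sin. Qed.

Let sin1 (x : R) : `|sin x| <= 1. Proof. by rewrite ler_norml sin_geN1 sin_le1. Qed.

Let isin (t : R) : mu.-integrable setT (EFin \o (fun x => sin (t * x) * pdf x)).
Proof.
apply: (integrable_dominated (mu := mu) (g := pdf)) => //.
- by apply: measurable_funM => //; apply: measurableT_comp => //; exact: measurable_cos.
- by move=> x; rewrite normrM (ger0_norm (normal_pdf_ge0 0 s x)) ler_piMl ?normal_pdf_ge0.
Qed.

Let iabs : mu.-integrable setT (EFin \o (fun x => `|x| * pdf x)).
Proof.
have h := normal_sqr_integrable 0 s0.
apply: (integrable_dominated (mu := mu) (g := fun x => pdf x + (x - 0) ^+ 2 * pdf x)).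
- by apply: measurable_funM => //; exact: measurableT_comp.
- move=> x; rewrite normrM normr_id (ger0_norm (normal_pdf_ge0 0 s x)).
  rewrite -{2}[pdf x]mul1r -mulrDl ler_wpM2r ?normal_pdf_ge0// subr0.
  rewrite -real_normK ?num_real//.
  by have := sqr_ge0 (`|x| - 1); rewrite sqrrB expr1n mulr1; have := normr_ge0 x; lra.
- exact: (integrable_add ipdf h).
Qed.

Let steincos (t : R) : \int[mu]_x ((x - 0) * cos (t * x) * pdf x) =
  s ^+ 2 * \int[mu]_x (- t * sin (t * x) * pdf x).
Proof.
apply: (@normal_stein _ 0 s s0 (fun x => cos (t * x)) (fun x => - t * sin (t * x)) (1 + `|t|)).
- by move=> x; apply: is_derive_eq; rewrite /GRing.scale/=; ring.
- move=> x; apply: cvgM; first exact: cvg_cst.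
  apply: (@continuous_comp _ _ _ (fun x : R => t * x) sin); last exact: continuous_sin.
  exact: mulrl_continuous.
- move=> x; have := normr_cos_le1 (t * x); have := normr_ge0 t; have := normr_ge0 (x - 0); nra.
- move=> x; rewrite normrM normrN; have := sin1 (t * x); have := normr_ge0 t; nra.
Qed.

Let steinsin (t : R) : \int[mu]_x ((x - 0) * sin (t * x) * pdf x) =
  s ^+ 2 * \int[mu]_x (t * cos (t * x) * pdf x).
Proof.
apply: (@normal_stein _ 0 s s0 (fun x => sin (t * x)) (fun x => t * cos (t * x)) (1 + `|t|)).
- by move=> x; apply: is_derive_eq; rewrite /GRing.scale/=; ring.
- move=> x; apply: cvgM; first exact: cvg_cst.
  apply: (@continuous_comp _ _ _ (fun x : R => t * x) cos); last exact: continuous_cos.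
  exact: mulrl_continuous.
- move=> x; have := sin1 (t * x); have := normr_ge0 t; have := normr_ge0 (x - 0); nra.
- move=> x; rewrite normrM; have := normr_cos_le1 (t * x); have := normr_ge0 t; nra.
Qed.

Lemma is_derive_under_integral (f df : R -> R -> R) (G : R -> R) (t : R) :
  (forall t, mu.-integrable setT (EFin \o f t)) ->
  (forall t x : R, is_derive t 1 (f^~ x) (df t x)) ->
  (forall x, 0 <= G x) -> mu.-integrable setT (EFin \o G) ->
  (forall t x, `|df t x| <= G x) ->
  is_derive t 1 (fun t => \int[mu]_x f t x) (\int[mu]_x df t x).
Proof.
move=> fi fdf G0 iG dfG.
have tI : `]t - 1, t + 1[%classic t by rewrite /= in_itv/= ltrBlDr ltrDl ltr01.
have pE (u : R) (x : R) : partial1of2 f u x = df u x.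
  by rewrite /partial1of2 derive1E; exact: (@derive_val _ _ _ _ _ _ _ (fdf u x)).
have df1 (u : R) (x : R) : `]t - 1, t + 1[%classic u -> [set: R] x -> derivable (f^~ x) u 1.
  by move=> _ _; exact: (@ex_derive _ _ _ _ _ _ _ (fdf u x)).
have dfG' (u : R) (x : R) : `]t - 1, t + 1[%classic u -> [set: R] x -> `|partial1of2 f u x| <= G x.
  by move=> _ _; rewrite pE.
apply: DeriveDef.
  exact: (@derivable_under_integral _ _ _ mu f setT measurableT t _ _ tI (fun u _ => fi u) df1 G G0 iG dfG').
rewrite -derive1E (@differentiation_under_integral _ _ _ mu f setT measurableT t _ _ tI (fun u _ => fi u) df1 G G0 iG dfG').
by apply: eq_Rintegral => x _; rewrite pE.
Qed.

(** By Stein's identity the cosine transform satisfies c'(u) = - s^2 u c(u), so c(u) exp(s^2 u^2 /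
    2) has derivative 0 and equals c(0) = 1. The sine transform solves the same equation with
    initial value 0. *)
Lemma normal_cos (t : R) : \int[mu]_x (cos (t * x) * pdf x) = expR (- (s ^+ 2 * t ^+ 2 / 2)).
Proof.
pose c t := \int[mu]_x (cos (t * x) * pdf x).
have dc (u : R) : is_derive u 1 c (- (s ^+ 2 * u * c u)).
  have -> : - (s ^+ 2 * u * c u) = \int[mu]_x (- x * sin (u * x) * pdf x).
    have h : \int[mu]_x ((x - 0) * sin (u * x) * pdf x) = s ^+ 2 * u * c u.
      rewrite steinsin -mulrA; congr (_ * _).
      by under eq_Rintegral do rewrite -mulrA; rewrite RintegralZl.
    rewrite -h -mulN1r -RintegralZl//; last first.
      apply: (@normal_linear_integrable _ 0 s s0 (fun x => sin (u * x)) (fun x => u * cos (u * x)) (1 + `|u|)).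
      + by move=> x; apply: is_derive_eq; rewrite /GRing.scale/=; ring.
      + by move=> x; have := sin1 (u * x); have := normr_ge0 u; have := normr_ge0 (x - 0); nra.
      + by move=> x; rewrite normrM; have := normr_cos_le1 (u * x); have := normr_ge0 u; nra.
    by apply: eq_Rintegral => x _; rewrite subr0; ring.
  apply: (@is_derive_under_integral (fun t x => cos (t * x) * pdf x)
    (fun t x => - x * sin (t * x) * pdf x) (fun x => `|x| * pdf x)) => //.
  - by move=> v x; apply: is_derive_eq; rewrite /GRing.scale/=; ring.
  - by move=> x; rewrite mulr_ge0 ?normal_pdf_ge0.
  - move=> v x; rewrite !normrM normrN (ger0_norm (normal_pdf_ge0 0 s x)).
    by rewrite ler_wpM2r ?normal_pdf_ge0// ler_piMr.
have d0 (u : R) : is_derive u 1 (fun u => c u * expR (s ^+ 2 * u ^+ 2 / 2)) 0.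
  by have := dc u => dcu; apply: is_derive_eq; rewrite /GRing.scale/=; field.
have := @is_derive_0_is_cst _ _ t 0 d0.
rewrite expr0n/= mulr0 mul0r expR0 mulr1.
have -> : c 0 = 1.
  rewrite /c; under eq_Rintegral do rewrite mul0r cos0 mul1r.
  by rewrite /Rintegral integral_normal_pdf.
move/(congr1 (fun z => z * expR (- (s ^+ 2 * t ^+ 2 / 2)))).
by rewrite -[X in X = _ -> _]mulrA -expRD subrr expR0 mulr1 mul1r.
Qed.

Lemma normal_sin (t : R) : \int[mu]_x (sin (t * x) * pdf x) = 0.
Proof.
pose c t := \int[mu]_x (sin (t * x) * pdf x).
have dc (u : R) : is_derive u 1 c (- (s ^+ 2 * u * c u)).
  have -> : - (s ^+ 2 * u * c u) = \int[mu]_x (x * cos (u * x) * pdf x).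
    transitivity (\int[mu]_x ((x - 0) * cos (u * x) * pdf x)); last first.
      by apply: eq_Rintegral => x _; rewrite subr0.
    rewrite steincos -mulrA -mulrN; congr (_ * _).
    by under eq_Rintegral do rewrite -mulrA; rewrite RintegralZl// mulNr.
  apply: (@is_derive_under_integral (fun t x => sin (t * x) * pdf x)
    (fun t x => x * cos (t * x) * pdf x) (fun x => `|x| * pdf x)) => //.
  - by move=> v x; apply: is_derive_eq; rewrite /GRing.scale/=; ring.
  - by move=> x; rewrite mulr_ge0 ?normal_pdf_ge0.
  - move=> v x; rewrite !normrM (ger0_norm (normal_pdf_ge0 0 s x)).
    by rewrite ler_wpM2r ?normal_pdf_ge0// ler_piMr// normr_cos_le1.
have d0 (u : R) : is_derive u 1 (fun u => c u * expR (s ^+ 2 * u ^+ 2 / 2)) 0.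
  by have := dc u => dcu; apply: is_derive_eq; rewrite /GRing.scale/=; field.
have := @is_derive_0_is_cst _ _ t 0 d0.
have -> : c 0 = 0.
  rewrite /c; under eq_Rintegral do rewrite mul0r sin0 mul0r.
  by rewrite /Rintegral integral0.
rewrite mul0r => /eqP; rewrite mulf_eq0 (gt_eqF (expR_gt0 _)) orbF => /eqP; exact.
Qed.

Lemma normal_prob_cos (b t : R) :
  \int[normal_prob 0 s]_x cos (b + t * x) = expR (- (s ^+ 2 * t ^+ 2 / 2)) * cos b.
Proof.
have mcb : measurable_fun setT (fun x => cos (b + t * x)).
  by apply: measurableT_comp; [exact: measurable_cos|exact: measurable_funD].
have ib : (normal_prob (0 : R) s).-integrable setT (EFin \o (fun x => cos (b + t * x))).
  apply: bounded_mfun_integrable; split => //.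
  by exists 1 => x; exact: normr_cos_le1.
(* The change to the density is stated for nonnegative integrands, hence the 1 added to the
   cosine. *)
have E : (\int[normal_prob 0 s]_x (1 + cos (b + t * x))%:E =
   \int[mu]_x ((1 + cos (b + t * x)) * pdf x)%:E)%E.
  rewrite normal_probE//; first by apply/measurable_EFinP; exact: measurable_funD.
have i1 := integrable_scale (cos b) (icos t).
have i2 := integrable_scale (sin b) (isin t).
have fE : (fun x => (1 + cos (b + t * x)) * pdf x) =
    (fun x => pdf x + (cos b * (cos (t * x) * pdf x) - sin b * (sin (t * x) * pdf x))).
  by apply/funext => x; rewrite cosD; ring.
move: E; under [in RHS]eq_integral do rewrite (congr1 (fun f => f _) fE).
rewrite (EFin_Rintegral (integrable_add (integrable_cst _ 1) ib)) EFin_Rintegral; last first.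
  exact: (integrable_add ipdf (integrable_sub i1 i2)).
move=> [].
rewrite RintegralD//; last exact: integrable_cst.
rewrite RintegralD//; last exact: (integrable_sub i1 i2).
rewrite RintegralB// !RintegralZl// normal_cos normal_sin mulr0 subr0.
rewrite (Rintegral_probability_cst (normal_prob 0 s)).
rewrite {2}/Rintegral integral_normal_pdf/= => /addrI ->; exact: mulrC.
Qed.

End normal_characteristic_function.

Lemma normal_prob_variance {R : realType} (m s : R) : 0 < s ->
  (\int[normal_prob m s]_x ((x - m) ^+ 2)%:E = (s ^+ 2)%:E)%E.
Proof.
move=> s0; rewrite normal_probE//.
- rewrite -(@normal_variance _ m s s0) -EFin_Rintegral//; exact: normal_sqr_integrable.
- by apply/measurable_EFinP; apply: measurable_funX; exact: measurable_funB.
- by move=> x; rewrite lee_fin sqr_ge0.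
Qed.

(** * Characteristic functions and weak convergence *)

Section bounded_fubini.
Context {d1 d2 : measure_display} {T1 : measurableType d1} {T2 : measurableType d2}
  {R : realType}.
Variables (P : probability T1 R) (Q : probability T2 R).
Variable f : T1 * T2 -> R.
Hypothesis bf : bounded_mfun f.

Lemma bounded_mfun_pair1 x : bounded_mfun (fun y => f (x, y)).
Proof.
have [mf [M fM]] := bf; split; last by exists M.
exact: (measurableT_comp mf (@measurable_fun_pair _ _ _ _ _ _ (cst x) id (measurable_cst _) (@measurable_id _ _ setT))).
Qed.

Lemma bounded_mfun_pair2 y : bounded_mfun (fun x => f (x, y)).
Proof.
have [mf [M fM]] := bf; split; last by exists M.
exact: (measurableT_comp mf (@measurable_fun_pair _ _ _ _ _ _ id (cst y) (@measurable_id _ _ setT) (measurable_cst _))).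
Qed.

Let fM (x : T1 * T2) M := (f x + M)%:E.

Let integral_fM M x : (\int[Q]_y fM (x, y) M = (\int[Q]_y f (x, y) + M)%:E)%E.
Proof.
have i1 := bounded_mfun_integrable Q (bounded_mfun_pair1 x).
have i2 := integrable_cst Q M.
by rewrite (EFin_Rintegral (integrable_add i1 i2)) RintegralD// Rintegral_probability_cst.
Qed.

Let integral_fM2 M y : (\int[P]_x fM (x, y) M = (\int[P]_x f (x, y) + M)%:E)%E.
Proof.
have i1 := bounded_mfun_integrable P (bounded_mfun_pair2 y).
have i2 := integrable_cst P M.
by rewrite (EFin_Rintegral (integrable_add i1 i2)) RintegralD// Rintegral_probability_cst.
Qed.

Let mfM M : measurable_fun setT (fM^~ M).
Proof. by have [mf _] := bf; apply/measurable_EFinP; exact: measurable_funD. Qed.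

Let fM0 M : (forall x, `|f x| <= M) -> forall x, (0 <= fM x M)%E.
Proof. by move=> h x; rewrite lee_fin; have := h x; rewrite ler_norml => /andP[]; lra. Qed.

Lemma bounded_mfun_Rintegral1 : bounded_mfun (fun x => \int[Q]_y f (x, y)).
Proof.
have [mf [M h]] := bf; split; last first.
  by exists M => x; apply: Rintegral_bounded_le => //; case: (bounded_mfun_pair1 x).
have := @measurable_fun_fubini_tonelli_F _ _ T1 T2 R Q _ (mfM M) (fM0 h).
rewrite /fubini_F; under eq_fun do rewrite integral_fM.
move=> /measurable_EFinP mh.
have := measurable_funB mh (@measurable_cst _ _ T1 R setT M).
by apply: eq_measurable_fun => x _ /=; rewrite addrK.
Qed.

Lemma bounded_mfun_Rintegral2 : bounded_mfun (fun y => \int[P]_x f (x, y)).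
Proof.
have [mf [M h]] := bf; split; last first.
  by exists M => x; apply: Rintegral_bounded_le => //; case: (bounded_mfun_pair2 x).
have := @measurable_fun_fubini_tonelli_G _ _ T1 T2 R P _ (mfM M) (fM0 h).
rewrite /fubini_G; under eq_fun do rewrite integral_fM2.
move=> /measurable_EFinP mh.
have := measurable_funB mh (@measurable_cst _ _ T2 R setT M).
by apply: eq_measurable_fun => x _ /=; rewrite addrK.
Qed.

Lemma bounded_fubini : \int[P]_x \int[Q]_y f (x, y) = \int[Q]_y \int[P]_x f (x, y).
Proof.
have [mf [M h]] := bf.
have := @fubini_tonelli _ _ T1 T2 R P Q _ (mfM M) (fM0 h).
under eq_integral do rewrite integral_fM.
under [in RHS]eq_integral do rewrite integral_fM2.
have i1 := bounded_mfun_integrable P bounded_mfun_Rintegral1.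
have i2 := bounded_mfun_integrable Q bounded_mfun_Rintegral2.
rewrite (EFin_Rintegral (integrable_add i1 (integrable_cst P M))).
rewrite (EFin_Rintegral (integrable_add i2 (integrable_cst Q M))).
rewrite RintegralD//; last exact: integrable_cst.
rewrite RintegralD//; last exact: integrable_cst.
by rewrite !Rintegral_probability_cst => -[/addIr].
Qed.

End bounded_fubini.

Section bounded_convergence.
Context {d : measure_display} {T : measurableType d} {R : realType}.
Variable P : probability T R.

Lemma bounded_convergence (f : nat -> T -> R) (g : T -> R) (M : R) :
  (forall n, measurable_fun setT (f n)) -> (forall n x, `|f n x| <= M) ->
  (forall x, f n x @[n --> \oo] --> g x) ->
  \int[P]_x f n x @[n --> \oo] --> \int[P]_x g x.
Proof.
move=> mf fM fg.
have mg : measurable_fun setT g by apply: measurable_fun_cvg mf _ => x _; exact: fg.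
have [||||| ig _] := @dominated_convergence _ T R P setT measurableT
  (fun n => EFin \o f n) (EFin \o g) (cst M%:E).
- by move=> n; exact/measurable_EFinP.
- exact/measurable_EFinP.
- by apply: aeW => x _; apply: cvg_EFin; [exact: nearW|exact: fg].
- exact: integrable_cst.
- by apply: aeW => x n _ /=; rewrite lee_fin.
have ifn n : P.-integrable setT (EFin \o f n).
  by apply: bounded_mfun_integrable; split => //; exists M.
rewrite (EFin_Rintegral ig).
under eq_fun do rewrite (EFin_Rintegral (ifn _)).
by move=> /fine_cvg.
Qed.

End bounded_convergence.

Section gaussian_bump.
Context {R : realType}.
Variable e : R.
Hypothesis e0 : 0 < e.

Definition gbump (z : R) : R := expR (- (z ^+ 2 / (e ^+ 2 *+ 2))).

Lemma gbump_ge0 z : 0 <= gbump z. Proof. exact: expR_ge0. Qed.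

Lemma gbump_le1 z : gbump z <= 1.
Proof.
by rewrite /gbump -expR0 ler_expR oppr_le0 divr_ge0 ?sqr_ge0// mulrn_wge0// sqr_ge0.
Qed.

Lemma measurable_gbump : measurable_fun setT gbump.
Proof.
apply: measurableT_comp => //; apply: measurable_funN.
by apply: measurable_funM => //; exact: measurable_funX.
Qed.

Lemma normal_pdf_gbump x y : normal_pdf x e y = normal_peak e * gbump (x - y).
Proof. by rewrite normal_pdfE ?gt_eqF//= /normal_fun /gbump -sqrrN opprB mulNr. Qed.

Let ei0 : 0 < e^-1. Proof. by rewrite invr_gt0. Qed.
Local Notation gam := (normal_prob 0 e^-1).

(** The Gaussian is its own Fourier transform: a product of bumps of width e is an average of
    cosines whose frequencies are independent normal of standard deviation 1/e. *)
Lemma gbump_cos z1 z2 : gbump z1 * gbump z2 =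
  \int[gam]_s \int[gam]_t cos (s * z1 + t * z2).
Proof.
have gE z : gbump z = expR (- (e^-1 ^+ 2 * z ^+ 2 / 2)).
  by rewrite /gbump; congr (expR (- _)); field; rewrite gt_eqF.
under eq_Rintegral do under eq_Rintegral do rewrite [_ * z2]mulrC.
under eq_Rintegral do rewrite normal_prob_cos// -gE.
rewrite RintegralZl//; last first.
  apply: bounded_mfun_integrable; split; last by exists 1 => x; exact: normr_cos_le1.
  by apply: measurableT_comp; [exact: measurable_cos|exact: measurable_funM].
under eq_Rintegral do rewrite -[_ * z1]add0r [_ * z1]mulrC.
by rewrite normal_prob_cos// -gE cos0 mulr1 mulrC.
Qed.

End gaussian_bump.

Section levy_continuity.
Context {d d' : measure_display} {T : measurableType d} {T' : measurableType d'}
  {R : realType}.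
Variables (P : probability T R) (P' : probability T' R).
Variables (X Y : nat -> T -> R) (X' Y' : T' -> R).
Hypotheses (mX : forall n, measurable_fun setT (X n)) (mY : forall n, measurable_fun setT (Y n)).
Hypotheses (mX' : measurable_fun setT X') (mY' : measurable_fun setT Y').
Hypothesis cvg_char : forall b s t : R,
  \int[P]_w cos (b + s * X n w + t * Y n w) @[n --> \oo] -->
  \int[P']_w cos (b + s * X' w + t * Y' w).

Lemma bounded_mfun_char d0 (T0 : measurableType d0) (Z W : T0 -> R) (b s : R) :
  measurable_fun setT Z -> measurable_fun setT W ->
  bounded_mfun (fun z : T0 * R => cos (b + s * Z z.1 + z.2 * W z.1)).
Proof.
move=> mZ mW; split; last by exists 1 => x; exact: normr_cos_le1.
apply: measurableT_comp; first exact: measurable_cos.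
apply: measurable_funD; last first.
  by apply: measurable_funM; [exact: measurable_snd|exact: (measurableT_comp mW measurable_fst)].
apply: measurable_funD => //; apply: measurable_funM => //.
exact: (measurableT_comp mZ measurable_fst).
Qed.

Section bump.
Variable e : R.
Hypothesis e0 : 0 < e.
Let ei0 : 0 < e^-1. Proof. by rewrite invr_gt0. Qed.
Local Notation gam := (normal_prob 0 e^-1).

(** The expectation of a bump is thereby a mixture of cosine transforms of the law of (Z, W), so
    pointwise convergence of these transforms carries over to bumps by bounded convergence. *)
Lemma Rintegral_gbump d0 (T0 : measurableType d0) (P0 : probability T0 R) (Z W : T0 -> R) (y1 y2 : R) :
  measurable_fun setT Z -> measurable_fun setT W ->
  \int[P0]_w (gbump e (Z w - y1) * gbump e (W w - y2)) =
  \int[gam]_s \int[gam]_t \int[P0]_w cos ((- (s * y1) - t * y2) + s * Z w + t * W w).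
Proof.
move=> mZ mW.
have mZ1 : measurable_fun setT (fun w => Z w - y1) by exact: measurable_funB.
have mW1 : measurable_fun setT (fun w => W w - y2) by exact: measurable_funB.
have gE w s : \int[gam]_t cos (s * (Z w - y1) + t * (W w - y2)) =
    gbump e (W w - y2) * cos (s * (Z w - y1)).
  under eq_Rintegral do rewrite [_ * (W w - y2)]mulrC.
  rewrite normal_prob_cos//; congr (expR (- _) * _).
  by field; rewrite gt_eqF.
transitivity (\int[P0]_w \int[gam]_s \int[gam]_t cos (s * (Z w - y1) + t * (W w - y2))).
  by apply: eq_Rintegral => w _; exact: gbump_cos.
under eq_Rintegral do under eq_Rintegral do rewrite gE.
have b1 : bounded_mfun (fun z : T0 * R => gbump e (W z.1 - y2) * cos (z.2 * (Z z.1 - y1))).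
  split; last first.
    exists 1 => z; rewrite normrM -[leRHS]mulr1 ler_pM// ?normr_cos_le1//.
    by rewrite ger0_norm ?gbump_ge0 ?gbump_le1.
  apply: measurable_funM.
    apply: (measurableT_comp (measurable_gbump e)).
    exact: (measurableT_comp mW1 measurable_fst).
  apply: measurableT_comp; first exact: measurable_cos.
  by apply: measurable_funM; [exact: measurable_snd|exact: (measurableT_comp mZ1 measurable_fst)].
rewrite (bounded_fubini P0 gam b1)/=.
apply: eq_Rintegral => s _.
under eq_Rintegral do rewrite -gE.
have := bounded_fubini P0 gam (bounded_mfun_char 0 s mZ1 mW1) => /=.
under eq_Rintegral do under eq_Rintegral do rewrite add0r.
move=> ->; apply: eq_Rintegral => t _; apply: eq_Rintegral => w _.
by congr cos; ring.
Qed.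

Lemma cvg_gbump (y1 y2 : R) :
  \int[P]_w (gbump e (X n w - y1) * gbump e (Y n w - y2)) @[n --> \oo] -->
  \int[P']_w (gbump e (X' w - y1) * gbump e (Y' w - y2)).
Proof.
rewrite Rintegral_gbump//; under eq_fun do rewrite Rintegral_gbump//.
have mchar d0 (T0 : measurableType d0) (P0 : probability T0 R) (Z W : T0 -> R) :
    measurable_fun setT Z -> measurable_fun setT W ->
    bounded_mfun (fun z : R * R =>
      \int[P0]_w cos ((- (z.1 * y1) - z.2 * y2) + z.1 * Z w + z.2 * W w)).
  move=> mZ mW; apply: (@bounded_mfun_Rintegral2 _ _ T0 (R * R)%type R P0
    (fun z => cos ((- (z.2.1 * y1) - z.2.2 * y2) + z.2.1 * Z z.1 + z.2.2 * W z.1))).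
  split; last by exists 1 => x; exact: normr_cos_le1.
  apply: measurableT_comp; first exact: measurable_cos.
  have m1 : measurable_fun setT (fun z : T0 * (R * R) => z.2.1).
    exact: (measurableT_comp measurable_fst measurable_snd).
  have m2 : measurable_fun setT (fun z : T0 * (R * R) => z.2.2).
    exact: (measurableT_comp measurable_snd measurable_snd).
  apply: measurable_funD; last first.
    by apply: measurable_funM => //; exact: (measurableT_comp mW measurable_fst).
  apply: measurable_funD; last first.
    by apply: measurable_funM => //; exact: (measurableT_comp mZ measurable_fst).
  by apply: measurable_funB; [apply: measurable_funN|]; exact: measurable_funM.
have c1 d0 (T0 : measurableType d0) (P0 : probability T0 R) (Z W : T0 -> R) s t :
    measurable_fun setT Z -> measurable_fun setT W ->
    `|\int[P0]_w cos ((- (s * y1) - t * y2) + s * Z w + t * W w)| <= 1.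
  move=> mZ mW; apply: Rintegral_bounded_le => [|w]; last exact: normr_cos_le1.
  by case: (bounded_mfun_pair2 (bounded_mfun_char (- (s * y1) - t * y2) s mZ mW) t).
apply: (@bounded_convergence _ _ R gam _ _ 1) => [n|n s|s].
- by case: (bounded_mfun_Rintegral1 gam (mchar _ _ P _ _ (mX n) (mY n))).
- apply: Rintegral_bounded_le => [|t]; last exact: c1.
  by case: (bounded_mfun_pair1 (mchar _ _ P _ _ (mX n) (mY n)) s).
- apply: (@bounded_convergence _ _ R gam _ _ 1) => [n|n t|t].
  + by case: (bounded_mfun_pair1 (mchar _ _ P _ _ (mX n) (mY n)) s).
  + exact: c1.
  + exact: cvg_char.
Qed.

End bump.
End levy_continuity.

Section smoothing.
Context {R : realType}.
Variables (phi : R * R -> R) (M K e : R).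
Hypotheses (K0 : 0 < K) (e0 : 0 < e).
Hypotheses (mphi : measurable_fun setT phi) (phi0 : forall z, 0 <= phi z)
  (phiM : forall z, phi z <= M).

Let KK : - K < K. Proof. by rewrite gtrN. Qed.
Local Notation U := (uniform_prob KK).
Local Notation I := (\1_[set` `[- K, K] ] : R -> R).

Let mI : measurable_fun setT I.
Proof. by apply: measurable_indic; exact: measurable_itv. Qed.

Let I01 y : 0 <= I y <= 1.
Proof. by rewrite indicE; case: (_ \in _); rewrite /= ?ler01 ?lexx. Qed.

Let M0 : 0 <= M. Proof. exact: le_trans (phi0 (0, 0)) (phiM _). Qed.

Let pdf_le x y : 0 <= normal_pdf x e y <= normal_peak e.
Proof. by rewrite normal_pdf_ge0 normal_pdf_ub ?gt_eqF. Qed.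

Lemma normal_uniform (x : R) (f : R -> R) (C : R) : measurable_fun setT f ->
  (forall y, 0 <= f y <= C) ->
  \int[normal_prob x e]_y (f y * I y) = (2 * K) * \int[U]_y (f y * normal_pdf x e y).
Proof.
move=> mf f0; apply: EFin_inj.
have C0 : 0 <= C by have /andP[a b] := f0 0; exact: le_trans a b.
have mpdf : measurable_fun setT (normal_pdf x e) by exact: measurable_normal_pdf.
rewrite -EFin_Rintegral; last first.
  apply: bounded_mfun_integrable; split; first exact: measurable_funM.
  exists C => y; have /andP[a b] := f0 y; have /andP[i0 i1] := I01 y.
  by rewrite ger0_norm ?mulr_ge0// -[leRHS]mulr1 ler_pM.
rewrite EFinM -EFin_Rintegral; last first.
  apply: bounded_mfun_integrable; split; first exact: measurable_funM.
  exists (C * normal_peak e) => y; have /andP[a b] := f0 y; have /andP[i0 i1] := pdf_le x y.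
  by rewrite ger0_norm ?mulr_ge0// ler_pM.
rewrite normal_probE//; last 2 first.
- by apply/measurable_EFinP; exact: measurable_funM.
- by move=> y; rewrite lee_fin; apply: mulr_ge0; [case/andP: (f0 y)|case/andP: (I01 y)].
rewrite integral_uniform; last 2 first.
- by apply/measurable_EFinP; exact: measurable_funM.
- by move=> y; rewrite lee_fin; apply: mulr_ge0; [case/andP: (f0 y)|case/andP: (pdf_le x y)].
have e1 : 2 * K * (K - - K)^-1 = 1.
  by rewrite (_ : K - - K = 2 * K); [rewrite divff// mulf_neq0// gt_eqF|ring].
rewrite muleA -EFinM e1 mul1e [RHS]integral_mkcond; apply: eq_integral => y _.
rewrite patchE indicE; case: ifPn => yI; first by rewrite /= mulr1 -EFinM.
by rewrite /= mulr0 mul0e.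
Qed.

Let bpair : bounded_mfun phi.
Proof. by split => //; exists M => z; rewrite ger0_norm. Qed.

Let bphi2 x2 : bounded_mfun (fun z : R * R => phi z * normal_pdf x2 e z.2).
Proof.
split; last first.
  exists (M * normal_peak e) => z; have /andP[a b] := pdf_le x2 z.2.
  by rewrite ger0_norm ?mulr_ge0// ler_pM.
apply: measurable_funM => //.
exact: (measurableT_comp (measurable_normal_pdf x2 e) measurable_snd).
Qed.

Let bphi12 x1 x2 : bounded_mfun (fun z : R * R => phi z * normal_pdf x2 e z.2 * normal_pdf x1 e z.1).
Proof.
split; last first.
  exists (M * normal_peak e * normal_peak e) => z.
  have /andP[a b] := pdf_le x2 z.2; have /andP[a' b'] := pdf_le x1 z.1.
  rewrite ger0_norm ?mulr_ge0// ler_pM ?mulr_ge0//; exact: ler_pM.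
apply: measurable_funM; first by case: (bphi2 x2).
exact: (measurableT_comp (measurable_normal_pdf x1 e) measurable_fst).
Qed.

(** The convolution of [phi], cut off outside the square of half-side K, with a Gaussian density of
    width e. The Lebesgue integral over the square is written as (2K)^2 times a uniform average, so
    that Fubini for probability measures applies; [smoothE] gives it back as a normal expectation
    around (x1, x2). *)
Definition smooth x1 x2 : R := (2 * K) ^+ 2 *
  \int[U]_y1 \int[U]_y2 (phi (y1, y2) * normal_pdf x2 e y2 * normal_pdf x1 e y1).

Lemma smoothE x1 x2 : smooth x1 x2 =
  \int[normal_prob x1 e]_y1 \int[normal_prob x2 e]_y2 (phi (y1, y2) * I y2 * I y1).
Proof.
have bI : bounded_mfun (fun z : R * R => phi z * I z.2).
  split; last first.
    exists M => z; have /andP[a b] := I01 z.2.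
    by rewrite ger0_norm ?mulr_ge0// -[leRHS]mulr1 ler_pM.
  by apply: measurable_funM => //; exact: (measurableT_comp mI measurable_snd).
pose g y1 := \int[normal_prob x2 e]_y2 (phi (y1, y2) * I y2).
have gE y1 : g y1 = (2 * K) * \int[U]_y2 (phi (y1, y2) * normal_pdf x2 e y2).
  rewrite /g (@normal_uniform x2 (fun y2 => phi (y1, y2)) M)//.
    by case: (bounded_mfun_pair1 bpair y1).
  by move=> y; rewrite phi0 phiM.
have g0 y1 : 0 <= g y1 <= M.
  rewrite Rintegral_ge0 => [|y _]; last by rewrite mulr_ge0//; case/andP: (I01 y).
  rewrite (le_trans (ler_norm _))//; apply: Rintegral_bounded_le => [|y].
    by case: (bounded_mfun_pair1 bI y1).
  have /andP[a b] := I01 y.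
  by rewrite ger0_norm ?mulr_ge0// -[leRHS]mulr1 ler_pM.
have mg : measurable_fun setT g by case: (bounded_mfun_Rintegral1 (normal_prob x2 e) bI).
transitivity (\int[normal_prob x1 e]_y1 (g y1 * I y1)); last first.
  apply: eq_Rintegral => y1 _; rewrite /g mulrC -RintegralZl//; last first.
    exact: (bounded_mfun_integrable (normal_prob x2 e) (bounded_mfun_pair1 bI y1)).
  by apply: eq_Rintegral => y2 _; rewrite mulrC.
rewrite (normal_uniform x1 mg g0) /smooth expr2 -mulrA; congr (_ * _).
rewrite -RintegralZl//; last first.
  exact: (bounded_mfun_integrable U (bounded_mfun_Rintegral1 U (bphi12 x1 x2))).
apply: eq_Rintegral => y1 _; rewrite gE -[RHS]mulrA; congr (_ * _).
have := @RintegralZl _ _ _ U setT _ (normal_pdf x1 e y1) measurableT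
  (bounded_mfun_integrable U (bounded_mfun_pair1 (bphi2 x2) y1)).
rewrite [RHS]mulrC => <-; apply: eq_Rintegral => y2 _; exact: mulrC.
Qed.

Let btrunc : bounded_mfun (fun z : R * R => phi z * I z.2 * I z.1).
Proof.
split; last first.
  exists M => z; have /andP[a b] := I01 z.2; have /andP[a' b'] := I01 z.1.
  rewrite ger0_norm ?mulr_ge0// -[leRHS]mulr1 ler_pM ?mulr_ge0//.
  by rewrite -[leRHS]mulr1 ler_pM.
apply: measurable_funM; last exact: (measurableT_comp mI measurable_fst).
by apply: measurable_funM => //; exact: (measurableT_comp mI measurable_snd).
Qed.

Lemma smooth_bound x1 x2 : 0 <= smooth x1 x2 <= M.
Proof.
rewrite smoothE; apply/andP; split.
  apply: Rintegral_ge0 => y1 _; apply: Rintegral_ge0 => y2 _.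
  by rewrite !mulr_ge0.
rewrite (le_trans (ler_norm _))//; apply: Rintegral_bounded_le => [|y1].
  by case: (bounded_mfun_Rintegral1 (normal_prob x2 e) btrunc).
apply: Rintegral_bounded_le => [|y2]; first by case: (bounded_mfun_pair1 btrunc y1).
have /andP[a b] := I01 y2; have /andP[a' b'] := I01 y1.
rewrite ger0_norm ?mulr_ge0// -[leRHS]mulr1 ler_pM ?mulr_ge0//.
by rewrite -[leRHS]mulr1 ler_pM.
Qed.

Lemma normal_sqr_shift x : (normal_prob x e).-integrable setT (EFin \o (fun y => (y - x) ^+ 2)) /\
  \int[normal_prob x e]_y ((y - x) ^+ 2) = e ^+ 2.
Proof.
split; last by rewrite /Rintegral normal_prob_variance.
apply: ge0_integrable.
- by apply: measurable_funX; exact: measurable_funB.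
- by move=> y; exact: sqr_ge0.
- by rewrite normal_prob_variance// ltry.
Qed.

(** A Chebyshev argument: at distance at least delta in some coordinate, the trivial bound M is at
    most M / delta^2 times the squared distance, whose normal expectation is e^2 for each of the two
    coordinates. *)
Lemma smooth_approx x1 x2 (eta delta : R) : 0 <= eta -> 0 < delta ->
  (forall y1 y2, `|y1 - x1| < delta -> `|y2 - x2| < delta ->
    [/\ `|y1| <= K, `|y2| <= K & `|phi (y1, y2) - phi (x1, x2)| <= eta]) ->
  `|smooth x1 x2 - phi (x1, x2)| <= eta + 2 * (M / delta ^+ 2) * e ^+ 2.
Proof.
move=> eta0 delta0 h.
have d20 : 0 < delta ^+ 2 by rewrite exprn_gt0.
pose D := M / delta ^+ 2.
have D0 : 0 <= D by rewrite divr_ge0// ltW.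
have key y1 y2 : `|phi (y1, y2) * I y2 * I y1 - phi (x1, x2)| <=
    (eta + D * (y1 - x1) ^+ 2) + D * (y2 - x2) ^+ 2.
  have triv (z x : R) : delta <= `|z - x| -> M <= D * (z - x) ^+ 2.
    move=> dz; rewrite /D mulrAC ler_pdivlMr// ler_wpM2l//.
    by rewrite -[leRHS]real_normK ?num_real// lerXn2r// nnegrE ltW.
  have le1 : `|phi (y1, y2) * I y2 * I y1 - phi (x1, x2)| <= M.
    have /andP[a b] := I01 y2; have /andP[a' b'] := I01 y1.
    have : phi (y1, y2) * I y2 * I y1 <= M.
      rewrite -[leRHS]mulr1 ler_pM ?mulr_ge0//.
      by rewrite -[leRHS]mulr1 ler_pM.
    have : 0 <= phi (y1, y2) * I y2 * I y1 by rewrite !mulr_ge0.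
    have := phi0 (x1, x2); have := phiM (x1, x2).
    rewrite ler_norml; lra.
  have s1 : 0 <= D * (y1 - x1) ^+ 2 by rewrite mulr_ge0// sqr_ge0.
  have s2 : 0 <= D * (y2 - x2) ^+ 2 by rewrite mulr_ge0// sqr_ge0.
  have [d1|d1] := ltP `|y1 - x1| delta; last by have := triv _ _ d1; lra.
  have [d2|d2] := ltP `|y2 - x2| delta; last by have := triv _ _ d2; lra.
  have [k1 k2 ph] := h y1 y2 d1 d2.
  rewrite !indicE !mem_set /= ?in_itv/= -?ler_norml// !mulr1; lra.
have [i1 v1] := normal_sqr_shift x1; have [i2 v2] := normal_sqr_shift x2.
have j1 := integrable_scale D i1; have j2 := integrable_scale D i2.
have w1 : \int[normal_prob x1 e]_y (D * (y - x1) ^+ 2) = D * e ^+ 2.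
  by rewrite -v1; exact: RintegralZl.
have w2 : \int[normal_prob x2 e]_y (D * (y - x2) ^+ 2) = D * e ^+ 2.
  by rewrite -v2; exact: RintegralZl.
have cst2 y1 := integrable_cst (normal_prob x2 e) (eta + D * (y1 - x1) ^+ 2).
have bt1 y1 := bounded_mfun_integrable (normal_prob x2 e) (bounded_mfun_pair1 btrunc y1).
have step y1 : `|\int[normal_prob x2 e]_y2 (phi (y1, y2) * I y2 * I y1) - phi (x1, x2)| <=
    (eta + D * e ^+ 2) + D * (y1 - x1) ^+ 2.
  rewrite -[X in _ - X](Rintegral_probability_cst (normal_prob x2 e)).
  rewrite -RintegralB//; last exact: integrable_cst.
  apply: (@le_trans _ _ (\int[normal_prob x2 e]_y2 ((eta + D * (y1 - x1) ^+ 2) + D * (y2 - x2) ^+ 2))).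
    apply: Rintegral_norm_le => [||y2]; last exact: key.
      exact: (integrable_sub (bt1 y1) (integrable_cst _ _)).
    exact: (integrable_add (cst2 y1) j2).
  rewrite RintegralD; [|exact: measurableT|exact: cst2|exact: j2].
  rewrite w2.
  have -> : \int[normal_prob x2 e]__ (eta + D * (y1 - x1) ^+ 2) = eta + D * (y1 - x1) ^+ 2.
    exact: Rintegral_probability_cst.
  by rewrite addrAC.
have cst1 := integrable_cst (normal_prob x1 e) (eta + D * e ^+ 2).
have bt := bounded_mfun_integrable (normal_prob x1 e) (bounded_mfun_Rintegral1 (normal_prob x2 e) btrunc).
rewrite smoothE -[X in _ - X](Rintegral_probability_cst (normal_prob x1 e)).
rewrite -(RintegralB measurableT bt (integrable_cst _ _)).
apply: (@le_trans _ _ (\int[normal_prob x1 e]_y1 ((eta + D * e ^+ 2) + D * (y1 - x1) ^+ 2))).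
  apply: Rintegral_norm_le => [||y1]; last exact: step.
    exact: (integrable_sub bt (integrable_cst _ _)).
  exact: (integrable_add cst1 j1).
rewrite RintegralD; [|exact: measurableT|exact: cst1|exact: j1].
rewrite w1.
have -> : \int[normal_prob x1 e]__ (eta + D * e ^+ 2) = eta + D * e ^+ 2.
  exact: Rintegral_probability_cst.
rewrite -/D; set E := e ^+ 2.
by have -> : eta + 2 * D * E = eta + D * E + D * E by ring.
Qed.

Section expectation.
Context {d : measure_display} {T : measurableType d}.
Variables (P : probability T R) (X Y : T -> R).
Hypotheses (mX : measurable_fun setT X) (mY : measurable_fun setT Y).

Let bsm : bounded_mfun (fun z : T * (R * R) =>
  phi z.2 * normal_pdf (Y z.1) e z.2.2 * normal_pdf (X z.1) e z.2.1).
Proof.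
have mpdf (Z : T -> R) (p : R * R -> R) : measurable_fun setT Z -> measurable_fun setT p ->
    measurable_fun setT (fun z : T * (R * R) => normal_pdf (Z z.1) e (p z.2)).
  move=> mZ mp; under eq_fun do rewrite normal_pdf_gbump//.
  apply: measurable_funM => //; apply: (measurableT_comp (measurable_gbump e)).
  by apply: measurable_funB;
    [exact: (measurableT_comp mZ measurable_fst)|exact: (measurableT_comp mp measurable_snd)].
split; last first.
  exists (M * normal_peak e * normal_peak e) => z.
  have /andP[a b] := pdf_le (Y z.1) z.2.2; have /andP[a' b'] := pdf_le (X z.1) z.2.1.
  rewrite ger0_norm ?mulr_ge0// ler_pM ?mulr_ge0//; exact: ler_pM.
apply: measurable_funM; last exact: (mpdf X fst mX measurable_fst).
apply: measurable_funM; last exact: (mpdf Y snd mY measurable_snd).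
exact: (measurableT_comp mphi measurable_snd).
Qed.

Let bsm1 : bounded_mfun (fun z : (T * R) * R => phi (z.1.2, z.2) *
  normal_pdf (Y z.1.1) e z.2 * normal_pdf (X z.1.1) e z.1.2).
Proof.
have [mf [C fC]] := bsm; split; last by exists C => z; exact: (fC (z.1.1, (z.1.2, z.2))).
apply: (measurableT_comp mf (g := fun z : (T * R) * R => (z.1.1, (z.1.2, z.2)))).
apply: measurable_fun_pair; first exact: (measurableT_comp measurable_fst measurable_fst).
apply: measurable_fun_pair; last exact: measurable_snd.
exact: (measurableT_comp measurable_snd measurable_fst).
Qed.

Lemma bounded_mfun_smooth : bounded_mfun (fun w => smooth (X w) (Y w)).
Proof.
have b1 := bounded_mfun_Rintegral1 U bsm1.
have [m2 [C fC]] := bounded_mfun_Rintegral1 U b1.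
split; first exact: measurable_funM.
exists ((2 * K) ^+ 2 * C) => w; rewrite /smooth normrM (ger0_norm (sqr_ge0 _)).
by apply: ler_wpM2l; [exact: sqr_ge0|exact: fC].
Qed.

(** By Fubini, the law of (X, Y) enters only through the expectations of bumps, whose convergence is
    [cvg_gbump]. *)
Lemma Rintegral_smooth : \int[P]_w smooth (X w) (Y w) = (2 * K) ^+ 2 *
  \int[U]_y1 \int[U]_y2 (phi (y1, y2) * normal_peak e ^+ 2 *
    \int[P]_w (gbump e (X w - y1) * gbump e (Y w - y2))).
Proof.
have b1 := bounded_mfun_Rintegral1 U bsm1.
have b2 := bounded_mfun_Rintegral1 U b1.
rewrite /smooth RintegralZl//; last exact: (bounded_mfun_integrable P b2).
congr (_ * _); rewrite (bounded_fubini P U b1)/=.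
apply: eq_Rintegral => y1 _.
have b3 : bounded_mfun (fun z : T * R => phi (y1, z.2) *
    normal_pdf (Y z.1) e z.2 * normal_pdf (X z.1) e y1).
  have [mf [C fC]] := bsm1; split; last by exists C => z; exact: (fC ((z.1, y1), z.2)).
  apply: (measurableT_comp mf (g := fun z : T * R => ((z.1, y1), z.2))).
  apply: measurable_fun_pair; last exact: measurable_snd.
  by apply: measurable_fun_pair; [exact: measurable_fst|exact: measurable_cst].
rewrite (bounded_fubini P U b3)/=; apply: eq_Rintegral => y2 _.
rewrite -RintegralZl//; last first.
  apply: bounded_mfun_integrable; split.
    have mg (Z : T -> R) y : measurable_fun setT Z -> measurable_fun setT (fun w => gbump e (Z w - y)).
      by move=> mZ; apply: (measurableT_comp (measurable_gbump e)); exact: measurable_funB.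
    by apply: measurable_funM; exact: mg.
  exists 1 => w; rewrite ger0_norm ?mulr_ge0 ?gbump_ge0// -[leRHS]mulr1.
  by rewrite ler_pM ?gbump_ge0 ?gbump_le1.
by apply: eq_Rintegral => w _; rewrite !normal_pdf_gbump//; ring.
Qed.

End expectation.
End smoothing.

(** Only the base point x is confined to the square; its neighbor y may leave it. Compactness is
    used in its covering form for properties that hold for all small delta. *)
Lemma uniformly_continuous_square {R : realType} (phi : R * R -> R) (K eta : R) :
  continuous phi -> 0 < eta -> exists2 delta : R, 0 < delta &
  forall x1 x2 y1 y2, `|x1| <= K -> `|x2| <= K ->
    `|y1 - x1| < delta -> `|y2 - x2| < delta -> `|phi (y1, y2) - phi (x1, x2)| <= eta.
Proof.
move=> cphi eta0.
pose A : set (R * R) := `[- K, K] `*` `[- K, K].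
have cA : compact A by apply: compact_setX; exact: segment_compact.
pose Pd (delta : R) (x : R * R) := forall y1 y2, `|y1 - x.1| < delta ->
  `|y2 - x.2| < delta -> `|phi (y1, y2) - phi x| <= eta.
have near x : A x -> \forall x' \near x & delta \near (0 : R)^'+, Pd delta x'.
  move=> _.
  have /cvgrPdist_lt/(_ (eta / 2) (divr_gt0 eta0 (ltr0n _ 2))) := cphi x.
  move=> /nbhs_ballP[r /= r0 xr].
  exists (ball x (r / 2), [set delta | delta < r / 2]) => /=.
    split; first exact: nbhsx_ballx (divr_gt0 r0 (ltr0n _ 2)).
    exact: (nbhs_right_lt (divr_gt0 r0 (ltr0n _ 2))).
  move=> -[x' delta] /= [[xx1 xx2] dr] y1 y2 /= d1 d2.
  have h1 : ball x r x'.
    by split; apply: le_ball (xx1) || apply: le_ball (xx2); rewrite ler_pdivrMr//; lra.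
  have h2 : ball x r (y1, y2).
    split => /=; rewrite /ball/=.
      have := ler_distD x'.1 x.1 y1; rewrite [`|x'.1 - y1|]distrC.
      move: xx1; rewrite /ball/=; lra.
    have := ler_distD x'.2 x.2 y2; rewrite [`|x'.2 - y2|]distrC.
    move: xx2; rewrite /ball/=; lra.
  have := xr _ h1; have := xr _ h2; have := ler_distD (phi x) (phi (y1, y2)) (phi x').
  rewrite [`|phi (y1, y2) - phi x|]distrC; lra.
have H := (compact_near_coveringP A).1 cA R (0 : R)^'+ Pd _ near.
have : \forall delta \near (0 : R)^'+, 0 < delta /\ A `<=` Pd delta.
  near=> delta; split; first by near: delta; exact: nbhs_right_gt.
  by near: delta; exact: H.
move=> /filter_ex[delta [d0 AP]]; exists delta => // x1 x2 y1 y2 k1 k2 d1 d2.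
by apply: (AP (x1, x2)) => //; split; rewrite /= in_itv/= -ler_norml.
Unshelve. all: by end_near. Qed.

Section levy_theorem.
Context {d d' : measure_display} {T : measurableType d} {T' : measurableType d'}
  {R : realType}.
Variables (P : probability T R) (P' : probability T' R).
Variables (X Y : nat -> T -> R) (X' Y' : T' -> R).
Hypotheses (mX : forall n, measurable_fun setT (X n)) (mY : forall n, measurable_fun setT (Y n)).
Hypotheses (mX' : measurable_fun setT X') (mY' : measurable_fun setT Y').
Hypothesis cvg_char : forall b s t : R,
  \int[P]_w cos (b + s * X n w + t * Y n w) @[n --> \oo] -->
  \int[P']_w cos (b + s * X' w + t * Y' w).
Variable C : R.
Hypothesis momXY : forall n, (\int[P]_w (X n w ^+ 2 + Y n w ^+ 2)%:E <= C%:E)%E.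
Hypothesis momXY' : (\int[P']_w (X' w ^+ 2 + Y' w ^+ 2)%:E <= C%:E)%E.

(** The bounded second moments play the role of tightness: [phi] is close to its smoothing on a
    large square, the complement has a small contribution by Chebyshev, and the smoothed
    expectations converge. *)
Lemma levy_continuity_ge0 (phi : R * R -> R) (M : R) :
  continuous phi -> measurable_fun setT phi -> (forall z, 0 <= phi z <= M) ->
  \int[P]_w phi (X n w, Y n w) @[n --> \oo] --> \int[P']_w phi (X' w, Y' w).
Proof.
move=> cphi mphi phiM.
have phi0 z : 0 <= phi z by case/andP: (phiM z).
have phi1 z : phi z <= M by case/andP: (phiM z).
have M0 : 0 <= M := le_trans (phi0 (0, 0)) (phi1 _).
have C0 : 0 <= C.
  rewrite -lee_fin (le_trans _ momXY')// integral_ge0// => w _.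
  by rewrite lee_fin addr_ge0// sqr_ge0.
apply/cvgrPdist_lt => eta eta0.
(* Each of the two smoothing errors will be at most 3 eta', and the smoothed expectations differ by
   less than eta', in total 7 eta' < eta. *)
pose eta' := eta / 8.
have eta'0 : 0 < eta' by rewrite divr_gt0.
(* Outside the square the error is at most M C / K^2, and M C = eta' (K - 1) <= eta' K^2. *)
pose K := 1 + M * C / eta'.
have MC0 : 0 <= M * C / eta' by rewrite divr_ge0 ?mulr_ge0// ltW.
have K1 : 1 <= K by rewrite lerDl.
have K0 : 0 < K by lra.
have [delta0 delta00 unif] := @uniformly_continuous_square R phi K eta' cphi eta'0.
pose delta := Num.min delta0 1.
have delta_gt0 : 0 < delta by rewrite lt_min delta00 ltr01.
have d20 : 0 < delta ^+ 2 by rewrite exprn_gt0.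
pose L := 2 * (M / delta ^+ 2).
have L0 : 0 <= L by rewrite mulr_ge0// divr_ge0// ltW.
pose e := Num.min 1 (eta' / (L + 1)).
have e0 : 0 < e by rewrite lt_min ltr01 divr_gt0//; lra.
have Le : L * e ^+ 2 <= eta'.
  have e1 : e <= 1 by rewrite ge_min lexx.
  have : e <= eta' / (L + 1) by rewrite ge_min lexx orbT.
  rewrite ler_pdivlMr; last lra.
  have : L * e ^+ 2 <= L * e by rewrite ler_wpM2l// expr2 ler_piMr// ltW.
  nra.
(* The cut-off square is larger by 1 >= delta, so that the delta-neighborhood of a point of the
   square of half-side K stays inside. *)
have KK0 : 0 < K + 1 by lra.
pose sm e1 := smooth phi e1 KK0.
have approx x1 x2 : `|sm e x1 x2 - phi (x1, x2)| <= 2 * eta' + M / K ^+ 2 * (x1 ^+ 2 + x2 ^+ 2).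
  have K20 : 0 < K ^+ 2 by rewrite exprn_gt0.
  have s0 : 0 <= M / K ^+ 2 * (x1 ^+ 2 + x2 ^+ 2).
    by rewrite mulr_ge0 ?divr_ge0// ?addr_ge0 ?sqr_ge0// ltW.
  have big (x x' : R) : K < `|x| -> M <= M / K ^+ 2 * (x ^+ 2 + x' ^+ 2).
    move=> Kx; rewrite mulrAC ler_pdivlMr// ler_wpM2l//.
    rewrite (@le_trans _ _ (x ^+ 2))// ?lerDl ?sqr_ge0//.
    by rewrite -[leRHS]real_normK ?num_real// lerXn2r// ?nnegrE ltW.
  have trivial : `|sm e x1 x2 - phi (x1, x2)| <= M.
    have /andP[a b] := smooth_bound KK0 e0 mphi phi0 phi1 x1 x2.
    have := phi0 (x1, x2); have := phi1 (x1, x2); rewrite ler_norml /sm; lra.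
  have [k1|/big] := leP `|x1| K; last by move=> /(_ x2); lra.
  have [k2|/big] := leP `|x2| K; last by move=> /(_ x1); rewrite [_ ^+ 2 + x1 ^+ 2]addrC; lra.
  have := @smooth_approx R phi M (K + 1) e KK0 e0 mphi phi0 phi1 x1 x2 eta' delta (ltW eta'0) delta_gt0.
  move=> h; apply: (le_trans (h _)); last by rewrite -/L; lra.
  move=> y1 y2; rewrite !lt_min => /andP[a1 a2] /andP[b1 b2]; split.
  - by have := ler_distD x1 y1 0; rewrite !subr0; lra.
  - by have := ler_distD x2 y2 0; rewrite !subr0; lra.
  - exact: unif.
have close d0 (T0 : measurableType d0) (P0 : probability T0 R) (Z W : T0 -> R) :
    measurable_fun setT Z -> measurable_fun setT W ->
    (\int[P0]_w (Z w ^+ 2 + W w ^+ 2)%:E <= C%:E)%E ->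
    `|\int[P0]_w sm e (Z w) (W w) - \int[P0]_w phi (Z w, W w)| <= 3 * eta'.
  move=> mZ mW mom.
  have i1 := bounded_mfun_integrable P0 (bounded_mfun_smooth KK0 e0 mphi phi0 phi1 mZ mW).
  have i2 : P0.-integrable setT (EFin \o (fun w => phi (Z w, W w))).
    apply: bounded_mfun_integrable; split; last by exists M => w; rewrite ger0_norm.
    by apply: (measurableT_comp mphi); exact: measurable_fun_pair.
  have i3 : P0.-integrable setT (EFin \o (fun w => Z w ^+ 2 + W w ^+ 2)).
    apply: ge0_integrable.
    - by apply: measurable_funD; exact: measurable_funX.
    - by move=> w; rewrite addr_ge0// sqr_ge0.
    - by rewrite (le_lt_trans mom)// ltry.
  rewrite -RintegralB//.
  have i4 := integrable_scale (M / K ^+ 2) i3.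
  apply: (@le_trans _ _ (\int[P0]_w (2 * eta' + M / K ^+ 2 * (Z w ^+ 2 + W w ^+ 2)))).
    apply: Rintegral_norm_le => [||w]; last exact: approx.
      exact: integrable_sub.
    exact: (integrable_add (integrable_cst _ _) i4).
  rewrite RintegralD; [|exact: measurableT|exact: integrable_cst|exact: i4].
  rewrite RintegralZl// Rintegral_probability_cst.
  have : \int[P0]_w (Z w ^+ 2 + W w ^+ 2) <= C by rewrite -lee_fin -EFin_Rintegral.
  set J := \int[P0]_w (Z w ^+ 2 + W w ^+ 2) => JC.
  have MK : M / K ^+ 2 * J <= eta'.
    rewrite mulrAC ler_pdivrMr ?exprn_gt0//.
    apply: (@le_trans _ _ (M * C)); first exact: ler_wpM2l.
    have -> : M * C = eta' * (K - 1) by rewrite /K addrC addKr; field; rewrite gt_eqF.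
    rewrite ler_wpM2l// ?(ltW eta'0)// expr2; nra.
  lra.
have cvgsm : \int[P]_w sm e (X n w) (Y n w) @[n --> \oo] --> \int[P']_w sm e (X' w) (Y' w).
  rewrite /sm (Rintegral_smooth KK0 e0 mphi phi0 phi1 P' mX' mY').
  under eq_fun do rewrite (Rintegral_smooth KK0 e0 mphi phi0 phi1 P (mX _) (mY _)).
  apply: cvgM; first exact: cvg_cst.
  set U := uniform_prob _.
  have p0 : 0 <= normal_peak e := normal_peak_ge0 e.
  have bb d0 (T0 : measurableType d0) (P0 : probability T0 R) (Z W : T0 -> R) :
      measurable_fun setT Z -> measurable_fun setT W ->
      bounded_mfun (fun z : R * R => phi z * normal_peak e ^+ 2 *
        \int[P0]_w (gbump e (Z w - z.1) * gbump e (W w - z.2))).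
    move=> mZ mW.
    have bgb : bounded_mfun (fun z : T0 * (R * R) => gbump e (Z z.1 - z.2.1) * gbump e (W z.1 - z.2.2)).
      split; last first.
        exists 1 => z; rewrite ger0_norm ?mulr_ge0 ?gbump_ge0// -[leRHS]mulr1.
        by rewrite ler_pM ?gbump_ge0 ?gbump_le1.
      apply: measurable_funM; apply: (measurableT_comp (measurable_gbump e)); apply: measurable_funB.
      - exact: (measurableT_comp mZ measurable_fst).
      - exact: (measurableT_comp measurable_fst measurable_snd).
      - exact: (measurableT_comp mW measurable_fst).
      - exact: (measurableT_comp measurable_snd measurable_snd).
    have [mg [C' gC']] := bounded_mfun_Rintegral2 P0 bgb.
    split; first by apply: measurable_funM => //; exact: measurable_funM.
    exists (M * normal_peak e ^+ 2 * C') => z; rewrite normrM.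
    rewrite ger0_norm ?mulr_ge0 ?exprn_ge0// ler_pM ?mulr_ge0 ?exprn_ge0//.
    - by rewrite ler_wpM2r ?exprn_ge0.
    - exact: gC'.
  have bd n (y1 y2 : R) : `|phi (y1, y2) * normal_peak e ^+ 2 *
      \int[P]_w (gbump e (X n w - y1) * gbump e (Y n w - y2))| <= M * normal_peak e ^+ 2.
    rewrite normrM -[leRHS]mulr1 ler_pM//.
      by rewrite ger0_norm ?mulr_ge0 ?exprn_ge0// ler_wpM2r ?exprn_ge0.
    apply: Rintegral_bounded_le => [|w].
      apply: measurable_funM; apply: (measurableT_comp (measurable_gbump e));
      exact: measurable_funB.
    rewrite ger0_norm ?mulr_ge0 ?gbump_ge0// -[leRHS]mulr1.
    by rewrite ler_pM ?gbump_ge0 ?gbump_le1.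
  apply: (@bounded_convergence _ _ R _ _ _ (M * normal_peak e ^+ 2)) => [n|n y1|y1].
  - exact: (bounded_mfun_Rintegral1 U (bb _ _ P _ _ (mX n) (mY n))).1.
  - apply: Rintegral_bounded_le => [|y2]; last exact: bd.
    exact: (bounded_mfun_pair1 (bb _ _ P _ _ (mX n) (mY n)) y1).1.
  - apply: (@bounded_convergence _ _ R _ _ _ (M * normal_peak e ^+ 2)) => [n|n y2|y2].
    + exact: (bounded_mfun_pair1 (bb _ _ P _ _ (mX n) (mY n)) y1).1.
    + exact: bd.
    + apply: cvgM; first exact: cvg_cst.
      exact: (cvg_gbump mX mY mX' mY' cvg_char).
move/cvgrPdist_lt : cvgsm => /(_ eta' eta'0) cvgsm.
near=> n.
have h1 := close _ _ P _ _ (mX n) (mY n) (momXY n).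
have h2 := close _ _ P' _ _ mX' mY' momXY'.
have : `|\int[P']_w sm e (X' w) (Y' w) - \int[P]_w sm e (X n w) (Y n w)| < eta'.
  by near: n.
move: h1 h2; rewrite /eta'.
set a := \int[P]_w sm e (X n w) (Y n w); set b := \int[P]_w phi _.
set a' := \int[P']_w sm e (X' w) (Y' w); set b' := \int[P']_w phi _.
rewrite !ler_norml !ltr_norml => /andP[? ?] /andP[? ?] /andP[? ?].
apply/andP; split; lra.
Unshelve. all: by end_near. Qed.

Theorem levy_continuity (phi : R * R -> R) :
  continuous phi -> bounded_mfun phi ->
  \int[P]_w phi (X n w, Y n w) @[n --> \oo] --> \int[P']_w phi (X' w, Y' w).
Proof.
move=> cphi [mphi [M phiM]].
have cphi' : continuous (fun z => phi z + M) by move=> z; apply: cvgD; [exact: cphi|exact: cvg_cst].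
have mphi' : measurable_fun setT (fun z => phi z + M) by exact: measurable_funD.
have b (z : R * R) : 0 <= phi z + M <= 2 * M.
  by have := phiM z; rewrite ler_norml => /andP[? ?]; apply/andP; split; lra.
have E d0 (T0 : measurableType d0) (P0 : probability T0 R) (Z W : T0 -> R) :
    measurable_fun setT Z -> measurable_fun setT W ->
    \int[P0]_w (phi (Z w, W w) + M) = \int[P0]_w phi (Z w, W w) + M.
  move=> mZ mW; rewrite RintegralD; [|exact: measurableT| |exact: integrable_cst].
    by rewrite Rintegral_probability_cst.
  apply: bounded_mfun_integrable; split; last by exists M.
  by apply: (measurableT_comp mphi); exact: measurable_fun_pair.
have h := levy_continuity_ge0 cphi' mphi' b.
have -> : \int[P']_w phi (X' w, Y' w) = \int[P']_w (phi (X' w, Y' w) + M) - M.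
  by rewrite E// addrK.
have -> : (fun n => \int[P]_w phi (X n w, Y n w)) =
    (fun n => \int[P]_w (phi (X n w, Y n w) + M) - M).
  by apply/funext => n; rewrite E// addrK.
exact: (cvgB h (cvg_cst M)).
Qed.

End levy_theorem.

(** * A central limit theorem for weighted sums over a tree *)

Section complex_algebra.
Context {R : realType}.
Implicit Types (z a b : cplx R).

(** The squared modulus as a real polynomial in the coordinates, which, unlike [cmod], is open to
    ring and linear arithmetic. *)
Definition nsq z : R := re z ^+ 2 + im z ^+ 2.

Lemma cplxP z1 z2 : re z1 = re z2 -> im z1 = im z2 -> z1 = z2.
Proof. by case: z1 z2 => [? ?] [? ?]; rewrite /re /im /= => -> ->. Qed.

Lemma reD a b : re (a + b) = re a + re b. Proof. by case: a b => [? ?] [? ?]. Qed.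
Lemma imD a b : im (a + b) = im a + im b. Proof. by case: a b => [? ?] [? ?]. Qed.
Lemma reN a : re (- a) = - re a. Proof. by case: a. Qed.
Lemma imN a : im (- a) = - im a. Proof. by case: a. Qed.
Lemma reM a b : re (a * b) = re a * re b - im a * im b. Proof. by case: a b => [? ?] [? ?]. Qed.
Lemma imM a b : im (a * b) = re a * im b + im a * re b. Proof. by case: a b => [? ?] [? ?]. Qed.
Lemma re0 : re (0 : cplx R) = 0. Proof. by []. Qed.
Lemma im0 : im (0 : cplx R) = 0. Proof. by []. Qed.
Lemma re1 : re (1 : cplx R) = 1. Proof. by []. Qed.
Lemma im1 : im (1 : cplx R) = 0. Proof. by []. Qed.
Lemma re_toC (x : R) : re (toC x) = x. Proof. by []. Qed.
Lemma im_toC (x : R) : im (toC x) = 0. Proof. by []. Qed.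

Lemma re_Complex (x y : R) : re (Complex x y) = x. Proof. by []. Qed.
Lemma im_Complex (x y : R) : im (Complex x y) = y. Proof. by []. Qed.

Definition cplxE := (reD, imD, reN, imN, reM, imM, re0, im0, re1, im1, re_toC, im_toC,
  re_Complex, im_Complex).

Lemma re_sum (I : Type) (s : seq I) (F : I -> cplx R) :
  re (\sum_(i <- s) F i) = \sum_(i <- s) re (F i).
Proof. exact: (big_morph re reD re0). Qed.

Lemma im_sum (I : Type) (s : seq I) (F : I -> cplx R) :
  im (\sum_(i <- s) F i) = \sum_(i <- s) im (F i).
Proof. exact: (big_morph im imD im0). Qed.

Lemma nsq_ge0 z : 0 <= nsq z. Proof. by rewrite addr_ge0// sqr_ge0. Qed.

Lemma nsq0 : nsq 0 = 0. Proof. by rewrite /nsq !cplxE expr0n addr0. Qed.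

Lemma nsq1 : nsq 1 = 1. Proof. by rewrite /nsq !cplxE expr1n expr0n addr0. Qed.

Lemma nsqM a b : nsq (a * b) = nsq a * nsq b.
Proof. by rewrite /nsq !cplxE; ring. Qed.

Lemma nsqX z n : nsq (z ^+ n) = nsq z ^+ n.
Proof.
elim: n => [|n IH]; first by rewrite !expr0 /nsq !cplxE; ring.
by rewrite !exprS nsqM IH.
Qed.

Lemma nsq_toC (x : R) : nsq (toC x) = x ^+ 2.
Proof. by rewrite /nsq !cplxE expr0n addr0. Qed.

Lemma nsq_eq0 z : (nsq z == 0) = (z == 0).
Proof.
rewrite paddr_eq0 ?sqr_ge0// !sqrf_eq0; apply/andP/eqP => [[/eqP a /eqP b]|->].
  exact: cplxP.
by rewrite eqxx.
Qed.

Lemma nsqV z : nsq z^-1 = (nsq z)^-1.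
Proof.
have [->|z0] := eqVneq z 0; first by rewrite invr0 /nsq !cplxE expr0n addr0 invr0.
have n0 : nsq z != 0 by rewrite nsq_eq0.
by apply: (mulfI n0); rewrite -nsqM !mulfV// /nsq !cplxE expr1n expr0n addr0.
Qed.

Lemma cmod_nsq z : cmod z ^+ 2 = nsq z.
Proof.
by case: z => x y; rewrite /cmod /nsq /re /im/= sqr_sqrtr// addr_ge0// sqr_ge0.
Qed.

Lemma cmod_ge0 z : 0 <= cmod z.
Proof. by case: z => x y; rewrite /cmod/= sqrtr_ge0. Qed.

Lemma re_sqr_le z : re z ^+ 2 <= nsq z. Proof. by rewrite lerDl sqr_ge0. Qed.
Lemma im_sqr_le z : im z ^+ 2 <= nsq z. Proof. by rewrite lerDr sqr_ge0. Qed.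

Lemma re_mul_sqr a b : re (a * b) ^+ 2 = (nsq a * nsq b + re (a ^+ 2 * b ^+ 2)) / 2.
Proof. by rewrite /nsq !expr2 !cplxE; field. Qed.

Lemma norm_re_sqr z : `|re (z ^+ 2)| <= nsq z.
Proof.
rewrite expr2 !cplxE /nsq -!expr2 ler_norml.
have := sqr_ge0 (re z); have := sqr_ge0 (im z); lra.
Qed.

Lemma norm_im_sqr z : `|im (z ^+ 2)| <= nsq z.
Proof.
rewrite expr2 !cplxE /nsq ler_norml.
have := sqr_ge0 (re z + im z); have := sqr_ge0 (re z - im z); lra.
Qed.

Lemma cmeasurable_scale d (T : measurableType d) (c : cplx R) (f : T -> cplx R) :
  cmeasurable f -> cmeasurable (fun w => c * f w).
Proof.
move=> [mr mi]; split; rewrite /comp.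
  by under eq_fun do rewrite reM; apply: measurable_funB; apply: measurable_funM.
by under eq_fun do rewrite imM; apply: measurable_funD; apply: measurable_funM.
Qed.

Lemma cmeasurable_add d (T : measurableType d) (f g : T -> cplx R) :
  cmeasurable f -> cmeasurable g -> cmeasurable (fun w => f w + g w).
Proof.
move=> [mr mi] [mr' mi']; split; rewrite /comp.
  by under eq_fun do rewrite reD; exact: measurable_funD.
by under eq_fun do rewrite imD; exact: measurable_funD.
Qed.

Lemma cmeasurable_cst d (T : measurableType d) (c : cplx R) : cmeasurable (fun _ : T => c).
Proof. by split; exact: measurable_cst. Qed.

End complex_algebra.

Section complex_centered.
Context {d : measure_display} {T : measurableType d} {R : realType}.
Variable P : probability T R.

Definition ccentered (xi : T -> cplx R) :=
  [/\ cmeasurable xi, (\int[P]_w (nsq (xi w))%:E < +oo)%E,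
      \int[P]_w re (xi w) = 0 & \int[P]_w im (xi w) = 0].

Definition cvar (xi : T -> cplx R) : R := \int[P]_w nsq (xi w).

(** The pseudo-variance E[xi^2]. Together with [cvar] it determines the covariance matrix of (Re xi,
    Im xi); it decides between a complex and a real normal limit. *)
Definition cpvar (xi : T -> cplx R) : cplx R :=
  Complex (\int[P]_w re (xi w ^+ 2)) (\int[P]_w im (xi w ^+ 2)).

(* Variance of the real part of b * xi. *)
Definition lin_var (xi : T -> cplx R) (b : cplx R) : R :=
  (nsq b * cvar xi + re (b ^+ 2 * cpvar xi)) / 2.

Context (xi : T -> cplx R).
Hypothesis xic : ccentered xi.

Lemma ccentered_measurable : measurable_fun setT (re \o xi) /\ measurable_fun setT (im \o xi).
Proof. by case: xic. Qed.

Lemma measurable_nsq : measurable_fun setT (fun w => nsq (xi w)).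
Proof.
have [mr mi] := ccentered_measurable.
by apply: measurable_funD; apply: measurable_funX.
Qed.

Lemma integrable_nsq : P.-integrable setT (EFin \o (fun w => nsq (xi w))).
Proof. by apply: ge0_integrable => [||]; [exact: measurable_nsq|move=> w; exact: nsq_ge0|case: xic]. Qed.

Lemma integrable_re_sqr : P.-integrable setT (EFin \o (fun w => re (xi w ^+ 2))).
Proof.
have [mr mi] := ccentered_measurable.
apply: integrable_dominated integrable_nsq => [|w]; last exact: norm_re_sqr.
under eq_fun do rewrite expr2 reM.
by apply: measurable_funB; apply: measurable_funM.
Qed.

Lemma integrable_im_sqr : P.-integrable setT (EFin \o (fun w => im (xi w ^+ 2))).
Proof.
have [mr mi] := ccentered_measurable.
apply: integrable_dominated integrable_nsq => [|w]; last exact: norm_im_sqr.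
under eq_fun do rewrite expr2 imM.
by apply: measurable_funD; apply: measurable_funM.
Qed.

Lemma integrable_re : P.-integrable setT (EFin \o (fun w => re (xi w))).
Proof.
have [mr mi] := ccentered_measurable.
apply: integrable_dominated (integrable_add (integrable_cst P 1) integrable_nsq) => // w.
have := re_sqr_le (xi w); have := sqr_ge0 (re (xi w) - 1); have := sqr_ge0 (re (xi w) + 1).
rewrite ler_norml; nra.
Qed.

Lemma integrable_im : P.-integrable setT (EFin \o (fun w => im (xi w))).
Proof.
have [mr mi] := ccentered_measurable.
apply: integrable_dominated (integrable_add (integrable_cst P 1) integrable_nsq) => // w.
have := im_sqr_le (xi w); have := sqr_ge0 (im (xi w) - 1); have := sqr_ge0 (im (xi w) + 1).
rewrite ler_norml; nra.
Qed.

Lemma cvar_ge0 : 0 <= cvar xi.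
Proof. by apply: Rintegral_ge0 => w _; exact: nsq_ge0. Qed.

Lemma cvarE : (\int[P]_w (nsq (xi w))%:E = (cvar xi)%:E)%E.
Proof. by rewrite EFin_Rintegral//; exact: integrable_nsq. Qed.

Lemma centered_lin (b : cplx R) : centered_L2 P (fun w => re (b * xi w)) (lin_var xi b).
Proof.
have [mr mi] := ccentered_measurable.
have m1 : measurable_fun setT (fun w => re (b * xi w)).
  by under eq_fun do rewrite reM; apply: measurable_funB; apply: measurable_funM.
split => //; last first.
  under eq_Rintegral do rewrite reM.
  have [_ _ r0 i0] := xic.
  rewrite RintegralB; [|exact: measurableT|exact: (integrable_scale _ integrable_re)
    |exact: (integrable_scale _ integrable_im)].
  rewrite RintegralZl//; last exact: integrable_re.
  rewrite RintegralZl//; last exact: integrable_im.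
  by rewrite r0 i0 !mulr0 subr0.
have i1 := integrable_scale (nsq b / 2) integrable_nsq.
have i2 := integrable_scale (re (b ^+ 2) / 2) integrable_re_sqr.
have i3 := integrable_scale (im (b ^+ 2) / 2) integrable_im_sqr.
have E w : re (b * xi w) ^+ 2 = nsq b / 2 * nsq (xi w) + re (b ^+ 2) / 2 * re (xi w ^+ 2)
    - im (b ^+ 2) / 2 * im (xi w ^+ 2).
  by rewrite re_mul_sqr reM; field.
under eq_integral do rewrite E.
rewrite EFin_Rintegral; last exact: (integrable_sub (integrable_add i1 i2) i3).
congr EFin.
rewrite RintegralB; [|exact: measurableT|exact: (integrable_add i1 i2)|exact: i3].
rewrite RintegralD; [|exact: measurableT|exact: i1|exact: i2].
rewrite RintegralZl//; last exact: integrable_nsq.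
rewrite RintegralZl//; last exact: integrable_re_sqr.
rewrite RintegralZl//; last exact: integrable_im_sqr.
by rewrite /lin_var /cvar /cpvar (reM (b ^+ 2)) !cplxE; field.
Qed.

Lemma re_mul_sqr_le (a b : cplx R) : re (a * b) ^+ 2 <= nsq a * nsq b.
Proof. by rewrite -nsqM re_sqr_le. Qed.

Lemma lin_var_ge0 b : 0 <= lin_var xi b.
Proof. exact: centered_L2_ge0 (centered_lin b). Qed.

Lemma lin_var_le b : lin_var xi b <= nsq b * cvar xi.
Proof.
rewrite -lee_fin; have [m1 <- _] := centered_lin b.
rewrite EFinM -cvarE -ge0_integralZl//.
- apply: ge0_integral_le_EFin => [||w|w].
  + by apply: measurable_funX.
  + by apply: measurable_funM => //; exact: measurable_nsq.
  + exact: sqr_ge0.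
  + exact: re_mul_sqr_le.
- by apply/measurable_EFinP; exact: measurable_nsq.
- by move=> w _; rewrite lee_fin nsq_ge0.
- by rewrite lee_fin nsq_ge0.
Qed.

(** A softly truncated second moment. By [lindeberg_le] it controls, per unit of |b|^2, the Taylor
    error of Re(b xi) for all |b| <= x at once, and it tends to 0 with x by dominated
    convergence. *)
Definition lindeberg (x : R) : R := \int[P]_w (nsq (xi w) * Num.min 1 (x * Num.sqrt (nsq (xi w)))).

Let lind_measurable x : measurable_fun setT (fun w => nsq (xi w) * Num.min 1 (x * Num.sqrt (nsq (xi w)))).
Proof.
apply: measurable_funM; first exact: measurable_nsq.
apply: measurable_minr => //; apply: measurable_funM => //.
exact: (measurableT_comp (continuous_measurable_fun (@sqrt_continuous R)) measurable_nsq).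
Qed.

Let lind_bound x : 0 <= x -> forall w, 0 <= nsq (xi w) * Num.min 1 (x * Num.sqrt (nsq (xi w))) <= nsq (xi w).
Proof.
move=> x0 w; rewrite mulr_ge0 ?nsq_ge0 ?le_min ?ler01 ?mulr_ge0 ?sqrtr_ge0//=.
by rewrite -[leRHS]mulr1 ler_wpM2l ?nsq_ge0// ge_min lexx.
Qed.

Lemma lindeberg_integrable x : 0 <= x ->
  P.-integrable setT (EFin \o (fun w => nsq (xi w) * Num.min 1 (x * Num.sqrt (nsq (xi w))))).
Proof.
move=> x0; apply: integrable_dominated integrable_nsq => // w.
by have /andP[a b] := lind_bound x0 w; rewrite ger0_norm.
Qed.

Lemma lindeberg_le (b : cplx R) x : nsq b <= x ^+ 2 -> 0 <= x ->
  (\int[P]_w (re (b * xi w) ^+ 2 * Num.min 1 `|re (b * xi w)|)%:E <= (nsq b * lindeberg x)%:E)%E.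
Proof.
move=> bx x0; have [m1 _ _] := centered_lin b.
rewrite EFinM /lindeberg -EFin_Rintegral; last exact: lindeberg_integrable.
rewrite -ge0_integralZl//.
- apply: ge0_integral_le_EFin => [||w|w].
  + apply: measurable_funM; first exact: measurable_funX.
    by apply: measurable_minr => //; exact: measurableT_comp.
  + by apply: measurable_funM => //; exact: lind_measurable.
  + by rewrite mulr_ge0 ?sqr_ge0// le_min ler01 normr_ge0.
  + rewrite mulrA; apply: ler_pM => [|||].
    * exact: sqr_ge0.
    * by rewrite le_min ler01 normr_ge0.
    * exact: re_mul_sqr_le.
    rewrite le_min ge_min lexx/= ge_min; apply/orP; right.
    rewrite -[X in _ <= X * _](ger0_norm x0) -!sqrtr_sqr -sqrtrM ?sqr_ge0//.
    apply: ler_wsqrtr; apply: le_trans (re_mul_sqr_le _ _) _.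
    by rewrite ler_wpM2r ?nsq_ge0.
- by apply/measurable_EFinP; exact: lind_measurable.
- by move=> w _; rewrite lee_fin; case/andP: (lind_bound x0 w).
- by rewrite lee_fin nsq_ge0.
Qed.

Lemma cvg_lindeberg (x : nat -> R) : (forall n, 0 <= x n) -> x n @[n --> \oo] --> 0 ->
  lindeberg (x n) @[n --> \oo] --> 0.
Proof.
move=> x0 xcvg.
have [||||| _ _] := @dominated_convergence _ T R P setT measurableT
  (fun n w => (nsq (xi w) * Num.min 1 (x n * Num.sqrt (nsq (xi w))))%:E) (cst 0%E)
  (fun w => (nsq (xi w))%:E).
- by move=> n; apply/measurable_EFinP; exact: lind_measurable.
- exact: measurable_cst.
- apply: aeW => w _; rewrite (_ : cst 0%E w = 0%:E)//; apply/cvg_EFin; first exact: nearW.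
  rewrite /comp/=.
  have h : x n * Num.sqrt (nsq (xi w)) @[n --> \oo] --> 0.
    by rewrite -[X in _ --> X](mul0r (Num.sqrt (nsq (xi w)))); apply: cvgM => //; exact: cvg_cst.
  apply: (@squeeze_cvgr _ _ _ _ (cst 0) (fun n => nsq (xi w) * (x n * Num.sqrt (nsq (xi w))))).
  + apply: nearW => n; case/andP: (lind_bound (x0 n) w) => -> _ /=.
    by rewrite ler_wpM2l ?nsq_ge0// ge_min lexx orbT.
  + exact: cvg_cst.
  + rewrite -[X in _ --> X](mulr0 (nsq (xi w))); apply: cvgM => //; exact: cvg_cst.
- exact: integrable_nsq.
- apply: aeW => w n _; have /andP[p1 p2] := lind_bound (x0 n) w.
  by rewrite /= lee_fin ger0_norm.
by rewrite integral0 => /fine_cvg.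
Unshelve. all: by end_near. Qed.

End complex_centered.

Section tree_clt.
Context {R : realType} {d : measure_display} {T' : measurableType d}.
Local Notation tree := (tree R).
Local Notation cfg := (cfg R).
Variables (mu : probability tree R) (nu : probability cfg R).
Hypothesis mu_cyl : iid_tree_law mu nu.
Variable Y : tree -> cplx R.
Hypothesis Yc : ccentered mu Y.

Lemma ccentered_shift u : ccentered mu (Y \o shift u).
Proof.
have [mr mi] := ccentered_measurable Yc; have [_ Yfin r0 i0] := Yc.
split.
- by split; [exact: (measurableT_comp mr (measurable_shift u))|exact: (measurableT_comp mi (measurable_shift u))].
- rewrite (ge0_integral_shift mu_cyl u (F := fun w => (nsq (Y w))%:E))//.
  + by apply/measurable_EFinP; exact: (measurable_nsq Yc).
  + by move=> w; rewrite lee_fin nsq_ge0.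
- by rewrite (Rintegral_shift mu_cyl u (integrable_re Yc)).
- by rewrite (Rintegral_shift mu_cyl u (integrable_im Yc)).
Qed.

Lemma cvar_shift u : cvar mu (Y \o shift u) = cvar mu Y.
Proof. exact: (Rintegral_shift mu_cyl u (integrable_nsq Yc)). Qed.

Lemma cpvar_shift u : cpvar mu (Y \o shift u) = cpvar mu Y.
Proof.
rewrite /cpvar; congr Complex.
  exact: (Rintegral_shift mu_cyl u (integrable_re_sqr Yc)).
exact: (Rintegral_shift mu_cyl u (integrable_im_sqr Yc)).
Qed.

Lemma lin_var_shift u b : lin_var mu (Y \o shift u) b = lin_var mu Y b.
Proof. by rewrite /lin_var cvar_shift cpvar_shift. Qed.

Definition tree_sum (s : seq (seq nat)) (a : seq nat -> cplx R) w : cplx R :=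
  \sum_(u <- s) a u * Y (shift u w).

Lemma indep_sum_lin (s : seq (seq nat)) l (b : seq nat -> cplx R) :
  uniq s -> (forall u, u \in s -> size u = l) ->
  indep_sum mu (fun u w => re (b u * Y (shift u w))) s.
Proof.
move=> us sl.
apply: (indep_sum_shift mu_cyl (eta := fun u w => re (b u * Y w)) _ us sl) => u.
by case: (centered_lin Yc (b u)).
Qed.

Lemma centered_lin_shift b u : centered_L2 mu (fun w => re (b * Y (shift u w))) (lin_var mu Y b).
Proof. by rewrite -(lin_var_shift u); exact: (centered_lin (ccentered_shift u)). Qed.

Lemma measurable_tree_sum s a : cmeasurable (tree_sum s a).
Proof.
have [mr mi] : cmeasurable Y by case: Yc.
have mS u : cmeasurable (Y \o shift u).
  by split; [exact: (measurableT_comp mr (measurable_shift u))|exact: (measurableT_comp mi (measurable_shift u))].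
split.
  rewrite (_ : re \o _ = fun w => \sum_(u <- s) re (a u * Y (shift u w))).
    by apply: measurable_sum => u; case: (cmeasurable_scale (a u) (mS u)).
  by apply/funext => w; rewrite /= re_sum.
rewrite (_ : im \o _ = fun w => \sum_(u <- s) im (a u * Y (shift u w))).
  by apply: measurable_sum => u; case: (cmeasurable_scale (a u) (mS u)).
by apply/funext => w; rewrite /= im_sum.
Qed.

Lemma tree_sum_second_moment z s l a : uniq s -> (forall u, u \in s -> size u = l) ->
  (\int[mu]_w (nsq (z + tree_sum s a w))%:E =
     (nsq z + (\sum_(u <- s) nsq (a u)) * cvar mu Y)%:E)%E.
Proof.
move=> us sl; have [mre mim] := cmeasurable_add (@cmeasurable_cst R _ tree z) (measurable_tree_sum s a).
under eq_integral do rewrite EFinD.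
rewrite ge0_integralD//; last 4 first.
- by move=> w _; rewrite lee_fin sqr_ge0.
- by apply/measurable_EFinP; exact: measurable_funX.
- by move=> w _; rewrite lee_fin sqr_ge0.
- by apply/measurable_EFinP; exact: measurable_funX.
have H (c : cplx R) : (\int[mu]_w (re (c * (z + tree_sum s a w)) ^+ 2)%:E =
    (re (c * z) ^+ 2 + \sum_(u <- s) lin_var mu Y (c * a u))%:E)%E.
  have := @indep_sum_sqr _ _ _ mu _ _ _ s (fun u => lin_var mu Y (c * a u)) (re (c * z))
    (indep_sum_lin (fun u => c * a u) us sl).
  rewrite /= => <-; last by move=> u; exact: centered_lin_shift.
    apply: eq_integral => w _; rewrite mulrDr reD /tree_sum mulr_sumr [in LHS]re_sum.
    by congr ((_ ^+ 2)%:E); congr (_ + _); apply: eq_bigr => u _; rewrite mulrA.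
  by move=> u; case: (centered_lin_shift (c * a u) u).
(* Im z = Re(-i z), so both coordinates are real parts, with multipliers 1 and -i. Their squares are
   1 and -1, and the pseudo-variances cancel in the sum. *)
have H1 := H 1; have H2 := H (Complex 0 (- 1)).
have E1 w : re (z + tree_sum s a w) ^+ 2 = re (1 * (z + tree_sum s a w)) ^+ 2 by rewrite mul1r.
have E w : im (z + tree_sum s a w) ^+ 2 = re (Complex 0 (- 1) * (z + tree_sum s a w)) ^+ 2.
  by rewrite reM !cplxE; congr (_ ^+ 2); ring.
under [X in (_ + X)%E]eq_integral do rewrite E.
under [X in (X + _)%E]eq_integral do rewrite E1.
rewrite H1 H2 -EFinD addrACA -big_split/= mulr_suml; congr EFin; congr (_ + _).
  by rewrite /nsq !cplxE; ring.
apply: eq_bigr => u _.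
by rewrite mul1r /lin_var nsqM !expr2 !cplxE /nsq !cplxE; field.
Qed.

Variables (P' : probability T' R) (X1 X2 : T' -> R).
Hypotheses (mX1 : measurable_fun setT X1) (mX2 : measurable_fun setT X2).
Variable C : R.
Hypothesis X_moment : (\int[P']_w (X1 w ^+ 2 + X2 w ^+ 2)%:E <= C%:E)%E.
Variable L : cplx R -> R.
Hypothesis X_char : forall b s t : R, \int[P']_w cos (b + s * X1 w + t * X2 w) =
  expR (- (L (Complex s (- t)) / 2)) * cos b.

Variables (s : nat -> seq (seq nat)) (l : nat -> nat) (a : nat -> seq nat -> cplx R).
Hypotheses (us : forall k, uniq (s k)) (sl : forall k u, u \in s k -> size u = l k).
Hypothesis cvg_var : forall t : cplx R,
  \sum_(u <- s k) lin_var mu Y (t * a k u) @[k --> \oo] --> L t.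
Variable V : R.
Hypothesis cvg_nsq : \sum_(u <- s k) nsq (a k u) @[k --> \oo] --> V.
Variable x : nat -> R.
Hypothesis x0 : forall k, 0 <= x k.
Hypothesis xa : forall k u, u \in s k -> nsq (a k u) <= x k ^+ 2.
Hypothesis cvg_x : x k @[k --> \oo] --> 0.

Lemma tree_clt_char (b sr tr : R) :
  \int[mu]_w cos (b + sr * re (tree_sum (s k) (a k) w) + tr * im (tree_sum (s k) (a k) w))
    @[k --> \oo] --> expR (- (L (Complex sr (- tr)) / 2)) * cos b.
Proof.
(* With this sign, Re(t z) = sr Re z + tr Im z, so the joint transform of both coordinates is that
   of one real sum. *)
pose t : cplx R := Complex sr (- tr).
pose nt := Num.sqrt (nsq t).
have nt0 : 0 <= nt by exact: sqrtr_ge0.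
have nt2 : nt ^+ 2 = nsq t by rewrite sqr_sqrtr// nsq_ge0.
pose e k u := nsq (t * a k u) * lindeberg mu Y (nt * x k).
pose v k u := lin_var mu Y (t * a k u).
pose N k := \sum_(u <- s k) nsq (a k u).
have vY := cvar_ge0 mu Y.
pose err k := N k * (2 * (nsq t * lindeberg mu Y (nt * x k)) + (nsq t * cvar mu Y) ^+ 2 * x k ^+ 2).
have ntx k : 0 <= nt * x k by rewrite mulr_ge0.
have key k : `|\int[mu]_w cos (b + sr * re (tree_sum (s k) (a k) w) + tr * im (tree_sum (s k) (a k) w))
    - expR (- ((\sum_(u <- s k) v k u) / 2)) * cos b| <= err k.
  have E w : b + sr * re (tree_sum (s k) (a k) w) + tr * im (tree_sum (s k) (a k) w) =
      b + \sum_(u <- s k) re (t * a k u * Y (shift u w)).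
    rewrite -addrA; congr (_ + _); under eq_bigr do rewrite -mulrA.
    by rewrite -re_sum -mulr_sumr -/(tree_sum _ _ _) reM !cplxE; ring.
  under eq_Rintegral do rewrite E.
  apply: (@le_trans _ _ (\sum_(u <- s k) (2 * e k u + v k u ^+ 2))).
    (* [indep_sum_cos] asks for an error bound at every label. Off the list, where the weights need
       not be small, the plain variance bound is supplied; it does not enter the sum. *)
    pose e' u := if u \in s k then e k u else nsq (t * a k u) * cvar mu Y.
    rewrite [leRHS](_ : _ = \sum_(u <- s k) (2 * e' u + v k u ^+ 2)); last first.
      by apply: eq_big_seq => u us'; rewrite /e' us'.
    apply: indep_sum_cos.
    - by move=> u; case: (centered_lin_shift (t * a k u) u).
    - exact: (indep_sum_lin (fun u => t * a k u) (us k) (@sl k)).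
    - by move=> u; exact: centered_lin_shift.
    move=> u; rewrite /e'; case: ifPn => us'.
      have := @lindeberg_le _ _ _ mu _ (ccentered_shift u) (t * a k u) (nt * x k) _ (ntx k).
      rewrite (_ : lindeberg mu (Y \o shift u) _ = lindeberg mu Y (nt * x k)); last first.
        exact: (Rintegral_shift mu_cyl u (lindeberg_integrable Yc (ntx k))).
      apply; rewrite nsqM exprMn nt2 ler_wpM2l ?nsq_ge0//; exact: xa.
    have [m1 m2 _] := centered_lin_shift (t * a k u) u.
    apply: (@le_trans _ _ (\int[mu]_w (re (t * a k u * Y (shift u w)) ^+ 2)%:E)%E); last first.
      by rewrite m2 lee_fin; exact: lin_var_le.
    apply: ge0_integral_le_EFin => [||w|w].
    - apply: measurable_funM; first exact: measurable_funX.
      by apply: measurable_minr => //; exact: measurableT_comp.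
    - exact: measurable_funX.
    - by rewrite mulr_ge0 ?sqr_ge0// le_min ler01 normr_ge0.
    - by rewrite -[leRHS]mulr1 ler_wpM2l ?sqr_ge0// ge_min lexx.
  rewrite /err /N mulr_suml; rewrite [leLHS]big_seq [leRHS]big_seq.
  apply: ler_sum => u us'; rewrite mulrDr; apply: lerD.
    by rewrite /e nsqM le_eqVlt; apply/orP; left; apply/eqP; ring.
  have h1 : v k u <= nsq t * nsq (a k u) * cvar mu Y by rewrite -nsqM; exact: lin_var_le.
  have h0 : 0 <= v k u by exact: (lin_var_ge0 Yc).
  apply: (@le_trans _ _ ((nsq t * nsq (a k u) * cvar mu Y) ^+ 2)).
    by rewrite lerXn2r// ?nnegrE// (le_trans h0).
  have := xa us'; have := nsq_ge0 (a k u).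
  rewrite (_ : (nsq t * nsq (a k u) * cvar mu Y) ^+ 2 =
    nsq (a k u) * ((nsq t * cvar mu Y) ^+ 2 * nsq (a k u))); last by ring.
  by move=> ? ?; rewrite ler_wpM2l// ler_wpM2l// sqr_ge0.
have cx : nt * x k @[k --> \oo] --> 0.
  by rewrite -[X in _ --> X](mulr0 nt); apply: cvgM => //; exact: cvg_cst.
have cerr : err k @[k --> \oo] --> 0.
  have -> : 0 = V * (2 * (nsq t * 0) + (nsq t * cvar mu Y) ^+ 2 * (0 * 0)) :> R by ring.
  apply: cvgM => //; apply: cvgD.
    apply: cvgM; first exact: cvg_cst.
    apply: cvgM; first exact: cvg_cst.
    exact: cvg_lindeberg.
  apply: cvgM; first exact: cvg_cst.
  by under eq_fun do rewrite expr2; exact: cvgM.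
have cexpv : expR (- ((\sum_(u <- s k) v k u) / 2)) * cos b @[k --> \oo] --> expR (- (L t / 2)) * cos b.
  apply: cvgM; last exact: cvg_cst.
  have h : - ((\sum_(u <- s k) v k u) / 2) @[k --> \oo] --> - (L t / 2).
    by apply: cvgN; apply: cvgM; [exact: cvg_var|exact: cvg_cst].
  exact: (cvg_comp _ _ h (@continuous_expR R _)).
apply/cvgrPdist_lt => eps eps0.
move/cvgrPdist_lt : cexpv => /(_ (eps / 2) (divr_gt0 eps0 (ltr0n _ 2))) c1.
move/cvgrPdist_lt : cerr => /(_ (eps / 2) (divr_gt0 eps0 (ltr0n _ 2))) c2.
near=> k.
have e2 : `|expR (- (L t / 2)) * cos b - expR (- ((\sum_(u <- s k) v k u) / 2)) * cos b| < eps / 2.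
  by near: k.
have : `|0 - err k| < eps / 2 by near: k.
rewrite sub0r normrN => e1; move: (key k) e2.
set J := \int[mu]_w _; set A := expR _ * _ => e3 e2.
have := ler_norm (err k).
have := ler_distD A (expR (- (L t / 2)) * cos b) J.
rewrite [`|A - J|]distrC; lra.
Unshelve. all: by end_near. Qed.

Theorem tree_clt (phi : R * R -> R) : continuous phi -> bounded_mfun phi ->
  \int[mu]_w phi (re (tree_sum (s k) (a k) w), im (tree_sum (s k) (a k) w))
    @[k --> \oo] --> \int[P']_w phi (X1 w, X2 w).
Proof.
move=> cphi bphi.
(* The sums of squared weights converge, hence are bounded; this provides the uniform second moment
   that [levy_continuity] asks for. *)
have : cvg (\sum_(u <- s k) nsq (a k u) @[k --> \oo]) by apply/cvg_ex; exists V.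
move=> /cvg_seq_bounded [B [_ /(_ (B + 1))]]; rewrite ltrDl ltr01 => /(_ isT) hB.
have bN k : \sum_(u <- s k) nsq (a k u) <= B + 1.
  by apply: le_trans (hB k I); exact: ler_norm.
apply: (@levy_continuity _ _ _ _ R mu P'
  (fun k => re \o tree_sum (s k) (a k)) (fun k => im \o tree_sum (s k) (a k)) X1 X2 _ _ _ _ _
  (Num.max ((B + 1) * cvar mu Y) C)) => //.
- by move=> k; case: (measurable_tree_sum (s k) (a k)).
- by move=> k; case: (measurable_tree_sum (s k) (a k)).
- by move=> b sr tr; rewrite X_char; exact: tree_clt_char.
- move=> k; rewrite [leLHS](_ : _ = (\int[mu]_w (nsq (tree_sum (s k) (a k) w))%:E)%E)//.
  under eq_integral do rewrite -[tree_sum _ _ _]add0r.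
  rewrite (tree_sum_second_moment 0 (a k) (us k) (@sl k)) lee_fin le_max.
  rewrite [nsq 0](_ : _ = 0) ?add0r; last by rewrite /nsq !cplxE; ring.
  by rewrite ler_wpM2r// cvar_ge0.
- by apply: (le_trans X_moment); rewrite lee_fin le_max lexx orbT.
Qed.

End tree_clt.

(** * Multiplicative weights and their martingales *)

Lemma cvg_sum_seq {R : realType} (I : Type) (s : seq I) (F : nat -> I -> R) (l : I -> R) :
  (forall i, F n i @[n --> \oo] --> l i) ->
  \sum_(i <- s) F n i @[n --> \oo] --> \sum_(i <- s) l i.
Proof.
move=> Fl; elim: s => [|i s IH].
  by rewrite big_nil; under eq_fun do rewrite big_nil; exact: cvg_cst.
by rewrite big_cons; under eq_fun do rewrite big_cons; exact: cvgD.
Qed.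

Section summable.
Context {d : measure_display} {T : measurableType d} {R : realType}.
Variable P : probability T R.

Lemma summable_cvg0 (f : nat -> R) (C : R) : (forall n, 0 <= f n) ->
  (forall n, \sum_(k < n) f k <= C) -> f n @[n --> \oo] --> 0.
Proof.
move=> f0 fC; apply: cvg_series_cvg_0; apply: nondecreasing_is_cvgn.
  by apply: nondecreasing_series => n _ _; exact: f0.
by exists C => _ [n _ <-]; rewrite /series/= big_mkord.
Qed.

(** The full sum is integrable by monotone convergence, hence finite almost everywhere. It is kept
    as an integrable majorant of the partial sums for a later use of dominated convergence. *)
Lemma ae_summable (f : nat -> T -> R) (c : nat -> R) (C : R) :
  (forall n, measurable_fun setT (f n)) -> (forall n w, 0 <= f n w) ->
  (forall n, (\int[P]_w (f n w)%:E <= (c n)%:E)%E) -> (forall n, \sum_(k < n) c k <= C) ->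
  exists2 G : T -> R, P.-integrable setT (EFin \o G) &
    {ae P, forall w, forall n, \sum_(k < n) f k w <= G w}.
Proof.
move=> mf f0 fc cC.
pose S w := (\sum_(0 <= n <oo) (f n w)%:E)%E.
have mS : measurable_fun setT S.
  apply: ge0_emeasurable_sum => [k w _ _|k _]; first by rewrite lee_fin.
  exact/measurable_EFinP.
have S0 w : (0 <= S w)%E by apply: nneseries_ge0 => k _ _; rewrite lee_fin.
have iS : P.-integrable setT S.
  apply/integrableP; split => //; under eq_integral do rewrite gee0_abs//.
  rewrite integral_nneseries//; last 2 first.
  - by move=> n; exact/measurable_EFinP.
  - by move=> n w _; rewrite lee_fin.
  apply: (@le_lt_trans _ _ C%:E); last exact: ltry.
  apply: lime_le; first by apply: is_cvg_nneseries => n _ _; apply: integral_ge0 => w _; rewrite lee_fin.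
  apply: nearW => n; rewrite big_mkord; apply: le_trans (_ : \sum_(k < n) (c k)%:E <= _)%E.
    by apply: lee_sum => k _; exact: fc.
  by rewrite sumEFin lee_fin.
exists (fine \o S).
  have [|||||i _ _] := @dominated_convergence _ T R P setT measurableT (fun=> S) (EFin \o (fine \o S)) S.
  - by move=> _.
  - by apply/measurable_EFinP; exact: (measurableT_comp (fine_measurable measurableT) mS).
  - have := integrable_ae measurableT iS; apply: filterS => w /(_ I) Sw _ /=.
    by rewrite fineK//; exact: cvg_cst.
  - exact: iS.
  - by apply: aeW => w n _; rewrite gee0_abs.
  exact: i.
have := integrable_ae measurableT iS; apply: filterS => w /(_ I) Sw n.
rewrite -lee_fin /= fineK// -sumEFin /S (nneseries_split 0 n); last first.
  by move=> k _; rewrite lee_fin.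
rewrite add0n big_mkord leeDl//; apply: nneseries_ge0 => k _ _; rewrite lee_fin//.
Qed.

Lemma ae_cvg0 (f : nat -> T -> R) (c : nat -> R) (C : R) :
  (forall n, measurable_fun setT (f n)) -> (forall n w, 0 <= f n w) ->
  (forall n, (\int[P]_w (f n w)%:E <= (c n)%:E)%E) -> (forall n, \sum_(k < n) c k <= C) ->
  {ae P, forall w, f n w @[n --> \oo] --> 0}.
Proof.
move=> mf f0 fc cC; have [G _] := ae_summable mf f0 fc cC.
by apply: filterS => w; apply: summable_cvg0.
Qed.

Lemma sum_geometric (r : R) n : 0 <= r < 1 -> \sum_(k < n) r ^+ k <= (1 - r)^-1.
Proof.
move=> /andP[r0 r1]; have r10 : 0 < 1 - r by rewrite subr_gt0.
rewrite -[leRHS]mul1r ler_pdivlMr// mulrC.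
by rewrite -[1 - r]opprB mulNr -subrX1 opprB gerBl exprn_ge0.
Qed.

(** Cauchy-Schwarz with the geometric weights r^k, which turns a bound on the sums of d_k^2 / r^k
    into absolute summability of d_k. *)
Lemma weighted_cauchy_schwarz (d0 : nat -> R) (r : R) n : 0 < r < 1 ->
  (\sum_(k < n) `|d0 k|) ^+ 2 <= (1 - r)^-1 * \sum_(k < n) (d0 k ^+ 2 / r ^+ k).
Proof.
move=> /andP[r0 r1].
apply: (@le_trans _ _ ((\sum_(k < n) r ^+ k) * \sum_(k < n) (d0 k ^+ 2 / r ^+ k))); last first.
  rewrite ler_wpM2r//; last by apply: sum_geometric; rewrite ltW.
  by apply: sumr_ge0 => k _; rewrite divr_ge0 ?sqr_ge0 ?exprn_ge0// ltW.
elim: n => [|n IH]; first by rewrite !big_ord0 mul0r expr0n.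
rewrite !big_ord_recr /=.
set A := \sum_(k < n) `|_| in IH *; set B := \sum_(k < n) r ^+ k in IH *.
set D := \sum_(k < n) _ in IH *.
have A0 : 0 <= A by exact: sumr_ge0.
have B0 : 0 <= B by apply: sumr_ge0 => k _; rewrite exprn_ge0// ltW.
have rn : 0 < r ^+ n by exact: exprn_gt0.
pose t := `|d0 n| / r ^+ n.
have t0 : 0 <= t by rewrite divr_ge0// ltW.
have e1 : `|d0 n| = t * r ^+ n by rewrite divfK// gt_eqF.
have e2 : d0 n ^+ 2 / r ^+ n = t ^+ 2 * r ^+ n.
  by rewrite -[d0 n ^+ 2]real_normK ?num_real// e1; field; rewrite gt_eqF.
rewrite e1 e2; set b := r ^+ n in rn *.
have D0 : 0 <= D.
  by apply: sumr_ge0 => k _; rewrite divr_ge0 ?sqr_ge0 ?exprn_ge0// ltW.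
clearbody A B D t b.
(* The induction hypothesis A^2 <= B D says that the quadratic polynomial B t^2 - 2 A t + D is
   nonnegative; the case B = 0 forces A = 0. *)
have key : 2 * A * t <= B * t ^+ 2 + D.
  have [B00|B00] := eqVneq B 0.
    move: IH; rewrite B00 mul0r => A2; have -> : A = 0.
      by apply/eqP; rewrite -sqrf_eq0 eq_le A2 sqr_ge0.
    by rewrite mulr0 !mul0r add0r.
  have Bp : 0 < B by rewrite lt_def B00.
  have e : B * (B * t ^+ 2 + D) - B * (2 * A * t) = (B * t - A) ^+ 2 + (B * D - A ^+ 2) by ring.
  by rewrite -(ler_pM2l Bp) -subr_ge0 e addr_ge0 ?sqr_ge0// subr_ge0.
have := ler_wpM2r (ltW rn) key; nra.
Qed.

End summable.

Section multiplicative_functionals.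
Context {R : realType}.
Local Notation tree := (tree R).
Local Notation cfg := (cfg R).
Variables (mu : probability tree R) (nu : probability cfg R).
Hypothesis mu_cyl : iid_tree_law mu nu.

Lemma ae_shift (Q : tree -> Prop) : {ae mu, forall w, Q w} ->
  {ae mu, forall w, forall u, Q (shift u w)}.
Proof.
move=> [N [mN N0 NQ]]; exists (\bigcup_(u in [set: seq nat]) (shift u @^-1` N)); split.
- apply: countable_bigcup_measurable => u _; rewrite -[_ @^-1` _]setTI.
  exact: (measurable_shift u).
- pose F n := if @unpickle (seq nat) n is Some u then shift u @^-1` N else set0.
  have mF n : measurable (F n).
    by rewrite /F; case: unpickle => // u; rewrite -[_ @^-1` _]setTI; exact: (measurable_shift u).
  have F0 n : mu (F n) = 0%E.
    rewrite /F; case: unpickle => [u|]; last exact: measure0.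
    by rewrite (probability_shift mu_cyl).
  have -> : \bigcup_(u in [set: seq nat]) (shift u @^-1` N) = \bigcup_n F n.
    rewrite /F; apply/seteqP; split => [w [u _ Nu]|w [n _]].
      by exists (pickle u) => //; rewrite pickleK.
    by case: unpickle => // u Nu; exists u.
  apply/eqP; rewrite eq_le measure_ge0 andbT.
  apply: (le_trans (measure_sigma_subadditive mu mF _ (@subset_refl _ _))).
    exact: (bigcup_measurable (fun n _ => mF n)).
  by rewrite (eq_eseriesr (fun n _ => F0 n)) eseries0.
- by move=> w /= /existsNP[u] nQ; exists u => //; exact: NQ.
Qed.

Lemma shift_splice n u (w w' : tree) : size u = n ->
  shift u (splice (fun v => (size v < n)%N) (w, w')) = shift u w'.
Proof.
move=> un; apply/funext => v; rewrite /shift /splice /= size_cat un.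
by rewrite ltnNge leq_addr.
Qed.

(** A cocycle along the tree whose value at u is determined before the mark of u. The exponential
    weights are of this form, and so are their squares, squared moduli and powers, so that the
    generation sums of all of them obey one branching recursion, [gsum_add]. *)
Definition multiplicative (A : pzRingType) (x : seq nat -> tree -> A) :=
  [/\ forall w, x [::] w = 1, forall u v w, x (u ++ v) w = x u w * x v (shift u w) &
      forall u, depends_on (fun v => (size v < size u)%N) (x u)].

Definition gsum (A : pzRingType) (x : seq nat -> tree -> A) n w := \sum_(u <- gen n w) x u w.

Section ring_valued.
Variables (A : pzRingType) (x : seq nat -> tree -> A).
Hypothesis xm : multiplicative x.

Lemma gsum0 w : gsum x 0 w = 1.
Proof. by rewrite /gsum big_seq1; case: xm. Qed.

Lemma gsum_add n k w : gsum x (n + k) w = \sum_(u <- gen n w) x u w * gsum x k (shift u w).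
Proof.
rewrite /gsum sum_gen_add; apply: eq_bigr => u _; rewrite mulr_sumr.
by apply: eq_bigr => v _; case: xm.
Qed.

Lemma gsum_depends n : depends_on (fun u => (size u < n)%N) (gsum x n).
Proof.
move=> w w' ww'; rewrite /gsum (gen_depends ww'); rewrite big_seq [RHS]big_seq.
apply: eq_bigr => u /gen_size un; case: xm => _ _ /(_ u); apply => v vu.
by apply: ww'; rewrite -un.
Qed.

Lemma gsum_splice n w w' : gsum x n (splice (fun v => (size v < n)%N) (w, w')) = gsum x n w.
Proof. exact: (depends_on_splice_l _ (@gsum_depends n)). Qed.

(** The branching property at time n: individuals and weights come from the first tree, the subtrees
    below them from the independent second one. *)
Lemma sum_gen_splice n w w' (G : tree -> A) : let z := splice (fun v => (size v < n)%N) (w, w') in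
  \sum_(u <- gen n z) x u z * G (shift u z) = \sum_(u <- gen n w) x u w * G (shift u w').
Proof.
move=> z; rewrite (depends_on_splice_l (w, w') (@gen_depends _ n))/=.
rewrite big_seq [RHS]big_seq; apply: eq_bigr => u /gen_size un.
rewrite shift_splice//; congr (_ * _); case: xm => _ _ /(_ u) h.
by rewrite /z -un (depends_on_splice_l (w, w') h).
Qed.

End ring_valued.

Lemma ge0_integral_shift_sum (s : seq (seq nat)) (c : seq nat -> R) (G : tree -> R) (I : R) :
  (forall u, 0 <= c u) -> measurable_fun setT G -> (forall w, 0 <= G w) ->
  (\int[mu]_w (G w)%:E = I%:E)%E ->
  (\int[mu]_w (\sum_(u <- s) c u * G (shift u w))%:E = ((\sum_(u <- s) c u) * I)%:E)%E.
Proof.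
move=> c0 mG G0 GI; under eq_integral do rewrite -sumEFin.
have mGs u : measurable_fun setT (fun w => G (shift u w)).
  exact: (measurableT_comp mG (measurable_shift u)).
rewrite ge0_integral_sum//; last 2 first.
- by move=> u; apply/measurable_EFinP; exact: measurable_funM.
- by move=> u w _; rewrite lee_fin mulr_ge0.
rewrite mulr_suml -sumEFin; apply: eq_bigr => u _.
under eq_integral do rewrite EFinM.
rewrite ge0_integralZl//; last 3 first.
- exact/measurable_EFinP.
- by move=> w _; rewrite lee_fin.
- by rewrite lee_fin.
rewrite (ge0_integral_shift mu_cyl u (F := fun w => (G w)%:E)) ?GI//.
exact/measurable_EFinP.
Qed.

Section nonnegative.
Variable y : seq nat -> tree -> R.
Hypotheses (ym : multiplicative y) (my : forall u, measurable_fun setT (y u))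
  (y0 : forall u w, 0 <= y u w).

Lemma measurable_gsum n : measurable_fun setT (gsum y n).
Proof. exact: measurable_sum_gen. Qed.

Lemma gsum_ge0 n w : 0 <= gsum y n w.
Proof. exact: sumr_ge0. Qed.

Variable r : R.
Hypothesis y1 : (\int[mu]_w (gsum y 1 w)%:E = r%:E)%E.

Lemma expectation_gsum n : (\int[mu]_w (gsum y n w)%:E = (r ^+ n)%:E)%E.
Proof.
elim: n => [|n IH].
  by under eq_integral do rewrite (gsum0 ym); rewrite integral_probability_cst.
have mS : measurable_fun setT (fun w => (gsum y n.+1 w)%:E) by apply/measurable_EFinP; exact: measurable_gsum.
rewrite (ge0_integral_splice mu_cyl (fun v => (size v < n)%N) mS); last first.
  by move=> w; rewrite lee_fin gsum_ge0.
transitivity (\int[mu]_w (r%:E * (gsum y n w)%:E))%E.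
  apply: eq_integral => w _.
  transitivity (\int[mu]_w' (\sum_(u <- gen n w) y u w * gsum y 1 (shift u w'))%:E)%E.
    by apply: eq_integral => w' _; rewrite -addn1 (gsum_add ym) (sum_gen_splice ym).
  rewrite (@ge0_integral_shift_sum _ (y ^~ w) (gsum y 1) r)//.
  - by rewrite mulrC EFinM.
  - exact: measurable_gsum.
  - exact: gsum_ge0.
have r0 : (0 <= r%:E)%E by rewrite -y1; apply: integral_ge0 => w _; rewrite lee_fin gsum_ge0.
rewrite ge0_integralZl//; last 2 first.
- by apply/measurable_EFinP; exact: measurable_gsum.
- by move=> w _; rewrite lee_fin gsum_ge0.
by rewrite IH -EFinM exprS.
Qed.

End nonnegative.

(** The upper limit is measurable whether or not the sequence converges, so the limit variables are
    measurable everywhere and equal the limits where these exist. *)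
Definition ulim (f : nat -> tree -> R) (w : tree) : R := fine (limn_esup (fun n => (f n w)%:E)).

Lemma measurable_ulim (f : nat -> tree -> R) : (forall n, measurable_fun setT (f n)) ->
  measurable_fun setT (ulim f).
Proof.
move=> mf; apply: (measurableT_comp (fine_measurable measurableT)).
by apply: measurable_fun_limn_esup => n; exact/measurable_EFinP.
Qed.

Lemma ulimE (f : nat -> tree -> R) w (l : R) : f n w @[n --> \oo] --> l -> ulim f w = l.
Proof.
move=> fl; have h : (f n w)%:E @[n --> \oo] --> l%:E by apply: cvg_EFin; [exact: nearW|exact: fl].
by rewrite /ulim (cvg_limn_einf_sup h).2.
Qed.

Section L2_martingale.
Variable x : seq nat -> tree -> cplx R.
Hypotheses (xm : multiplicative x) (mx : forall u, cmeasurable (x u)).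
Local Notation Z := (gsum x).
Let xi w := Z 1 w - 1.
Hypothesis xic : ccentered mu xi.
Variable q : R.
Hypotheses (q0 : 0 < q) (q1 : q < 1).
Let y u w := nsq (x u w).
Hypothesis yq : (\int[mu]_w (gsum y 1 w)%:E = q%:E)%E.

Lemma multiplicative_nsq : multiplicative y.
Proof.
have [x0 xc xd] := xm; split.
- by move=> w; rewrite /y x0 /nsq !cplxE; ring.
- by move=> u v w; rewrite /y xc nsqM.
- by move=> u w w' h; rewrite /y (xd _ _ _ h).
Qed.

Let ym := multiplicative_nsq.

Lemma measurable_nsq_weight u : measurable_fun setT (y u).
Proof.
have [m1 m2] := mx u.
by rewrite /y /nsq; apply: measurable_funD; apply: measurable_funX.
Qed.

Let y0 u w : 0 <= y u w. Proof. exact: nsq_ge0. Qed.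

Lemma cmeasurable_gsum n : cmeasurable (Z n).
Proof.
split.
  rewrite (_ : _ \o _ = fun w => \sum_(u <- gen n w) re (x u w)).
    by apply: measurable_sum_gen => u; case: (mx u).
  by apply/funext => w; rewrite /= /gsum re_sum.
rewrite (_ : _ \o _ = fun w => \sum_(u <- gen n w) im (x u w)).
  by apply: measurable_sum_gen => u; case: (mx u).
by apply/funext => w; rewrite /= /gsum im_sum.
Qed.

Lemma gsum_succ_splice n w w' : Z n.+1 (splice (fun v => (size v < n)%N) (w, w')) =
  Z n w + tree_sum xi (gen n w) (x ^~ w) w'.
Proof.
rewrite -addn1 (gsum_add xm) (sum_gen_splice xm) /tree_sum.
rewrite /gsum -big_split/=; apply: eq_bigr => u _.
by rewrite /xi /gsum -[X in X + _]mulr1 -mulrDr addrC subrK.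
Qed.

Lemma second_moment_step n (z : cplx R) :
  (\int[mu]_w (nsq (Z n.+1 w - z))%:E =
   \int[mu]_w (nsq (Z n w - z) + gsum y n w * cvar mu xi)%:E)%E.
Proof.
have mS : measurable_fun setT (fun w => (nsq (Z n.+1 w - z))%:E).
  apply/measurable_EFinP; have [a b] := cmeasurable_add (cmeasurable_gsum n.+1) (@cmeasurable_cst R _ tree (- z)).
  by apply: measurable_funD; apply: measurable_funX.
rewrite (ge0_integral_splice mu_cyl (fun v => (size v < n)%N) mS); last first.
  by move=> w; rewrite lee_fin nsq_ge0.
apply: eq_integral => w _.
under eq_integral do rewrite gsum_succ_splice addrAC.
exact: (tree_sum_second_moment mu_cyl xic (Z n w - z) (x ^~ w) (gen_uniq n w) (@gen_size _ n w)).
Qed.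

Let vx := cvar mu xi.
Let vx0 : 0 <= vx. Proof. exact: cvar_ge0. Qed.

Let my n : measurable_fun setT (gsum y n).
Proof. by apply: measurable_gsum; exact: measurable_nsq_weight. Qed.

Let Ey n : (\int[mu]_w (gsum y n w)%:E = (q ^+ n)%:E)%E.
Proof. by apply: expectation_gsum => //; exact: measurable_nsq_weight. Qed.

(** Given the first n generations, the increment is a sum of independent centered terms with
    coefficients x_u, and the mean of the sum of |x_u|^2 is q^n. *)
Lemma increment_second_moment n :
  (\int[mu]_w (nsq (Z n.+1 w - Z n w))%:E = (q ^+ n * vx)%:E)%E.
Proof.
have mS : measurable_fun setT (fun w => (nsq (Z n.+1 w - Z n w))%:E).
  apply/measurable_EFinP.
  have [a b] := cmeasurable_add (cmeasurable_gsum n.+1) (cmeasurable_scale (-1) (cmeasurable_gsum n)).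
  rewrite (_ : (fun _ => _) = (fun w => nsq (Z n.+1 w + -1 * Z n w))).
    by apply: measurable_funD; apply: measurable_funX.
  by apply/funext => w; rewrite mulN1r.
rewrite (ge0_integral_splice mu_cyl (fun v => (size v < n)%N) mS); last first.
  by move=> w; rewrite lee_fin nsq_ge0.
transitivity (\int[mu]_w (vx%:E * (gsum y n w)%:E))%E.
  apply: eq_integral => w _.
  under eq_integral do rewrite gsum_succ_splice (gsum_splice xm) addrAC subrr.
  rewrite (tree_sum_second_moment mu_cyl xic 0 (x ^~ w) (gen_uniq n w) (@gen_size _ n w)).
  by rewrite nsq0 add0r -EFinM mulrC.
rewrite ge0_integralZl//; last 2 first.
- exact/measurable_EFinP.
- by move=> w _; rewrite lee_fin sumr_ge0.
by rewrite Ey -EFinM mulrC.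
Qed.

(** The center z is left free: comparing two centers later recovers the mean of the limit from
    second moments alone. *)
Lemma gsum_second_moment (z : cplx R) n :
  (\int[mu]_w (nsq (Z n w - z))%:E = (nsq (1 - z) + vx * \sum_(k < n) q ^+ k)%:E)%E.
Proof.
elim: n => [|n IH].
  rewrite big_ord0 mulr0 addr0; under eq_integral do rewrite (gsum0 xm).
  exact: integral_probability_cst.
rewrite second_moment_step; under eq_integral do rewrite EFinD EFinM.
rewrite ge0_integralD//; last 4 first.
- by move=> w _; rewrite lee_fin nsq_ge0.
- apply/measurable_EFinP; have [a b] := cmeasurable_add (cmeasurable_gsum n) (@cmeasurable_cst R _ tree (- z)).
  by apply: measurable_funD; apply: measurable_funX.
- by move=> w _; rewrite -EFinM lee_fin mulr_ge0// sumr_ge0.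
- by apply/measurable_EFinP; exact: measurable_funM.
rewrite IH ge0_integralZr//; last 2 first.
- exact/measurable_EFinP.
- by move=> w _; rewrite lee_fin sumr_ge0.
rewrite Ey -EFinM -EFinD big_ord_recr/=; congr EFin.
by rewrite mulrDr addrA [in RHS](mulrC _ (q ^+ n)).
Qed.

Definition Zinf w : cplx R := Complex (ulim (fun n w => re (Z n w)) w) (ulim (fun n w => im (Z n w)) w).

Lemma cmeasurable_Zinf : cmeasurable Zinf.
Proof.
by split; apply: measurable_ulim => n; case: (cmeasurable_gsum n).
Qed.

(** The geometric decay of the increments takes the place of a maximal inequality: it gives almost
    sure convergence and an integrable bound on sup |Z_n - 1|^2 at the same time. *)
Lemma gsum_dominated : exists2 G : tree -> R, mu.-integrable setT (EFin \o G) &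
  {ae mu, forall w, (re (Z n w) @[n --> \oo] --> re (Zinf w)) /\
    (im (Z n w) @[n --> \oo] --> im (Zinf w)) /\ forall n, nsq (Z n w - 1) <= G w}.
Proof.
(* The rate q^n is shared equally: after division by r^n the squared increments still have summable
   means r^n vx, and the factors r^n are left for Cauchy-Schwarz. *)
pose r := Num.sqrt q.
have r0 : 0 < r by rewrite sqrtr_gt0.
have r2 : r ^+ 2 = q by rewrite sqr_sqrtr// ltW.
have r1 : r < 1 by rewrite -[ltRHS](sqrtr1 R) ltr_sqrt.
have r01 : 0 < r < 1 by rewrite r0 r1.
pose f n w := nsq (Z n.+1 w - Z n w) / r ^+ n.
have rn n : 0 <= (r ^+ n)^-1 by rewrite invr_ge0 exprn_ge0// ltW.
have mf n : measurable_fun setT (f n).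
  have [a b] := cmeasurable_add (cmeasurable_gsum n.+1) (cmeasurable_scale (-1) (cmeasurable_gsum n)).
  apply: measurable_funM => //.
  rewrite (_ : (fun _ => _) = (fun w => nsq (Z n.+1 w + -1 * Z n w))).
    by apply: measurable_funD; apply: measurable_funX.
  by apply/funext => w; rewrite mulN1r.
have f0 n w : 0 <= f n w by rewrite mulr_ge0// nsq_ge0.
have fI n : (\int[mu]_w (f n w)%:E <= (r ^+ n * vx)%:E)%E.
  under eq_integral do rewrite /f EFinM.
  rewrite ge0_integralZr//; last 3 first.
  - apply/measurable_EFinP.
    have [a b] := cmeasurable_add (cmeasurable_gsum n.+1) (cmeasurable_scale (-1) (cmeasurable_gsum n)).
    rewrite (_ : (fun _ => _) = (fun w => nsq (Z n.+1 w + -1 * Z n w))).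
      by apply: measurable_funD; apply: measurable_funX.
    by apply/funext => w; rewrite mulN1r.
  - by move=> w _; rewrite lee_fin nsq_ge0.
  - by rewrite lee_fin.
  rewrite increment_second_moment -EFinM lee_fin -r2 -exprM mulnC exprM expr2.
  by rewrite le_eqVlt; apply/orP; left; apply/eqP; field; rewrite expf_neq0// gt_eqF.
have fC n : \sum_(k < n) r ^+ k * vx <= (1 - r)^-1 * vx.
  by rewrite -mulr_suml ler_wpM2r//; apply: sum_geometric; rewrite ltW.
have [G iG fG] := ae_summable mf f0 fI fC.
exists (fun w => (1 - r)^-1 * G w); first exact: integrable_scale.
move: fG; apply: filterS => w fG.
have r10 : 0 <= (1 - r)^-1 by rewrite invr_ge0 subr_ge0 ltW.
have tele (p : cplx R -> R) : (forall a b, p (a - b) = p a - p b) -> p 1 - p 1 = 0 ->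
    forall n, p (Z n w) = p 1 + \sum_(k < n) p (Z k.+1 w - Z k w).
  move=> pB _; elim=> [|n IH]; first by rewrite big_ord0 addr0 (gsum0 xm).
  by rewrite big_ord_recr/= addrA -IH pB addrCA subrr addr0.
have abs (p : cplx R -> R) : (forall z, p z ^+ 2 <= nsq z) ->
    forall n, (\sum_(k < n) `|p (Z k.+1 w - Z k w)|) ^+ 2 <= (1 - r)^-1 * G w.
  move=> pn n; apply: (le_trans (weighted_cauchy_schwarz (fun k => p (Z k.+1 w - Z k w)) n r01)).
  rewrite ler_wpM2l//; apply: le_trans (fG n); apply: ler_sum => k _.
  by rewrite ler_wpM2r.
have cv (p : cplx R -> R) : (forall a b, p (a - b) = p a - p b) -> (forall z, p z ^+ 2 <= nsq z) ->
    cvgn (fun n => p (Z n w)).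
  move=> pB pn; rewrite (_ : (fun n => _) = (fun n => p 1 + series (fun k => p (Z k.+1 w - Z k w)) n)).
    apply: is_cvgD; first exact: is_cvg_cst.
    apply: normed_cvg; apply: nondecreasing_is_cvgn.
      by apply: nondecreasing_series => n _ _; exact: normr_ge0.
    exists (1 + (1 - r)^-1 * G w) => _ [n _ <-] /=.
    rewrite /series/= big_mkord; have := abs p pn n.
    set s := \sum_(k < n) _ => s2; have : 0 <= (s - 1) ^+ 2 by exact: sqr_ge0.
    have s0 : 0 <= s by exact: sumr_ge0.
    nra.
  by apply/funext => n; rewrite (tele p pB (subrr _)) /series/= big_mkord.
split; [|split].
- by rewrite /Zinf re_Complex; have c := cv re _ re_sqr_le; rewrite (ulimE (c _)) => [|a b]; rewrite ?cplxE//; apply: c => a b; rewrite !cplxE.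
- by rewrite /Zinf im_Complex; have c := cv im _ im_sqr_le; rewrite (ulimE (c _)) => [|a b]; rewrite ?cplxE//; apply: c => a b; rewrite !cplxE.
- move=> n; have h (p : cplx R -> R) : (forall a b, p (a - b) = p a - p b) ->
      p (Z n w - 1) ^+ 2 <= (1 - r)^-1 * \sum_(k < n) (p (Z k.+1 w - Z k w) ^+ 2 / r ^+ k).
    move=> pB; apply: le_trans (weighted_cauchy_schwarz (fun k => p (Z k.+1 w - Z k w)) n r01).
    rewrite pB (tele p pB (subrr _)) addrAC subrr add0r.
    by rewrite -real_normK ?num_real// lerXn2r ?nnegrE// ?sumr_ge0// ler_norm_sum.
  rewrite /nsq; apply: le_trans (lerD (h re _) (h im _)) _; try by move=> a b; rewrite !cplxE.
  rewrite -mulrDr ler_wpM2l// -big_split/=; apply: le_trans (fG n).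
  by apply: ler_sum => k _; rewrite -mulrDl.
Qed.

Lemma Zinf_second_moment (z : cplx R) :
  (\int[mu]_w (nsq (Zinf w - z))%:E = (nsq (1 - z) + vx / (1 - q))%:E)%E.
Proof.
have [G iG GZ] := gsum_dominated.
have i2 := integrable_add (integrable_scale 2 iG) (integrable_cst mu (2 * nsq (1 - z))).
have mn f : cmeasurable f -> measurable_fun setT (fun w : tree => (nsq (f w - z))%:E).
  move=> mf; apply/measurable_EFinP.
  have [a b] := cmeasurable_add mf (@cmeasurable_cst R _ tree (- z)).
  by apply: measurable_funD; apply: measurable_funX.
have [|||||_ _] := @dominated_convergence _ _ R mu setT measurableT
  (fun n w => (nsq (Z n w - z))%:E) (fun w => (nsq (Zinf w - z))%:E)
  (EFin \o (fun w => 2 * G w + 2 * nsq (1 - z))).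
- by move=> n; apply: mn; exact: cmeasurable_gsum.
- exact: (mn _ cmeasurable_Zinf).
- move: GZ; apply: filterS => w [h1 [h2 _]] _.
  apply: cvg_EFin; first exact: nearW.
  rewrite /comp/= /nsq; under eq_fun do rewrite !cplxE.
  rewrite !cplxE; apply: cvgD; rewrite expr2; under eq_fun do rewrite expr2.
    by apply: cvgM; (apply: cvgB; [exact: h1|exact: cvg_cst]).
  by apply: cvgM; (apply: cvgB; [exact: h2|exact: cvg_cst]).
- exact: i2.
- move: GZ; apply: filterS => w [_ [_ h]] n _ /=.
  rewrite lee_fin ger0_norm ?nsq_ge0//; apply: le_trans (_ : 2 * nsq (Z n w - 1) + 2 * nsq (1 - z) <= _).
    rewrite /nsq !cplxE; set u := re (Z n w); set v := im (Z n w).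
    have := sqr_ge0 (u - 1 - (1 - re z)); have := sqr_ge0 (v - 0 - (0 - im z)); nra.
  by rewrite lerD2r ler_wpM2l.
have -> : [sequence (\int[mu]_w (nsq (Z n w - z))%:E)%E]_n =
    (fun n => (nsq (1 - z) + vx * \sum_(k < n) q ^+ k)%:E).
  by apply/funext => n /=; rewrite gsum_second_moment.
move=> h1.
have h2 : (nsq (1 - z) + vx * \sum_(k < n) q ^+ k)%:E @[n --> \oo] --> (nsq (1 - z) + vx / (1 - q))%:E.
  apply: cvg_EFin; first exact: nearW.
  apply: cvgD; first exact: cvg_cst.
  apply: cvgM; first exact: cvg_cst.
  have := @cvg_geometric_series R 1 q; rewrite ger0_norm ?(ltW q0)// => /(_ q1).
  rewrite /geometric/= div1r; apply: cvg_trans; apply: near_eq_cvg; apply: nearW => n.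
  by rewrite /series/= big_mkord; apply: eq_bigr => k _; rewrite mul1r.
by rewrite -(cvg_lim _ h1)// -(cvg_lim _ h2).
Qed.

Lemma Zinf_ccentered : ccentered mu (fun w => Zinf w - 1).
Proof.
have [mr mi] := cmeasurable_add cmeasurable_Zinf (@cmeasurable_cst R _ tree (- 1)).
have fin : (\int[mu]_w (nsq (Zinf w - 1))%:E < +oo)%E by rewrite Zinf_second_moment ltry.
have i1 : mu.-integrable setT (EFin \o (fun w => nsq (Zinf w - 1))).
  apply: ge0_integrable => //; last by move=> w; exact: nsq_ge0.
  by apply: measurable_funD; apply: measurable_funX.
have small (p : cplx R -> R) : measurable_fun setT (fun w => p (Zinf w - 1)) ->
    (forall z, p z ^+ 2 <= nsq z) -> mu.-integrable setT (EFin \o (fun w => p (Zinf w - 1))).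
  move=> mp pn; apply: integrable_dominated (integrable_add (integrable_cst mu 1) i1) => // w.
  have := pn (Zinf w - 1); set t := p _ => h.
  have := sqr_ge0 (t - 1); have := sqr_ge0 (t + 1); rewrite ler_norml; nra.
(* The mean of a coordinate is obtained by polarization from the second moments around 1 and around
   z, where z = 0 serves for the real part and z = 1 - i for the imaginary part. *)
have zero (p : cplx R -> R) (z : cplx R) : measurable_fun setT (fun w => p (Zinf w - 1)) ->
    (forall z, p z ^+ 2 <= nsq z) -> nsq (1 - z) = 1 ->
    (forall w, nsq (Zinf w - z) = nsq (Zinf w - 1) + 2 * p (Zinf w - 1) + 1) ->
    \int[mu]_w p (Zinf w - 1) = 0.
  move=> mp pn z1 E; have ip := small p mp pn; have ip2 := integrable_scale 2 ip.
  have := Zinf_second_moment z; under eq_integral do rewrite E.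
  rewrite EFin_Rintegral; last exact: (integrable_add (integrable_add i1 ip2) (integrable_cst mu 1)).
  rewrite RintegralD; [|exact: measurableT|exact: (integrable_add i1 ip2)|exact: integrable_cst].
  rewrite RintegralD; [|exact: measurableT|exact: i1|exact: ip2].
  rewrite Rintegral_probability_cst RintegralZl// => -[].
  have := Zinf_second_moment 1; rewrite EFin_Rintegral// => -[->].
  rewrite subrr nsq0 z1; lra.
split => //.
- apply: (zero re 0) => //; [exact: re_sqr_le|by rewrite subr0 nsq1|].
  by move=> w; rewrite /nsq !cplxE; ring.
- apply: (zero im (1 - Complex 0 1)) => //; [exact: im_sqr_le|by rewrite /nsq !cplxE; ring|].
  by move=> w; rewrite /nsq !cplxE; ring.
Qed.

Lemma cvar_Zinf : cvar mu (fun w => Zinf w - 1) = vx / (1 - q).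
Proof.
apply: EFin_inj; rewrite -(cvarE Zinf_ccentered) Zinf_second_moment subrr nsq0 add0r//.
Qed.

(** The branching identity [gsum_add] at time n + k is passed to the limit in k. Convergence in all
    subtrees simultaneously comes from [ae_shift], and the sum over generation n is finite. *)
Lemma Zinf_remainder : {ae mu, forall w, forall n,
  Zinf w - Z n w = tree_sum (fun w => Zinf w - 1) (gen n w) (x ^~ w) w}.
Proof.
have [G iG GZ] := gsum_dominated.
have hae := @ae_shift (fun w => (re (Z n w) @[n --> \oo] --> re (Zinf w)) /\
    (im (Z n w) @[n --> \oo] --> im (Zinf w))) _.
apply: filterS (hae _) => [w h n|]; last first.
  by move: GZ; apply: filterS => w [? [? _]].
have h0 := h [::]; rewrite (_ : shift [::] w = w) in h0; last exact/funext.
rewrite /tree_sum; under eq_bigr do rewrite mulrBr mulr1.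
rewrite sumrB -/(gsum x n w); congr (_ - _).
have shiftn (f g : nat -> R) (l l' : R) : f n @[n --> \oo] --> l -> g n @[n --> \oo] --> l' ->
    (forall k, f (n + k)%N = g k) -> l = l'.
  move=> fl gl fg; have : g k @[k --> \oo] --> l.
    have := fl; rewrite -(cvg_shiftn n) /=.
    by rewrite (_ : (fun k => f (k + n)%N) = g)//; apply/funext => k; rewrite addnC fg.
  by move=> gl'; rewrite -(cvg_lim (@Rhausdorff R) gl) -(cvg_lim (@Rhausdorff R) gl').
apply: cplxP.
  rewrite re_sum; apply: (shiftn _ _ _ _ h0.1 (@cvg_sum_seq R _ (gen n w) (fun k u => re (x u w * Z k (shift u w)))
    (fun u => re (x u w * Zinf (shift u w))) _) _) => [u|k].
    rewrite reM; under eq_fun do rewrite reM; have [h1 h2] := h u.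
    by apply: cvgB; apply: cvgM => //; exact: cvg_cst.
  by rewrite (gsum_add xm) re_sum.
rewrite im_sum; apply: (shiftn _ _ _ _ h0.2 (@cvg_sum_seq R _ (gen n w) (fun k u => im (x u w * Z k (shift u w)))
  (fun u => im (x u w * Zinf (shift u w))) _) _) => [u|k].
  rewrite imM; under eq_fun do rewrite imM; have [h1 h2] := h u.
  by apply: cvgD; apply: cvgM => //; exact: cvg_cst.
by rewrite (gsum_add xm) im_sum.
Qed.

Lemma real_weights :
  {ae mu, forall w, forall u, u \in gen 1 w -> im (x u w) = 0} ->
  {ae mu, forall w, (forall n u, u \in gen n w -> im (x u w) = 0) /\ im (Zinf w) = 0}.
Proof.
move=> /ae_shift; apply: filterS => w h.
have hx n u : u \in gen n w -> im (x u w) = 0.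
  elim: n u => [|n IH] u; first by rewrite inE => /eqP ->; case: xm => -> _ _.
  rewrite -addn1 gen_add => /flattenP[_ /mapP[v vn ->]] /mapP[v' v'1 ->].
  by have [_ -> _] := xm; rewrite imM (IH _ vn) (h v _ v'1) mulr0 mul0r addr0.
split => //; rewrite im_Complex; apply: ulimE.
rewrite (_ : (fun n => _) = (fun=> 0)); first exact: cvg_cst.
apply/funext => n; rewrite im_sum big_seq big1// => u; exact: hx.
Qed.

Lemma cpvar_Zinf : {ae mu, forall w, im (Zinf w) = 0} ->
  cpvar mu (fun w => Zinf w - 1) = toC (vx / (1 - q)).
Proof.
move=> [N [mN N0 NZ]].
have E w : ~ N w -> im (Zinf w) = 0 by move=> Nw; apply: contrapT => h; exact: Nw (NZ w h).
rewrite /cpvar -cvar_Zinf /cvar /toC; congr Complex.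
  rewrite /Rintegral; congr fine; apply: (integral_eq_off_null mN N0) => w _ /E.
  by move: (Zinf w) => z i0; rewrite /nsq !expr2 !cplxE i0; congr EFin; ring.
transitivity (\int[mu]_w (0 : R)); last by rewrite Rintegral_probability_cst.
rewrite /Rintegral; congr fine; apply: (integral_eq_off_null mN N0) => w _ /E.
by move: (Zinf w) => z i0; rewrite expr2 !cplxE i0; congr EFin; ring.
Qed.

End L2_martingale.
End multiplicative_functionals.

(** * Upcrossings and almost sure convergence of nonnegative martingales *)

Section upcrossings.
Context {R : realType}.
Variables (a b : R) (W : nat -> R).

(** The strategy that buys below a and sells above b. The value at n is decided at time n and is the
    stake over the step from n to n + 1; [upcrossed n] marks a sale at time n + 1. *)
Fixpoint holding n : bool :=
  if n is k.+1 then (if holding k then W n <= b else W n < a) else W 0 < a.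

Definition upcrossed n : R := (holding n && (b < W n.+1))%:R.

Hypotheses (a0 : 0 <= a) (ab : a < b) (W0 : forall n, 0 <= W n).

(** Every completed trade earns at least b - a. The conditional term is the gain of a trade still
    open; as W >= 0, it is at least -a, which is the only possible loss. *)
Lemma upcrossing_gain n : (b - a) * (\sum_(k < n) upcrossed k) +
    (if holding n then W n - a else 0) <= \sum_(k < n) (holding k)%:R * (W k.+1 - W k).
Proof.
elim: n => [|n IH]; first by rewrite !big_ord0 mulr0 add0r /=; case: ifPn => //; lra.
rewrite !big_ord_recr /= mulrDr /upcrossed.
set S := \sum_(k < n) _ in IH *; set G := \sum_(k < n) _ in IH *.
have := W0 n.+1.
case: (holding n) IH => /= IH; case: (leP (W n.+1) b) => h /=; case: (ltP (W n.+1) a) => h' /=; lra.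
Qed.

Lemma upcrossing_bound n : (b - a) * (\sum_(k < n) upcrossed k) + \sum_(k < n) (holding k)%:R * W k
   <= a + \sum_(k < n) (holding k)%:R * W k.+1.
Proof.
have : (b - a) * (\sum_(k < n) upcrossed k) + - a <= \sum_(k < n) (holding k)%:R * (W k.+1 - W k).
  apply: le_trans (upcrossing_gain n); rewrite lerD2l.
  by case: ifP => _; [rewrite lerBrDr addNr; exact: W0|rewrite oppr_le0].
have -> : \sum_(k < n) (holding k)%:R * (W k.+1 - W k) =
    \sum_(k < n) (holding k)%:R * W k.+1 - \sum_(k < n) (holding k)%:R * W k.
  by rewrite -sumrB; apply: eq_bigr => k _; rewrite mulrBr.
lra.
Qed.

(** If W were below a and above b infinitely often, each passage from below a to above b would
    complete one more trade, and the count would exceed C. *)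
Lemma finite_upcrossings (C : R) : (forall n, \sum_(k < n) upcrossed k <= C) ->
  (exists n0, forall n, (n0 <= n)%N -> W n <= b) \/ (exists n0, forall n, (n0 <= n)%N -> a <= W n).
Proof.
move=> UC; apply: contrapT => /not_orP[/forallNP nb /forallNP na].
have fb n : exists2 m, (n <= m)%N & b < W m.
  have /existsNP[m /not_implyP[nm /negP]] := nb n; rewrite -ltNge; by exists m.
have fa n : exists2 m, (n <= m)%N & W m < a.
  have /existsNP[m /not_implyP[nm /negP]] := na n; rewrite -ltNge; by exists m.
pose U n : R := \sum_(k < n) upcrossed k.
have US n : U n.+1 = U n + upcrossed n by rewrite /U big_ord_recr.
have u0 n : 0 <= upcrossed n by exact: ler0n.
have Uh n m : (n <= m)%N -> U n <= U m.
  by move=> /subnKC <-; elim: (m - n)%N => [|k IH]; rewrite ?addn0// addnS US (le_trans IH)// lerDl.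
have step n : exists2 m, (n <= m)%N & U n + 1 <= U m.
  have [m1 nm1 Wm1] := fa n.+1.
  have h1 : holding m1.
    case: m1 nm1 Wm1 => // k _ Wk /=; case: ifP => _ //; rewrite ltW// (lt_trans Wk)//.
  have [m2 m12 Wm2] := fb m1.
  have key k : holding (m1 + k) \/ U m1 + 1 <= U (m1 + k)%N.
    elim: k => [|k [h|h]]; first by left; rewrite addn0.
      have [Wk|Wk] := leP (W (m1 + k).+1) b; first by left; rewrite addnS /= h.
      by right; rewrite addnS US /upcrossed h Wk /= lerD2r; exact: (Uh _ _ (leq_addr _ _)).
    by right; rewrite addnS US (le_trans h)// lerDl.
  exists m2; first by rewrite (leq_trans _ m12)// ltnW.
  have := key (m2 - m1)%N; rewrite subnKC// => -[h|h]; last first.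
    by rewrite (le_trans _ h)// lerD2r Uh// ltnW.
  case: m2 m12 Wm2 h => [|k] m12 Wm2 /=.
    by move: m12 nm1; rewrite leqn0 => /eqP ->.
  case: ifP => _ h; first by move: Wm2; rewrite ltNge h.
  by have := lt_trans h ab; rewrite ltNge (ltW Wm2).
have big (k : nat) : exists n, k%:R <= U n.
  elim: k => [|k [n kn]]; first by exists 0%N; rewrite /U big_ord0.
  have [m _ h] := step n; exists m; rewrite -natr1 (le_trans _ h)// lerD2r//.
have C0 : 0 <= C by apply: le_trans (UC 0%N); rewrite big_ord0.
have [n] := big (Num.truncn C).+1; have := UC n; rewrite -/(U n) => h1 h2.
have := Num.Theory.truncnS_gt C; rewrite ltNge (le_trans h2)//.
Qed.

End upcrossings.

(** The limit is the infimum of the eventual upper bounds of W. Two rationals just below it leave,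
    by the dichotomy, only the possibility that W is eventually above the smaller one. The
    hypothesis with M excludes divergence to infinity. *)
Lemma cvg_finite_upcrossings {R : realType} (W : nat -> R) (M : R) :
  (forall n, 0 <= W n) -> (forall n, exists2 m, (n <= m)%N & W m < M) ->
  (forall p q : rat, 0 <= (ratr p : R) -> (ratr p : R) < ratr q ->
     exists C : R, forall n, \sum_(k < n) upcrossed (ratr p) (ratr q) W k <= C) ->
  cvgn W.
Proof.
move=> W0 WM up.
have dich (p q : rat) : 0 <= (ratr p : R) -> (ratr p : R) < ratr q ->
    (exists n0, forall n, (n0 <= n)%N -> W n <= ratr q) \/
    (exists n0, forall n, (n0 <= n)%N -> ratr p <= W n).
  by move=> p0 pq; have [C] := up p q p0 pq; exact: finite_upcrossings.
pose B := [set x : R | exists n0, forall n, (n0 <= n)%N -> W n <= x].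
have rat_between (u v : R) : u < v -> exists p : rat, u < ratr p < v.
  by move=> uv; have [p] := rat_in_itvoo uv; rewrite in_itv /=; exists p.
have Bnonempty : B !=set0.
  have M0 : 0 < M by have [m _] := WM 0%N; exact: le_lt_trans.
  have [p /andP[Mp pM]] := rat_between M (M + 1) ltac:(lra).
  have [q /andP[Mq _]] := rat_between (M + 1) (M + 2) ltac:(lra).
  exists (ratr q); have [||//|[n0 h]] := dich p q; [lra|lra|].
  have [m nm Wm] := WM n0; have := h m nm; lra.
have B0 : lbound B 0.
  by move=> x [n0 h]; apply: le_trans (h n0 _).
have infB : has_inf B by split => //; exists 0.
apply/cvg_ex; exists (inf B); apply/cvgrPdist_lt => e e0.
have [x [n1 h1] xe] := inf_adherent e0 infB.
have [n2 h2] : exists n2, forall n, (n2 <= n)%N -> inf B - e < W n.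
  have [neg|pos] := ltP (inf B - e) 0; first by exists 0%N => n _; exact: lt_le_trans (W0 n).
  have [p /andP[p1 p2]] := rat_between (inf B - e) (inf B - e / 2) ltac:(lra).
  have [q /andP[q1 q2]] := rat_between (inf B - e / 2) (inf B) ltac:(lra).
  have [||[n0 h]|[n0 h]] := dich p q; [lra|lra| |].
    have : inf B <= ratr q by apply: ge_inf; [exact: infB.2|exists n0].
    lra.
  by exists n0 => n nn; exact: lt_le_trans (h n nn).
near=> n.
have a1 : W n <= x by apply: h1; near: n; exact: nbhs_infty_ge.
have a2 : inf B - e < W n by apply: h2; near: n; exact: nbhs_infty_ge.
rewrite ltr_norml; lra.
Unshelve. all: by end_near. Qed.

Section nonnegative_martingale.
Context {R : realType}.
Local Notation tree := (tree R).
Local Notation cfg := (cfg R).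
Variables (mu : probability tree R) (nu : probability cfg R).
Hypothesis mu_cyl : iid_tree_law mu nu.
Variable y : seq nat -> tree -> R.
Hypotheses (ym : multiplicative y) (my : forall u, measurable_fun setT (y u))
  (y0 : forall u w, 0 <= y u w).
Hypothesis y1 : (\int[mu]_w (gsum y 1 w)%:E = 1)%E.
Local Notation W := (gsum y).

Let mW n : measurable_fun setT (W n). Proof. exact: measurable_gsum. Qed.
Let W0 n w : 0 <= W n w. Proof. exact: gsum_ge0. Qed.
Let EW n : (\int[mu]_w (W n w)%:E = 1)%E.
Proof. by rewrite (expectation_gsum mu_cyl ym my y0 y1) expr1n. Qed.

Lemma holding_depends a b n : depends_on (fun u => (size u < n)%N) (fun w => holding a b (W ^~ w) n).
Proof.
elim: n => [|n IH] w w' h /=; first by rewrite !(gsum0 ym).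
rewrite (IH w w') => [|u un]; last by apply: h; exact: ltnW.
by rewrite (gsum_depends ym h).
Qed.

Lemma measurable_holding a b n : measurable_fun setT (fun w => holding a b (W ^~ w) n).
Proof.
elim: n => [|n IH] /=; first by apply: measurable_fun_ltr.
by apply: measurable_fun_ifT => //; [exact: measurable_fun_ler|exact: measurable_fun_ltr].
Qed.

Lemma integral_martingale_step n (c : tree -> R) : measurable_fun setT c -> (forall w, 0 <= c w) ->
  depends_on (fun u => (size u < n)%N) c ->
  (\int[mu]_w (c w * W n.+1 w)%:E = \int[mu]_w (c w * W n w)%:E)%E.
Proof.
move=> mc c0 dc.
have mS : measurable_fun setT (fun w => (c w * W n.+1 w)%:E).
  by apply/measurable_EFinP; exact: measurable_funM.
rewrite (ge0_integral_splice mu_cyl (fun v => (size v < n)%N) mS); last first.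
  by move=> w; rewrite lee_fin mulr_ge0.
apply: eq_integral => w _.
transitivity (\int[mu]_w' (\sum_(u <- gen n w) (c w * y u w) * W 1 (shift u w'))%:E)%E.
  apply: eq_integral => w' _; rewrite (depends_on_splice_l _ dc)/=.
  rewrite -addn1 (gsum_add ym) (sum_gen_splice ym) mulr_sumr.
  by congr EFin; apply: eq_bigr => u _; rewrite mulrA.
rewrite (@ge0_integral_shift_sum _ _ _ mu_cyl _ (fun u => c w * y u w) (W 1) 1)//.
  by rewrite mulr1 -mulr_sumr.
by move=> u; rewrite mulr_ge0.
Qed.

(** By the martingale property the stake at time k has the same mean value at times k and k + 1, so
    [upcrossing_bound] integrates to (b - a) E U_n <= a, uniformly in n. *)
Lemma ae_finite_upcrossings a b : 0 <= a -> a < b ->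
  {ae mu, forall w, exists C : R, forall n, \sum_(k < n) upcrossed a b (W ^~ w) k <= C}.
Proof.
move=> a0 ab.
have mup k : measurable_fun setT (fun w => upcrossed a b (W ^~ w) k).
  rewrite /upcrossed.
  have -> : (fun w => (holding a b (W ^~ w) k && (b < W k.+1 w))%:R : R) =
      (fun w => if holding a b (W ^~ w) k && (b < W k.+1 w) then 1 else 0 : R).
    by apply/funext => w; case: (_ && _).
  apply: measurable_fun_ifT => //; apply: measurable_and; first exact: measurable_holding.
  exact: measurable_fun_ltr.
have mh k : measurable_fun setT (fun w => (holding a b (W ^~ w) k)%:R : R).
  have -> : (fun w => (holding a b (W ^~ w) k)%:R : R) = (fun w => if holding a b (W ^~ w) k then 1 else 0 : R).
    by apply/funext => w; case: (holding _ _ _ _).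
  by apply: measurable_fun_ifT => //; exact: measurable_holding.
have u0 k w : 0 <= upcrossed a b (W ^~ w) k by exact: ler0n.
have iup k : mu.-integrable setT (EFin \o (fun w => upcrossed a b (W ^~ w) k)).
  apply: bounded_mfun_integrable; split => //; exists 1 => w.
  by rewrite ger0_norm// /upcrossed; case: (_ && _); rewrite /= ?ler01.
have ihW k m : mu.-integrable setT (EFin \o (fun w => (holding a b (W ^~ w) k)%:R * W m w)).
  apply: (@integrable_dominated _ _ _ mu _ (W m)).
  - exact: measurable_funM.
  - by move=> w; rewrite ger0_norm ?mulr_ge0//; case: (holding _ _ _ _); rewrite /= ?mul1r ?mul0r.
  - by apply: ge0_integrable => //; rewrite EW ltry.
pose c k := \int[mu]_w upcrossed a b (W ^~ w) k.
have C n : \sum_(k < n) c k <= a / (b - a).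
  rewrite ler_pdivlMr ?subr_gt0// mulrC.
  pose h k : R := \int[mu]_w ((holding a b (W ^~ w) k)%:R * W k w).
  have hE k : \int[mu]_w ((holding a b (W ^~ w) k)%:R * W k.+1 w) = h k.
    apply: EFin_inj; rewrite /h -!EFin_Rintegral//; apply: integral_martingale_step => //.
    by move=> w w' ww'; rewrite (holding_depends a b ww').
  have sumI (f : nat -> tree -> R) : (forall k, mu.-integrable setT (EFin \o f k)) ->
      mu.-integrable setT (EFin \o (fun w => \sum_(k < n) f k w)) /\
      \int[mu]_w (\sum_(k < n) f k w) = \sum_(k < n) \int[mu]_w f k w.
    move=> fi; elim: n => [|m [IH1 IH2]].
      split; last by under eq_Rintegral do rewrite big_ord0; rewrite big_ord0 Rintegral_probability_cst.
      have -> : (fun w => \sum_(k < 0) f k w) = (fun=> 0) by apply/funext => w; rewrite big_ord0.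
      exact: integrable_cst.
    split.
      have -> : (fun w => \sum_(k < m.+1) f k w) = (fun w => \sum_(k < m) f k w + f m w).
        by apply/funext => w; rewrite big_ord_recr.
      exact: integrable_add.
    under eq_Rintegral do rewrite big_ord_recr.
    by rewrite big_ord_recr RintegralD//= IH2.
  have [iU EU] := sumI _ iup.
  have [iH EH] := sumI _ (fun k => ihW k k).
  have [iH' EH'] := sumI _ (fun k => ihW k k.+1).
  have iU' := integrable_scale (b - a) iU.
  have : \int[mu]_w ((b - a) * (\sum_(k < n) upcrossed a b (W ^~ w) k) +
      \sum_(k < n) (holding a b (W ^~ w) k)%:R * W k w) <=
      \int[mu]_w (a + \sum_(k < n) (holding a b (W ^~ w) k)%:R * W k.+1 w).
    apply: le_Rintegral => //; first exact: integrable_add.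
      exact: (integrable_add (integrable_cst mu a) iH').
    by move=> w _; exact: upcrossing_bound.
  rewrite RintegralD; [|exact: measurableT|exact: iU'|exact: iH].
  rewrite RintegralD; [|exact: measurableT|exact: integrable_cst|exact: iH'].
  rewrite RintegralZl// EU EH EH' Rintegral_probability_cst.
  by under [X in _ <= _ + X -> _]eq_bigr do rewrite hE; rewrite lerD2r.
have hc k : (\int[mu]_w (upcrossed a b (W ^~ w) k)%:E <= (c k)%:E)%E by rewrite EFin_Rintegral.
have [G _] := ae_summable mup u0 hc C.
by apply: filterS => w h; exists (G w).
Qed.

(** Fatou's lemma bounds the mean of the lower limit by 1, which excludes W_n tending to infinity, a
    case that upcrossings do not see. *)
Lemma ae_liminf_finite : {ae mu, forall w, exists M : R, forall n, exists2 m, (n <= m)%N & W m w < M}.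
Proof.
pose g w := limn_einf (fun n => (W n w)%:E).
have mg : measurable_fun setT g.
  have m : measurable_fun setT (fun w => limn_esup (fun n => - (W n w)%:E)%E).
    apply: measurable_fun_limn_esup => n.
    by apply/measurable_EFinP; exact: measurable_funN.
  exact: (measurableT_comp (@oppe_measurable R setT) m).
have gE w : g w = ereal_sup (range (einfs (fun n => (W n w)%:E))).
  by rewrite /g limn_einf_lim; apply: cvg_lim => //; exact: cvg_einfs_sup.
have g0 w : (0 <= g w)%E.
  rewrite gE; apply: (@le_trans _ _ (einfs (fun n => (W n w)%:E) 0%N)).
    by apply: le_ereal_inf_tmp => _ [m _ <-]; rewrite lee_fin.
  by apply: ereal_sup_ubound; exists 0%N.
have ig : mu.-integrable setT g.
  apply/integrableP; split => //; under eq_integral do rewrite gee0_abs//.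
  apply: le_lt_trans (fatou mu measurableT (f := fun n w => (W n w)%:E) _ _) _.
  - by move=> n; exact/measurable_EFinP.
  - by move=> n w _; rewrite lee_fin.
  - under [X in limn_einf X]eq_fun do rewrite EW.
    by rewrite (cvg_limn_einf_sup (cvg_cst 1%E)).1 ltry.
have := integrable_ae measurableT ig; apply: filterS => w /(_ I) gw.
exists (fine (g w) + 1) => n.
have : (einfs (fun n => (W n w)%:E) n < (fine (g w) + 1)%:E)%E.
  rewrite EFinD fineK//; apply: (@le_lt_trans _ _ (g w)); last by rewrite lteDl// lte01.
  by rewrite gE; apply: ereal_sup_ubound; exists n.
rewrite /einfs /= => /ereal_inf_lt[_ [m nm <-]]; rewrite lte_fin => h.
by exists m.
Qed.

Lemma ae_cvg_gsum : {ae mu, forall w, W n w @[n --> \oo] --> ulim W w}.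
Proof.
have up : {ae mu, forall w, forall p q : rat, 0 <= (ratr p : R) -> (ratr p : R) < ratr q ->
    exists C : R, forall n, \sum_(k < n) upcrossed (ratr p) (ratr q) (W ^~ w) k <= C}.
  have h (m : nat) : {ae mu, forall w, if @unpickle (rat * rat)%type m is Some pq then
      0 <= (ratr pq.1 : R) -> (ratr pq.1 : R) < ratr pq.2 ->
      exists C : R, forall n, \sum_(k < n) upcrossed (ratr pq.1) (ratr pq.2) (W ^~ w) k <= C
      else True}.
    case: unpickle => [[p q]|]; last exact: aeW.
    have [p0|p0] := leP 0 (ratr p : R); last first.
      by apply: aeW.
    have [pq|pq] := ltP (ratr p : R) (ratr q); last first.
      by apply: aeW.
    by have := ae_finite_upcrossings p0 pq; apply: filterS => w hC /= _ _.
  have := ae_foralln h; apply: filterS => w hw p q.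
  by have := hw (pickle (p, q)); rewrite pickleK.
have := ae_liminf_finite; have := up; apply: filterS2 => w hw [M hM].
have /cvg_ex[l hl] := cvg_finite_upcrossings (W0 ^~ w) hM hw.
by rewrite (ulimE hl).
Qed.

End nonnegative_martingale.

Lemma cmodM {R : realType} (a b : cplx R) : cmod (a * b) = cmod a * cmod b.
Proof. exact: ComplexField.Normc.normcM. Qed.

Lemma cmodD {R : realType} (a b : cplx R) : cmod (a + b) <= cmod a + cmod b.
Proof. exact: le_normcD. Qed.

Lemma cmodE {R : realType} (a : cplx R) : cmod a = Num.sqrt (nsq a).
Proof. by rewrite -cmod_nsq sqrtr_sqr ger0_norm// cmod_ge0. Qed.

Lemma cmod_le_re_im {R : realType} (a : cplx R) : cmod a <= `|re a| + `|im a|.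
Proof.
rewrite -(@ler_pXn2r _ 2)// ?nnegrE ?addr_ge0 ?cmod_ge0// cmod_nsq /nsq sqrrD !real_normK ?num_real//.
by rewrite -addrA lerD2l lerDr mulrn_wge0// mulr_ge0.
Qed.

Lemma measurable_cmod {R : realType} d (T : measurableType d) (f : T -> cplx R) :
  cmeasurable f -> measurable_fun setT (fun w => cmod (f w)).
Proof.
move=> [mr mi]; under eq_fun do rewrite cmodE.
apply: (measurableT_comp (continuous_measurable_fun (@sqrt_continuous R))).
by apply: measurable_funD; apply: measurable_funX.
Qed.

Lemma cvg_softabs0 {R : realType} (f : nat -> R) :
  softabs (f n) @[n --> \oo] --> 0 -> `|f n| @[n --> \oo] --> 0.
Proof.
move=> h; apply/cvgrPdist_lt => e e0.
move/cvgrPdist_lt : h => /(_ _ (softabs_gt0 e0)); apply: filterS => n.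
rewrite sub0r normrN (ger0_norm (softabs_ge0 _)) => h.
rewrite sub0r normrN normr_id ltNge; apply/negP => en; move: h; rewrite ltNge => /negP; apply.
by apply: softabs_mono => //; exact: ltW.
Qed.

Lemma cmeasurable_mul {R : realType} d (T : measurableType d) (f g : T -> cplx R) :
  cmeasurable f -> cmeasurable g -> cmeasurable (fun w => f w * g w).
Proof.
move=> [mr mi] [mr' mi']; split; rewrite /comp.
  by under eq_fun do rewrite reM; apply: measurable_funB; apply: measurable_funM.
by under eq_fun do rewrite imM; apply: measurable_funD; apply: measurable_funM.
Qed.

Lemma cmeasurable_comp {R : realType} d d' (T : measurableType d) (U : measurableType d')
  (f : T -> cplx R) (g : U -> T) :
  cmeasurable f -> measurable_fun setT g -> cmeasurable (fun w => f (g w)).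
Proof. by move=> [mr mi] mg; split; [exact: (measurableT_comp mr mg)|exact: (measurableT_comp mi mg)]. Qed.

Lemma cmeasurable_sqr {R : realType} d (T : measurableType d) (f : T -> cplx R) :
  cmeasurable f -> cmeasurable (fun w => f w ^+ 2).
Proof.
move=> mf; rewrite (_ : (fun w => _) = (fun w => f w * f w)); first exact: cmeasurable_mul.
by apply/funext => w; rewrite expr2.
Qed.

(** * Convergence to 0 in probability *)

Section vanishing.
Context {d : measure_display} {T : measurableType d} {R : realType}.
Variable P : probability T R.
Implicit Types f g : nat -> T -> R.

(** Convergence to 0 in probability for nonnegative f; the absolute value is left out, as only upper
    bounds are ever propagated. *)
Definition vanishes f := forall e t : R, 0 < e -> 0 < t ->
  \forall n \near \oo, (P [set w | (e < f n w)%R] <= t%:E)%E.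

Lemma measurable_gt (f : T -> R) (e : R) : measurable_fun setT f -> measurable [set w | (e < f w)%R].
Proof.
move=> mf; rewrite -[X in measurable X]setTI.
have -> : [set w | (e < f w)%R] = f @^-1` `]e, +oo[ by apply/seteqP; split => w /=; rewrite in_itv/= andbT.
exact: mf.
Qed.

Lemma markov_le (f : T -> R) (c e : R) : measurable_fun setT f -> (forall w, 0 <= f w) ->
  0 < e -> (\int[P]_w (f w)%:E <= c%:E)%E -> (P [set w | (e < f w)%R] <= (c / e)%:E)%E.
Proof.
move=> mf f0 e0 fc; have mA := measurable_gt e mf.
rewrite -integral_indic_probability// EFinM muleC.
rewrite -[X in (X <= _)%E]mul1e -(@divff _ e) ?gt_eqF// mulrC EFinM -muleA.
rewrite lee_pmul2l//; last by rewrite lte_fin invr_gt0.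
apply: le_trans fc; rewrite -ge0_integralZl//.
- apply: ge0_le_integral => //.
  + by move=> w _; rewrite mule_ge0// ?lee_fin// ltW.
  + by apply/measurable_EFinP; apply: measurable_funM => //; exact: measurable_indic.
  + exact/measurable_EFinP.
  + move=> w _; rewrite -EFinM lee_fin indicE; case: (boolP (w \in _)) => h /=.
      by rewrite mulr1 ltW//; move: h; rewrite inE.
    by rewrite mulr0.
- by apply/measurable_EFinP; exact: measurable_indic.
- by rewrite lee_fin ltW.
Qed.

Lemma vanishes_L1 f (c : nat -> R) : (forall n, measurable_fun setT (f n)) ->
  (forall n w, 0 <= f n w) -> (forall n, (\int[P]_w (f n w)%:E <= (c n)%:E)%E) ->
  c n @[n --> \oo] --> 0 -> vanishes f.
Proof.
move=> mf f0 fc c0 e t e0 t0.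
move/cvgrPdist_lt : c0 => /(_ (t * e) (mulr_gt0 t0 e0)); apply: filterS => n.
rewrite sub0r normrN => cn; apply: (le_trans (markov_le (mf n) (f0 n) e0 (fc n))).
by rewrite lee_fin ler_pdivrMr// (le_trans (ler_norm _))// ltW.
Qed.

Lemma ae_vanishes f : (forall n, measurable_fun setT (f n)) -> (forall n w, 0 <= f n w) ->
  {ae P, forall w, f n w @[n --> \oo] --> 0} -> vanishes f.
Proof.
move=> mf f0 fae.
have mm n : measurable_fun setT (fun w => Num.min 1 (f n w)) by exact: measurable_minr.
have m0 n w : 0 <= Num.min 1 (f n w) by rewrite le_min ler01 f0.
have [|||||_ _] := @dominated_convergence _ _ R P setT measurableT
  (fun n w => (Num.min 1 (f n w))%:E) (cst 0%E) (cst 1%E).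
- by move=> n; exact/measurable_EFinP.
- exact: measurable_cst.
- move: fae; apply: filterS => w h _; apply: (cvg_EFin (a := 0)); first exact: nearW.
  apply: (@squeeze_cvgr _ _ _ _ (cst 0) (fun n => f n w)) => //; last exact: cvg_cst.
  by apply: nearW => n; rewrite m0 ge_min lexx orbT.
- exact: integrable_cst.
- by apply: aeW => w n _; rewrite lee_fin ger0_norm// ge_min lexx.
have ib n : P.-integrable setT (EFin \o (fun w => Num.min 1 (f n w))).
  apply: bounded_mfun_integrable; split => //; exists 1 => w.
  by rewrite ger0_norm// ge_min lexx.
rewrite integral0 => h.
have c0 : (\int[P]_w Num.min 1 (f n w)) @[n --> \oo] --> 0.
  have : (\int[P]_w Num.min 1 (f n w))%:E @[n --> \oo] --> 0%:E.
    by under eq_fun do rewrite -(EFin_Rintegral (ib _)).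
  by move=> /fine_cvg.
(* The threshold must be below 1 to be seen after the truncation by min(1, f). *)
move=> e t e0 t0; pose e' := Num.min e (1 / 2).
have e'0 : 0 < e' by rewrite lt_min e0 divr_gt0.
have v := @vanishes_L1 (fun n w => Num.min 1 (f n w)) _ mm m0 _ c0 e' t e'0 t0.
apply: filterS (v _) => [n|n]; last by rewrite EFin_Rintegral.
apply: le_trans; apply: le_measure; rewrite ?inE; [exact: measurable_gt|exact: measurable_gt|].
move=> w /= ew; rewrite lt_min; apply/andP; split.
  by rewrite gt_min; apply/orP; right; lra.
by apply: le_lt_trans ew; rewrite ge_min lexx.
Qed.

Lemma vanishes_add f g : (forall n, measurable_fun setT (f n)) ->
  (forall n, measurable_fun setT (g n)) -> vanishes f -> vanishes g ->
  vanishes (fun n w => f n w + g n w).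
Proof.
move=> mf mg vf vg e t e0 t0.
have e2 : 0 < e / 2 by rewrite divr_gt0.
have t2 : 0 < t / 2 by rewrite divr_gt0.
near=> n.
have h1 : (P [set w | (e / 2 < f n w)%R] <= (t / 2)%:E)%E by near: n; exact: vf.
have h2 : (P [set w | (e / 2 < g n w)%R] <= (t / 2)%:E)%E by near: n; exact: vg.
apply: (@le_trans _ _ (P ([set w | (e / 2 < f n w)%R] `|` [set w | (e / 2 < g n w)%R]))).
  apply: le_measure; rewrite ?inE.
  - by apply: measurable_gt; exact: measurable_funD.
  - by apply: measurableU; exact: measurable_gt.
  - move=> w /= h; apply/orP; rewrite -[_ || _]negbK negb_or -!leNgt.
    by apply/negP => /andP[? ?]; move: h; rewrite ltNge => /negP; apply; lra.
apply: (le_trans (measureU2 _ _ _)); try exact: measurable_gt.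
by rewrite [t]splitr EFinD leeD.
Unshelve. all: by end_near. Qed.

Lemma vanishes_le f g : (forall n, measurable_fun setT (f n)) ->
  (forall n, measurable_fun setT (g n)) -> (forall n w, f n w <= g n w) ->
  vanishes g -> vanishes f.
Proof.
move=> mf mg fg vg e t e0 t0; apply: filterS (vg e t e0 t0) => n.
apply: le_trans; apply: le_measure; rewrite ?inE; [exact: measurable_gt|exact: measurable_gt|].
by move=> w /= h; exact: lt_le_trans h (fg n w).
Qed.

Lemma vanishes_shift f k : vanishes f -> vanishes (fun n => f (n + k)%N).
Proof.
move=> vf e t e0 t0; have [N _ hN] := vf e t e0 t0.
by exists N => // n /= nN; apply: hN; rewrite /= (leq_trans nN)// leq_addr.
Qed.

(* After k steps, the noise accumulated since time n vanishes, and the value at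
   time n, bounded in mean, has been multiplied by c^k. *)
Lemma vanishes_recursion (u v b : nat -> T -> R) (c : R) : 0 <= c -> c < 1 ->
  (forall n, measurable_fun setT (u n)) -> (forall n, measurable_fun setT (v n)) ->
  (forall n, measurable_fun setT (b n)) -> (forall n w, 0 <= b n w) ->
  (forall n w, u n w <= b n w) -> (forall n, (\int[P]_w (b n w)%:E <= 1)%E) ->
  (forall n w, u n.+1 w <= c * u n w + v n w) -> (forall n w, 0 <= v n w) ->
  vanishes v -> vanishes u.
Proof.
move=> c0 c1 mu mv mb b0 ub bI uv v0 vv.
pose s k n w := \sum_(i < k) v (n + i)%N w.
have ms k n : measurable_fun setT (s k n) by exact: measurable_sum.
have vs k : vanishes (s k).
  elim: k => [|k IH].
    move=> e t e0 t0; apply: nearW => n; rewrite (_ : [set _ | _] = set0); last first.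
      by apply/seteqP; split => // w /=; rewrite /s big_ord0 ltNge ltW.
    by rewrite measure0 lee_fin ltW.
  have := vanishes_add (ms k) (fun n => mv (n + k)%N) IH (vanishes_shift k vv).
  apply: vanishes_le => n.
  - exact: ms.
  - exact: measurable_funD.
  - by move=> w; rewrite /s big_ord_recr.
have unroll k n w : u (n + k)%N w <= c ^+ k * b n w + s k n w.
  elim: k => [|k IH]; first by rewrite addn0 expr0 mul1r /s big_ord0 addr0.
  rewrite addnS (le_trans (uv _ _))// /s big_ord_recr/= addrA lerD2r.
  apply: (le_trans (ler_wpM2l c0 IH)); rewrite mulrDr mulrA -exprS lerD2l -[leRHS]mul1r.
  by rewrite ler_wpM2r ?(ltW c1)//; exact: sumr_ge0.
move=> e t e0 t0; have e2 : 0 < e / 2 by rewrite divr_gt0.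
have t2 : 0 < t / 2 by rewrite divr_gt0.
have [k ck] : exists k, c ^+ k / (e / 2) <= t / 2.
  have : c ^+ k @[k --> \oo] --> 0 by apply: cvg_expr; rewrite ger0_norm.
  move/cvgrPdist_lt => /(_ (t / 2 * (e / 2)) (mulr_gt0 t2 e2)) [k _ /(_ k (leqnn k))].
  rewrite /= sub0r normrN ger0_norm ?exprn_ge0// => h.
  by exists k; rewrite ler_pdivrMr// ltW.
have [N _ hN] := vs k (e / 2) (t / 2) e2 t2.
exists (N + k)%N => // n /= nN.
have nk : (k <= n)%N by exact: leq_trans (leq_addl _ _) nN.
have Nn : (N <= n - k)%N by rewrite leq_subRL// addnC.
have := hN _ Nn; rewrite /= => h2.
have mcb : measurable_fun setT (fun w => c ^+ k * b (n - k)%N w) by exact: measurable_funM.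
have h1 : (P [set w | (e / 2 < c ^+ k * b (n - k)%N w)%R] <= (t / 2)%:E)%E.
  apply: le_trans (_ : (c ^+ k / (e / 2))%:E <= _)%E; last by rewrite lee_fin.
  apply: markov_le => //; first by move=> w; rewrite mulr_ge0// exprn_ge0.
  under eq_integral do rewrite EFinM; rewrite ge0_integralZl//.
  - by rewrite -[leRHS]mule1; apply: lee_pmul => //; rewrite ?lee_fin ?exprn_ge0//;
      apply: integral_ge0 => w _; rewrite lee_fin.
  - exact/measurable_EFinP.
  - by move=> w _; rewrite lee_fin.
  - by rewrite lee_fin exprn_ge0.
apply: (@le_trans _ _ (P ([set w | (e / 2 < c ^+ k * b (n - k)%N w)%R] `|` [set w | (e / 2 < s k (n - k)%N w)%R]))).
  apply: le_measure; rewrite ?inE.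
  - exact: measurable_gt.
  - by apply: measurableU; exact: measurable_gt.
  - move=> w /= h; have := unroll k (n - k)%N w; rewrite subnK// => h'.
    apply/orP; rewrite -[_ || _]negbK negb_or -!leNgt.
    by apply/negP => /andP[? ?]; move: h; rewrite ltNge => /negP; apply; lra.
apply: (le_trans (measureU2 _ _ _)); try exact: measurable_gt.
by rewrite [t]splitr EFinD leeD.
Qed.

Lemma recursion_cvg0 (u v : nat -> R) (c : R) : 0 <= c -> c < 1 ->
  (forall n, 0 <= u n) -> (forall n, u n.+1 <= c * u n + v n) ->
  v n @[n --> \oo] --> 0 -> u n @[n --> \oo] --> 0.
Proof.
move=> c0 c1 u0 uv v0; apply/cvgrPdist_lt => e e0.
have c10 : 0 < 1 - c by rewrite subr_gt0.
(* The fixed point of u -> c u + e1 is e/2, so noise below e1 keeps the accumulated part below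
   e/2. *)
pose e1 := e * (1 - c) / 2.
have e10 : 0 < e1 by rewrite !mulr_gt0.
move/cvgrPdist_lt : v0 => /(_ e1 e10) [N _ hN].
have bound k : u (N + k)%N <= c ^+ k * u N + e / 2.
  elim: k => [|k IH]; first by rewrite addn0 expr0 mul1r lerDl ltW// divr_gt0.
  rewrite addnS (le_trans (uv _))//.
  have := hN (N + k)%N (leq_addr _ _); rewrite /= sub0r normrN => /ltW/(le_trans (ler_norm _)) vN.
  have := ler_wpM2l c0 IH; rewrite exprS -mulrA.
  move: vN; rewrite /e1; set z := c ^+ k * u N => vN; nra.
have : c ^+ k * u N @[k --> \oo] --> 0.
  rewrite -[X in _ --> X](mul0r (u N)); apply: cvgM; last exact: cvg_cst.
  by apply: cvg_expr; rewrite ger0_norm.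
move/cvgrPdist_lt => /(_ (e / 2) (divr_gt0 e0 (ltr0n _ 2))) [K _ hK].
exists (N + K)%N => // n /= nNK; rewrite sub0r normrN ger0_norm//.
have Nn : (N <= n)%N by exact: leq_trans (leq_addr _ _) nNK.
have Kn : (K <= n - N)%N by rewrite leq_subRL.
have := bound (n - N)%N; rewrite subnKC// => h.
have := hK _ Kn; rewrite /= sub0r normrN => /(le_lt_trans (ler_norm _)); lra.
Qed.

End vanishing.

Section ae_zero.
Context {d : measure_display} {T : measurableType d} {R : realType}.
Variable P : probability T R.

Lemma ae_ge0_eq0 (G : T -> R) : P.-integrable setT (EFin \o G) -> \int[P]_w G w = 0 ->
  {ae P, forall w, 0 <= G w} -> {ae P, forall w, G w = 0}.
Proof.
move=> iG G0 [N [mN N0 NG]].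
have mG : measurable_fun setT (EFin \o G) by case/integrableP: iG.
have H : (\int[P]_w `|(EFin \o G) w| = 0)%E.
  transitivity (\int[P]_w (G w)%:E)%E; last by rewrite EFin_Rintegral// G0.
  apply: (integral_eq_off_null mN N0) => w _ Nw /=.
  by rewrite ger0_norm//; apply: contrapT => h; exact: Nw (NG w h).
have := (ae_eq_integral_abs P measurableT mG).1 H.
by apply: filterS => w /(_ I) [].
Qed.

End ae_zero.

(** * Negligibility of the weights *)

Lemma multiplicative_powR {R : realType} (y : seq nat -> tree R -> R) : multiplicative y ->
  (forall u w, 0 <= y u w) -> forall p, multiplicative (fun u w => y u w `^ p).
Proof.
move=> [a b c] y0 p; split.
- by move=> w; rewrite a powR1.
- by move=> u v w; rewrite b powRM.
- by move=> u w w' h; rewrite (c u w w' h).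
Qed.

Section small_weights.
Context {R : realType}.
Local Notation tree := (tree R).
Local Notation cfg := (cfg R).
Variables (mu : probability tree R) (nu : probability cfg R).
Hypothesis mu_cyl : iid_tree_law mu nu.

Section splice_set.
Variables (p : pred (seq nat)) (S : set tree).
Hypothesis mS : measurable S.

Let splice_indic w : (\int[mu]_w' (\1_S (splice p (w, w')) : R)%:E)%E =
  mu [set w' | S (splice p (w, w'))].
Proof.
rewrite -integral_indic_probability.
  by apply: eq_integral => w' _; congr (_%:E); rewrite !indicE; congr (_%:R);
    apply/idP/idP; rewrite !inE.
have m : measurable_fun setT (fun w' => splice p (w, w') : tree).
  by apply: (measurableT_comp (measurable_splice p)); exact: measurable_fun_pair.
by rewrite -[X in measurable X]setTI; exact: m.
Qed.

Let mindic : measurable_fun setT (fun w : tree => (\1_S w : R)%:E).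
Proof. by apply/measurable_EFinP; exact: measurable_indic. Qed.

Let indic0 w : (0 <= (\1_S w : R)%:E)%E.
Proof. by rewrite lee_fin indicE; case: (_ \in _). Qed.

Lemma probability_splice : (mu S = \int[mu]_w mu [set w' | S (splice p (w, w'))])%E.
Proof.
rewrite -(integral_indic_probability mu mS).
rewrite (ge0_integral_splice mu_cyl p mindic indic0).
by apply: eq_integral => w _; exact: splice_indic.
Qed.

Lemma measurable_probability_splice : measurable_fun setT (fun w => mu [set w' | S (splice p (w, w'))]).
Proof.
have := measurable_integral_splice mu p mindic indic0.
by apply: eq_measurable_fun => w _; exact: splice_indic.
Qed.

End splice_set.

Variable y : seq nat -> tree -> R.
Hypotheses (ym : multiplicative y) (my : forall u, measurable_fun setT (y u))
  (ypos : forall u w, 0 < y u w).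
Hypothesis y1 : (\int[mu]_w (gsum y 1 w)%:E = 1)%E.
Hypothesis supercritical_tree : (1 < \int[mu]_w ((size (gen 1 w))%:R : R)%:E)%E.
Local Notation W := (gsum y).

Let y0 u w : 0 <= y u w. Proof. exact: ltW. Qed.
Let mW n : measurable_fun setT (W n). Proof. exact: measurable_gsum. Qed.
Let W0 n w : 0 <= W n w. Proof. exact: gsum_ge0. Qed.
Let EW n : (\int[mu]_w (W n w)%:E = 1)%E.
Proof. by rewrite (expectation_gsum mu_cyl ym my y0 y1) expr1n. Qed.
Let iW n : mu.-integrable setT (EFin \o W n).
Proof. by apply: ge0_integrable => //; rewrite EW ltry. Qed.
Let RW n : \int[mu]_w W n w = 1.
Proof. by apply: EFin_inj; rewrite -EFin_Rintegral. Qed.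

Let y2 u w := y u w ^+ 2.

Lemma multiplicative_sqr : multiplicative y2.
Proof.
have [a b c] := ym; split.
- by move=> w; rewrite /y2 a expr1n.
- by move=> u v w; rewrite /y2 b exprMn.
- by move=> u w w' h; rewrite /y2 (c u w w' h).
Qed.

Let my2 u : measurable_fun setT (y2 u). Proof. exact: measurable_funX. Qed.
Let y20 u w : 0 <= y2 u w. Proof. exact: sqr_ge0. Qed.

Lemma weight_le_gsum n w u : u \in gen n w -> y u w <= W n w.
Proof. by move=> un; rewrite /gsum (big_rem u un)/= lerDl sumr_ge0. Qed.

Lemma gsum_sqr_le n w (c : R) : (forall u, u \in gen n w -> y u w <= c) -> gsum y2 n w <= c * W n w.
Proof.
move=> h; rewrite /gsum mulr_sumr big_seq [leRHS]big_seq; apply: ler_sum => u un.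
by rewrite /y2 expr2 ler_wpM2r// h.
Qed.

Section degenerate.
Hypothesis deg : {ae mu, forall w, W 1 w = 1}.

(** When the weights of the first generation sum to 1, each is at most 1 and the sum of squares is
    at most 1. Mean 1 would force all weights to be 1, hence exactly one child almost surely,
    against supercriticality. *)
Lemma degenerate_sqr_lt1 : exists2 r : R, 0 <= r < 1 & (\int[mu]_w (gsum y2 1 w)%:E = r%:E)%E.
Proof.
have [N [mN N0 NW]] := deg.
have W1 w : ~ N w -> W 1 w = 1 by move=> Nw; apply: contrapT => h; exact: Nw (NW w h).
have T1 w : ~ N w -> gsum y2 1 w <= 1.
  move=> /W1 w1; rewrite -[leRHS]mulr1 -{2}w1; apply: gsum_sqr_le => u.
  by move=> /weight_le_gsum; rewrite w1.
have mT : measurable_fun setT (gsum y2 1) by exact: measurable_gsum.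
have T0 w : 0 <= gsum y2 1 w by exact: gsum_ge0.
have IT : (\int[mu]_w (gsum y2 1 w)%:E <= 1)%E.
  rewrite -y1 (integral_eq_off_null mN N0 (g := fun w => (Num.min (gsum y2 1 w) (W 1 w))%:E)).
    apply: ge0_integral_le_EFin => // [|w|w].
    - exact: measurable_minr.
    - by rewrite le_min T0 W0.
    - by rewrite ge_min lexx orbT.
  by move=> w _ Nw; rewrite (W1 _ Nw) (min_idPl _)// T1.
have iT : mu.-integrable setT (EFin \o gsum y2 1).
  by apply: ge0_integrable => //; apply: le_lt_trans IT _; rewrite ltry.
exists (\int[mu]_w gsum y2 1 w); last by rewrite EFin_Rintegral.
apply/andP; split; first by apply: Rintegral_ge0.
rewrite lt_neqAle; apply/andP; split; last by rewrite -lee_fin -EFin_Rintegral.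
apply/negP => /eqP RT.
have iG := integrable_sub (iW 1) iT.
have G0 : \int[mu]_w (W 1 w - gsum y2 1 w) = 0 by rewrite RintegralB// RW RT subrr.
have Gae : {ae mu, forall w, 0 <= W 1 w - gsum y2 1 w}.
  by move: deg => [N' [mN' N0' NW']]; exists N; split => // w /=; apply: contra_notP => /[dup] Nw /W1 ->; rewrite subr_ge0 T1.
have := ae_ge0_eq0 iG G0 Gae.
have size1 : {ae mu, forall w, W 1 w - gsum y2 1 w = 0} -> {ae mu, forall w, (size (gen 1 w))%:R = 1 :> R}.
  move=> h; move: h deg; apply: filterS2 => w.
  move=> /eqP + w1; rewrite {1}/gsum {1}/gsum -sumrB => h; transitivity (W 1 w) => //.
  have y01 u : u \in gen 1 w -> 0 <= y u w - y2 u w.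
    move=> /weight_le_gsum; rewrite w1 => yu.
    by rewrite /y2 expr2 -{1}[y u w]mulr1 -mulrBr mulr_ge0// subr_ge0.
  move: h; rewrite big_seq psumr_eq0// => /allP h.
  rewrite (_ : (size (gen 1 w))%:R = \sum_(u <- gen 1 w) 1); last first.
    by rewrite big_const_seq count_predT -Monoid.iteropE/= -mulr_natr mul1r.
  rewrite /gsum big_seq [RHS]big_seq; apply: eq_bigr => u un.
  have := h u un; rewrite un implyTb /y2 expr2 -{1}[y u w]mulr1 -mulrBr mulf_eq0 gt_eqF//=.
  by rewrite subr_eq0 => /eqP.
move=> /size1 [N' [mN' N0' NS]].
move: supercritical_tree; rewrite (integral_eq_off_null mN' N0' (g := cst 1%E)).
  by rewrite integral_probability_cst ltxx.
by move=> w _ Nw /=; congr EFin; apply: contrapT => h; exact: Nw (NS w h).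
Qed.

Lemma degenerate_vanishes : vanishes mu (gsum y2).
Proof.
have [r /andP[r0 r1] Er] := degenerate_sqr_lt1.
apply: (@vanishes_L1 _ _ _ mu _ (fun n => r ^+ n)).
- by move=> n; exact: measurable_gsum.
- by move=> n w; exact: gsum_ge0.
- by move=> n; rewrite (expectation_gsum mu_cyl multiplicative_sqr my2 y20 Er).
- by apply: cvg_expr; rewrite ger0_norm.
Qed.

End degenerate.

Section nondegenerate.
Hypothesis nondeg : ~ {ae mu, forall w, W 1 w = 1}.

(** W_1 has mean 1 and is not constant, so it exceeds 1 and stays below some 1 - s, each with
    positive probability. The product is the probability that two independent copies do so
    respectively. *)
Lemma nondegenerate_spread : exists s k : R, [/\ 0 < s, 0 < k &
  (mu [set w | (1 < W 1 w)%R] * mu [set w | (W 1 w < 1 - s)%R] = k%:E)%E].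
Proof.
have mlt c : measurable [set w | (W 1 w < c)%R].
  rewrite -[X in measurable X]setTI.
  have -> : [set w | (W 1 w < c)%R] = W 1 @^-1` `]-oo, c[.
    by apply/seteqP; split => w /=; rewrite in_itv.
  exact: mW.
have pA : mu [set w | (1 < W 1 w)%R] <> 0%E.
  move=> h; apply: nondeg.
  have iG := integrable_sub (integrable_cst mu 1) (iW 1).
  have G0 : \int[mu]_w (1 - W 1 w) = 0.
    rewrite RintegralB//; last exact: integrable_cst.
    by rewrite RW Rintegral_probability_cst subrr.
  have Gae : {ae mu, forall w, 0 <= 1 - W 1 w}.
    exists [set w | (1 < W 1 w)%R]; split => //; first exact: measurable_gt.
    by move=> w /= /negP; rewrite subr_ge0 -ltNge.
  by have := ae_ge0_eq0 iG G0 Gae; apply: filterS => w /eqP; rewrite subr_eq0 => /eqP.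
have [s s0 pB] : exists2 s : R, 0 < s & mu [set w | (W 1 w < 1 - s)%R] <> 0%E.
  apply: contrapT => h; apply: nondeg.
  have iG := integrable_sub (iW 1) (integrable_cst mu 1).
  have G0 : \int[mu]_w (W 1 w - 1) = 0.
    rewrite RintegralB//; last exact: integrable_cst.
    by rewrite RW Rintegral_probability_cst subrr.
  have Gae : {ae mu, forall w, 0 <= W 1 w - 1}.
    have hn (n : nat) : {ae mu, forall w, 1 - n.+1%:R^-1 <= W 1 w}.
      exists [set w | (W 1 w < 1 - n.+1%:R^-1)%R]; split => //.
        by apply: contrapT => h'; apply: h; exists n.+1%:R^-1.
      by move=> w /= /negP; rewrite -ltNge.
    have := ae_foralln hn; apply: filterS => w hw; rewrite subr_ge0.
    rewrite leNgt; apply/negP => w1; pose e := 1 - W 1 w.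
    have e0 : 0 < e by rewrite subr_gt0.
    have := hw (Num.truncn e^-1); apply/negP; rewrite -ltNge ltrBrDl -ltrBrDr -/e.
    by rewrite -[ltRHS]invrK ltf_pV2 ?posrE ?invr_gt0// Num.Theory.truncnS_gt.
  by have := ae_ge0_eq0 iG G0 Gae; apply: filterS => w /eqP; rewrite subr_eq0 => /eqP.
exists s, (fine (mu [set w | (1 < W 1 w)%R]) * fine (mu [set w | (W 1 w < 1 - s)%R])); split => //.
- apply: mulr_gt0; apply: fine_gt0; apply/andP; split.
  + by rewrite lt0e measure_ge0 andbT; apply/eqP.
  + by rewrite (le_lt_trans (probability_le1 mu _)) ?ltry//; exact: measurable_gt.
  + by rewrite lt0e measure_ge0 andbT; apply/eqP.
  + by rewrite (le_lt_trans (probability_le1 mu _)) ?ltry.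
- rewrite EFinM !fineK//; by rewrite fin_num_measure//; exact: measurable_gt.
Qed.

(** All subtrees are frozen except the one below an individual of weight > delta. Two independent
    copies of its contribution differ by more than delta s with the probability of the preceding
    lemma, so anticoncentration applies with c = delta s / 2. The probability k depends neither on
    delta nor on n. *)
Lemma large_weight_spread : exists2 k : R, 0 < k & forall delta : R, 0 < delta ->
  exists2 c : R, 0 < c & forall n w, has (fun u => delta < y u w) (gen n w) ->
  (k%:E <= mu [set w' | (c < `|\sum_(u <- gen n w) y u w * W 1 (shift u w') - W n w|)%R])%E.
Proof.
have [s [k [s0 k0 kE]]] := nondegenerate_spread.
exists (k / 2); first by rewrite divr_gt0.
move=> delta delta0; exists (delta * s / 2); first by rewrite !mulr_gt0.
move=> n w /hasP[u0 u0n yu0].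
pose X w' := y u0 w * W 1 (shift u0 w').
pose Y w' := \sum_(u <- rem u0 (gen n w)) y u w * W 1 (shift u w') - W n w.
have mS u : measurable_fun setT (fun w' => y u w * W 1 (shift u w')).
  by apply: measurable_funM => //; exact: (measurableT_comp (mW 1) (measurable_shift u)).
have mX : measurable_fun setT X by exact: mS.
have mY : measurable_fun setT Y by apply: measurable_funB => //; exact: measurable_sum.
have XY : indep2 mu X Y.
  apply: (depends_on_indep2 mu_cyl (p := prefix u0) mX mY).
    move=> a b ab; rewrite /X; congr (_ * _).
    exact: (depends_on_shift (W 1) ab).
  move=> a b ab; rewrite /Y; congr (_ - _); rewrite big_seq [RHS]big_seq.
  apply: eq_bigr => u ur; congr (_ * _).
  have un : u \in gen n w by exact: mem_rem ur.
  have uu0 : u != u0 by move: ur; rewrite mem_rem_uniq ?gen_uniq// inE => /andP[].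
  apply: (depends_on_shift (W 1)) => v uv; apply: ab; rewrite /=.
  apply/negP => u0v; move: uu0; apply/negP/negPn/eqP.
  move: uv u0v; rewrite !prefixE (gen_size un) (gen_size u0n) => /eqP <- /eqP <- //.
have -> : [set w' | (delta * s / 2 < `|\sum_(u <- gen n w) y u w * W 1 (shift u w') - W n w|)%R] =
    [set w' | (delta * s / 2 < `|X w' + Y w'|)%R].
  apply/seteqP; split => w' /=; rewrite /X /Y addrA (big_rem u0 u0n)//.
apply: (indep2_anticoncentration mX mY XY).
have mA := measurable_gt 1 (mW 1).
have mB : measurable [set w | (W 1 w < 1 - s)%R].
  rewrite -[X in measurable X]setTI.
  have -> : [set w | (W 1 w < 1 - s)%R] = W 1 @^-1` `]-oo, 1 - s[.
    by apply/seteqP; split => w0 /=; rewrite in_itv.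
  exact: mW.
have mA' : measurable (shift u0 @^-1` [set w | (1 < W 1 w)%R] : set tree).
  by rewrite -[X in measurable X]setTI; exact: measurable_shift.
have mB' : measurable (shift u0 @^-1` [set w | (W 1 w < 1 - s)%R] : set tree).
  by rewrite -[X in measurable X]setTI; exact: measurable_shift.
rewrite -kE -(probability_shift mu_cyl u0 mA) -(probability_shift mu_cyl u0 mB).
rewrite -product_measure1E//; apply: le_measure; rewrite ?inE.
- exact: measurableX.
- have m2 : measurable_fun setT (fun z : tree * tree => `|X z.1 - X z.2|).
    apply: measurableT_comp => //; apply: measurable_funB.
      exact: (measurableT_comp mX measurable_fst).
    exact: (measurableT_comp mX measurable_snd).
  exact: (measurable_gt _ m2).
- move=> [w1 w2] [/= h1 h2]; rewrite /X -mulrBr normrM (gtr0_norm (ypos _ _)).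
  rewrite mulrC divfK// ; apply: (@lt_le_trans _ _ (y u0 w * s)).
    by rewrite ltr_pM2r.
  rewrite ler_wpM2l// (le_trans _ (ler_norm _))//; lra.
Qed.

Definition large_weight (delta : R) n : set tree :=
  [set w | has (fun u => delta < y u w) (gen n w)].

Lemma measurable_large_weight (delta : R) n : measurable (large_weight delta n).
Proof.
pose f u w : R := if delta < y u w then 1 else 0.
have -> : large_weight delta n = [set w | (0 < gsum f n w)%R].
  apply/seteqP; split => w; rewrite /large_weight /= /gsum.
    move=> /hasP[u un h]; rewrite (big_rem u un)/= {1}/f h ltr_pwDl//.
    by apply: sumr_ge0 => v _; rewrite /f; case: ifP.
  rewrite lt_neqAle => /andP[h _]; apply: contraT => /hasPn hn.
  move: h; rewrite big_seq big1 ?eqxx// => u /hn; by rewrite /f; case: ifP.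
apply: measurable_gt; apply: measurable_sum_gen => u.
by apply: measurable_fun_ifT => //; exact: measurable_fun_ltr.
Qed.

(** Given a large weight at time n, the increment W_(n+1) - W_n exceeds c with conditional
    probability at least k; but these increments tend to 0 because the nonnegative martingale W_n
    converges. *)
Lemma large_weight_vanishes (delta t : R) : 0 < delta -> 0 < t ->
  \forall n \near \oo, (mu (large_weight delta n) <= t%:E)%E.
Proof.
move=> delta0 t0; have [k k0 /(_ delta delta0) [c c0 h]] := large_weight_spread.
have mD n : measurable_fun setT (fun w => `|W n.+1 w - W n w|).
  by apply: measurableT_comp => //; exact: measurable_funB.
have v : vanishes mu (fun n w => `|W n.+1 w - W n w|).
  apply: ae_vanishes => //; have := ae_cvg_gsum mu_cyl ym my y0 y1; apply: filterS => w hw.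
  rewrite -(normr0 R); apply: cvg_norm; rewrite -(subrr (ulim W w)); apply: cvgB => //.
  by have := hw; rewrite -(cvg_shiftS (W ^~ w)).
have tk : 0 < t * k by exact: mulr_gt0.
apply: filterS (v c (t * k) c0 tk) => n hn.
have mE := measurable_large_weight delta n.
rewrite -(lee_pmul2l _ (_ : (0 < k%:E)%E))//; rewrite -EFinM mulrC.
apply: le_trans hn; rewrite (probability_splice (fun v => (size v < n)%N) (measurable_gt c (mD n))).
rewrite -integral_indic_probability// -ge0_integralZl//; last 2 first.
- by apply/measurable_EFinP; exact: measurable_indic.
- by rewrite lee_fin ltW.
have mS := measurable_gt c (mD n).
apply: ge0_le_integral => //.
- by move=> w _; rewrite mule_ge0// lee_fin// ltW.
- apply/measurable_EFinP; apply: measurable_funM => //; exact: measurable_indic.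
- exact: (measurable_probability_splice (fun v => (size v < n)%N) mS).
move=> w _; rewrite -EFinM indicE; case: (boolP (w \in _)) => [|_]; last by rewrite mulr0.
rewrite inE mulr1 => /(h n w) hk; apply: (le_trans hk).
rewrite le_eqVlt; apply/orP; left; apply/eqP; congr (mu _).
apply/seteqP; split => w' /=; rewrite -[n.+1]addn1 (gsum_add ym) (sum_gen_splice ym) (gsum_splice ym)//.
Qed.

Lemma nondegenerate_vanishes : vanishes mu (gsum y2).
Proof.
(* With all weights at most delta, the sum of squares is at most delta W_n, which exceeds e with
   probability at most delta / e = t / 2 by Markov. *)
move=> e t e0 t0; pose delta := t / 2 * e.
have t2 : 0 < t / 2 by rewrite divr_gt0.
have delta0 : 0 < delta by rewrite mulr_gt0.
apply: filterS (large_weight_vanishes delta0 t2) => n hn.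
have mE := measurable_large_weight delta n.
have md : measurable_fun setT (fun w => delta * W n w) by exact: measurable_funM.
apply: (@le_trans _ _ (mu (large_weight delta n `|`
    [set w | (e < delta * W n w)%R]))).
  apply: le_measure; rewrite ?inE.
  - by apply: measurable_gt; exact: measurable_gsum.
  - by apply: measurableU => //; exact: measurable_gt.
  - move=> w /= ew; have [|/hasPn h] := boolP (has (fun u => delta < y u w) (gen n w)); first by left.
    right; apply: lt_le_trans ew _; apply: gsum_sqr_le => u /h; by rewrite -leNgt.
apply: (le_trans (measureU2 _ _ _)) => //; first exact: measurable_gt.
rewrite [t]splitr EFinD leeD//.
have -> : t / 2 = delta / e by rewrite mulfK// gt_eqF.
apply: markov_le => //; first by move=> w; rewrite mulr_ge0// ltW.
under eq_integral do rewrite EFinM; rewrite ge0_integralZl//.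
- by rewrite EW mule1.
- exact/measurable_EFinP.
- by move=> w _; rewrite lee_fin.
- by rewrite lee_fin ltW.
Qed.

End nondegenerate.

Theorem weights_vanish : vanishes mu (gsum y2).
Proof.
have [|] := pselect {ae mu, forall w, W 1 w = 1}; first exact: degenerate_vanishes.
exact: nondegenerate_vanishes.
Qed.

(** The sums of p-th powers have means r^n with r < 1, so they tend to 0 almost surely. All weights
    are then eventually at most 1, and p <= 2 bounds squares by p-th powers. *)
Theorem weights_cvg0 (p : R) : 1 < p <= 2 ->
  (\int[mu]_w (gsum (fun u w => y u w `^ p) 1 w)%:E < 1)%E ->
  {ae mu, forall w, gsum y2 n w @[n --> \oo] --> 0}.
Proof.
move=> /andP[p1 p2] Ep; pose yp u w := y u w `^ p.
have ypm : multiplicative yp := multiplicative_powR ym y0 p.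
have myp u : measurable_fun setT (yp u).
  exact: (measurableT_comp (measurable_powR p) (my u)).
have yp0 u w : 0 <= yp u w by exact: powR_ge0.
have Ip0 : (0 <= \int[mu]_w (gsum yp 1 w)%:E)%E.
  by apply: integral_ge0 => w _; rewrite lee_fin; exact: gsum_ge0.
pose r := fine (\int[mu]_w (gsum yp 1 w)%:E).
have rE : (\int[mu]_w (gsum yp 1 w)%:E = r%:E)%E.
  by rewrite fineK// ge0_fin_numE// (lt_trans Ep)// ltry.
have r0 : 0 <= r by rewrite -lee_fin -rE.
have r1 : r < 1 by rewrite -lte_fin -rE.
have : {ae mu, forall w, gsum yp n w @[n --> \oo] --> 0}.
  apply: (@ae_cvg0 _ _ _ mu _ (fun n => r ^+ n) (1 - r)^-1).
  - by move=> n; exact: measurable_gsum.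
  - by move=> n w; exact: gsum_ge0.
  - by move=> n; rewrite (expectation_gsum mu_cyl ypm myp yp0 rE).
  - by move=> n; apply: sum_geometric; rewrite r0 r1.
apply: filterS => w hw.
apply: (@squeeze_cvgr _ _ _ _ (cst 0) (fun n => gsum yp n w)); [|exact: cvg_cst|exact: hw].
have : \forall n \near \oo, gsum yp n w <= 1.
  move/cvgrPdist_le : hw => /(_ 1 ltr01); apply: filterS => n.
  by rewrite sub0r normrN; exact: le_trans (ler_norm _).
apply: filterS => n hn; rewrite /= gsum_ge0//=.
rewrite /gsum big_seq [leRHS]big_seq; apply: ler_sum => u un.
have yu1 : yp u w <= 1.
  by apply: le_trans hn; rewrite /gsum (big_rem u un)/= lerDl sumr_ge0.
have yu : y u w <= 1.
  rewrite leNgt; apply/negP => h; move: yu1; rewrite leNgt => /negP; apply.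
  by apply: (lt_le_trans h); rewrite /yp le1r_powR// ltW.
rewrite /y2 /yp -powR_mulrn//; apply: ger_powR => //.
by rewrite ypos yu.
Qed.

End small_weights.

Section small_squares.
Context {R : realType}.
Local Notation tree := (tree R).
Local Notation cfg := (cfg R).
Variables (mu : probability tree R) (nu : probability cfg R).
Hypothesis mu_cyl : iid_tree_law mu nu.
Variable a : seq nat -> tree -> cplx R.
Hypotheses (am : multiplicative a) (ma : forall u, cmeasurable (a u)).
Hypothesis apos : forall u w, 0 < nsq (a u w).
Let y u w := nsq (a u w).
Hypothesis y1 : (\int[mu]_w (gsum y 1 w)%:E = 1)%E.
Hypothesis supercritical_tree : (1 < \int[mu]_w ((size (gen 1 w))%:R : R)%:E)%E.
Local Notation W := (gsum y).
Let b u w : cplx R := a u w ^+ 2.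
Local Notation Q := (gsum b).
Variable kap : cplx R.
Hypotheses (kap_re : \int[mu]_w re (Q 1 w) = re kap) (kap_im : \int[mu]_w im (Q 1 w) = im kap).
Hypothesis kap1 : cmod kap < 1.

Let ym : multiplicative y := multiplicative_nsq am.
Let my u : measurable_fun setT (y u) := measurable_nsq_weight ma u.
Let y0 u w : 0 <= y u w. Proof. exact: nsq_ge0. Qed.
Let mW n : measurable_fun setT (W n). Proof. exact: measurable_gsum. Qed.
Let W0 n w : 0 <= W n w. Proof. exact: gsum_ge0. Qed.
Let EW n : (\int[mu]_w (W n w)%:E = 1)%E.
Proof. by rewrite (expectation_gsum mu_cyl ym my y0 y1) expr1n. Qed.
Let iW n : mu.-integrable setT (EFin \o W n).
Proof. by apply: ge0_integrable => //; rewrite EW ltry. Qed.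

Lemma multiplicative_square : multiplicative b.
Proof.
have [h1 h2 h3] := am; split.
- by move=> w; rewrite /b h1 expr1n.
- by move=> u v w; rewrite /b h2 exprMn.
- by move=> u w w' h; rewrite /b (h3 u w w' h).
Qed.
Let bm := multiplicative_square.

Let mb u : cmeasurable (b u).
Proof.
exact: cmeasurable_sqr.
Qed.

Let cmod_b u w : cmod (b u w) = y u w.
Proof. by rewrite /b expr2 cmodM -expr2 cmod_nsq. Qed.

Let mQ n : cmeasurable (Q n). Proof. exact: (cmeasurable_gsum mb n). Qed.

Lemma cmod_gsum_sqr_le n w : cmod (Q n w) <= W n w.
Proof.
rewrite /gsum; elim: (gen n w) => [|u s IH].
  by rewrite !big_nil cmodE /nsq !cplxE expr0n addr0 sqrtr0.
by rewrite !big_cons (le_trans (cmodD _ _))// cmod_b lerD2l.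
Qed.

(** The centered noise that one generation adds to Q. In general only its first moment is known to
    be finite, through the envelope h = W_1 + 1, which dominates |xi| because |kap| < 1; this is why
    [softabs] is used in place of a variance. *)
Let xi w := Q 1 w - kap.
Let h w := W 1 w + 1.
Let h1 w : 1 <= h w. Proof. by rewrite lerDr. Qed.
Let h0 w : 0 <= h w. Proof. exact: le_trans ler01 (h1 w). Qed.
Let mh : measurable_fun setT h. Proof. exact: measurable_funD. Qed.
Let ih : mu.-integrable setT (EFin \o h).
Proof. exact: (integrable_add (iW 1) (integrable_cst mu 1)). Qed.

Let cmodN (z : cplx R) : cmod (- z) = cmod z.
Proof. by rewrite !cmodE; congr Num.sqrt; rewrite /nsq !cplxE !sqrrN. Qed.

Let xi_le w : cmod (xi w) <= h w.
Proof. by rewrite (le_trans (cmodD _ _))// cmodN lerD ?cmod_gsum_sqr_le// ltW. Qed.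

Let mxi : cmeasurable xi. Proof. exact: (cmeasurable_add (mQ 1) (@cmeasurable_cst R _ tree (- kap))). Qed.

Lemma norm_re_le_cmod (z : cplx R) : `|re z| <= cmod z.
Proof. by rewrite cmodE -sqrtr_sqr ler_sqrt ?nsq_ge0// re_sqr_le. Qed.

Lemma norm_im_le_cmod (z : cplx R) : `|im z| <= cmod z.
Proof. by rewrite cmodE -sqrtr_sqr ler_sqrt ?nsq_ge0// im_sqr_le. Qed.

Let iQre : mu.-integrable setT (EFin \o (fun w => re (Q 1 w))).
Proof.
apply: integrable_dominated (iW 1) => [|w]; first by case: (mQ 1).
exact: le_trans (norm_re_le_cmod _) (cmod_gsum_sqr_le 1 w).
Qed.

Let iQim : mu.-integrable setT (EFin \o (fun w => im (Q 1 w))).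
Proof.
apply: integrable_dominated (iW 1) => [|w]; first by case: (mQ 1).
exact: le_trans (norm_im_le_cmod _) (cmod_gsum_sqr_le 1 w).
Qed.

Let ire : mu.-integrable setT (EFin \o (fun w => re (xi w))).
Proof.
by apply: integrable_dominated ih => [|w]; [case: mxi|exact: le_trans (norm_re_le_cmod _) (xi_le w)].
Qed.

Let iim : mu.-integrable setT (EFin \o (fun w => im (xi w))).
Proof.
by apply: integrable_dominated ih => [|w]; [case: mxi|exact: le_trans (norm_im_le_cmod _) (xi_le w)].
Qed.

Let re0xi : \int[mu]_w re (xi w) = 0.
Proof.
under eq_Rintegral do rewrite reD reN.
rewrite RintegralB//; last exact: integrable_cst.
by rewrite kap_re Rintegral_probability_cst subrr.
Qed.

Let im0xi : \int[mu]_w im (xi w) = 0.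
Proof.
under eq_Rintegral do rewrite imD imN.
rewrite RintegralB//; last exact: integrable_cst.
by rewrite kap_im Rintegral_probability_cst subrr.
Qed.

Let X (c : cplx R) u w' := re (c * xi (shift u w')).

Let mX c u : measurable_fun setT (X c u).
Proof.
have [m1 _] := cmeasurable_scale c mxi.
exact: (measurableT_comp m1 (measurable_shift u)).
Qed.

Let X_le c u w' : `|X c u w'| <= cmod c * h (shift u w').
Proof.
rewrite (le_trans (norm_re_le_cmod _))// cmodM.
by rewrite ler_wpM2l// ?cmod_ge0.
Qed.

Let ihs u : mu.-integrable setT (EFin \o (fun w' => h (shift u w'))).
Proof. exact: (integrable_shift mu_cyl u ih). Qed.

Let iX c u : mu.-integrable setT (EFin \o X c u).
Proof.
exact: (integrable_dominated (mX c u) (X_le c u) (integrable_scale (cmod c) (ihs u))).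
Qed.

Let X0 c u : \int[mu]_w X c u w = 0.
Proof.
have i1 : mu.-integrable setT (EFin \o (fun w => re (c * xi w))).
  have : mu.-integrable setT (EFin \o X c [::]) by exact: iX.
  by congr (_ .-integrable _ _); apply/funext => w; rewrite /X /=.
rewrite /X (Rintegral_shift mu_cyl u (F := fun w => re (c * xi w)) i1).
under eq_Rintegral do rewrite reM.
rewrite RintegralB; [|exact: measurableT|exact: integrable_scale|exact: integrable_scale].
by rewrite RintegralZl// RintegralZl// re0xi im0xi !mulr0 subrr.
Qed.

Lemma softabs_increment (c : cplx R) (s : seq (seq nat)) l (z : seq nat -> cplx R) (e : seq nat -> R) :
  uniq s -> (forall u, u \in s -> size u = l) ->
  (forall u, (\int[mu]_w (Num.min `|X (c * z u) u w| (X (c * z u) u w ^+ 2))%:E <= (e u)%:E)%E) ->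
  (\int[mu]_w' (softabs (re (c * \sum_(u <- s) z u * xi (shift u w'))))%:E
     <= (2 * \sum_(u <- s) e u)%:E)%E.
Proof.
move=> us sl he.
have ind : indep_sum mu (fun u w => X (c * z u) u w) s.
  apply: (indep_sum_shift mu_cyl (eta := fun u w => re (c * z u * xi w)) _ us sl) => u.
  by case: (cmeasurable_scale (c * z u) mxi).
have := @indep_sum_softabs _ _ _ mu _ _ (fun u => mX (c * z u) u) s e 0 ind
  (fun u => iX (c * z u) u) (fun u => X0 (c * z u) u) he.
rewrite softabs0 add0r; apply: le_trans; rewrite le_eqVlt; apply/orP; left; apply/eqP.
apply: eq_integral => w _; congr EFin; congr softabs; rewrite add0r mulr_sumr re_sum.
by apply: eq_bigr => u _; rewrite /X mulrA.
Qed.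

Lemma min_norm_sqr_le (x t : R) : `|x| <= t -> Num.min `|x| (x ^+ 2) <= t * Num.min 1 t.
Proof.
move=> xt; have x0 := normr_ge0 x; rewrite -[x ^+ 2]real_normK ?num_real//.
move: (`|x|) x0 xt => r r0 rt.
have [t1|t1] := leP 1 t; first by rewrite mulr1 ge_min rt.
by rewrite ge_min; apply/orP; right; rewrite -expr2 lerXn2r// nnegrE// (le_trans r0).
Qed.

(** The first-moment analogue of [lindeberg]: a noise term with coefficient c contributes at most
    |c| tau(|c|), and tau vanishes at 0. *)
Definition tau (x : R) := \int[mu]_w (h w * Num.min 1 (x * h w)).

Let mtau x : measurable_fun setT (fun w => h w * Num.min 1 (x * h w)).
Proof. by apply: measurable_funM => //; apply: measurable_minr => //; exact: measurable_funM. Qed.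

Let tau_bound x w : 0 <= x -> 0 <= h w * Num.min 1 (x * h w) <= h w.
Proof.
move=> x0; rewrite mulr_ge0// ?le_min ?ler01 ?mulr_ge0//=.
by rewrite -[leRHS]mulr1 ler_wpM2l// ge_min lexx.
Qed.

Let itau x : 0 <= x -> mu.-integrable setT (EFin \o (fun w => h w * Num.min 1 (x * h w))).
Proof.
move=> x0; apply: integrable_dominated ih => // w.
by have /andP[t1 t2] := tau_bound w x0; rewrite ger0_norm.
Qed.

Lemma tau_ge0 x : 0 <= x -> 0 <= tau x.
Proof. by move=> x0; apply: Rintegral_ge0 => w _; case/andP: (tau_bound w x0). Qed.

Lemma tau_le x x' : 0 <= x -> x <= x' -> tau x <= tau x'.
Proof.
move=> x0 xx'; have x'0 := le_trans x0 xx'.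
apply: le_Rintegral => [|||w _]; [exact: measurableT|exact: itau|exact: itau|].
by rewrite ler_wpM2l// le_min ge_min lexx/= ge_min ler_wpM2r ?orbT.
Qed.

Lemma cvg_tau : tau (n.+1%:R^-1) @[n --> \oo] --> 0.
Proof.
have n0 (n : nat) : 0 <= n.+1%:R^-1 :> R by rewrite invr_ge0.
have [|||||_ _] := @dominated_convergence _ _ R mu setT measurableT
  (fun n w => (h w * Num.min 1 (n.+1%:R^-1 * h w))%:E) (cst 0%E) (EFin \o h).
- by move=> n; apply/measurable_EFinP; exact: mtau.
- exact: measurable_cst.
- apply: aeW => w _; apply: (cvg_EFin (a := 0)); first exact: nearW.
  apply: (@squeeze_cvgr _ _ _ _ (cst 0) (fun n => h w * (n.+1%:R^-1 * h w))).
  + apply: nearW => n; case/andP: (tau_bound w (n0 n)) => -> _ /=.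
    by rewrite ler_wpM2l// ge_min lexx orbT.
  + exact: cvg_cst.
  + rewrite -[X in _ --> X](mulr0 (h w)); apply: cvgM; first exact: cvg_cst.
    rewrite -[X in _ --> X](mul0r (h w)); apply: cvgM; last exact: cvg_cst.
    exact: cvg_harmonic.
- exact: ih.
- apply: aeW => w n _ /=; have /andP[t1 t2] := tau_bound w (n0 n).
  by rewrite lee_fin ger0_norm.
rewrite integral0 => hc.
have : (tau (n.+1%:R^-1))%:E @[n --> \oo] --> 0%:E.
  by under eq_fun do rewrite /tau -(EFin_Rintegral (itau (n0 _))).
by move=> /fine_cvg.
Qed.

Let min_tau c u : (\int[mu]_w (Num.min `|X c u w| (X c u w ^+ 2))%:E <= (cmod c * tau (cmod c))%:E)%E.
Proof.
have c0 := cmod_ge0 c; have ic := itau c0.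
apply: (@le_trans _ _ (\int[mu]_w (cmod c * (h (shift u w) * Num.min 1 (cmod c * h (shift u w))))%:E)%E).
  apply: ge0_integral_le_EFin => [||w|w].
  - by apply: measurable_minr; [exact: measurableT_comp|exact: measurable_funX].
  - by apply: measurable_funM => //; exact: (measurableT_comp (mtau (cmod c)) (measurable_shift u)).
  - by rewrite le_min normr_ge0 sqr_ge0.
  - by rewrite mulrA; apply: min_norm_sqr_le; exact: X_le.
have i2 := integrable_shift mu_cyl u ic.
rewrite EFin_Rintegral; last exact: (integrable_scale (cmod c) i2).
rewrite RintegralZl//.
by rewrite lee_fin /tau (Rintegral_shift mu_cyl u ic).
Qed.

Let D n w := Q n.+1 w - kap * Q n w.

Let mD n : cmeasurable (D n).
Proof.
rewrite (_ : D n = (fun w => Q n.+1 w + (- kap) * Q n w)); last first.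
  by apply/funext => w; rewrite /D mulNr.
exact: (cmeasurable_add (mQ _) (cmeasurable_scale _ (mQ _))).
Qed.

Lemma increment_splice n w w' : D n (splice (fun v => (size v < n)%N) (w, w')) =
  \sum_(u <- gen n w) b u w * xi (shift u w').
Proof.
rewrite /D -[n.+1]addn1 (gsum_add bm) (sum_gen_splice bm) (gsum_splice bm).
rewrite /gsum mulr_sumr -sumrB; apply: eq_bigr => u _.
by rewrite /xi mulrBr [kap * _]mulrC.
Qed.

Let y2 u w := y u w ^+ 2.

(** When the sum of |a_u|^4 is at most z^2, every weight y_u is at most z, so given F_n the softened
    noise has mean at most 2 W_n tau(z). The complementary event is negligible by [weights_vanish].
    Directions c = 1 and c = -i will cover both coordinates. *)
Lemma increment_vanishes (c : cplx R) : cmod c = 1 ->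
  vanishes mu (fun n w => `|re (c * D n w)|).
Proof.
move=> c1 e t e0 t0.
have t2 : 0 < t / 2 by rewrite divr_gt0.
have Phi0 : 0 < softabs e / 2 by rewrite divr_gt0// softabs_gt0.
(* The factor 2 comes from [softabs_increment], the denominator from Markov's inequality at the
   level [softabs e / 2]. *)
pose K := 2 / (softabs e / 2).
have K0 : 0 < K by rewrite divr_gt0.
have [m hm] : exists m : nat, K * tau (m.+1%:R^-1) <= t / 2.
  move/cvgrPdist_lt : cvg_tau => /(_ (t / 2 / K) (divr_gt0 t2 K0)) [m _ /(_ m (leqnn m))].
  rewrite /= sub0r normrN => /(le_lt_trans (ler_norm _)) /ltW.
  by exists m; rewrite mulrC -ler_pdivlMr.
pose z : R := m.+1%:R^-1.
have z0 : 0 < z by rewrite invr_gt0.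
have Kt0 : 0 <= K * tau z by rewrite mulr_ge0 ?tau_ge0 ?ltW.
have := weights_vanish mu_cyl ym my apos y1 supercritical_tree.
move=> /(_ (z ^+ 2) (t / 2) (exprn_gt0 2 z0) t2); apply: filterS => n hn.
have [m1 _] := cmeasurable_scale c (mD n).
have mn : measurable_fun setT (fun w => `|re (c * D n w)|) by exact: measurableT_comp.
have mS := measurable_gt e mn.
have mT : measurable_fun setT (gsum y2 n).
  by apply: measurable_gsum => u; exact: measurable_funX.
have mA := measurable_gt (z ^+ 2) mT.
rewrite (probability_splice mu_cyl (fun v => (size v < n)%N) mS).
apply: (@le_trans _ _ (\int[mu]_w ((\1_[set w | (z ^+ 2 < gsum y2 n w)%R] w : R)%:E +
    (K * tau z)%:E * (W n w)%:E))%E).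
  apply: ge0_le_integral => //.
  - exact: (measurable_probability_splice mu (fun v => (size v < n)%N) mS).
  - apply: emeasurable_funD; first by apply/measurable_EFinP; exact: measurable_indic.
    by apply: measurable_funeM; exact/measurable_EFinP.
  move=> w _; rewrite indicE; case: (boolP (w \in _)) => hw /=.
    apply: (@le_trans _ _ 1%E).
      apply: probability_le1; have ms : measurable_fun setT (fun w' => splice (fun v => (size v < n)%N) (w, w') : tree).
        by apply: (measurableT_comp (measurable_splice _)); exact: measurable_fun_pair.
      exact: (measurable_gt e (measurableT_comp mn ms)).
    by rewrite -EFinM -EFinD lee_fin lerDl mulr_ge0.
  have Tz : gsum y2 n w <= z ^+ 2.
    by move/negP : hw; rewrite inE /= => /negP; rewrite -leNgt.
  have yz u : u \in gen n w -> y u w <= z.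
    move=> un; rewrite -(@ler_pXn2r _ 2)// ?nnegrE ?(ltW z0)//; apply: le_trans Tz.
    by rewrite /gsum (big_rem u un)/= lerDl sumr_ge0// => v _; exact: sqr_ge0.
  rewrite add0e.
  pose f w' := softabs (re (c * \sum_(u <- gen n w) b u w * xi (shift u w'))).
  have mf : measurable_fun setT f.
    apply: (measurableT_comp measurable_softabs).
    have := cmeasurable_scale c (mD n) => -[m2 _].
    have ms : measurable_fun setT (fun w' => splice (fun v => (size v < n)%N) (w, w') : tree).
      by apply: (measurableT_comp (measurable_splice _)); exact: measurable_fun_pair.
    have := measurableT_comp m2 ms; apply: eq_measurable_fun => w' _ /=.
    by rewrite increment_splice.
  have f0 w' : 0 <= f w' by exact: softabs_ge0.
  have If : (\int[mu]_w' (f w')%:E <= (2 * \sum_(u <- gen n w) y u w * tau z)%:E)%E.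
    apply: le_trans (@softabs_increment c (gen n w) n (b ^~ w)
      (fun u => y u w * tau (y u w)) (gen_uniq n w) (@gen_size _ n w) _) _.
      by move=> u; have := min_tau (c * b u w) u; rewrite cmodM c1 mul1r cmod_b.
    rewrite lee_fin ler_wpM2l// big_seq [leRHS]big_seq.
    by apply: ler_sum => u un; rewrite ler_wpM2l// tau_le// yz.
  (* [softabs_mono] is not strict, so the level is halved to keep a strict inequality in the
     event. *)
  apply: (@le_trans _ _ (mu [set w' | (softabs e / 2 < f w')%R])).
    apply: le_measure; rewrite ?inE.
    - have ms : measurable_fun setT (fun w' => splice (fun v => (size v < n)%N) (w, w') : tree).
        by apply: (measurableT_comp (measurable_splice _)); exact: measurable_fun_pair.
      exact: (measurable_gt e (measurableT_comp mn ms)).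
    - exact: measurable_gt.
    - move=> w' /=; rewrite increment_splice /f => ex.
      apply: (@lt_le_trans _ _ (softabs e)); last by apply: softabs_mono; exact: ltW.
      have := softabs_gt0 e0 => s0; lra.
  apply: (le_trans (markov_le mf f0 Phi0 If)).
  rewrite -EFinM lee_fin /K le_eqVlt; apply/orP; left; apply/eqP.
  by rewrite /gsum -mulr_suml; field; rewrite gt_eqF// softabs_gt0.
rewrite ge0_integralD//; last 3 first.
- by apply/measurable_EFinP; exact: measurable_indic.
- by move=> w _; rewrite -EFinM lee_fin mulr_ge0.
- by apply: measurable_funeM; exact/measurable_EFinP.
rewrite integral_indic_probability// ge0_integralZl//; last 2 first.
- exact/measurable_EFinP.
- by move=> w _; rewrite lee_fin.
by rewrite EW mule1 [t]splitr EFinD leeD.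
Qed.

Let cmod_D n w : cmod (D n w) <= `|re (1 * D n w)| + `|re (Complex 0 (- 1) * D n w)|.
Proof.
rewrite (le_trans (cmod_le_re_im _))// mul1r lerD2l le_eqVlt; apply/orP; left; apply/eqP.
by congr (`|_|); rewrite reM !cplxE; ring.
Qed.

Let cmod1 : cmod (1 : cplx R) = 1. Proof. by rewrite cmodE nsq1 sqrtr1. Qed.
Let cmodi : cmod (Complex 0 (- 1) : cplx R) = 1.
Proof. by rewrite cmodE /nsq !cplxE expr0n add0r sqrrN expr1n sqrtr1. Qed.

Let recursion n w : cmod (Q n.+1 w) <= cmod kap * cmod (Q n w) + cmod (D n w).
Proof.
have -> : Q n.+1 w = kap * Q n w + D n w by rewrite /D addrC subrK.
by rewrite (le_trans (cmodD _ _))// cmodM.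
Qed.

Theorem squares_vanish : vanishes mu (fun n w => cmod (Q n w)).
Proof.
have m1 c n : measurable_fun setT (fun w => `|re (c * D n w)|).
  by apply: measurableT_comp => //; case: (cmeasurable_scale c (mD n)).
have mC n : measurable_fun setT (fun w => cmod (Q n w)) by exact: (measurable_cmod (mQ n)).
have mCD n : measurable_fun setT (fun w => cmod (D n w)) by exact: (measurable_cmod (mD n)).
apply: (@vanishes_recursion _ _ _ mu _ (fun n w => cmod (D n w)) W (cmod kap)) => //.
- exact: cmod_ge0.
- by move=> n w; exact: cmod_gsum_sqr_le.
- by move=> n; rewrite EW.
- by move=> n w; exact: cmod_ge0.
apply: vanishes_le (vanishes_add (m1 1) (m1 (Complex 0 (- 1))) (increment_vanishes cmod1) (increment_vanishes cmodi)) => // n.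
by apply: measurable_funD; exact: m1.
Qed.

(** As 1 < p <= 2, min(|x|, x^2) is at most t^p whenever |x| <= t. The softened noise at time n
    therefore has mean at most 2 C r^n, which is summable; the almost sure convergence then passes
    through the contracting recursion path by path. *)
Theorem squares_cvg0 (p : R) : 1 < p <= 2 ->
  (\int[mu]_w (gsum (fun u w => y u w `^ p) 1 w)%:E < 1)%E ->
  (\int[mu]_w (h w `^ p)%:E < +oo)%E ->
  {ae mu, forall w, cmod (Q n w) @[n --> \oo] --> 0}.
Proof.
move=> /andP[p1 p2] Ep hp; pose yp u w := y u w `^ p.
have ypm : multiplicative yp := multiplicative_powR ym y0 p.
have myp u : measurable_fun setT (yp u) by exact: (measurableT_comp (measurable_powR p) (my u)).
have yp0 u w : 0 <= yp u w by exact: powR_ge0.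
have Ip0 : (0 <= \int[mu]_w (gsum yp 1 w)%:E)%E.
  by apply: integral_ge0 => w _; rewrite lee_fin; exact: gsum_ge0.
pose r := fine (\int[mu]_w (gsum yp 1 w)%:E).
have rE : (\int[mu]_w (gsum yp 1 w)%:E = r%:E)%E.
  by rewrite fineK// ge0_fin_numE// (lt_trans Ep)// ltry.
have r0 : 0 <= r by rewrite -lee_fin -rE.
have r1 : r < 1 by rewrite -lte_fin -rE.
have mhp : measurable_fun setT (fun w => h w `^ p) by exact: (measurableT_comp (measurable_powR p) mh).
have hp0 w : 0 <= h w `^ p by exact: powR_ge0.
have ihp : mu.-integrable setT (EFin \o (fun w => h w `^ p)) by exact: ge0_integrable.
pose C := \int[mu]_w (h w `^ p).
have C0 : 0 <= C by exact: Rintegral_ge0.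
have minp (x t : R) : `|x| <= t -> Num.min `|x| (x ^+ 2) <= t `^ p.
  move=> xt; apply: le_trans (min_norm_sqr_le xt) _.
  have t0 : 0 <= t := le_trans (normr_ge0 x) xt.
  have [t1|t1] := leP 1 t; first by rewrite mulr1 le1r_powR// ltW.
  have [->|tn0] := eqVneq t 0; first by rewrite mul0r powR_ge0.
  by rewrite -expr2 -powR_mulrn// ger_powR// lt_def tn0 t0 ltW.
have bound c u : (\int[mu]_w (Num.min `|X c u w| (X c u w ^+ 2))%:E <= (cmod c `^ p * C)%:E)%E.
  apply: (@le_trans _ _ (\int[mu]_w (cmod c `^ p * h (shift u w) `^ p)%:E)%E).
    apply: ge0_integral_le_EFin => [||w|w].
    - by apply: measurable_minr; [exact: measurableT_comp|exact: measurable_funX].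
    - by apply: measurable_funM => //; exact: (measurableT_comp mhp (measurable_shift u)).
    - by rewrite le_min normr_ge0 sqr_ge0.
    - by rewrite -powRM ?cmod_ge0//; apply: minp; exact: X_le.
  have i2 := integrable_shift mu_cyl u ihp.
  rewrite EFin_Rintegral; last exact: (integrable_scale (cmod c `^ p) i2).
  rewrite (@RintegralZl _ _ R mu setT (fun w => h (shift u w) `^ p) (cmod c `^ p) measurableT i2).
  by rewrite lee_fin /C (Rintegral_shift mu_cyl u ihp).
have half c : cmod c = 1 -> {ae mu, forall w, softabs (re (c * D n w)) @[n --> \oo] --> 0}.
  move=> c1.
  have mf n : measurable_fun setT (fun w => softabs (re (c * D n w))).
    by apply: (measurableT_comp measurable_softabs); case: (cmeasurable_scale c (mD n)).
  apply: (@ae_cvg0 _ _ _ mu _ (fun n => 2 * C * r ^+ n) (2 * C * (1 - r)^-1)) => //.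
  - by move=> n w; exact: softabs_ge0.
  - move=> n; have mf' : measurable_fun setT (fun w => (softabs (re (c * D n w)))%:E) by exact/measurable_EFinP.
    rewrite (ge0_integral_splice mu_cyl (fun v => (size v < n)%N) mf'); last first.
      by move=> w; rewrite lee_fin softabs_ge0.
    apply: (@le_trans _ _ (\int[mu]_w ((2 * C)%:E * (gsum yp n w)%:E))%E).
      apply: ge0_le_integral => //.
      + by move=> w _; apply: integral_ge0 => w' _; rewrite lee_fin softabs_ge0.
      + have := measurable_integral_splice mu (fun v => (size v < n)%N) mf'.
        by apply; move=> w; rewrite lee_fin softabs_ge0.
      + by apply: measurable_funeM; apply/measurable_EFinP; exact: measurable_gsum.
      + move=> w _; under eq_integral do rewrite increment_splice.
        apply: le_trans (@softabs_increment c (gen n w) n (b ^~ w)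
          (fun u => yp u w * C) (gen_uniq n w) (@gen_size _ n w) _) _.
          by move=> u; have := bound (c * b u w) u; rewrite cmodM c1 mul1r cmod_b.
        by rewrite -EFinM lee_fin -mulr_suml -mulrA [_ * C]mulrC.
    rewrite ge0_integralZl//; last 3 first.
    + by apply/measurable_EFinP; exact: measurable_gsum.
    + by move=> w _; rewrite lee_fin gsum_ge0.
    + by rewrite lee_fin mulr_ge0.
    by rewrite (expectation_gsum mu_cyl ypm myp yp0 rE).
  - move=> n; rewrite -mulr_sumr ler_wpM2l ?mulr_ge0//.
    by apply: sum_geometric; rewrite r0 r1.
have := half _ cmod1; have := half _ cmodi; apply: filterS2 => w hi h1w.
apply: (@recursion_cvg0 _ _ (fun n => cmod (D n w)) (cmod kap)) => //.
- exact: cmod_ge0.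
- by move=> n; exact: cmod_ge0.
- apply: (@squeeze_cvgr _ _ _ _ (cst 0) (fun n => `|re (1 * D n w)| + `|re (Complex 0 (- 1) * D n w)|)).
  + by apply: nearW => n; rewrite cmod_ge0 cmod_D.
  + exact: cvg_cst.
  + by rewrite -[X in _ --> X](addr0 0); apply: cvgD; apply: cvg_softabs0.
Qed.

End small_squares.

(** * The conditional central limit theorem *)

Section conditional_clt.
Context {R : realType} {d' : measure_display} {T' : measurableType d'}.
Local Notation tree := (tree R).
Local Notation cfg := (cfg R).
Variables (mu : probability tree R) (nu : probability cfg R).
Hypothesis mu_cyl : iid_tree_law mu nu.
Variable x : seq nat -> tree -> cplx R.
Hypotheses (xm : multiplicative x) (mx : forall u, cmeasurable (x u)).
Hypothesis xpos : forall u w, 0 < nsq (x u w).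
Hypothesis xic : ccentered mu (fun w => gsum x 1 w - 1).
Variable q : R.
Hypotheses (q0 : 0 < q) (q1 : q < 1).
Hypothesis xq : (\int[mu]_w (gsum (fun u w => nsq (x u w)) 1 w)%:E = q%:E)%E.
Hypothesis supercritical_tree : (1 < \int[mu]_w ((size (gen 1 w))%:R : R)%:E)%E.
Variable beta : cplx R.
Hypothesis beta_q : q * nsq beta = 1.

(** With beta = m(lambda) / m^(1/2), this passes from the weights of Z_n(lambda) to those divided by
    m^(n/2). The condition q |beta|^2 = 1 gives the sum of |a_u|^2 mean 1. *)
Definition renorm u w : cplx R := x u w * beta ^+ size u.
Local Notation a := renorm.
Let y u w := nsq (a u w).
Local Notation W := (gsum y).
Local Notation Q := (gsum (fun u w => a u w ^+ 2)).

Lemma multiplicative_renorm : multiplicative a.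
Proof.
have [h1 h2 h3] := xm; split.
- by move=> w; rewrite /renorm h1 mul1r expr0.
- by move=> u v w; rewrite /renorm h2 size_cat exprD mulrACA.
- by move=> u w w' h; rewrite /renorm (h3 u w w' h).
Qed.
Let am := multiplicative_renorm.

Lemma cmeasurable_renorm u : cmeasurable (a u).
Proof.
rewrite (_ : a u = fun w => beta ^+ size u * x u w); last by apply/funext => w; rewrite /renorm mulrC.
exact: cmeasurable_scale.
Qed.
Let ma := cmeasurable_renorm.

Let beta_pos : 0 < nsq beta.
Proof. by rewrite -(pmulr_rgt0 _ q0) beta_q ltr01. Qed.

Lemma renorm_pos u w : 0 < nsq (a u w).
Proof. by rewrite /renorm nsqM mulr_gt0// nsqX exprn_gt0. Qed.
Let apos := renorm_pos.

Lemma expectation_renorm : (\int[mu]_w (W 1 w)%:E = 1)%E.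
Proof.
have E w : W 1 w = nsq beta * gsum (fun u w => nsq (x u w)) 1 w.
  rewrite /gsum mulr_sumr big_seq [RHS]big_seq; apply: eq_bigr => u /gen_size un.
  by rewrite /y /renorm un nsqM expr1 mulrC.
under eq_integral do rewrite E EFinM.
rewrite ge0_integralZl//; last 3 first.
- apply/measurable_EFinP; apply: measurable_gsum => u; exact: measurable_nsq_weight.
- by move=> w _; rewrite lee_fin gsum_ge0// => u w'; exact: nsq_ge0.
- by rewrite lee_fin ltW.
by rewrite xq -EFinM mulrC beta_q.
Qed.
Let y1 := expectation_renorm.

Let ym : multiplicative y := multiplicative_nsq am.
Let my u : measurable_fun setT (y u) := measurable_nsq_weight ma u.
Let y0 u w : 0 <= y u w. Proof. exact: nsq_ge0. Qed.
Let mW n : measurable_fun setT (W n). Proof. exact: measurable_gsum. Qed.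
Let W0 n w : 0 <= W n w. Proof. exact: gsum_ge0. Qed.

Local Notation Zoo := (Zinf x).
Definition fluct w : cplx R := Zoo w - 1.
Local Notation Y := fluct.
Let Yc : ccentered mu Y. Proof. exact: (Zinf_ccentered mu_cyl xm mx xic q0 q1 xq). Qed.

(** The variance of Z(lambda): the increments of Z_n have variances q^n times that of Z_1, a
    geometric series. *)
Definition limvar : R := cvar mu (fun w => gsum x 1 w - 1) / (1 - q).
Local Notation v := limvar.
Let Yv : cvar mu Y = v. Proof. exact: (cvar_Zinf mu_cyl xm mx xic q0 q1 xq). Qed.
Let v0 : 0 <= v. Proof. by rewrite -Yv cvar_ge0. Qed.

Definition Winf w : R := ulim W w.
Let mWinf : measurable_fun setT Winf. Proof. exact: measurable_ulim. Qed.
Let ae_W : {ae mu, forall w, W n w @[n --> \oo] --> Winf w}.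
Proof. exact: (ae_cvg_gsum mu_cyl ym my y0 y1). Qed.

(** Given F_n, the variance in any direction t depends on generation n only through W_n and Q_n.
    Their limits are all that the central limit theorem needs besides the smallness of single
    weights. *)
Lemma sum_lin_var t n w : \sum_(u <- gen n w) lin_var mu Y (t * a u w) =
  (nsq t * v * W n w + re (t ^+ 2 * cpvar mu Y * Q n w)) / 2.
Proof.
rewrite /lin_var -mulr_suml big_split/=; congr (_ / 2); congr (_ + _).
  by rewrite Yv /gsum mulr_sumr; apply: eq_bigr => u _; rewrite nsqM /y; ring.
rewrite /gsum mulr_sumr re_sum; apply: eq_bigr => u _; congr re.
by rewrite exprMn; ring.
Qed.

(* k is 1 in the case where the weights and the limit are real, and 0 otherwise. *)
Variable k : bool.
Local Notation kR := (k%:R : R).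
Variables (P' : probability T' R) (X1 X2 : T' -> R).
Hypotheses (mX1 : measurable_fun setT X1) (mX2 : measurable_fun setT X2).
Variable C : R.
Hypothesis X_moment : (\int[P']_w (X1 w ^+ 2 + X2 w ^+ 2)%:E <= C%:E)%E.
(** One formula for both cases: k = 0 gives two independent coordinates of variance 1/2, and k = 1
    gives a real coordinate of variance 1 and an imaginary part equal to 0. *)
Hypothesis X_char : forall b s t : R, \int[P']_w cos (b + s * X1 w + t * X2 w) =
  expR (- ((s ^+ 2 + t ^+ 2 + kR * (s ^+ 2 - t ^+ 2)) / 4)) * cos b.

Definition good w := forall n, k -> Q n w = toC (W n w).
Hypothesis ae_good : {ae mu, forall w, good w}.
Hypothesis real_case : k -> cpvar mu Y = toC v.

Let T n w := gsum (fun u w => y u w ^+ 2) n w.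
(** A single real number that gathers the conditions of the central limit theorem on a given tree,
    so that convergence in probability or almost surely has to be discussed only once. The factor 1
    - k drops Q_n in the real case, where it equals W_n. *)
Definition discrepancy n w := `|W n w - Winf w| + T n w + (1 - kR) * cmod (Q n w).
Local Notation D := discrepancy.

Let mQ n : cmeasurable (Q n).
Proof. by apply: cmeasurable_gsum => u; exact: cmeasurable_sqr. Qed.

Let mT n : measurable_fun setT (T n).
Proof. by apply: measurable_gsum => u; exact: measurable_funX. Qed.
Let T0 n w : 0 <= T n w. Proof. by apply: gsum_ge0 => u w'; exact: sqr_ge0. Qed.
Let k01 : 0 <= 1 - kR. Proof. by case: k; rewrite ?subrr ?subr0. Qed.

Let mD1 n : measurable_fun setT (fun w => `|W n w - Winf w|).
Proof. by apply: measurableT_comp => //; exact: measurable_funB. Qed.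
Let mD3 n : measurable_fun setT (fun w => (1 - kR) * cmod (Q n w)).
Proof. by apply: measurable_funM => //; exact: measurable_cmod. Qed.

Lemma measurable_discrepancy n : measurable_fun setT (D n).
Proof. by apply: measurable_funD => //; exact: measurable_funD. Qed.

Lemma discrepancy_ge0 n w : 0 <= D n w.
Proof. by rewrite !addr_ge0// mulr_ge0// cmod_ge0. Qed.

Variable phi : R * R -> R.
Hypotheses (cphi : continuous phi) (bphi : bounded_mfun phi).

(** The past, with its weights, and the future are read from two different trees. On the diagonal
    this is the actual fluctuation ([ae_remainder]); integrating over the second tree gives its
    conditional law. *)
Definition remainder n (z : tree * tree) := tree_sum Y (gen n z.1) (a ^~ z.1) z.2.

Definition cond_law n w := \int[mu]_w' phi (re (remainder n (w, w')), im (remainder n (w, w'))).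

Definition limit_law w := \int[P']_w' phi (Num.sqrt (v * Winf w) * X1 w', Num.sqrt (v * Winf w) * X2 w').

(** A deterministic statement about one first tree. The times N(j) are arbitrary and need not
    increase, as the argument in probability picks them without any order. *)
Lemma clt_along w (N : nat -> nat) : good w -> D (N j) w @[j --> \oo] --> 0 ->
  cond_law (N j) w @[j --> \oo] --> limit_law w.
Proof.
move=> gw Dw.
have c1 : W (N j) w @[j --> \oo] --> Winf w.
  apply/subr_cvg0; apply/norm_cvg0P.
  apply: (@squeeze_cvgr _ _ _ _ (cst 0) (fun j => D (N j) w)); [|exact: cvg_cst|exact: Dw].
  apply: nearW => j; rewrite normr_ge0/= /discrepancy -addrA lerDl addr_ge0//.
  by rewrite mulr_ge0// cmod_ge0.
have Winf0 : 0 <= Winf w by apply: (ler_cvg_to (cvg_cst 0) c1); exact: nearW.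
have cT : T (N j) w @[j --> \oo] --> 0.
  apply: (@squeeze_cvgr _ _ _ _ (cst 0) (fun j => D (N j) w)); [|exact: cvg_cst|exact: Dw].
  apply: nearW => j; rewrite T0/= /discrepancy addrAC lerDr addr_ge0//.
  by rewrite mulr_ge0// cmod_ge0.
have cQ : re (Q (N j) w) @[j --> \oo] --> kR * Winf w /\ im (Q (N j) w) @[j --> \oo] --> 0.
  case: (boolP k) => kk.
    split; last by under eq_fun do rewrite (gw _ kk) im_toC; exact: cvg_cst.
    by rewrite mul1r; under eq_fun do rewrite (gw _ kk) re_toC.
  have cm : cmod (Q (N j) w) @[j --> \oo] --> 0.
    apply: (@squeeze_cvgr _ _ _ _ (cst 0) (fun j => D (N j) w)); [|exact: cvg_cst|exact: Dw].
    apply: nearW => j; rewrite cmod_ge0/= /discrepancy (negbTE kk) subr0 mul1r.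
    by rewrite lerDr addr_ge0.
  rewrite mul0r; split; apply/norm_cvg0P.
    apply: (@squeeze_cvgr _ _ _ _ (cst 0) (fun j => cmod (Q (N j) w))); [|exact: cvg_cst|exact: cm].
    by apply: nearW => j; rewrite normr_ge0 norm_re_le_cmod.
  apply: (@squeeze_cvgr _ _ _ _ (cst 0) (fun j => cmod (Q (N j) w))); [|exact: cvg_cst|exact: cm].
  by apply: nearW => j; rewrite normr_ge0 norm_im_le_cmod.
pose L (t : cplx R) := v * Winf w * (nsq t + kR * re (t ^+ 2)) / 2.
pose r := Num.sqrt (v * Winf w).
have r2 : r ^+ 2 = v * Winf w by rewrite sqr_sqrtr// mulr_ge0.
have Xm : (\int[P']_w' ((r * X1 w') ^+ 2 + (r * X2 w') ^+ 2)%:E <= (r ^+ 2 * C)%:E)%E.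
  under eq_integral do rewrite !exprMn -mulrDr EFinM.
  rewrite ge0_integralZl//; last 3 first.
  - by apply/measurable_EFinP; apply: measurable_funD; apply: measurable_funX.
  - by move=> w' _; rewrite lee_fin addr_ge0// sqr_ge0.
  - by rewrite lee_fin sqr_ge0.
  by rewrite [leRHS]EFinM; apply: lee_wpmul2l => //; rewrite lee_fin sqr_ge0.
have Xc b s t : \int[P']_w' cos (b + s * (r * X1 w') + t * (r * X2 w')) =
    expR (- (L (Complex s (- t)) / 2)) * cos b.
  under eq_Rintegral do rewrite !mulrA.
  rewrite X_char; congr (expR (- _) * _).
  by rewrite /L -r2 /nsq expr2 !cplxE; field.
have cv t : \sum_(u <- gen (N j) w) lin_var mu Y (t * a u w) @[j --> \oo] --> L t.
  under eq_fun do rewrite sum_lin_var.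
  have -> : L t = (nsq t * v * Winf w + (re (t ^+ 2 * cpvar mu Y) * (kR * Winf w) - im (t ^+ 2 * cpvar mu Y) * 0)) / 2.
    rewrite /L; case: (boolP k) => kk /=; last by rewrite !mul0r; ring.
    by rewrite (real_case kk) [re (t ^+ 2 * _)]reM re_toC im_toC; ring.
  apply: cvgM; last exact: cvg_cst.
  apply: cvgD; first by apply: cvgM => //; exact: cvg_cst.
  under eq_fun do rewrite reM; case: cQ => cq1 cq2.
  by apply: cvgB; apply: cvgM => //; exact: cvg_cst.
(* A single |a_u|^4 is at most the sum T, so |a_u| is at most the fourth root of T. *)
pose z j := Num.sqrt (Num.sqrt (T (N j) w)).
have az j u : u \in gen (N j) w -> nsq (a u w) <= z j ^+ 2.
  move=> un; rewrite sqr_sqrtr ?sqrtr_ge0// -[leLHS]ger0_norm ?nsq_ge0// -sqrtr_sqr.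
  by rewrite ler_sqrt ?T0// /T /gsum (big_rem u un)/= lerDl sumr_ge0// => u' _; exact: sqr_ge0.
have z0 j : 0 <= z j by exact: sqrtr_ge0.
have cz : z j @[j --> \oo] --> 0.
  rewrite -[X in _ --> X](sqrtr0 R) -[X in Num.sqrt X](sqrtr0 R).
  exact: (cvg_comp _ _ (cvg_comp _ _ cT (@sqrt_continuous R 0)) (@sqrt_continuous R _)).
exact: (tree_clt mu_cyl Yc (measurable_funM (measurable_cst r) mX1)
  (measurable_funM (measurable_cst r) mX2) Xm Xc (fun j => gen_uniq (N j) w)
  (fun j => @gen_size _ (N j) w) cv c1 z0 az cz cphi bphi).
Qed.

Let measurable_remainder n : cmeasurable (remainder n).
Proof.
have kg : countably_measurable (fun z : tree * tree => gen n z.1).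
  move=> s; have := gen_countably_measurable (R := R) n s.
  by move=> m; rewrite -[X in measurable X]setTI; exact: (measurable_fst measurableT _ m).
have mY : cmeasurable Y by case: Yc.
have term u : cmeasurable (fun z : tree * tree => a u z.1 * Y (shift u z.2)).
  apply: cmeasurable_mul; first exact: (cmeasurable_comp (ma u) measurable_fst).
  exact: (cmeasurable_comp mY (measurableT_comp (measurable_shift u) measurable_snd)).
split.
  rewrite (_ : _ \o _ = fun z => \sum_(u <- gen n z.1) re (a u z.1 * Y (shift u z.2))); last first.
    by apply/funext => z; rewrite /= /remainder /tree_sum re_sum.
  apply: (measurable_fun_countable_case (F := fun s z => \sum_(u <- s) re (a u z.1 * Y (shift u z.2))) kg) => s.
  by apply: measurable_sum => u; case: (term u).
rewrite (_ : _ \o _ = fun z => \sum_(u <- gen n z.1) im (a u z.1 * Y (shift u z.2))); last first.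
  by apply/funext => z; rewrite /= /remainder /tree_sum im_sum.
apply: (measurable_fun_countable_case (F := fun s z => \sum_(u <- s) im (a u z.1 * Y (shift u z.2))) kg) => s.
by apply: measurable_sum => u; case: (term u).
Qed.

Let bounded_remainder n : bounded_mfun (fun z => phi (re (remainder n z), im (remainder n z))).
Proof.
have [mphi [M hM]] := bphi; have [m1 m2] := measurable_remainder n.
split; last by exists M => z; exact: hM.
by apply: (measurableT_comp mphi); exact: measurable_fun_pair.
Qed.

Lemma bounded_cond_law n : bounded_mfun (cond_law n).
Proof. exact: (bounded_mfun_Rintegral1 mu (bounded_remainder n)). Qed.

Lemma bounded_limit_joint : bounded_mfun (fun z : tree * T' =>
  phi (Num.sqrt (v * Winf z.1) * X1 z.2, Num.sqrt (v * Winf z.1) * X2 z.2)).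
Proof.
have [mphi [M hM]] := bphi; split; last by exists M => z; exact: hM.
have ms : measurable_fun setT (fun z : tree * T' => Num.sqrt (v * Winf z.1)).
  apply: (measurableT_comp (continuous_measurable_fun (@sqrt_continuous R))).
  by apply: measurable_funM => //; exact: (measurableT_comp mWinf measurable_fst).
apply: (measurableT_comp mphi); apply: measurable_fun_pair.
  by apply: measurable_funM => //; exact: (measurableT_comp mX1 measurable_snd).
by apply: measurable_funM => //; exact: (measurableT_comp mX2 measurable_snd).
Qed.

Lemma bounded_limit_law : bounded_mfun limit_law.
Proof. exact: (bounded_mfun_Rintegral1 P' bounded_limit_joint). Qed.

Lemma ae_remainder : {ae mu, forall w, forall n,
  beta ^+ n * (Zoo w - gsum x n w) = remainder n (w, w)}.
Proof.
have := Zinf_remainder mu_cyl xm mx xic q0 q1 xq; apply: filterS => w h n.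
rewrite h /remainder /tree_sum mulr_sumr big_seq [RHS]big_seq; apply: eq_bigr => u /gen_size un.
by rewrite /renorm /fluct un /=; ring.
Qed.

Lemma cond_law_depends n : depends_on (fun u => (size u < n)%N) (cond_law n).
Proof.
move=> w w' h; rewrite /cond_law; apply: eq_Rintegral => w'' _.
have -> // : remainder n (w, w'') = remainder n (w', w'').
rewrite /remainder /tree_sum /= (gen_depends h) big_seq [RHS]big_seq.
apply: eq_bigr => u /gen_size un; congr (_ * _).
by have [_ _ /(_ u)] := am; apply => v' vu; apply: h; rewrite -un.
Qed.

(** Splicing at depth n leaves the indicator of B unchanged and turns the diagonal of [remainder]
    into independent past and future; the inner integral is then [cond_law]. The constant M makes
    the integrand nonnegative and is subtracted at the end. *)
Lemma cond_law_condexp n (B : set tree) : measurable B ->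
  depends_on (fun u => (size u < n)%N) (fun w => w \in B) ->
  (\int[mu]_(w in B) (cond_law n w)%:E =
   \int[mu]_(w in B) (phi (re (remainder n (w, w)), im (remainder n (w, w))))%:E)%E.
Proof.
move=> mB dB; have [mphi [M hM]] := bphi.
pose f z := phi (re (remainder n z), im (remainder n z)).
have [mf _] := bounded_remainder n.
have mdiag : measurable_fun setT (fun w => f (w, w)).
  by apply: (measurableT_comp mf (g := fun w : tree => (w, w))); exact: measurable_fun_pair.
have [mG [M' hM']] := bounded_cond_law n.
pose F w : R := (w \in B)%:R * (f (w, w) + M).
have mind : measurable_fun setT (fun w => (w \in B)%:R : R).
  by rewrite (_ : (fun w => _) = \1_B)//; exact: measurable_indic.
have F0 w : 0 <= F w.
  by rewrite mulr_ge0//; have := hM (re (remainder n (w, w)), im (remainder n (w, w)));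
     rewrite ler_norml /f => /andP[? ?]; lra.
have mF : measurable_fun setT F by apply: measurable_funM => //; exact: measurable_funD.
have mFE : measurable_fun setT (fun w => (F w)%:E) by exact/measurable_EFinP.
have F0E w : (0 <= (F w)%:E)%E by rewrite lee_fin.
have E := @ge0_integral_splice _ _ _ mu_cyl (fun u => (size u < n)%N) (fun w => (F w)%:E)
  mFE F0E.
have inner w : (\int[mu]_w' (F (splice (fun u => (size u < n)%N) (w, w')))%:E =
    ((w \in B)%:R * (cond_law n w + M))%:E)%E.
  have Fs w' : F (splice (fun u => (size u < n)%N) (w, w')) = (w \in B)%:R * (f (w, w') + M).
    rewrite /F (depends_on_splice_l (w, w') dB)/=; congr (_ * (phi _ + _)).
    by rewrite /remainder /tree_sum /= (sum_gen_splice am).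
  under eq_integral do rewrite Fs.
  have [mfw [Mw hMw]] := bounded_mfun_pair1 (bounded_remainder n) w.
  have ifw := bounded_mfun_integrable mu (bounded_mfun_pair1 (bounded_remainder n) w).
  have ifM := integrable_add ifw (integrable_cst mu M).
  rewrite EFin_Rintegral; last exact: (integrable_scale _ ifM).
  congr EFin; rewrite (@RintegralZl _ _ R mu setT _ _ measurableT ifM); congr (_ * _).
  rewrite RintegralD; [|exact: measurableT|exact: ifw|exact: integrable_cst].
  by rewrite Rintegral_probability_cst.
have expand (g : tree -> R) : bounded_mfun g ->
    (\int[mu]_w ((w \in B)%:R * (g w + M))%:E =
     \int[mu]_(w in B) (g w)%:E + (\int[mu]_w ((w \in B)%:R * M))%:E)%E.
  move=> [mg [Mg hMg]].
  have ind1 w : `|(w \in B)%:R : R| <= 1 by case: (w \in B); rewrite ?normr1 ?normr0.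
  have i1 : mu.-integrable setT (EFin \o (fun w => (w \in B)%:R * g w)).
    apply: bounded_mfun_integrable; split; first exact: measurable_funM.
    exists Mg => w; rewrite normrM -[leRHS]mul1r; apply: ler_pM => //.
  have i2 : mu.-integrable setT (EFin \o (fun w => (w \in B)%:R * M)).
    apply: bounded_mfun_integrable; split; first exact: measurable_funM.
    exists `|M| => w; rewrite normrM -[leRHS]mul1r; apply: ler_pM => //.
  under eq_integral do rewrite mulrDr EFinD.
  rewrite (integralD measurableT i1 i2) (EFin_Rintegral i2); congr (_ + _)%E.
  rewrite [RHS]integral_mkcond; apply: eq_integral => w _; rewrite patchE.
  by rewrite /=; case: (w \in B); rewrite ?mul1r ?mul0r.
have bdiag : bounded_mfun (fun w => f (w, w)) by split => //; exists M => w; exact: hM.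
have := expand _ bdiag; have := expand _ (bounded_cond_law n).
rewrite -[X in X = _ -> _](eq_integral _ _ (fun w _ => inner w)) => e1 e2.
move: E; rewrite /F e2 e1 => /(congr1 (fun t => t - (\int[mu]_w ((w \in B)%:R * M))%:E)%E).
by rewrite !addeK// => ->.
Qed.

Lemma discrepancy_vanishes : (~~ k -> vanishes mu (fun n w => cmod (Q n w))) -> vanishes mu D.
Proof.
move=> hQ; apply: vanishes_add => //; first by move=> n; exact: measurable_funD.
  apply: vanishes_add => //.
    apply: ae_vanishes => //; have := ae_W; apply: filterS => w h.
    by apply/norm_cvg0P; apply/subr_cvg0.
  exact: (weights_vanish mu_cyl ym my apos y1 supercritical_tree).
case: (boolP k) => kk.
  move=> e t e0 t0; apply: nearW => n; rewrite (_ : [set _ | _] = set0); last first.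
    by apply/seteqP; split => // w /=; rewrite subrr mul0r ltNge ltW.
  by rewrite measure0 lee_fin ltW.
apply: vanishes_le (hQ kk) => [n|n|n w]; last by rewrite mulr0n subr0 mul1r.
  by apply: measurable_funM => //; exact: (measurable_cmod (mQ n)).
exact: (measurable_cmod (mQ n)).
Qed.

(** No subsequence is extracted: [clt_along] shows that a small discrepancy together with a
    conditional law far from its limit cannot recur at all scales on one tree, and continuity from
    above makes this uniform up to small probability. *)
Theorem conditional_clt_in_prob : (~~ k -> vanishes mu (fun n w => cmod (Q n w))) ->
  cvg_in_prob mu cond_law limit_law.
Proof.
move=> hQ e e0; have vD := discrepancy_vanishes hQ.
have [N [mN N0 NG]] := ae_good.
have mG n : measurable_fun setT (cond_law n) by case: (bounded_cond_law n).
have mh : measurable_fun setT limit_law by case: bounded_limit_law.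
have mdiff n : measurable_fun setT (fun w => `|cond_law n w - limit_law w|).
  by apply: measurableT_comp => //; exact: measurable_funB.
have mlt n (c : R) : measurable [set w | (D n w < c)%R].
  rewrite -[X in measurable X]setTI.
  have -> : [set w | (D n w < c)%R] = D n @^-1` `]-oo, c[.
    by apply/seteqP; split => w /=; rewrite in_itv.
  exact: measurable_discrepancy.
(* The trees on which, at some time n, the discrepancy is below 1/(j+1) and the conditional law is
   still e-far from its limit. A tree in all of these sets would supply times contradicting
   [clt_along], so they decrease to the empty set. *)
pose F j := \bigcup_n ([set w | (D n w < j.+1%:R^-1)%R] `&` [set w | (e < `|cond_law n w - limit_law w|)%R]) `\` N.
have mF j : measurable (F j).
  apply: measurableD => //; apply: bigcup_measurable => n _.
  by apply: measurableI => //; exact: measurable_gt.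
have F0 : \bigcap_j F j = set0.
  apply/seteqP; split => // w Fw.
  have gw : good w by apply: contrapT => h; have [_ Nw] := Fw 0%N I; exact: Nw (NG w h).
  have /choice[M hM] : forall j, exists n, D n w < j.+1%:R^-1 /\ e < `|cond_law n w - limit_law w|.
    by move=> j; have [[n _ [h1 h2]] _] := Fw j I; exists n.
  have DM : D (M j) w @[j --> \oo] --> 0.
    apply: (@squeeze_cvgr _ _ _ _ (cst 0) (fun j => j.+1%:R^-1)); [|exact: cvg_cst|exact: cvg_harmonic].
    by apply: nearW => j; rewrite discrepancy_ge0/= ltW//; case: (hM j).
  have := clt_along gw DM; move/cvgrPdist_lt => /(_ e e0) [j _ /(_ j (leqnn j))] /=.
  by rewrite distrC ltNge ltW//; case: (hM j).
have cF : mu (F j) @[j --> \oo] --> 0%E.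
  rewrite -(measure0 mu) -F0; apply: nonincreasing_cvg_mu => //.
  - by rewrite (le_lt_trans (probability_le1 mu _))// ltry.
  - exact: bigcap_measurable.
  - apply/nonincreasing_seqP => j; apply/subsetPset => w [[n _ [h1 h2]] Nw]; split => //.
    exists n => //; split => //=; rewrite /= in h1; apply: lt_le_trans h1 _.
    by rewrite lef_pV2 ?posrE// ler_nat.
apply/fine_cvgP; split.
  by apply: nearW => n; rewrite fin_num_measure//; exact: measurable_gt.
apply/cvgrPdist_le => t t0; have t2 : 0 < t / 2 by rewrite divr_gt0.
have [j hj] : exists j, (mu (F j) <= (t / 2)%:E)%E.
  move/fine_cvgP : cF => [_ /cvgrPdist_le /(_ (t / 2) t2) [j _ /(_ j (leqnn j))]].
  rewrite /= sub0r normrN ger0_norm ?fine_ge0// => h.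
  by exists j; rewrite -[leLHS]fineK ?lee_fin// fin_num_measure.
pose c : R := j.+1%:R^-1.
have c0 : 0 < c by rewrite invr_gt0.
apply: filterS (vD (c / 2) (t / 2) (divr_gt0 c0 (ltr0n _ 2)) t2) => n hn.
rewrite /= sub0r normrN ger0_norm ?fine_ge0//.
rewrite -lee_fin fineK; last by rewrite fin_num_measure//; exact: measurable_gt.
have mDn := measurable_gt (c / 2) (measurable_discrepancy n).
apply: (@le_trans _ _ (mu ((F j `|` [set w | (c / 2 < D n w)%R]) `|` N))).
  apply: le_measure; rewrite ?inE.
  - exact: measurable_gt.
  - by apply: measurableU => //; exact: measurableU.
  - move=> w /= ew; have [Nw|Nw] := pselect (N w); first by right.
    left; have [Dw|Dw] := ltP (D n w) c; last by right => /=; lra.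
    by left; split => //; exists n.
have mAB : measurable (F j `|` [set w | (c / 2 < D n w)%R]) by exact: measurableU.
apply: (le_trans (measureU2 _ mAB mN)).
apply: (@le_trans _ _ (mu (F j) + mu [set w | (c / 2 < D n w)%R] + mu N)%E).
  by rewrite leeD// measureU2.
rewrite [X in (_ + X <= _)%E]N0 adde0.
by rewrite [t]splitr EFinD leeD.
Qed.

Theorem conditional_clt_ae : {ae mu, forall w, D n w @[n --> \oo] --> 0} ->
  {ae mu, forall w, cond_law n w @[n --> \oo] --> limit_law w}.
Proof.
move=> h; have := ae_good; move: h; apply: filterS2 => w Dw gw.
exact: (@clt_along w id gw Dw).
Qed.

Lemma discrepancy_cvg0 (p : R) : 1 < p <= 2 ->
  (\int[mu]_w (gsum (fun u w => y u w `^ p) 1 w)%:E < 1)%E ->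
  (~~ k -> {ae mu, forall w, cmod (Q n w) @[n --> \oo] --> 0}) ->
  {ae mu, forall w, D n w @[n --> \oo] --> 0}.
Proof.
move=> p12 Ep hQ.
have hT := weights_cvg0 mu_cyl ym my apos p12 Ep.
have hQ' : {ae mu, forall w, (1 - kR) * cmod (Q n w) @[n --> \oo] --> 0}.
  case: (boolP k) => kk.
    by apply: aeW => w; under eq_fun do rewrite subrr mul0r; exact: cvg_cst.
  have := hQ kk; apply: filterS => w.
  rewrite (_ : (fun n => (1 - _) * cmod (Q n w)) = (fun n => cmod (Q n w)))//.
  by apply/funext => n; rewrite mulr0n subr0 mul1r.
have := ae_W; have := hQ'; have := hT; apply: filterS3 => w c1 c2 c3.
rewrite /discrepancy -[X in _ --> X](addr0 0) -[X in _ --> X + _](addr0 0).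
by apply: cvgD => //; apply: cvgD => //; apply/norm_cvg0P; apply/subr_cvg0.
Qed.

(** If the limit of W_n is 0, every part of the discrepancy is dominated by W_n: the sum of squares
    is at most W_n^2, and |Q_n| is at most W_n. *)
Lemma discrepancy_cvg0_trivial : {ae mu, forall w, Winf w = 0} ->
  {ae mu, forall w, D n w @[n --> \oo] --> 0}.
Proof.
move=> h0; have := ae_W; move: h0; apply: filterS2 => w w0 cW; rewrite w0 in cW.
apply: (@squeeze_cvgr _ _ _ _ (cst 0) (fun n => W n w + W n w * W n w + W n w)).
- apply: nearW => n; rewrite discrepancy_ge0/= /discrepancy w0 subr0 ger0_norm//.
  apply: lerD; first apply: lerD => //.
    apply: gsum_sqr_le => // u; exact: weight_le_gsum.
  apply: le_trans (_ : cmod (Q n w) <= _); last exact: cmod_gsum_sqr_le.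
  by rewrite ler_piMl ?cmod_ge0//; case: k; rewrite ?subrr ?subr0.
- exact: cvg_cst.
- have -> : 0 = 0 + 0 * 0 + 0 :> R by ring.
  by apply: cvgD => //; apply: cvgD => //; exact: cvgM.
Qed.

End conditional_clt.

(** * Laws and independence *)

Section laws.
Context {d d' : measure_display} {T : measurableType d} {T' : measurableType d'} {R : realType}.
Variables (P : probability T R) (f : T -> T').
Hypothesis mf : measurable_fun setT f.

Definition mfun_of : {mfun T >-> T'} := HB.pack f (isMeasurableFun.Build _ _ _ _ f mf).

Definition law : probability T' R := distribution P mfun_of.

Lemma lawE (A : set T') : law A = P (f @^-1` A). Proof. by []. Qed.

Lemma ge0_integral_law (g : T' -> \bar R) : measurable_fun setT g -> (forall x, 0 <= g x)%E ->
  (\int[law]_x g x = \int[P]_w g (f w))%E.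
Proof.
move=> mg g0.
by rewrite /law/= /distribution ge0_integral_pushforward.
Qed.

Lemma ae_law (Q : T' -> Prop) : {ae law, forall x, Q x} -> {ae P, forall w, Q (f w)}.
Proof.
move=> [N [mN N0 NQ]]; exists (f @^-1` N); split => //.
- by rewrite -[X in measurable X]setTI; exact: mf.
- by move=> w /= h; exact: (NQ (f w)).
Qed.

End laws.

Section bounded_product_law.
Context {d d' : measure_display} {T : measurableType d} {U : measurableType d'} {R : realType}.
Variables (P : probability T R) (f : T -> U) (X : T -> R * R).
Hypotheses (mf : measurable_fun setT f) (mX : measurable_fun setT X).
Hypothesis indep : forall (A : set U) (B : set (R * R)), measurable A -> measurable B ->
  P (f @^-1` A `&` X @^-1` B) = (P (f @^-1` A) * P (X @^-1` B))%E.

Lemma ge0_integral_indep (F : U * (R * R) -> \bar R) : measurable_fun setT F -> (forall z, 0 <= F z)%E ->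
  (\int[P]_w F (f w, X w) = \int[P]_w \int[P]_w' F (f w, X w'))%E.
Proof.
move=> mF F0.
have mfX : measurable_fun setT (fun w => (f w, X w)) by exact: measurable_fun_pair.
rewrite -(ge0_integral_law P mfX mF F0).
have E A : measurable A -> (law P mf \x law P mX)%E A = law P mfX A.
  by move=> mA; apply: product_measure_unique => // B C mB mC; rewrite !lawE -indep.
transitivity (\int[(law P mf \x law P mX)%E]_z F z)%E.
  by apply: eq_measure_integral => A mA _; first [exact: (E A mA)|exact: (esym (E A mA))].
rewrite fubini_tonelli1// /fubini_F.
rewrite (ge0_integral_law P mf (g := fun x => (\int[law P mX]_y F (x, y))%E)).
- apply: eq_integral => w _; rewrite (ge0_integral_law P mX (g := fun y => F (f w, y)))//.
  exact: (measurableT_comp mF (@pair1_measurable _ _ U (R * R)%type (f w))).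
- exact: measurable_fun_fubini_tonelli_F.
- by move=> x; apply: integral_ge0 => y _.
Qed.

Lemma bounded_indep (F : U * (R * R) -> R) : bounded_mfun F ->
  bounded_mfun (fun w => \int[P]_w' F (f w, X w')) /\
  \int[P]_w F (f w, X w) = \int[P]_w \int[P]_w' F (f w, X w').
Proof.
move=> bF; have [mF [M hM]] := bF.
have b2 : bounded_mfun (fun z : T * T => F (f z.1, X z.2)).
  split; last by exists M => z; exact: hM.
  apply: (measurableT_comp mF); apply: measurable_fun_pair.
    exact: (measurableT_comp mf measurable_fst).
  exact: (measurableT_comp mX measurable_snd).
have b1 := bounded_mfun_Rintegral1 P b2; split; first exact: b1.
have bd : bounded_mfun (fun w => F (f w, X w)).
  split; last by exists M => w; exact: hM.
  by apply: (measurableT_comp mF); exact: measurable_fun_pair.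
have mFM : measurable_fun setT (fun z => (F z + M)%:E).
  by apply/measurable_EFinP; exact: measurable_funD.
have FM0 z : (0 <= (F z + M)%:E)%E.
  by have := hM z; rewrite ler_norml lee_fin => /andP[? ?]; lra.
have := ge0_integral_indep mFM FM0.
have iM := integrable_cst P M.
have id := bounded_mfun_integrable P bd.
rewrite EFin_Rintegral; last exact: (integrable_add id iM).
have inner w : (\int[P]_w' (F (f w, X w') + M)%:E = (\int[P]_w' F (f w, X w') + M)%:E)%E.
  have ib := bounded_mfun_integrable P (bounded_mfun_pair1 b2 w).
  rewrite EFin_Rintegral; last exact: (integrable_add ib iM).
  rewrite RintegralD; [|exact: measurableT|exact: ib|exact: iM].
  by rewrite Rintegral_probability_cst.
under [X in _ = X -> _]eq_integral do rewrite inner.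
have i1 := bounded_mfun_integrable P b1.
rewrite EFin_Rintegral; last exact: (integrable_add i1 iM).
rewrite RintegralD; [|exact: measurableT|exact: id|exact: iM].
rewrite RintegralD; [|exact: measurableT|exact: i1|exact: iM].
by move=> [] /addIr.
Qed.

End bounded_product_law.

Section complex_topology.
Context {R : realType}.

Lemma cvg_cplx (f : nat -> cplx R) (l : cplx R) :
  re (f n) @[n --> \oo] --> re l -> im (f n) @[n --> \oo] --> im l -> f n @[n --> \oo] --> l.
Proof.
move=> hr hi; apply/cvgrPdist_lt => e e0.
(* In the order of R[i] a positive element is real, so the bound e reduces to a real one. *)
have eE : e = toC (re e).
  by apply: cplxP; rewrite ?re_toC ?im_toC//; move: e0; rewrite ltcE => /andP[/eqP + _]; rewrite /im /= => ->.
have re0' : 0 < re e by move: e0; rewrite eE ltcR.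
have e2 : 0 < re e / 2 by rewrite divr_gt0.
move/cvgrPdist_lt : hr => /(_ _ e2) hr; move/cvgrPdist_lt : hi => /(_ _ e2) hi.
near=> n.
have h1 : `|re l - re (f n)| < re e / 2 by near: n.
have h2 : `|im l - im (f n)| < re e / 2 by near: n.
rewrite eE /toC; change (`|l - f n|) with ((cmod (l - f n))%:C%C); rewrite ltcR.
apply: (le_lt_trans (cmod_le_re_im _)); rewrite reD imD reN imN; lra.
Unshelve. all: by end_near. Qed.

Lemma cplx_lim (f : nat -> cplx R) (l : cplx R) :
  re (f n) @[n --> \oo] --> re l -> im (f n) @[n --> \oo] --> im l -> lim (f n @[n --> \oo]) = l.
Proof. by move=> hr hi; apply: cvg_lim; [exact: norm_hausdorff|exact: cvg_cplx]. Qed.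

Lemma continuous_Complex (phi : cplx R -> R) : continuous phi ->
  continuous (fun z : R * R => phi (Complex z.1 z.2)).
Proof.
move=> cphi z; apply: (@continuous_comp _ _ _ (fun z : R * R => Complex z.1 z.2 : cplx R) phi); last exact: cphi.
apply/cvgrPdist_lt => e e0.
have eE : e = toC (re e).
  by apply: cplxP; rewrite ?re_toC ?im_toC//; move: e0; rewrite ltcE => /andP[/eqP + _]; rewrite /im /= => ->.
have re0' : 0 < re e by move: e0; rewrite eE ltcR.
have e2 : 0 < re e / 2 by rewrite divr_gt0.
near=> t.
have h1 : `|z.1 - t.1| < re e / 2.
  near: t; have /cvgrPdist_lt/(_ _ e2) : (fst (t : R * R)) @[t --> z] --> z.1 by move=> A [e' e'0 he]; exists (ball z.1 e', setT) => /=; [split; [exact: nbhsx_ballx|exact: filterT]|move=> t [t1 _]; exact: he].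
  exact.
have h2 : `|z.2 - t.2| < re e / 2.
  near: t; have /cvgrPdist_lt/(_ _ e2) : (snd (t : R * R)) @[t --> z] --> z.2 by move=> A [e' e'0 he]; exists (setT, ball z.2 e') => /=; [split; [exact: filterT|exact: nbhsx_ballx]|move=> t [_ t2]; exact: he].
  exact.
rewrite eE /toC; set u := (X in `|X|); change (`|u|) with ((cmod u)%:C%C); rewrite ltcR.
apply: (le_lt_trans (cmod_le_re_im _)); rewrite /u reD imD reN imN !cplxE; lra.
Unshelve. all: by end_near. Qed.

(* Approximation by the functions (x, y) |-> phi (x, floor (n y) / n), which
   depend on y through a countably valued map. *)
Lemma continuous_measurable_fun2 (phi : R * R -> R) : continuous phi -> measurable_fun setT phi.
Proof.
move=> cphi.
pose k n (z : R * R) : int := Num.floor (n.+1%:R * z.2).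
pose F n (i : int) (z : R * R) := phi (z.1, i%:~R / n.+1%:R).
have mk n : countably_measurable (k n).
  move=> i; have m2 : measurable_fun setT (fun z : R * R => n.+1%:R * z.2 : R).
    by apply: measurable_funM => //; exact: measurable_snd.
  rewrite (_ : [set _ | _] = (fun z : R * R => n.+1%:R * z.2 : R) @^-1` `[i%:~R, (i + 1)%:~R[%classic).
    by rewrite -[X in measurable X]setTI; apply: m2 => //; exact: measurable_itv.
  apply/seteqP; split => z /=; rewrite in_itv/= /k.
    by move=> <-; rewrite floor_le ?ltzD1 // floorD1_gt.
  by move=> h; apply/eqP; rewrite floor_eq ?num_real.
have mF n i : measurable_fun setT (F n i).
  apply: (measurableT_comp (f := fun x : R => phi (x, i%:~R / n.+1%:R))); last exact: measurable_fst.
  apply: continuous_measurable_fun => x.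
  have hp : (x0, i%:~R / n.+1%:R : R) @[x0 --> x] --> (x, i%:~R / n.+1%:R : R).
    exact: (cvg_pair (@cvg_id _ (nbhs x)) (cvg_cst (i%:~R / n.+1%:R : R))).
  exact: (cvg_comp _ _ hp (cphi _)).
apply: (measurable_fun_cvg (fun n => measurable_fun_countable_case (mk n) (mF n))) => z _.
have cz : (z.1, (k n z)%:~R / n.+1%:R : R) @[n --> \oo] --> z.
  rewrite [X in _ --> X](_ : z = (z.1, z.2)); last by case: z.
  suff h : (fun n => (k n z)%:~R / n.+1%:R : R) @ \oo --> z.2.
    exact: (cvg_pair (@cvg_cst _ z.1 _ \oo _) h).
  apply: (@squeeze_cvgr _ _ _ _ (fun n => z.2 - n.+1%:R^-1) (fun=> z.2)).
  - apply: nearW => n; rewrite ler_pdivlMr// ler_pdivrMr// mulrBl mulVf ?pnatr_eq0//.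
    rewrite [z.2 * _]mulrC floor_le andbT lerBlDr.
    have := floorD1_gt (n.+1%:R * z.2); rewrite intrD => /ltW; exact.
  - rewrite -[X in _ --> X]subr0; apply: cvgB; [exact: cvg_cst|exact: cvg_harmonic].
  - exact: cvg_cst.
exact: (cvg_comp _ _ cz (cphi z)).
Qed.

End complex_topology.

(** * Transforms and moments of normal variables *)

Lemma measurable_fun_ocitv {d : measure_display} {T : measurableType d} {R : realType} (f : T -> R) :
  measurable_fun setT f -> measurable_fun setT (f : T -> measurableTypeR R).
Proof. by move=> mf mD B mB; exact: mf. Qed.

Lemma ge0_integral_normal_law {d : measure_display} {T : measurableType d} {R : realType}
    (P : probability T R) (f : T -> R) (m s : R) (g : R -> \bar R) :
  measurable_fun setT f ->
  (forall B : set R, measurable B -> P (f @^-1` B) = normal_prob m s B) ->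
  measurable_fun setT g -> (forall x, 0 <= g x)%E ->
  (\int[P]_w g (f w) = \int[normal_prob m s]_x g x)%E.
Proof.
move=> mf hf mg g0; have mf' := measurable_fun_ocitv mf.
have mg' : measurable_fun setT (g : measurableTypeR R -> \bar R) by move=> mD B mB; exact: mg.
rewrite -(ge0_integral_law P mf' mg' g0).
by apply: eq_measure_integral => A mA _; first [exact: (hf A mA)|exact: (esym (hf A mA))].
Qed.

Lemma Rintegral_normal_law {d : measure_display} {T : measurableType d} {R : realType}
    (P : probability T R) (f : T -> R) (m s : R) (g : R -> R) :
  measurable_fun setT f ->
  (forall B : set R, measurable B -> P (f @^-1` B) = normal_prob m s B) ->
  measurable_fun setT g -> (exists M, forall x, `|g x| <= M) ->
  \int[P]_w g (f w) = \int[normal_prob m s]_x g x.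
Proof.
move=> mf hf mg [M hM].
have mgM : measurable_fun setT (fun x => (g x + M)%:E).
  by apply/measurable_EFinP; exact: measurable_funD.
have gM0 x : (0 <= (g x + M)%:E)%E.
  by have := hM x; rewrite ler_norml lee_fin => /andP[? ?]; lra.
have := ge0_integral_normal_law mf hf mgM gM0.
have i1 : P.-integrable setT (EFin \o (fun w => g (f w))).
  apply: bounded_mfun_integrable; split; first exact: (measurableT_comp mg mf).
  by exists M => w; exact: hM.
have i2 : (normal_prob m s).-integrable setT (EFin \o g).
  by apply: bounded_mfun_integrable; split => //; exists M => x; exact: hM.
have iM1 := integrable_cst P M; have iM2 := integrable_cst (normal_prob m s) M.
rewrite (EFin_Rintegral (integrable_add i1 iM1)) (EFin_Rintegral (integrable_add i2 iM2)) => -[].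
rewrite RintegralD; [|exact: measurableT|exact: i1|exact: iM1].
rewrite RintegralD; [|exact: measurableT|exact: i2|exact: iM2].
by rewrite !Rintegral_probability_cst => /addIr.
Qed.

Section gaussian_laws.
Context {d : measure_display} {T : measurableType d} {R : realType}.
Variables (P : probability T R) (X : T -> cplx R).
Hypothesis mX : cmeasurable X.
Let X1 w := re (X w).
Let X2 w := im (X w).
Let mX1 : measurable_fun setT X1. Proof. by case: mX. Qed.
Let mX2 : measurable_fun setT X2. Proof. by case: mX. Qed.

Lemma real_normal_char : real_std_normal P X -> forall b s t : R,
  \int[P]_w cos (b + s * X1 w + t * X2 w) =
  expR (- ((s ^+ 2 + t ^+ 2 + true%:R * (s ^+ 2 - t ^+ 2)) / 4)) * cos b.
Proof.
move=> [_ [[N [mN N0 NX]] hX]] b s t.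
have E : \int[P]_w cos (b + s * X1 w + t * X2 w) = \int[P]_w cos (b + s * X1 w).
  rewrite /Rintegral; congr fine; apply: (integral_eq_off_null mN N0) => w _ Nw.
  have i0 : im (X w) = 0 by apply: contrapT => h; exact: Nw (NX w h).
  by rewrite /X2 i0 mulr0 addr0.
rewrite E.
have mc : measurable_fun setT (fun x : R => cos (b + s * x)).
  by apply: measurableT_comp; [exact: measurable_cos|apply: measurable_funD => //; exact: measurable_funM].
rewrite (Rintegral_normal_law mX1 hX mc); last by exists 1 => x; exact: normr_cos_le1.
have -> := @normal_prob_cos R 1 ltr01 b s.
by rewrite /=; congr (expR (- _) * _); field.
Qed.

Lemma real_normal_moment : real_std_normal P X ->
  (\int[P]_w (X1 w ^+ 2 + X2 w ^+ 2)%:E <= 1%:E)%E.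
Proof.
move=> [_ [[N [mN N0 NX]] hX]].
have -> : (\int[P]_w (X1 w ^+ 2 + X2 w ^+ 2)%:E = \int[P]_w (X1 w ^+ 2)%:E)%E.
  apply: (integral_eq_off_null mN N0) => w _ Nw.
  have i0 : im (X w) = 0 by apply: contrapT => h; exact: Nw (NX w h).
  by rewrite /X2 i0 expr0n addr0.
have msq : measurable_fun setT (fun x : R => (x ^+ 2)%:E).
  by apply/measurable_EFinP; exact: measurable_funX.
have sq0 (x : R) : (0 <= (x ^+ 2)%:E)%E by rewrite lee_fin sqr_ge0.
rewrite (ge0_integral_normal_law mX1 hX msq sq0).
have := @normal_prob_variance R 0 1 ltr01; rewrite expr1n => <-.
by rewrite le_eqVlt; apply/orP; left; apply/eqP; apply: eq_integral => x _; rewrite subr0.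
Qed.

Lemma complex_normal_moment : complex_std_normal P X ->
  (\int[P]_w (X1 w ^+ 2 + X2 w ^+ 2)%:E <= 1%:E)%E.
Proof.
move=> [_ [_ [_ <-]]].
by rewrite le_eqVlt; apply/orP; left; apply/eqP; apply: eq_integral => w _; rewrite cmod_nsq.
Qed.

Lemma complex_normal_char : complex_std_normal P X -> forall b s t : R,
  \int[P]_w cos (b + s * X1 w + t * X2 w) =
  expR (- ((s ^+ 2 + t ^+ 2 + false%:R * (s ^+ 2 - t ^+ 2)) / 4)) * cos b.
Proof.
move=> [_ [[r r0 hX] [ind m2]]] b s t.
have hX1 B (mB : measurable B) := (hX B mB).1.
have hX2 B (mB : measurable B) := (hX B mB).2.
have msq : measurable_fun setT (fun x : R => (x ^+ 2)%:E).
  by apply/measurable_EFinP; exact: measurable_funX.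
have sq0 (x : R) : (0 <= (x ^+ 2)%:E)%E by rewrite lee_fin sqr_ge0.
have var : (\int[normal_prob 0 r]_x (x ^+ 2)%:E = (r ^+ 2)%:E)%E.
  rewrite -(@normal_prob_variance R 0 r r0).
  by apply: eq_integral => x _; rewrite subr0.
(* Both coordinates have the same variance r^2, and the second moment of the modulus is 1. *)
have r2 : r ^+ 2 = 2^-1.
  have : (\int[P]_w (cmod (X w) ^+ 2)%:E = (r ^+ 2 + r ^+ 2)%:E)%E.
    under eq_integral do rewrite cmod_nsq /nsq EFinD.
    have m1 := measurableT_comp msq mX1; have m2' := measurableT_comp msq mX2.
    rewrite (ge0_integralD _ measurableT (fun w _ => sq0 (X1 w)) m1 (fun w _ => sq0 (X2 w)) m2').
    rewrite (ge0_integral_normal_law mX1 hX1 msq sq0) (ge0_integral_normal_law mX2 hX2 msq sq0).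
    by rewrite var.
  by rewrite m2 => -[]; lra.
have mcb b' s' : measurable_fun setT (fun x : R => cos (b' + s' * x)).
  by apply: measurableT_comp; [exact: measurable_cos|apply: measurable_funD => //; exact: measurable_funM].
have bcb b' s' : exists M, forall x : R, `|cos (b' + s' * x)| <= M.
  by exists 1 => x; exact: normr_cos_le1.
have char1 b' s' : \int[P]_w cos (b' + s' * X1 w) = expR (- (r ^+ 2 * s' ^+ 2 / 2)) * cos b'.
  by rewrite (Rintegral_normal_law mX1 hX1 (mcb b' s') (bcb b' s')) normal_prob_cos.
have char2 b' s' : \int[P]_w cos (b' + s' * X2 w) = expR (- (r ^+ 2 * s' ^+ 2 / 2)) * cos b'.
  by rewrite (Rintegral_normal_law mX2 hX2 (mcb b' s') (bcb b' s')) normal_prob_cos.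
pose F (z : R * (R * R)) := cos (b + s * z.1 + t * z.2.2).
have bF : bounded_mfun F.
  split; last by exists 1 => z; exact: normr_cos_le1.
  apply: measurableT_comp; first exact: measurable_cos.
  apply: measurable_funD.
    by apply: measurable_funD => //; apply: measurable_funM => //; exact: measurable_fst.
  apply: measurable_funM => //.
  exact: (measurableT_comp measurable_snd measurable_snd).
(* [bounded_indep] expects a pair as its second variable; the first entry is padding. *)
pose X0 w : R * R := (0, X2 w).
have mX0 : measurable_fun setT X0 by exact: measurable_fun_pair.
have ind' (A : set R) (B : set (R * R)) : measurable A -> measurable B ->
    P (X1 @^-1` A `&` X0 @^-1` B) = (P (X1 @^-1` A) * P (X0 @^-1` B))%E.
  move=> mA mB; apply: (ind A (pair 0 @^-1` B)) => //.
  by rewrite -[X in measurable X]setTI; apply: pair1_measurable.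
have [_ ->] := bounded_indep mX1 mX0 ind' bF.
rewrite /F /=.
under eq_Rintegral do rewrite char2.
have i1 : P.-integrable setT (EFin \o (fun w => cos (b + s * X1 w))).
  apply: bounded_mfun_integrable; split; first exact: (measurableT_comp (mcb b s) mX1).
  by exists 1 => w; exact: normr_cos_le1.
rewrite (RintegralZl _ _ i1)// char1 mulrA -expRD mulr0n mul0r addr0; congr (expR _ * _).
by rewrite r2; field.
Qed.

End gaussian_laws.

(** * The branching random walk as a marked tree *)

Section weights.
Context {R : realType}.
Local Notation tree := (tree R).

Lemma cexpD (a b : cplx R) : cexp (a + b) = cexp a * cexp b.
Proof.
by apply: cplxP; rewrite /cexp /toC !cplxE expRD cosD sinD /im /re /=; ring.
Qed.

Lemma cexp0 : cexp (0 : cplx R) = 1.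
Proof. by apply: cplxP; rewrite /cexp /toC !cplxE expR0 cos0 sin0 /im /re /=; ring. Qed.

Lemma nsq_cexp (z : cplx R) : nsq (cexp z) = expR (re z *+ 2).
Proof.
rewrite /cexp nsqM nsq_toC mulr2n expRD -expr2 /nsq /re /im /= cos2Dsin2; ring.
Qed.

Lemma cmod_cexp (z : cplx R) : cmod (cexp z) = expR (re z).
Proof.
have h : cmod (cexp z) ^+ 2 = expR (re z) ^+ 2.
  by rewrite cmod_nsq nsq_cexp mulr2n expRD -expr2.
by move/eqP: h; rewrite eqrXn2// ?cmod_ge0// ?expR_ge0// => /eqP.
Qed.

Lemma cmeasurable_cexp (l : cplx R) (f : tree -> R) : measurable_fun setT f ->
  cmeasurable (fun w => cexp (- l * toC (f w))).
Proof.
move=> mf.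
have mre : measurable_fun setT (fun w => re (- l * toC (f w))).
  rewrite (_ : (fun _ => _) = fun w => re (- l) * f w); last by apply/funext => w; rewrite !cplxE; ring.
  exact: measurable_funM.
have mim : measurable_fun setT (fun w => im (- l * toC (f w))).
  rewrite (_ : (fun _ => _) = fun w => im (- l) * f w); last by apply/funext => w; rewrite !cplxE; ring.
  exact: measurable_funM.
split.
  rewrite (_ : _ \o _ = fun w => expR (re (- l * toC (f w))) * cos (im (- l * toC (f w)))).
    apply: measurable_funM; first exact: measurableT_comp.
    by apply: measurableT_comp => //; exact: measurable_cos.
  by apply/funext => w; rewrite /=; ring.
rewrite (_ : _ \o _ = fun w => expR (re (- l * toC (f w))) * sin (im (- l * toC (f w)))).
  apply: measurable_funM; first exact: measurableT_comp.
    by apply: measurableT_comp => //; exact: (continuous_measurable_fun (@continuous_sin R)).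
by apply/funext => w; rewrite /=; ring.
Qed.

(** Three normalizations occur: c = 1 gives the plain exponential sums, c = m(l) the martingale
    Z_n(l), and c = m^(1/2) the weights of the central limit theorem. *)
Definition wgt (l c : cplx R) (u : seq nat) (w : tree) : cplx R :=
  cexp (- l * toC (tpos u w)) * c ^- size u.

Lemma multiplicative_wgt l c : multiplicative (wgt l c).
Proof.
split.
- move=> w; rewrite /wgt tpos_nil /= expr0 invr1 mulr1 -cexp0; congr cexp.
  by apply: cplxP; rewrite !cplxE; ring.
- move=> u v w; rewrite /wgt tpos_cat size_cat exprD invfM [RHS]mulrACA -cexpD; congr (cexp _ * _).
  by apply: cplxP; rewrite !cplxE; ring.
- by move=> u w w' h; rewrite /wgt (tpos_depends (leqnn _) h).
Qed.

Lemma cmeasurable_wgt l c u : cmeasurable (wgt l c u).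
Proof.
rewrite (_ : wgt l c u = fun w => c ^- size u * cexp (- l * toC (tpos u w))).
  by apply: cmeasurable_scale; apply: cmeasurable_cexp; exact: measurable_tpos.
by apply/funext => w; rewrite /wgt mulrC.
Qed.

Lemma nsq_wgt l c u w : nsq (wgt l c u w) =
  expR (- (2 * re l) * tpos u w) * nsq c ^- size u.
Proof.
rewrite /wgt nsqM nsq_cexp nsqV nsqX; congr (expR _ * _).
by rewrite !cplxE; ring.
Qed.

Lemma wgt_pos l c u w : c != 0 -> 0 < nsq (wgt l c u w).
Proof.
move=> c0; rewrite nsq_wgt mulr_gt0 ?expR_gt0// invr_gt0 exprn_gt0//.
by rewrite lt_neqAle eq_sym nsq_eq0 c0 nsq_ge0.
Qed.

Lemma gsum_wgt l c n w : gsum (wgt l c) n w = c ^- n * gsum (wgt l 1) n w.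
Proof.
rewrite /gsum mulr_sumr big_seq [RHS]big_seq; apply: eq_bigr => u /gen_size un.
by rewrite /wgt un expr1n invr1 mulr1 mulrC.
Qed.

Lemma wgt_real (t : R) u w : wgt (toC t) 1 u w = toC (expR (- t * tpos u w)).
Proof.
rewrite /wgt expr1n invr1 mulr1; apply: cplxP; rewrite /cexp /toC !cplxE /= /re /im /=.
  by rewrite !(mul0r, oppr0, mulr0, subr0, addr0, add0r, cos0, sin0, mulr1).
by rewrite !(mul0r, oppr0, mulr0, subr0, addr0, add0r, cos0, sin0, mulr1).
Qed.

End weights.

Section canonical_tree.
Context {d : measure_display} {T : measurableType d} {R : realType} {P : probability T R}.
Variable b : branching_walk P.
Local Notation tree := (tree R).
Local Notation cfg := (cfg R).

Definition tree_of (w : T) : tree := fun u => pproc b u w.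

Lemma measurable_pproc u : measurable_fun setT (pproc b u : T -> cfg).
Proof. by move=> _ B mB; rewrite setTI; apply: pproc_measurable; rewrite -cfg_measurableE. Qed.

Lemma measurable_tree_of : measurable_fun setT tree_of.
Proof. by apply: measurable_fun_tree => u; exact: measurable_pproc. Qed.

Definition tree_law : probability tree R := law P measurable_tree_of.
Definition cfg_law : probability cfg R := law P (measurable_pproc [::]).

Lemma tree_law_iid : iid_tree_law tree_law cfg_law.
Proof.
move=> s B us mB; rewrite lawE.
have -> : tree_of @^-1` cyl s B = \bigcap_(u in [set` s]) pproc b u @^-1` B u.
  by apply/seteqP; split => w /= h u us1; exact: h.
rewrite pproc_indep//.
rewrite big_seq [RHS]big_seq; apply: eq_bigr => u us1; exact: (pproc_identd b u (mB u us1)).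
Qed.

(** Finiteness is asked of every label, present in the tree or not, which makes this a countable
    intersection of almost sure events. On it, generations and their sums agree with the list
    versions on the tree. *)
Definition finite_walk (w : T) := forall u, (Defs.num b u w < +oo)%E.

Lemma finite_walk_null : exists N, [/\ measurable N, P N = 0%E & forall w, ~ N w -> finite_walk w].
Proof.
pose C : set cfg := [set c | c.1 = +oo%E].
have mC : measurable C.
  by rewrite -[X in measurable X]setTI; apply: (@measurable_num R measurableT [set +oo%E]); exact: emeasurable_set1.
have C0 u : P (pproc b u @^-1` C) = 0%E.
  rewrite (pproc_identd b u mC); have [N [mN N0 NF]] := num_fin b.
  apply: (@subset_measure0 _ _ _ P _ N) => //; last first.
    by move=> w /= Cw; apply: NF => /=; rewrite /C /= in Cw; rewrite Cw ltxx.
  exact: (pproc_measurable b [::] mC).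
exists (\bigcup_(u in [set: seq nat]) (pproc b u @^-1` C)); split.
- by apply: countable_bigcup_measurable => u _; exact: (pproc_measurable b u mC).
- pose F n := if unpickle n is Some u then pproc b u @^-1` C else set0.
  have -> : \bigcup_(u in [set: seq nat]) (pproc b u @^-1` C) = \bigcup_n F n.
    apply/seteqP; split => w [u _ h]; first by exists (pickle u) => //; rewrite /F pickleK.
    by move: h; rewrite /F; case: unpickle => // v h; exists v.
  have mF n : measurable (F n).
    by rewrite /F; case: unpickle => [u|]; [exact: (pproc_measurable b u mC)|exact: measurable0].
  apply: measure_negligible; first exact: bigcupT_measurable.
  apply: negligible_bigcup => n; exists (F n); split => //.
  by rewrite /F; case: unpickle => [u|]; [exact: C0|exact: measure0].
- move=> w Nw u; rewrite ltey; apply/eqP => h; apply: Nw; exists u => //.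
Qed.

Lemma ae_finite_walk (Q : T -> Prop) : (forall w, finite_walk w -> Q w) -> {ae P, forall w, Q w}.
Proof.
have [N [mN N0 h]] := finite_walk_null => hQ; exists N; split => // w nQ.
by apply: contrapT => /h /hQ.
Qed.

Lemma lt_num u w j : finite_walk w -> (j%:R%:E < Defs.num b u w)%E = (j < nchildren (tree_of w u))%N.
Proof.
move=> /(_ u); rewrite /nchildren /tree_of /pproc /=; case: (num_natP b u w) => [->//|[k ->] _].
by rewrite lte_fin ltr_nat /= natrK.
Qed.

Lemma generationE n w : finite_walk w -> generation b n w = [set` gen n (tree_of w)].
Proof.
move=> fw; elim: n => [|n ih] /=; first by apply/seteqP; split => u /=; rewrite inE => /eqP.
rewrite ih; apply/seteqP; split => u /=.
  move=> [v [j [vg [jN ->]]]]; apply/flatten_mapP; exists v => //; apply/mapP; exists j => //.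
  by rewrite mem_iota /= add0n -lt_num.
move=> /flatten_mapP[v vg /mapP[j]]; rewrite mem_iota /= add0n -lt_num// => jN ->.
by exists v, j.
Qed.

Lemma sum_labels_rcons (f : seq nat -> nat -> R) (v : seq nat) j :
  \sum_(i < size (rcons v j)) f (take i (rcons v j)) (nth 0%N (rcons v j) i) =
  \sum_(i < size v) f (take i v) (nth 0%N v i) + f v j.
Proof.
rewrite size_rcons big_ord_recr /= -cats1 take_size_cat// nth_cat ltnn subnn /=.
congr (_ + _); apply: eq_bigr => i _.
by rewrite takel_cat ?nth_cat ?ltn_ord// ltnW.
Qed.

Lemma tpos_tree_of n u w : finite_walk w -> u \in gen n (tree_of w) ->
  tpos u (tree_of w) = position b u w.
Proof.
move=> fw; elim: n u => [u|n ih u] /=.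
  by rewrite inE => /eqP ->; rewrite /tpos /position !big_ord0.
move=> /flatten_mapP[v vg /mapP[j]]; rewrite mem_iota /= add0n -lt_num// => jN ->.
rewrite /tpos /position (sum_labels_rcons (fun u i => (tree_of w u).2 i)).
rewrite (sum_labels_rcons (fun u i => pos b u i w)); congr (_ + _); first exact: ih.
by rewrite /tree_of /pproc /= jN.
Qed.

Lemma csumE n l w : finite_walk w -> csum b n l w = gsum (wgt l 1) n (tree_of w).
Proof.
move=> fw; rewrite /csum generationE// -fsbig_seq ?gen_uniq// /gsum big_seq [RHS]big_seq.
by apply: eq_bigr => u ug; rewrite /wgt expr1n invr1 mulr1 (tpos_tree_of fw ug).
Qed.

Lemma ZnE n l w : finite_walk w -> Zn b n l w = gsum (wgt l (cmgf b l)) n (tree_of w).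
Proof. by move=> fw; rewrite /Zn csumE//; exact: esym (gsum_wgt _ _ _ _). Qed.

(** The function f on the original space need not be measurable, since it is compared with g only
    off a null set. *)
Lemma ge0_integral_tree_law (g : tree -> \bar R) (f : T -> \bar R) :
  measurable_fun setT g -> (forall x, 0 <= g x)%E ->
  (forall w, finite_walk w -> f w = g (tree_of w)) ->
  (\int[P]_w f w = \int[tree_law]_w g w)%E.
Proof.
move=> mg g0 fg; rewrite (ge0_integral_law P measurable_tree_of mg g0).
have [N [mN N0 h]] := finite_walk_null.
by apply: (integral_eq_off_null mN N0) => w _ /h; exact: fg.
Qed.

Lemma integral_tree_law (g : tree -> \bar R) (f : T -> \bar R) :
  measurable_fun setT g ->
  (forall w, finite_walk w -> f w = g (tree_of w)) ->
  (\int[P]_w f w = \int[tree_law]_w g w)%E.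
Proof.
move=> mg fg; rewrite [LHS]integralE [RHS]integralE; congr (_ - _)%E.
  apply: ge0_integral_tree_law; first exact: measurable_funepos.
  - by move=> x; exact: funepos_ge0.
  - by move=> w /fg; rewrite !funeposE => ->.
apply: ge0_integral_tree_law; first exact: measurable_funeneg.
- by move=> x; exact: funeneg_ge0.
- by move=> w /fg; rewrite !funenegE => ->.
Qed.

Lemma mgfE t : mgf b t = (\int[tree_law]_w (gsum (fun u w => expR (- t * tpos u w)) 1 w)%:E)%E.
Proof.
apply: ge0_integral_tree_law.
- apply/measurable_EFinP; apply: measurable_gsum => u; apply: measurableT_comp => //.
  by apply: measurable_funM => //; exact: measurable_tpos.
- by move=> w; rewrite lee_fin gsum_ge0// => u w'; exact: expR_ge0.
- move=> w fw; rewrite generationE// -fsbig_seq ?gen_uniq// /gsum big_seq [in RHS]big_seq.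
  by congr EFin; apply: eq_bigr => u ug; rewrite (tpos_tree_of fw ug).
Qed.

Lemma cmgfE l : cmgf b l = Complex (\int[tree_law]_w re (gsum (wgt l 1) 1 w))
                                  (\int[tree_law]_w im (gsum (wgt l 1) 1 w)).
Proof.
have [m1 m2] := cmeasurable_gsum (cmeasurable_wgt l 1) 1.
rewrite /cmgf /cexpectation /Rintegral; congr (Complex (fine _) (fine _)).
  apply: integral_tree_law; first exact/measurable_EFinP.
  by move=> w fw; rewrite /= csumE.
apply: integral_tree_law; first exact/measurable_EFinP.
by move=> w fw; rewrite /= csumE.
Qed.

Lemma sigma2E l :
  sigma2 b l = (\int[tree_law]_w (nsq (gsum (wgt l (cmgf b l)) 1 w - 1))%:E)%E.
Proof.
have [m1 m2] := cmeasurable_add (cmeasurable_gsum (cmeasurable_wgt l (cmgf b l)) 1) (@cmeasurable_cst R _ tree (- 1)).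
apply: ge0_integral_tree_law.
- by apply/measurable_EFinP; rewrite /nsq; apply: measurable_funD; apply: measurable_funX.
- by move=> w; rewrite lee_fin nsq_ge0.
- by move=> w fw; rewrite cmod_nsq ZnE.
Qed.

Lemma supercriticalE : (\int[P]_w Defs.num b [::] w = \int[tree_law]_w ((size (gen 1 w))%:R : R)%:E)%E.
Proof.
apply: ge0_integral_tree_law.
- have h : measurable_fun setT (fun w : tree => \sum_(u <- gen 1 w) (1 : R)) by exact: measurable_sum_gen.
  rewrite (_ : (fun _ => _) = (fun w : tree => (\sum_(u <- gen 1 w) (1 : R))%:E)); first exact/measurable_EFinP.
  by apply/funext => w; rewrite big_const_seq count_predT iter_addr addr0.
- by move=> w; rewrite lee_fin ler0n.
- move=> w /(_ [::]); rewrite gen1 size_map size_iota /nchildren /tree_of /pproc /=.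
  by case: (num_natP b [::] w) => [->//|[k ->] _] /=; rewrite natrK.
Qed.

End canonical_tree.

Section complex_integrals.
Context {d : measure_display} {T : measurableType d} {R : realType}.
Variables (P : probability T R) (f : T -> cplx R).
Hypotheses (ir : P.-integrable setT (EFin \o (fun w => re (f w))))
  (ii : P.-integrable setT (EFin \o (fun w => im (f w)))).
Let e : cplx R := Complex (\int[P]_w re (f w)) (\int[P]_w im (f w)).

Lemma Rintegral_re_scale (a : cplx R) : \int[P]_w re (a * f w) = re (a * e).
Proof.
under eq_Rintegral do rewrite reM.
have i1 := integrable_scale (re a) ir; have i2 := integrable_scale (im a) ii.
rewrite (RintegralB measurableT i1 i2).
by rewrite (@RintegralZl _ _ R P setT (fun w => re (f w)) (re a) measurableT ir) (@RintegralZl _ _ R P setT (fun w => im (f w)) (im a) measurableT ii) reM.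
Qed.

Lemma Rintegral_im_scale (a : cplx R) : \int[P]_w im (a * f w) = im (a * e).
Proof.
under eq_Rintegral do rewrite imM.
have i1 := integrable_scale (re a) ii; have i2 := integrable_scale (im a) ir.
rewrite (RintegralD measurableT i1 i2).
by rewrite (@RintegralZl _ _ R P setT (fun w => im (f w)) (re a) measurableT ii) (@RintegralZl _ _ R P setT (fun w => re (f w)) (im a) measurableT ir) imM.
Qed.

Lemma integrable_re_scale (a : cplx R) : P.-integrable setT (EFin \o (fun w => re (a * f w))).
Proof.
rewrite (_ : (fun w => re (a * f w)) = fun w => re a * re (f w) - im a * im (f w)).
  exact: (integrable_sub (integrable_scale (re a) ir) (integrable_scale (im a) ii)).
by apply/funext => w; rewrite reM.
Qed.

Lemma cmod_expectation_le (G : T -> R) : P.-integrable setT (EFin \o G) ->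
  (forall w, cmod (f w) <= G w) -> cmod e <= \int[P]_w G w.
Proof.
move=> iG fG; have [->|e0] := eqVneq e 0.
  rewrite /cmod /= /ComplexField.Normc.normc /= expr0n addr0 sqrtr0.
  apply: Rintegral_ge0 => w _; exact: le_trans (cmod_ge0 _) (fG w).
have em : 0 < cmod e.
  by rewrite lt_neqAle cmod_ge0 andbT eq_sym -sqrf_eq0 cmod_nsq nsq_eq0.
(* Multiplying by the conjugate of e turns the integral into the real number |e|^2, so that the
   bound on |f| can be applied under a real integral. *)
pose a : cplx R := Complex (re e) (- im e).
have ae : re (a * e) = cmod e ^+ 2 by rewrite cmod_nsq /nsq !cplxE; ring.
have am : cmod a = cmod e by rewrite /cmod /= /ComplexField.Normc.normc /a /= sqrrN.
rewrite -(ler_pM2l em) -expr2 -ae -Rintegral_re_scale -(@RintegralZl _ _ R P setT G (cmod e) measurableT iG).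
apply: le_Rintegral => //; [exact: integrable_re_scale|exact: (integrable_scale (cmod e) iG)|].
move=> w _; apply: (le_trans (ler_norm _)); apply: (le_trans (norm_re_le_cmod _)).
by rewrite cmodM am ler_wpM2l// cmod_ge0.
Qed.

End complex_integrals.

Section walk_parameters.
Context {d : measure_display} {T : measurableType d} {R : realType} {P : probability T R}.
Variable b : branching_walk P.
Variables (lambda m_sqrt : cplx R).
Local Notation tree := (tree R).
Local Notation mu := (tree_law b).
Let mu_cyl : iid_tree_law mu (cfg_law b) := tree_law_iid b.
Local Notation theta := (re lambda).
Local Notation c := (cmgf b lambda).
Hypotheses (scr : supercritical b) (ld : dom b lambda) (c0 : c != 0).
Hypothesis s_theta : (sigma2 b (toC theta) < +oo)%E.
Hypothesis mgf_lt : (mgf b (2 * theta) < (cmod c ^+ 2)%:E)%E.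
Hypothesis m_sqrtE : m_sqrt ^+ 2 = norming b lambda.

Definition laplace (t : R) (w : tree) : R := gsum (fun u w => expR (- t * tpos u w)) 1 w.

Lemma measurable_laplace t : measurable_fun setT (laplace t).
Proof.
apply: measurable_gsum => u; apply: measurableT_comp => //.
by apply: measurable_funM => //; exact: measurable_tpos.
Qed.

Lemma laplace_ge0 t w : 0 <= laplace t w.
Proof. by apply: gsum_ge0 => u w'; exact: expR_ge0. Qed.

Lemma supercritical_tree_law : (1 < \int[mu]_w ((size (gen 1 w))%:R : R)%:E)%E.
Proof. by rewrite -supercriticalE. Qed.

(** A vanishing mean would leave almost surely no child, against supercriticality. *)
Lemma mgf_gt0 t : (0 < mgf b t)%E.
Proof.
rewrite mgfE lt_neqAle; apply/andP; split; last first.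
  by apply: integral_ge0 => w _; rewrite lee_fin; exact: laplace_ge0.
apply/eqP => E0.
have iS : mu.-integrable setT (EFin \o laplace t).
  apply: ge0_integrable; [exact: measurable_laplace|exact: laplace_ge0|by rewrite -E0 ltry].
have S0 : \int[mu]_w laplace t w = 0 by rewrite /Rintegral -E0.
have S0p : {ae mu, forall w, 0 <= laplace t w} by apply: aeW => w; exact: laplace_ge0.
have [N [mN N0 NS]] := ae_ge0_eq0 iS S0 S0p.
have : (\int[mu]_w ((size (gen 1 w))%:R : R)%:E = \int[mu]_w 0)%E.
  apply: (integral_eq_off_null mN N0) => w _ Nw.
  have : laplace t w = 0 by apply: contrapT => h; exact: Nw (NS w h).
  rewrite /laplace /gsum; case: (gen 1 w) => // u s.
  rewrite big_cons => /eqP; rewrite gt_eqF// ltr_wpDr ?expR_gt0//.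
  by apply: sumr_ge0 => v _; exact: expR_ge0.
rewrite integral0 => h; have := supercritical_tree_law; rewrite h.
by rewrite lte_fin ltr10.
Qed.

Lemma integrable_laplace t : (mgf b t < +oo)%E -> mu.-integrable setT (EFin \o laplace t).
Proof.
by rewrite mgfE => h; apply: ge0_integrable; [exact: measurable_laplace|exact: laplace_ge0|].
Qed.

Lemma Rintegral_laplace t : \int[mu]_w laplace t w = fine (mgf b t).
Proof. by rewrite mgfE. Qed.

Lemma fine_mgf_gt0 t : (mgf b t < +oo)%E -> 0 < fine (mgf b t).
Proof. by move=> h; rewrite fine_gt0// mgf_gt0. Qed.

Lemma mgf_fine t : (mgf b t < +oo)%E -> mgf b t = (fine (mgf b t))%:E.
Proof. by move=> h; rewrite fineK// ge0_fin_numE// ltW// mgf_gt0. Qed.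

Lemma gsum_wgt_real t w : gsum (wgt (toC t) 1) 1 w = toC (laplace t w).
Proof.
apply: cplxP; rewrite /gsum ?re_sum ?im_sum; under eq_bigr do rewrite wgt_real ?re_toC ?im_toC.
  by [].
by rewrite big1.
Qed.

Lemma cmgf_real t : cmgf b (toC t) = toC (fine (mgf b t)).
Proof.
rewrite cmgfE; apply: cplxP; rewrite ?re_Complex ?im_Complex ?re_toC ?im_toC.
  by under eq_Rintegral do rewrite gsum_wgt_real re_toC; exact: Rintegral_laplace.
by under eq_Rintegral do rewrite gsum_wgt_real im_toC; rewrite /Rintegral integral0.
Qed.

Lemma cmod_gsum_le l w : cmod (gsum (wgt l 1) 1 w) <= laplace (re l) w.
Proof.
rewrite /laplace /gsum.
apply: (big_ind2 (fun (z : cplx R) (r : R) => cmod z <= r)).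
- by rewrite /cmod /= /ComplexField.Normc.normc /= expr0n addr0 sqrtr0.
- by move=> z1 r1 z2 r2 h1 h2; apply: le_trans (cmodD _ _) (lerD h1 h2).
- move=> u _; rewrite /wgt expr1n invr1 mulr1 cmod_cexp ler_expR !cplxE.
  by rewrite mulr0 subr0.
Qed.

Lemma integrable_gsum_wgt l : (mgf b (re l) < +oo)%E ->
  mu.-integrable setT (EFin \o (fun w => re (gsum (wgt l 1) 1 w))) /\
  mu.-integrable setT (EFin \o (fun w => im (gsum (wgt l 1) 1 w))).
Proof.
move=> h; have iS := integrable_laplace h.
have [m1 m2] := cmeasurable_gsum (cmeasurable_wgt l 1) 1.
split; apply: (le_integrable measurableT _ _ iS).
- exact/measurable_EFinP.
- move=> w _; rewrite /= lee_fin (ger0_norm (laplace_ge0 _ _)).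
  exact: le_trans (norm_re_le_cmod _) (cmod_gsum_le _ _).
- exact/measurable_EFinP.
- move=> w _; rewrite /= lee_fin (ger0_norm (laplace_ge0 _ _)).
  exact: le_trans (norm_im_le_cmod _) (cmod_gsum_le _ _).
Qed.

Local Notation M := (fine (mgf b (2 * theta))).

Lemma mgf2_fin : (mgf b (2 * theta) < +oo)%E.
Proof. exact: lt_trans mgf_lt (ltry _). Qed.

Lemma mgf2_gt0 : 0 < M. Proof. exact: fine_mgf_gt0 mgf2_fin. Qed.

Let nsqc_gt0 : 0 < nsq c.
Proof. by rewrite lt_neqAle nsq_ge0 andbT eq_sym nsq_eq0. Qed.

(** The mean of the sum of |x_u|^2 over the first generation, hence the rate of the L2 theory; m(2
    theta) < |m(lambda)|^2 says that it is below 1. *)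
Definition ratio : R := M / nsq c.
Local Notation q := ratio.

Lemma ratio_gt0 : 0 < q. Proof. by rewrite divr_gt0// mgf2_gt0. Qed.

Lemma ratio_lt1 : q < 1.
Proof.
have h := mgf_lt; rewrite (mgf_fine mgf2_fin) lte_fin cmod_nsq in h.
by rewrite /ratio ltr_pdivrMr// mul1r.
Qed.

Local Notation x := (wgt lambda c).

(** The hypothesis on sigma_theta^2 enters here. The real sum at theta dominates |m(lambda)
    Z_1(lambda)|, so its second moment makes Z_1(lambda) square integrable. The bound in the proof
    is f^2 <= 2 (f - m)^2 + 2 m^2 with m = m(theta). *)
Lemma laplace_second_moment : (\int[mu]_w (laplace theta w ^+ 2)%:E < +oo)%E.
Proof.
pose mt := fine (mgf b theta); have mt0 : 0 < mt by exact: fine_mgf_gt0 ld.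
pose g w := (mt^-1 * laplace theta w - 1) ^+ 2.
have mg : measurable_fun setT g.
  by apply: measurable_funX; apply: measurable_funB => //; apply: measurable_funM => //; exact: measurable_laplace.
have fg : (\int[mu]_w (g w)%:E < +oo)%E.
  move: s_theta; rewrite sigma2E cmgf_real; congr (_ < _)%E; apply: eq_integral => w _.
  by rewrite gsum_wgt gsum_wgt_real expr1 /nsq; congr EFin; rewrite /g /mt !cplxE /toC /re /im /=; field; rewrite gt_eqF.
have ig : mu.-integrable setT (EFin \o (fun w => (2 * mt ^+ 2) * (g w + 1))).
  apply: integrable_scale; apply: integrable_add; last exact: integrable_cst.
  by apply: ge0_integrable => // w; exact: sqr_ge0.
have le w : laplace theta w ^+ 2 <= (2 * mt ^+ 2) * (g w + 1).
  have -> : (2 * mt ^+ 2) * (g w + 1) = 2 * (laplace theta w - mt) ^+ 2 + 2 * mt ^+ 2.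
    by rewrite /g; field; rewrite gt_eqF.
  have := sqr_ge0 (laplace theta w - 2 * mt); rewrite -subr_ge0; nra.
have /integrableP[_] : mu.-integrable setT (EFin \o (fun w => laplace theta w ^+ 2)).
  apply: (le_integrable measurableT _ _ ig).
    by apply/measurable_EFinP; apply: measurable_funX; exact: measurable_laplace.
  move=> w _; rewrite /= lee_fin (ger0_norm (sqr_ge0 _)) ger0_norm//.
  exact: le_trans (sqr_ge0 _) (le w).
by under eq_integral do rewrite /= (ger0_norm (sqr_ge0 _)).
Qed.

Lemma ccentered_gsum : ccentered mu (fun w => gsum x 1 w - 1).
Proof.
have [ir ii] := integrable_gsum_wgt ld.
have cE w : gsum x 1 w = c^-1 * gsum (wgt lambda 1) 1 w.
  by have := gsum_wgt lambda c 1 w; rewrite expr1.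
have mx := cmeasurable_gsum (cmeasurable_wgt lambda c) 1.
have ir' := integrable_re_scale ir ii c^-1.
have ec : Complex (\int[mu]_w re (gsum (wgt lambda 1) 1 w)) (\int[mu]_w im (gsum (wgt lambda 1) 1 w)) = c.
  by rewrite cmgfE.
split.
- exact: (cmeasurable_add mx (@cmeasurable_cst R _ tree (- 1))).
- pose G w := 2 * (nsq c^-1 * laplace theta w ^+ 2 + 1).
  have iG : mu.-integrable setT (EFin \o G).
    apply: integrable_scale; apply: integrable_add; last exact: integrable_cst.
    apply: integrable_scale; apply: ge0_integrable => [|w|]; last exact: laplace_second_moment.
      by apply: measurable_funX; exact: measurable_laplace.
    exact: sqr_ge0.
  have [m1 m2] := cmeasurable_add mx (@cmeasurable_cst R _ tree (- 1)).
  have /integrableP[_] : mu.-integrable setT (EFin \o (fun w => nsq (gsum x 1 w - 1))).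
    apply: (le_integrable measurableT _ _ iG).
      by apply/measurable_EFinP; rewrite /nsq; apply: measurable_funD; apply: measurable_funX.
    move=> w _; rewrite /= lee_fin (ger0_norm (nsq_ge0 _)) ger0_norm; last first.
      by rewrite mulr_ge0// addr_ge0// mulr_ge0 ?nsq_ge0 ?sqr_ge0.
    apply: (@le_trans _ _ (2 * (nsq (gsum x 1 w) + 1))).
      rewrite /nsq !cplxE subr0; set r := re _; set i := im _.
      have := sqr_ge0 (r + 1); have := sqr_ge0 i; nra.
    rewrite ler_pM2l// lerD2r cE nsqM ler_wpM2l ?nsq_ge0// -cmod_nsq lerXn2r// ?nnegrE ?cmod_ge0 ?laplace_ge0//.
    exact: cmod_gsum_le.
  by under eq_integral do rewrite /= (ger0_norm (nsq_ge0 _)).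
- under eq_Rintegral do rewrite cE reD reN re1.
  rewrite RintegralB; [|exact: measurableT|exact: ir'|exact: integrable_cst].
  by rewrite Rintegral_re_scale// ec mulVf// re1 Rintegral_probability_cst subrr.
- under eq_Rintegral do rewrite cE imD imN im1 oppr0 addr0.
  by rewrite Rintegral_im_scale// ec mulVf.
Qed.

Lemma expectation_nsq_wgt : (\int[mu]_w (gsum (fun u w => nsq (x u w)) 1 w)%:E = q%:E)%E.
Proof.
have E w : gsum (fun u w => nsq (x u w)) 1 w = (nsq c)^-1 * laplace (2 * theta) w.
  rewrite /laplace /gsum mulr_sumr big_seq [RHS]big_seq; apply: eq_bigr => u /gen_size un.
  by rewrite nsq_wgt un expr1 mulrC.
under eq_integral do rewrite E.
have iS := integrable_laplace mgf2_fin.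
rewrite EFin_Rintegral; last exact: (integrable_scale (nsq c)^-1 iS).
by rewrite (@RintegralZl _ _ R mu setT (laplace (2 * theta)) (nsq c)^-1 measurableT iS) Rintegral_laplace /ratio mulrC.
Qed.

Lemma cmod_cmgf2_le : cmod (cmgf b (2 * lambda)) <= M.
Proof.
have r2 : re (2 * lambda) = 2 * theta.
  by rewrite mulr_natl mulr2n reD; ring.
rewrite cmgfE -Rintegral_laplace -r2.
have h : (mgf b (re (2 * lambda)%R) < +oo)%E by rewrite r2; exact: mgf2_fin.
have [ir ii] := integrable_gsum_wgt h.
apply: (cmod_expectation_le ir ii (integrable_laplace h)) => w; exact: cmod_gsum_le.
Qed.

Lemma cmod_norming : cmod (norming b lambda) = M.
Proof.
rewrite /norming; case: ltP => h.
  by rewrite /cmod /= expr0n addr0 sqrtr_sqr ger0_norm// ltW// mgf2_gt0.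
by apply/eqP; rewrite eq_le h cmod_cmgf2_le.
Qed.

Lemma nsq_m_sqrt : nsq m_sqrt = M.
Proof.
have h : nsq m_sqrt ^+ 2 = M ^+ 2 by rewrite -nsqX m_sqrtE -cmod_nsq cmod_norming.
by move/eqP: h; rewrite eqrXn2// ?nsq_ge0 ?ltW ?mgf2_gt0// => /eqP.
Qed.

Lemma m_sqrt_neq0 : m_sqrt != 0.
Proof. by rewrite -nsq_eq0 nsq_m_sqrt gt_eqF// mgf2_gt0. Qed.

Lemma norming_neq0 : norming b lambda != 0.
Proof. by rewrite -m_sqrtE expf_neq0// m_sqrt_neq0. Qed.

Definition scaling : cplx R := c / m_sqrt.
Local Notation beta := scaling.

Lemma scaling_ratio : q * nsq beta = 1.
Proof.
rewrite /ratio /scaling nsqM nsqV nsq_m_sqrt.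
have h1 := mgf2_gt0; have h2 := nsqc_gt0.
by field; rewrite !gt_eqF.
Qed.

Lemma renormE : renorm x beta = wgt lambda m_sqrt.
Proof.
apply/funext => u; apply/funext => w; rewrite /renorm /wgt /scaling -mulrA; congr (_ * _).
by rewrite exprMn mulrA mulVf ?mul1r ?exprVn// expf_neq0.
Qed.

Lemma square_wgt u w : wgt lambda m_sqrt u w ^+ 2 = wgt (2 * lambda) (norming b lambda) u w.
Proof.
rewrite /wgt -m_sqrtE exprMn expr2 -cexpD exprVn -!exprM mulnC; congr (cexp _ * _).
by rewrite -mulr2n -mulr_natl; ring.
Qed.

Lemma gsum_square n w : gsum (fun u w => renorm x beta u w ^+ 2) n w =
  norming b lambda ^- n * gsum (wgt (2 * lambda) 1) n w.
Proof.
rewrite -gsum_wgt renormE /gsum; apply: eq_bigr => u _; exact: square_wgt.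
Qed.

Lemma nsq_renorm u w : nsq (renorm x beta u w) = expR (- (2 * theta) * tpos u w) * M ^- size u.
Proof. by rewrite renormE nsq_wgt nsq_m_sqrt. Qed.

Lemma gsum_wgt2 n w : gsum (wgt (toC (2 * theta)) (cmgf b (toC (2 * theta)))) n w =
  toC (gsum (fun u w => nsq (renorm x beta u w)) n w).
Proof.
rewrite gsum_wgt cmgf_real /gsum.
transitivity (toC (M ^- n * \sum_(u <- gen n w) expR (- (2 * theta) * tpos u w))).
  have toCX k (r : R) : toC r ^+ k = toC (r ^+ k).
    elim: k => [|k ih]; first by apply: cplxP; rewrite !expr0.
    by rewrite !exprS ih; apply: cplxP; rewrite !cplxE; ring.
  have toCV (r : R) : r != 0 -> (toC r)^-1 = toC r^-1.
    move=> r0; have h : toC r != 0 by rewrite -nsq_eq0 nsq_toC expf_neq0.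
    by apply: (mulfI h); rewrite mulfV//; apply: cplxP; rewrite !cplxE ?mulfV//; ring.
  rewrite toCX toCV ?expf_neq0 ?gt_eqF ?mgf2_gt0//.
  have -> : \sum_(u <- gen n w) wgt (toC (2 * theta)) 1 u w = toC (\sum_(u <- gen n w) expR (- (2 * theta) * tpos u w)).
    apply: cplxP; rewrite ?re_sum ?im_sum; under eq_bigr do rewrite wgt_real ?re_toC ?im_toC.
      by [].
    by rewrite big1.
  by apply: cplxP; rewrite !cplxE; ring.
congr toC; rewrite mulr_sumr big_seq [RHS]big_seq; apply: eq_bigr => u /gen_size un.
by rewrite nsq_renorm un mulrC.
Qed.

(** The mean of Q_1, that is m(2 lambda) / m: of modulus below 1 in the complex case, and equal to 1
    in the critical one. *)
Definition square_mean : cplx R := (norming b lambda)^-1 * cmgf b (2 * lambda).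

Let re2 : re (2 * lambda) = 2 * theta.
Proof. by rewrite mulr_natl mulr2n reD; ring. Qed.

Let i2 : mu.-integrable setT (EFin \o (fun w => re (gsum (wgt (2 * lambda) 1) 1 w))) /\
  mu.-integrable setT (EFin \o (fun w => im (gsum (wgt (2 * lambda) 1) 1 w))).
Proof. by apply: integrable_gsum_wgt; rewrite re2; exact: mgf2_fin. Qed.

Lemma square_mean_re :
  \int[mu]_w re (gsum (fun u w => renorm x beta u w ^+ 2) 1 w) = re square_mean.
Proof.
under eq_Rintegral do rewrite gsum_square expr1.
by have [h1 h2] := i2; rewrite Rintegral_re_scale// -cmgfE.
Qed.

Lemma square_mean_im :
  \int[mu]_w im (gsum (fun u w => renorm x beta u w ^+ 2) 1 w) = im square_mean.
Proof.
under eq_Rintegral do rewrite gsum_square expr1.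
by have [h1 h2] := i2; rewrite Rintegral_im_scale// -cmgfE.
Qed.

Lemma cmod_square_mean : cmod (cmgf b (2 * lambda)) < M -> cmod square_mean < 1.
Proof.
move=> h; rewrite /square_mean cmodM.
have -> : cmod (norming b lambda)^-1 = M^-1.
  have e : cmod (norming b lambda)^-1 ^+ 2 = M^-1 ^+ 2.
    by rewrite cmod_nsq nsqV -cmod_nsq cmod_norming exprVn.
  by move/eqP: e; rewrite eqrXn2// ?cmod_ge0 ?invr_ge0 ?ltW ?mgf2_gt0// => /eqP.
by rewrite mulrC ltr_pdivrMr ?mgf2_gt0// mul1r.
Qed.

Local Notation a := (renorm x beta).
Let xm := @multiplicative_wgt R lambda c.
Let mx u := cmeasurable_wgt lambda c u.
Let xpos u w : 0 < nsq (x u w) := wgt_pos lambda u w c0.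
Let am := multiplicative_renorm xm beta.
Let ma u := cmeasurable_renorm mx beta u.
Let y1 := expectation_renorm mx ratio_gt0 expectation_nsq_wgt scaling_ratio.
Let apos := renorm_pos xpos ratio_gt0 scaling_ratio.
Let W n w := gsum (fun u w => nsq (a u w)) n w.

Let W0 n w : 0 <= W n w. Proof. by apply: gsum_ge0 => u w'; exact: nsq_ge0. Qed.

Let iW : mu.-integrable setT (EFin \o W 1).
Proof.
apply: ge0_integrable => //; last by rewrite y1 ltry.
by apply: measurable_gsum => u; exact: measurable_nsq_weight.
Qed.

Definition critical : bool := cmod (cmgf b (2 * lambda)) == M.

(* In the critical case E sum (|a_u|^2 - Re a_u^2) = 0 over the first
   generation, which forces the renormalized weights a_u to be real. *)
Lemma critical_real_weights : critical ->
  {ae mu, forall w, forall u, u \in gen 1 w -> im (a u w) = 0}.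
Proof.
move=> /eqP hk.
have sm : square_mean = 1.
  by rewrite /square_mean; have := norming_neq0; rewrite /norming hk ltxx => h; rewrite mulVf.
have iQ : mu.-integrable setT (EFin \o (fun w => re (gsum (fun u w => a u w ^+ 2) 1 w))).
  rewrite (_ : (fun w => re _) = fun w => re ((norming b lambda)^-1 * gsum (wgt (2 * lambda) 1) 1 w)).
    by have [h1 h2] := i2; exact: integrable_re_scale.
  by apply/funext => w; rewrite gsum_square expr1.
pose G w := W 1 w - re (gsum (fun u w => a u w ^+ 2) 1 w).
have GE w : G w = \sum_(u <- gen 1 w) im (a u w) ^+ 2 *+ 2.
  rewrite /G /W /gsum re_sum -sumrB; apply: eq_bigr => u _.
  by rewrite expr2 reM /nsq; ring.
have G0 w : 0 <= G w by rewrite GE; apply: sumr_ge0 => u _; rewrite mulrn_wge0// sqr_ge0.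
have EG : \int[mu]_w G w = 0.
  rewrite (RintegralB measurableT iW iQ) square_mean_re sm re1.
  by rewrite [X in X - _](_ : _ = 1) ?subrr// /Rintegral y1.
have := ae_ge0_eq0 (integrable_sub iW iQ) EG (aeW _ G0).
apply: filterS => w /eqP; rewrite -/(G w) GE psumr_eq0; last by move=> u _; rewrite mulrn_wge0// sqr_ge0.
by move=> /allP h u /h /=; rewrite mulrn_eq0 /= sqrf_eq0 => /eqP.
Qed.

(** The scaling is the mean of the sum of the a_u over the first generation, and these are real in
    the critical case. As it is also nonzero, the unscaled weights x_u are real too. *)
Lemma critical_im_scaling : critical -> im beta = 0.
Proof.
move=> hk; have [N [mN N0 Na]] := critical_real_weights hk.
have [ir ii] := integrable_gsum_wgt ld.
have ec : Complex (\int[mu]_w re (gsum (wgt lambda 1) 1 w)) (\int[mu]_w im (gsum (wgt lambda 1) 1 w)) = c.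
  by rewrite cmgfE.
have aE w : gsum a 1 w = m_sqrt^-1 * gsum (wgt lambda 1) 1 w.
  by rewrite renormE; have := gsum_wgt lambda m_sqrt 1 w; rewrite expr1.
have -> : im beta = \int[mu]_w im (gsum a 1 w).
  under eq_Rintegral do rewrite aE.
  by rewrite (Rintegral_im_scale ir ii) ec /scaling mulrC.
transitivity (fine (\int[mu]_w 0)%E); last by rewrite integral0.
rewrite /Rintegral; apply: (congr1 fine); apply: (integral_eq_off_null mN N0) => w _ Nw.
have h : forall u, u \in gen 1 w -> im (a u w) = 0 by apply: contrapT => h; exact: Nw (Na w h).
by rewrite /gsum im_sum big_seq big1.
Qed.

Lemma critical_real : critical ->
  {ae mu, forall w, (forall n u, u \in gen n w -> im (x u w) = 0) /\ im (Zinf x w) = 0}.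
Proof.
move=> hk; have ib := critical_im_scaling hk.
have rb : re beta != 0.
  apply/eqP => rb; have := scaling_ratio; rewrite /nsq rb ib expr0n addr0 mulr0 => /eqP.
  by rewrite eq_sym oner_eq0.
apply: (real_weights mu_cyl xm); have := critical_real_weights hk; apply: filterS => w h u ug.
have := h u ug; rewrite /renorm (gen_size ug) expr1 imM ib mulr0 add0r => /eqP.
by rewrite mulf_eq0 (negbTE rb) orbF => /eqP.
Qed.

Lemma ae_good_walk : {ae mu, forall w, good x beta critical w}.
Proof.
have [hk|hk] := boolP critical; last first.
  by apply: aeW => w n.
have ib := critical_im_scaling hk.
have ibn n : im (beta ^+ n) = 0.
  by elim: n => [|n ih]; [rewrite expr0 im1|rewrite exprS imM ib ih mulr0 mul0r addr0].
have := critical_real hk; apply: filterS => w [h _] n _.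
apply: cplxP; rewrite /gsum ?re_sum ?im_sum ?re_toC ?im_toC.
  rewrite big_seq [RHS]big_seq; apply: eq_bigr => u ug.
  have ia : im (a u w) = 0 by rewrite /renorm imM (h n u ug) ibn mulr0 mul0r addr0.
  by rewrite expr2 reM /nsq ia; ring.
rewrite big_seq big1// => u ug.
have ia : im (a u w) = 0 by rewrite /renorm imM (h n u ug) ibn mulr0 mul0r addr0.
by rewrite expr2 imM ia; ring.
Qed.

Lemma critical_cpvar : critical -> cpvar mu (fluct x) = toC (limvar mu x q).
Proof.
move=> hk; apply: (cpvar_Zinf mu_cyl xm mx ccentered_gsum ratio_gt0 ratio_lt1 expectation_nsq_wgt).
by have := critical_real hk; apply: filterS => w [].
Qed.

Lemma noncritical_square_mean : ~~ critical -> cmod square_mean < 1.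
Proof. by move=> h; apply: cmod_square_mean; rewrite lt_neqAle h cmod_cmgf2_le. Qed.

Lemma noncritical_vanishes : ~~ critical ->
  vanishes mu (fun n w => cmod (gsum (fun u w => a u w ^+ 2) n w)).
Proof.
move=> h; exact: (squares_vanish mu_cyl am ma apos y1 supercritical_tree_law
  square_mean_re square_mean_im (noncritical_square_mean h)).
Qed.

Lemma ae_cvg_W : {ae mu, forall w, W n w @[n --> \oo] --> Winf x beta w}.
Proof.
apply: (ae_cvg_gsum mu_cyl (multiplicative_nsq am) _ _ y1).
  by move=> u; exact: measurable_nsq_weight.
by move=> u w; exact: nsq_ge0.
Qed.

(** The infimum in the definition of the third set supplies an exponent p at which the p-th powers
    of the weights have total mean below 1; the first set supplies the moment of W_1 of order gamma
    >= p. *)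
Lemma Lambda_moments : Lambda b (toC (2 * theta)) -> exists2 p, 1 < p <= 2 &
  (\int[mu]_w (gsum (fun u w => nsq (a u w) `^ p) 1 w)%:E < 1)%E /\
  (\int[mu]_w ((W 1 w + 1) `^ p)%:E < +oo)%E.
Proof.
have M0 := mgf2_gt0.
move=> [gam /=]; rewrite in_itv /= => /andP[gam1 gam2] [/interior_subset [_ L1] /interior_subset [_ [_ L3]]].
have [z [p pin <-] Lp] := ereal_inf_lt L3.
have /andP[p1 pgam] : 1 <= p <= gam by move: pin; rewrite /= in_itv.
move: Lp; rewrite cmgf_real re_toC.
have -> : cmod (toC M) = M by rewrite /cmod /= expr0n addr0 sqrtr_sqr ger0_norm// ltW.
move=> Lp.
have Mp0 : 0 < M `^ p by rewrite powR_gt0.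
have fp : (mgf b (p * (2 * theta)) < +oo)%E.
  by rewrite ltey; apply/eqP => h; move: Lp; rewrite h gt0_mulye ?lte_fin ?invr_gt0//.
have Lp' : fine (mgf b (p * (2 * theta))) / M `^ p < 1.
  by move: Lp; rewrite (mgf_fine fp) -EFinM lte_fin.
(* At the real parameter 2 theta the ratio for p = 1 is exactly 1, so a value below 1 is reached
   only for p > 1. *)
have p_gt1 : 1 < p.
  rewrite lt_neqAle p1 andbT; apply/eqP => e; move: Lp'.
  by rewrite -e mul1r powRr1 ?ltW// divff ?gt_eqF// ltxx.
exists p; first by rewrite p_gt1 (le_trans pgam gam2).
split.
  have E w : gsum (fun u w => nsq (a u w) `^ p) 1 w = (M `^ p)^-1 * laplace (p * (2 * theta)) w.
    rewrite /laplace /gsum mulr_sumr big_seq [RHS]big_seq; apply: eq_bigr => u /gen_size un.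
    rewrite nsq_renorm un expr1 powRM ?expR_ge0 ?invr_ge0 ?(ltW M0)// mulrC; congr (_ * _).
      have Mp : M `^ p != 0 by rewrite gt_eqF.
      apply: (mulIf Mp); rewrite mulVf// -powRM ?invr_ge0 ?(ltW M0)//.
      by rewrite mulVf ?powR1// gt_eqF.
    by rewrite -expRM; congr expR; ring.
  under eq_integral do rewrite E.
  have iS := integrable_laplace fp.
  rewrite EFin_Rintegral; last exact: (integrable_scale (M `^ p)^-1 iS).
  rewrite (@RintegralZl _ _ R mu setT (laplace (p * (2 * theta))) (M `^ p)^-1 measurableT iS).
  by rewrite Rintegral_laplace lte_fin mulrC.
have mW1 : measurable_fun setT (W 1).
  by apply: measurable_gsum => u; exact: measurable_nsq_weight.
have Wgam : (\int[mu]_w (W 1 w `^ gam)%:E < +oo)%E.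
  move: L1; congr (_ < _)%E; apply: ge0_integral_tree_law.
  - by apply/measurable_EFinP; exact: (measurableT_comp (measurable_powR gam) mW1).
  - by move=> w; rewrite lee_fin powR_ge0.
  - by move=> w fw; rewrite re_toC ZnE// gsum_wgt2 re_toC.
(* W + 1 >= 1 allows raising the exponent from p to gamma, and W + 1 is at most twice the larger of
   W and 1. *)
pose G w := 2 `^ gam * (W 1 w `^ gam + 1).
have iG : mu.-integrable setT (EFin \o G).
  apply: integrable_scale; apply: integrable_add; last exact: integrable_cst.
  apply: ge0_integrable => // [|w]; last exact: powR_ge0.
  exact: (measurableT_comp (measurable_powR gam) mW1).
have /integrableP[_] : mu.-integrable setT (EFin \o (fun w => (W 1 w + 1) `^ p)).
  apply: (le_integrable measurableT _ _ iG).
    apply/measurable_EFinP; apply: (measurableT_comp (measurable_powR p)).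
    exact: measurable_funD.
  move=> w _; rewrite /= lee_fin (ger0_norm (powR_ge0 _ _)) ger0_norm; last first.
    by rewrite mulr_ge0 ?powR_ge0// addr_ge0// powR_ge0.
  apply: (@le_trans _ _ ((W 1 w + 1) `^ gam)); first by rewrite ler_powR// lerDr.
  have gam0 : 0 <= gam by rewrite ltW// (lt_trans ltr01).
  rewrite /G mulrDr mulr1; have [W1|W1] := leP (W 1 w) 1.
    apply: (@le_trans _ _ (2 `^ gam)).
      by rewrite ge0_ler_powR ?nnegrE ?addr_ge0//; lra.
    by rewrite lerDr mulr_ge0// powR_ge0.
  apply: (@le_trans _ _ (2 `^ gam * W 1 w `^ gam)); last by rewrite lerDl powR_ge0.
  rewrite -powRM//; apply: ge0_ler_powR; rewrite ?nnegrE ?addr_ge0 ?mulr_ge0//; lra.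
by under eq_integral do rewrite /= (ger0_norm (powR_ge0 _ _)).
Qed.

Lemma Lambda_discrepancy : Lambda b (toC (2 * theta)) ->
  {ae mu, forall w, discrepancy x beta critical n w @[n --> \oo] --> 0}.
Proof.
move=> /Lambda_moments[p p12 [Ep hp]].
apply: (discrepancy_cvg0 mu_cyl xm mx xpos ratio_gt0 expectation_nsq_wgt scaling_ratio p12 Ep) => hk.
exact: (squares_cvg0 mu_cyl am ma y1 square_mean_re square_mean_im (noncritical_square_mean hk) p12 Ep hp).
Qed.

Lemma ae_tree_law (Q : tree -> Prop) : {ae mu, forall w, Q w} -> {ae P, forall w, Q (tree_of b w)}.
Proof. exact: ae_law. Qed.

Lemma ae_finite : {ae P, forall w, finite_walk b w}.
Proof. by apply: ae_finite_walk => w fw; exact: fw. Qed.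

Lemma ae_Zlim : {ae P, forall w, Zlim b lambda w = Zinf x (tree_of b w)}.
Proof.
have [G _ hG] := gsum_dominated mu_cyl xm mx ccentered_gsum ratio_gt0 ratio_lt1 expectation_nsq_wgt.
have := ae_tree_law hG; have := ae_finite; apply: filterS2 => w fw [hr [hi _]].
rewrite /Zlim (_ : (fun n => Zn b n lambda w) = fun n => gsum x n (tree_of b w)).
  exact: cplx_lim.
by apply/funext => n; rewrite ZnE.
Qed.

Lemma ae_Zlim2 : {ae P, forall w, Zlim b (toC (2 * theta)) w = toC (Winf x beta (tree_of b w))}.
Proof.
have := ae_tree_law ae_cvg_W; have := ae_finite; apply: filterS2 => w fw hW.
rewrite /Zlim (_ : (fun n => Zn b n (toC (2 * theta)) w) = fun n => toC (W n (tree_of b w))).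
  by apply: cplx_lim; [exact: hW|exact: cvg_cst].
by apply/funext => n; rewrite ZnE// gsum_wgt2.
Qed.

Lemma ae_Winf_ge0 : {ae mu, forall w, 0 <= Winf x beta w}.
Proof.
have := ae_cvg_W; apply: filterS => w hW.
rewrite -(cvg_lim (@Rhausdorff R) hW); apply: limr_ge; first by apply/cvg_ex; exists (Winf x beta w).
exact: nearW.
Qed.

Lemma trivial_discrepancy : {ae P, forall w, Zlim b (toC (2 * theta)) w = 0} ->
  {ae mu, forall w, discrepancy x beta critical n w @[n --> \oo] --> 0}.
Proof.
move=> hZ.
apply: (discrepancy_cvg0_trivial mu_cyl xm mx xpos ratio_gt0 expectation_nsq_wgt scaling_ratio).
have mWi : measurable_fun setT (Winf x beta).
  apply: measurable_ulim => n; apply: measurable_gsum => u; exact: measurable_nsq_weight.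
have h0 : {ae P, forall w, Winf x beta (tree_of b w) = 0}.
  have := ae_Zlim2; move: hZ; apply: filterS2 => w -> /(congr1 re).
  by rewrite re0 re_toC.
have mN : measurable (Winf x beta @^-1` [set~ 0]).
  by rewrite -[X in measurable X]setTI; apply: mWi => //; apply: measurableC; exact: measurable_set1.
exists (Winf x beta @^-1` [set~ 0]); split => //.
rewrite lawE; case: h0 => N [mN' N0 hN].
apply: (@subset_measure0 _ _ _ P _ N) => //.
by rewrite -[X in measurable X]setTI; apply: measurable_tree_of.
Qed.

End walk_parameters.

(** * Conditional expectations *)

Section walk_filtration.
Context {d : measure_display} {T : measurableType d} {R : realType} {P : probability T R}.
Variable b : branching_walk P.
Local Notation tree := (tree R).
Local Notation cfg := (cfg R).
Local Notation tree_of := (tree_of b).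
Local Notation past n := (fun u : seq nat => (size u < n)%N).

(** The sets of this form are stable under complements and countable unions, so only generators
    matter. The dependence on the past is recorded because splicing at depth n must leave the event
    unchanged. *)
Lemma filtration_preimage n A : filtration b n A -> exists B : set tree,
  [/\ measurable B, depends_on (past n) (fun w => w \in B) & A = tree_of @^-1` B].
Proof.
move: A; apply: smallest_sub.
- split.
  + by exists set0; split => //; move=> w w' _; rewrite !in_set0.
  + move=> _ [B [mB dB ->]]; exists (~` B); split; first exact: measurableC.
    * by move=> w w' h; rewrite !in_setC (dB w w' h).
    * by apply/seteqP; split => w //= [].
  + move=> A /choice[B hB]; exists (\bigcup_k B k); split.
    * by apply: bigcupT_measurable => k; case: (hB k).
    * move=> w w' h; apply/idP/idP; rewrite !inE => -[k _ Bk]; exists k => //.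
        by have [_ dB _] := hB k; rewrite -inE -(dB w w' h) inE.
      by have [_ dB _] := hB k; rewrite -inE (dB w w' h) inE.
    * apply/seteqP; split => w [k _ h]; exists k => //; have [_ _ e] := hB k.
        by move: h; rewrite e.
      by rewrite e.
- move=> _ [u [un [B mB ->]]]; exists ((fun w : tree => w u : cfg) @^-1` B); split => //.
  + by rewrite -[X in measurable X]setTI; exact: measurable_coord.
  + by move=> w w' h; apply/idP/idP; rewrite !inE /= (h u un).
Qed.

Lemma filtration_oo_preimage A : filtration_oo b A -> exists2 B : set tree,
  measurable B & A = tree_of @^-1` B.
Proof.
move: A; apply: smallest_sub.
- split.
  + by exists set0.
  + move=> _ [B mB ->]; exists (~` B); first exact: measurableC.
    by apply/seteqP; split => w //= [].
  + move=> A hA.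
    have /choice[B hB] : forall k, exists B : set tree, measurable B /\ A k = tree_of @^-1` B.
      by move=> k; have [B] := hA k; exists B.
    exists (\bigcup_k B k).
      by apply: bigcupT_measurable => k; case: (hB k).
    by apply/seteqP; split => w [k _ h]; exists k => //; have [_ e] := hB k; move: h; rewrite e.
- by move=> A [n _ /filtration_preimage[B [mB _ e]]]; exists B.
Qed.

Let past_generators n : set (set T) := [set A | exists u, (size u < n)%N /\
  exists2 B, config_measurable B & A = pproc b u @^-1` B].

Lemma filtration_of_preimage n (f : tree -> R) : measurable_fun setT f ->
  depends_on (past n) f -> forall B : set R, measurable B ->
  filtration b n ((f \o tree_of) @^-1` B).
Proof.
move=> mf df B mB.
(* All marks from depth n on are replaced by a constant. The resulting tree is measurable with
   respect to F_n, and f cannot tell it from the original. *)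
pose past_tree (w : g_sigma_algebraType (past_generators n)) : tree :=
  fun u => if (size u < n)%N then pproc b u w else (0%E, fun=> 0).
have mp : measurable_fun setT past_tree.
  apply: measurable_fun_tree => u; rewrite /past_tree; case: (boolP (size u < n)%N) => un; last exact: measurable_cst.
  move=> _ C mC; rewrite setTI; apply: sub_sigma_algebra; exists u; split => //.
  by exists C => //; rewrite -cfg_measurableE.
rewrite (_ : (f \o tree_of) @^-1` B = (f \o past_tree) @^-1` B).
  by have := measurableT_comp mf mp; move=> /(_ measurableT B mB); rewrite setTI.
apply/seteqP; split => w /=; rewrite (df (tree_of w) (past_tree w))// => u un;
  by rewrite /past_tree un.
Qed.

Lemma filtration_oo_of_preimage (A : set tree) : measurable A ->
  filtration_oo b (tree_of @^-1` A).
Proof.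
move=> mA; pose f (w : g_sigma_algebraType (\bigcup_n filtration b n)) : tree := tree_of w.
have mf : measurable_fun setT f.
  apply: measurable_fun_tree => u _ C mC; rewrite setTI; apply: sub_sigma_algebra.
  exists (size u).+1 => //; apply: sub_sigma_algebra; exists u; split => //.
  by exists C => //; rewrite -cfg_measurableE.
by have := mf measurableT A mA; rewrite setTI.
Qed.

Lemma filtration_oo_of_preimage_fun (f : tree -> R) : measurable_fun setT f ->
  forall B : set R, measurable B -> filtration_oo b ((f \o tree_of) @^-1` B).
Proof.
move=> mf B mB; apply: (filtration_oo_of_preimage (A := f @^-1` B)).
by rewrite -[X in measurable X]setTI; exact: mf.
Qed.

Lemma cvg_in_prob_tree_law (f : nat -> tree -> R) (g : tree -> R) :
  cvg_in_prob (tree_law b) f g -> cvg_in_prob P (fun n w => f n (tree_of w)) (g \o tree_of).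
Proof. by move=> h e e0; exact: (h e e0). Qed.

Lemma integral_tree_law_in (B : set tree) (g : tree -> \bar R) (f : T -> \bar R) :
  measurable B -> measurable_fun setT g ->
  {ae P, forall w, f w = g (tree_of w)} ->
  (\int[P]_(w in tree_of @^-1` B) f w = \int[tree_law b]_(w in B) g w)%E.
Proof.
move=> mB mg [N [mN N0 hN]].
transitivity (\int[P]_(w in tree_of @^-1` B) g (tree_of w))%E.
  apply: (integral_eq_off_null mN N0) => w _ Nw.
  by apply: contrapT => h; exact: Nw (hN w h).
rewrite integral_mkcond [RHS]integral_mkcond; apply: integral_tree_law.
  exact/(measurable_restrictT _ mB)/measurable_funTS.
by [].
Qed.

End walk_filtration.

Section conditional_laws.
Context {d : measure_display} {T : measurableType d} {R : realType} {P : probability T R}.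
Variable b : branching_walk P.
Variables (lambda m_sqrt : cplx R).
Local Notation tree := (tree R).
Local Notation mu := (tree_law b).
Local Notation c := (cmgf b lambda).
Local Notation x := (wgt lambda c).
Local Notation q := (ratio b lambda).
Local Notation beta := (scaling b lambda m_sqrt).
Hypotheses (scr : supercritical b) (ld : dom b lambda) (c0 : c != 0).
Hypothesis s_theta : (sigma2 b (toC (re lambda)) < +oo)%E.
Hypothesis mgf_lt : (mgf b (2 * re lambda) < (cmod c ^+ 2)%:E)%E.
Hypothesis m_sqrtE : m_sqrt ^+ 2 = norming b lambda.
Let mu_cyl : iid_tree_law mu (cfg_law b) := tree_law_iid b.
Let xm : multiplicative x := multiplicative_wgt lambda c.
Let mx u : cmeasurable (x u) := cmeasurable_wgt lambda c u.
Let xic := ccentered_gsum scr ld c0 s_theta.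
Let q0 := ratio_gt0 scr c0 mgf_lt.
Let q1 := ratio_lt1 scr c0 mgf_lt.
Let xq := expectation_nsq_wgt mgf_lt.

Variable phi : cplx R -> R.
Let psi (z : R * R) := phi (Complex z.1 z.2).
Hypothesis bpsi : bounded_mfun psi.
Let psiE z : phi z = psi (re z, im z). Proof. by rewrite /psi; case: z. Qed.

Lemma fluctuation_condexp n : is_condexp P (filtration b n)
  (phi \o fun w => c ^+ n / m_sqrt ^+ n * (Zlim b lambda w - Zn b n lambda w))
  (fun w => cond_law mu x beta psi n (tree_of b w)).
Proof.
have bg := bounded_cond_law mu_cyl xm mx xic q0 q1 xq beta bpsi n.
have dg := cond_law_depends mu xm beta psi (n := n).
have [mg [C hC]] := bg.
split; first by move=> B mB; exact: (filtration_of_preimage mg dg mB).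
split.
  apply: bounded_mfun_integrable; split; last by exists C => w; exact: hC.
  exact: (measurableT_comp mg (measurable_tree_of b)).
move=> _ /filtration_preimage[B [mB dB ->]].
pose F (w : tree) : cplx R := beta ^+ n * (Zinf x w - gsum x n w).
have mF : cmeasurable F.
  apply: cmeasurable_scale; apply: cmeasurable_add; first exact: cmeasurable_Zinf.
  rewrite (_ : (fun w => - _) = fun w => -1 * gsum x n w).
    by apply: cmeasurable_scale; exact: cmeasurable_gsum.
  by apply/funext => w; rewrite mulN1r.
have [mF1 mF2] := mF.
have mpF : measurable_fun setT (fun w => (psi (re (F w), im (F w)))%:E).
  apply/measurable_EFinP; apply: (measurableT_comp (proj1 bpsi)).
  exact: measurable_fun_pair.
transitivity (\int[mu]_(w in B) (cond_law mu x beta psi n w)%:E)%E.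
  apply: integral_tree_law_in => //; first exact/measurable_EFinP.
  exact: aeW.
rewrite (cond_law_condexp mu_cyl xm mx xic q0 q1 xq beta bpsi mB dB).
transitivity (\int[mu]_(w in B) (psi (re (F w), im (F w)))%:E)%E.
  have [N [mN N0 hN]] := ae_remainder mu_cyl xm mx xic q0 q1 xq beta.
  apply: (integral_eq_off_null mN N0) => w _ Nw.
  by have <- : F w = remainder x beta n (w, w) by apply: contrapT => h; apply: Nw; apply: hN => /(_ n).
apply/esym; apply: integral_tree_law_in => //.
have := ae_Zlim scr ld c0 s_theta mgf_lt; have := ae_finite b; apply: filterS2 => w fw Zw.
rewrite /= psiE Zw (ZnE n lambda fw) -/(F _).
have -> : c ^+ n / m_sqrt ^+ n = beta ^+ n by rewrite /scaling exprMn exprVn.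
by [].
Qed.

Variable X : T -> cplx R.
Hypothesis mX : cmeasurable X.
Hypothesis indX : cindependent P (filtration_oo b) X.
Let X1 w := re (X w).
Let X2 w := im (X w).
Let mX1 : measurable_fun setT X1. Proof. by case: mX. Qed.
Let mX2 : measurable_fun setT X2. Proof. by case: mX. Qed.

Lemma sqrt_limvar w : 0 <= Winf x beta w ->
  Num.sqrt (fine (sigma2 b lambda)) / Num.sqrt (1 - fine (mgf b (2 * re lambda)) / cmod c ^+ 2)
  * Num.sqrt (Winf x beta w) = Num.sqrt (limvar mu x q * Winf x beta w).
Proof.
move=> W0; have q1' : 0 <= 1 - q by rewrite subr_ge0 ltW.
rewrite cmod_nsq -/q /limvar /cvar /Rintegral -sigma2E.
have s0 : 0 <= fine (sigma2 b lambda).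
  by apply: fine_ge0; apply: integral_ge0 => w' _; rewrite lee_fin sqr_ge0.
by rewrite -sqrtrV// -sqrtrM// -sqrtrM// mulr_ge0// invr_ge0.
Qed.

Lemma limit_condexp : is_condexp P (filtration_oo b)
  (phi \o fun w => toC (Num.sqrt (fine (sigma2 b lambda))
     / Num.sqrt (1 - fine (mgf b (2 * re lambda)) / cmod c ^+ 2)
     * Num.sqrt (re (Zlim b (toC (2 * re lambda)) w))) * X w)
  (fun w => limit_law mu x q beta P X1 X2 psi (tree_of b w)).
Proof.
have bh := bounded_limit_law mu mx q beta P mX1 mX2 bpsi.
have [mh [C hC]] := bh.
have bhT : bounded_mfun (fun w => limit_law mu x q beta P X1 X2 psi (tree_of b w)).
  by split; [exact: (measurableT_comp mh (measurable_tree_of b))|exists C => w; exact: hC].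
split.
  by move=> B mB; exact: (filtration_oo_of_preimage_fun mh mB).
split; first exact: bounded_mfun_integrable.
move=> _ /filtration_oo_preimage[B mB ->].
pose s w := Num.sqrt (limvar mu x q * Winf x beta w).
have mS : measurable_fun setT s.
  apply: (measurableT_comp (continuous_measurable_fun (@sqrt_continuous R))).
  apply: measurable_funM => //; apply: measurable_ulim => n; apply: measurable_gsum => u.
  by apply: measurable_nsq_weight => v; exact: cmeasurable_renorm.
pose F (z : tree * (R * R)) := \1_B z.1 * psi (s z.1 * z.2.1, s z.1 * z.2.2).
have [mpsi [M hM]] := bpsi.
have bF : bounded_mfun F.
  split.
    apply: measurable_funM; first exact: (measurableT_comp (measurable_indic mB) measurable_fst).
    apply: (measurableT_comp mpsi); apply: measurable_fun_pair; apply: measurable_funM.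
    - exact: (measurableT_comp mS measurable_fst).
    - exact: (measurableT_comp measurable_fst measurable_snd).
    - exact: (measurableT_comp mS measurable_fst).
    - exact: (measurableT_comp measurable_snd measurable_snd).
  exists M => z; rewrite /F normrM -[leRHS]mul1r ler_pM// indicE.
  by case: (_ \in _); rewrite ?normr1 ?normr0.
have mX12 : measurable_fun setT (fun w => (X1 w, X2 w)) by exact: measurable_fun_pair.
have ind' (A : set tree) (C' : set (R * R)) : measurable A -> measurable C' ->
    P (tree_of b @^-1` A `&` (fun w => (X1 w, X2 w)) @^-1` C') =
    (P (tree_of b @^-1` A) * P ((fun w => (X1 w, X2 w)) @^-1` C'))%E.
  by move=> mA mC; apply: indX => //; exact: filtration_oo_of_preimage.
have [b1 EF] := bounded_indep (measurable_tree_of b) mX12 ind' bF.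
have bFX : bounded_mfun (fun w => F (tree_of b w, (X1 w, X2 w))).
  have [mF [M' hM']] := bF; split; last by exists M' => w; exact: hM'.
  by apply: (measurableT_comp mF); apply: measurable_fun_pair => //; exact: measurable_tree_of.
have indicI (f : T -> R) : (\int[P]_(w in tree_of b @^-1` B) (f w)%:E =
    \int[P]_w (\1_B (tree_of b w) * f w)%:E)%E.
  rewrite integral_mkcond; apply: eq_integral => w _; rewrite /patch indicE.
  rewrite (_ : (w \in _) = (tree_of b w \in B)); last by apply/idP/idP; rewrite !inE.
  by case: (_ \in _); rewrite ?mul1r ?mul0r.
transitivity (\int[P]_w (\int[P]_w' F (tree_of b w, (X1 w', X2 w')))%:E)%E.
  rewrite indicI; apply: eq_integral => w _; congr EFin.
  rewrite /F /= indicE; case: (_ \in _); rewrite ?mul1r ?mul0r.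
    by apply: eq_Rintegral => w' _; rewrite mul1r.
  by under eq_Rintegral do rewrite mul0r; rewrite Rintegral_probability_cst.
rewrite EFin_Rintegral; last exact: bounded_mfun_integrable.
rewrite -EF -EFin_Rintegral; last exact: bounded_mfun_integrable.
rewrite -[LHS]/(\int[P]_w (\1_B (tree_of b w) * psi (s (tree_of b w) * X1 w, s (tree_of b w) * X2 w))%:E)%E.
rewrite -indicI.
have W0 := ae_tree_law (ae_Winf_ge0 scr c0 mgf_lt m_sqrtE).
have Z2 := ae_Zlim2 scr c0 mgf_lt m_sqrtE.
have [N [mN N0 hN]] := filterI W0 Z2.
apply: (integral_eq_off_null mN N0) => w _ Nw.
have [Ww Zw] : 0 <= Winf x beta (tree_of b w) /\
    Zlim b (toC (2 * re lambda)) w = toC (Winf x beta (tree_of b w)).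
  by apply: contrapT => h; exact: Nw (hN w h).
rewrite /= psiE Zw re_toC (sqrt_limvar Ww) -/(s _); congr (psi _)%:E.
by rewrite reM imM re_toC im_toC !mul0r subr0 addr0.
Qed.

End conditional_laws.

Theorem theorem2p2 (d : measure_display) (T : measurableType d) (R : realType)
    (P : probability T R) (b : branching_walk P) (lambda : cplx R)
    (m_sqrt : cplx R) (X : T -> cplx R) :
  let theta := re lambda in
  let abs_m2lambda := cmod (cmgf b (2 * lambda)) in
  let m2theta := fine (mgf b (2 * theta)) in
  let zeta n w :=
    cmgf b lambda ^+ n / m_sqrt ^+ n * (Zlim b lambda w - Zn b n lambda w) in
  let zetaoo w :=
    toC (Num.sqrt (fine (sigma2 b lambda))
         / Num.sqrt (1 - m2theta / cmod (cmgf b lambda) ^+ 2)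
         * Num.sqrt (re (Zlim b (toC (2 * theta)) w))) * X w in
  supercritical b ->
  dom b lambda ->
  0 <= theta ->
  cmgf b lambda != 0 ->
  (sigma2 b (toC theta) < +oo)%E ->
  (0 < sigma2 b lambda)%E ->
  (mgf b (2 * theta) < (cmod (cmgf b lambda) ^+ 2)%:E)%E ->
  m_sqrt ^+ 2 = norming b lambda ->
  cindependent P (filtration_oo b) X ->
  (abs_m2lambda < m2theta -> complex_std_normal P X) ->
  (abs_m2lambda = m2theta -> real_std_normal P X) ->
  cond_weak_cvg P (cvg_in_prob P) (filtration b) (filtration_oo b) zeta zetaoo
  /\
  (Lambda b (toC (2 * theta)) \/
     {ae P, forall w, Zlim b (toC (2 * theta)) w = 0} ->
   cond_weak_cvg P (cvg_as P) (filtration b) (filtration_oo b) zeta zetaoo).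
Proof.
move=> theta abs_m2lambda m2theta zeta zetaoo scr ld _ c0 s_theta _ mgf_lt m_sqrtE indX hcplx hreal.
pose mu := tree_law b; pose c := cmgf b lambda; pose x := wgt lambda c.
pose q := ratio b lambda; pose beta := scaling b lambda m_sqrt; pose k := critical b lambda.
have mu_cyl : iid_tree_law mu (cfg_law b) := tree_law_iid b.
have xm : multiplicative x := multiplicative_wgt lambda c.
have mx u : cmeasurable (x u) := cmeasurable_wgt lambda c u.
have xpos u w : 0 < nsq (x u w) := wgt_pos lambda u w c0.
have xic := ccentered_gsum scr ld c0 s_theta.
have q0 := ratio_gt0 scr c0 mgf_lt.
have q1 := ratio_lt1 scr c0 mgf_lt.
have xq := expectation_nsq_wgt mgf_lt.
have sct := supercritical_tree_law scr.
have bq := scaling_ratio scr c0 mgf_lt m_sqrtE.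
have gd := ae_good_walk scr ld c0 mgf_lt m_sqrtE.
have rc := critical_cpvar scr ld c0 s_theta mgf_lt m_sqrtE.
(* The modulus of m(2 lambda) is at most m(2 theta), so failing equality means strict inequality and
   the two hypotheses on X cover all cases. *)
have Xnormal : if k then real_std_normal P X else complex_std_normal P X.
  rewrite /k; case: ifPn => hk; first by apply: hreal; exact/eqP.
  by apply: hcplx; rewrite lt_neqAle hk; exact: (cmod_cmgf2_le mgf_lt).
have mX : cmeasurable X by move: Xnormal; case: k => -[].
have [mX1 mX2] := mX.
pose X1 w := re (X w); pose X2 w := im (X w).
have Xmom : (\int[P]_w (X1 w ^+ 2 + X2 w ^+ 2)%:E <= 1%:E)%E.
  by move: Xnormal; case: k => h; [exact: real_normal_moment|exact: complex_normal_moment].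
have Xchar s0 s t : \int[P]_w cos (s0 + s * X1 w + t * X2 w) =
    expR (- ((s ^+ 2 + t ^+ 2 + (k%:R : R) * (s ^+ 2 - t ^+ 2)) / 4)) * cos s0.
  by move: Xnormal; case: k => h; [exact: real_normal_char|exact: complex_normal_char].
pose psi (phi : cplx R -> R) (z : R * R) := phi (Complex z.1 z.2).
pose g phi n w := cond_law mu x beta (psi phi) n (tree_of b w).
pose h phi w := limit_law mu x q beta P X1 X2 (psi phi) (tree_of b w).
(* The same explicit versions of the conditional expectations serve both modes of convergence. *)
have key phi : continuous phi -> (exists M : R, forall z, `|phi z| <= M) ->
    [/\ continuous (psi phi), bounded_mfun (psi phi),
     forall n, is_condexp P (filtration b n) (phi \o zeta n) (g phi n) &
     is_condexp P (filtration_oo b) (phi \o zetaoo) (h phi)].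
  move=> cphi [M hM].
  have cpsi : continuous (psi phi) := continuous_Complex cphi.
  have bpsi : bounded_mfun (psi phi).
    by split; [exact: continuous_measurable_fun2|exists M => z; exact: hM].
  split => //.
  - by move=> n; exact: (fluctuation_condexp m_sqrt scr ld c0 s_theta mgf_lt bpsi n).
  - exact: (limit_condexp scr c0 mgf_lt m_sqrtE bpsi mX indX).
split => [|hyp] phi cphi bphi; have [cpsi bpsi hg hh] := key phi cphi bphi.
  exists (g phi), (h phi); split => //; split => //.
  apply: cvg_in_prob_tree_law.
  have nv := noncritical_vanishes scr c0 mgf_lt m_sqrtE.
  exact: (conditional_clt_in_prob mu_cyl xm mx xpos xic q0 q1 xq sct bq mX1 mX2 Xmom Xchar gd rc cpsi bpsi nv).
exists (g phi), (h phi); split => //; split => //.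
have hD : {ae mu, forall w, discrepancy x beta k n w @[n --> \oo] --> 0}.
  by case: hyp => hyp; [exact: Lambda_discrepancy|exact: trivial_discrepancy].
have clt := conditional_clt_ae mu_cyl xm mx xic q0 q1 xq mX1 mX2 Xmom Xchar gd rc cpsi bpsi hD.
exact: (ae_tree_law clt).
Qed.
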